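(* For each real $\beta>1$, the function $G_\beta(s)=\sum_{n=1}^\infty S_\beta(n)n^{-s}$ has a meromorphic continuation to the region $\Re(s)>1$, with a double pole at $s=2$ with Laurent expansion \[ G_\beta(s) = \frac{\beta-1}{2\log \beta}(s-2)^{-2} + \biggl(\frac{\beta-1}{2\log \beta} \bigl(\log(2\pi) - 1\bigr) - \frac{\beta+1}{4}\biggr)(s-2)^{-1} +O(1) \] and simple poles at $s=2+2\pi i m/\log \beta$ for $m\in\mathbb{Z}$, $m\neq 0$, with residue \[ \operatorname{Res}\Bigl(G_\beta(s),s=2+\tfrac{2\pi i m}{\log \beta}\Bigr) = -\frac{\beta-1}{2\pi i m}\Bigl(1+\tfrac{2\pi i m}{\log \beta}\Bigr)^{-1}\zeta\Bigl(\tfrac{2\pi i m}{\log \beta} \Bigr). \]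
   Context: $\zeta$ is the Riemann zeta function. For real $\beta>1$ define coefficients $c_\beta(k)=-\frac{\beta-1}{2\pi i k}\bigl(1+\frac{2\pi i k}{\log\beta}\bigr)^{-1}\zeta\bigl(\frac{2\pi i k}{\log\beta}\bigr)$ for $k\in\mathbb{Z}\setminus\{0\}$ and $c_\beta(0)=\frac{\beta-1}{2\log\beta}(\log 2\pi-1)-\frac{\beta+1}{4}$, and the function $h_\beta(x)=\sum_{k=-\infty}^\infty c_\beta(k)e^{2\pi i k x}$ for $x\in\mathbb{R}$ (this series converges absolutely). For positive integers $n$ define $S_\beta(n)=\frac{\beta-1}{2\log\beta}n\log n + h_\beta\bigl(\frac{\log n}{\log\beta}\bigr)n$. The series $G_\beta(s)$ converges absolutely for $\Re(s)>2$. *)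

(* Defs.v *)
From Stdlib Require Import Reals ZArith Lra Lia.
From Coquelicot Require Import Coquelicot.

Open Scope R_scope.

Definition Cexp (z : C) : C :=
  (exp (Re z) * cos (Im z), exp (Re z) * sin (Im z)).

(* x ^ s for real x > 0, principal branch *)
Definition Rcpow (x : R) (s : C) : C := Cexp (s * RtoC (ln x))%C.

Definition CSeries (a : nat -> C) : C :=
  (Series (fun n => Re (a n)), Series (fun n => Im (a n))).

Definition CZseries (a : Z -> C) : C :=
  (CSeries (fun n => a (Z.of_nat n))
   + CSeries (fun n => a (- Z.of_nat (S n))%Z))%C.

(* bern m u = B_m(u) / m! with B_m the Bernoulli polynomial: the sequence is
   determined by b_0 = 1, b_{m+1}' = b_m and mean value 0 of b_{m+1} on [0,1]. *)
Fixpoint bern (m : nat) : R -> R :=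
  match m with
  | O => fun _ => 1
  | S m' => fun u => RInt (bern m') 0 u - RInt (fun v => RInt (bern m') 0 v) 0 1
  end.

Fixpoint Cpoch (s : C) (n : nat) : C :=
  match n with
  | O => RtoC 1
  | S n' => (Cpoch s n' * (s + RtoC (INR n')))%C
  end.

Definition EM_term (m : nat) (s : C) (n : nat) : C :=
  RInt (V := C_R_CompleteNormedModule)
    (fun u => (RtoC (bern m u) *
               Rcpow (INR (S n) + u) (- (s + RtoC (INR m))))%C) 0 1.

(* The Euler-Maclaurin formula of order m + 1 for sum n^(-s), valid for
   Re s > - m. *)
Definition zeta_EM (m : nat) (s : C) : C :=
  (/ (s - 1)
   + sum_n (G := C_AbelianMonoid)
       (fun k => RtoC (bern (S k) 1) * Cpoch s k) m
   - Cpoch s (S m) * CSeries (EM_term (S m) s))%C.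

(* The analytic continuation of sum n^(-s) to C minus {1}: see
   zeta_analytic_continuation below. The value at s = 1 is irrelevant. *)
Definition zeta (s : C) : C := zeta_EM (S (Z.to_nat (up (- Re s)))) s.

Definition Cdifferentiable (f : C -> C) (z : C) : Prop :=
  ex_derive (K := C_AbsRing) (V := C_NormedModule) f z.

Module ZetaContinuation.

Lemma Ceq (a b : C) : Re a = Re b -> Im a = Im b -> a = b.
Proof. destruct a, b; simpl; intros -> ->; reflexivity. Qed.

Lemma norm_CR (z : C) : norm (V := C_R_NormedModule) z = Cmod z.
Proof. symmetry. apply Cmod_norm. Qed.

Lemma Cexp_plus a b : Cexp (a + b) = (Cexp a * Cexp b)%C.
Proof.
  destruct a as [x y], b as [x' y']; unfold Cexp; apply Ceq; simpl;
  rewrite exp_plus, ?cos_plus, ?sin_plus; ring.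
Qed.

Lemma Cexp_0 : Cexp 0 = 1.
Proof. unfold Cexp; simpl. rewrite exp_0, cos_0, sin_0. apply Ceq; simpl; ring. Qed.

Lemma Cmod_Cexp z : Cmod (Cexp z) = exp (Re z).
Proof.
  unfold Cexp, Cmod; simpl.
  match goal with |- sqrt ?a = _ => replace a with ((exp (Re z))²) end.
  - apply sqrt_Rsqr. left; apply exp_pos.
  - pose proof (sin2_cos2 (Im z)) as H. unfold Rsqr in *.
    transitivity (exp (Re z) * exp (Re z) * (sin (Im z) * sin (Im z) + cos (Im z) * cos (Im z))).
    + rewrite H; ring.
    + ring.
Qed.

Lemma Cmod_Rcpow x s : Cmod (Rcpow x s) = exp (Re s * ln x).
Proof. unfold Rcpow. rewrite Cmod_Cexp. f_equal. destruct s; simpl; ring. Qed.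

Lemma Rcpow_plus x s t : Rcpow x (s + t) = (Rcpow x s * Rcpow x t)%C.
Proof. unfold Rcpow. rewrite <- Cexp_plus. f_equal. ring. Qed.

Lemma Rcpow_R x r : Rcpow x (RtoC r) = RtoC (exp (r * ln x)).
Proof.
  unfold Rcpow, Cexp. apply Ceq; simpl;
  replace (r * 0 + 0 * ln x) with 0 by ring.
  - rewrite cos_0. replace (r * ln x - 0 * 0) with (r * ln x) by ring. ring.
  - rewrite sin_0; ring.
Qed.

Lemma Rcpow_1_l s : Rcpow 1 s = 1.
Proof. unfold Rcpow. rewrite ln_1, Cmult_0_r. apply Cexp_0. Qed.

Lemma Cderive_pair (f : R -> C) x (l : C) :
  is_derive (fun t => Re (f t)) x (Re l) -> is_derive (fun t => Im (f t)) x (Im l) ->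
  is_derive (K := R_AbsRing) (V := C_R_NormedModule) f x l.
Proof.
  intros [_ H1] [_ H2]. split.
  - apply (is_linear_scal_l (V := C_R_NormedModule)).
  - intros y Hy eps.
    assert (He : 0 < eps / 2) by (destruct eps; simpl; lra).
    specialize (H1 y Hy (mkposreal _ He)). specialize (H2 y Hy (mkposreal _ He)).
    generalize (filter_and _ _ H1 H2). apply filter_imp. intros t [A B]. simpl in A, B.
    set (w := minus (minus (f t) (f y)) (scal (minus t y) l)).
    change (norm (V := C_R_NormedModule) w <= eps * norm (minus t y)). rewrite norm_CR.
    apply Rle_trans with (Rabs (Re w) + Rabs (Im w)).
    + replace w with (RtoC (Re w) + Ci * RtoC (Im w))%C by (apply Ceq; simpl; ring).
      eapply Rle_trans; [apply Cmod_triangle|].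
      rewrite Cmod_mult, Cmod_Ci, !Cmod_R.
      replace (Re (Re w + Ci * Im w)%C) with (Re w) by (simpl; ring).
      replace (Im (Re w + Ci * Im w)%C) with (Im w) by (simpl; ring). lra.
    + change (Rabs (Re w) <= eps / 2 * norm (minus t y)) in A.
      change (Rabs (Im w) <= eps / 2 * norm (minus t y)) in B. lra.
Qed.

Lemma is_derive_Rcpow x s : 0 < x ->
  is_derive (K := R_AbsRing) (V := C_R_NormedModule)
    (fun t => Rcpow t s) x (s * Rcpow x (s - 1))%C.
Proof.
  intros Hx.
  assert (E : (Rcpow x (s - 1) = Rcpow x s * RtoC (/ x))%C).
  { unfold Cminus. rewrite Rcpow_plus. f_equal.
    rewrite <- RtoC_opp, Rcpow_R. f_equal.
    transitivity (exp (- ln x)); [f_equal; ring|].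
    rewrite exp_Ropp, exp_ln; auto. }
  rewrite E. destruct s as [a b]. apply Cderive_pair; unfold Rcpow, Cexp; simpl;
  auto_derive; auto; unfold Rminus; ring.
Qed.

Lemma is_series_C (a : nat -> C) (l : C) :
  is_series (fun n => Re (a n)) (Re l) -> is_series (fun n => Im (a n)) (Im l) ->
  is_series (K := C_AbsRing) (V := C_NormedModule) a l.
Proof.
  intros H1 H2. unfold is_series in *.
  assert (S1 : forall n, Re (sum_n (G := C_AbelianMonoid) a n) = sum_n (fun n => Re (a n)) n).
  { induction n. now rewrite !sum_O. rewrite !sum_Sn, <- IHn. reflexivity. }
  assert (S2 : forall n, Im (sum_n (G := C_AbelianMonoid) a n) = sum_n (fun n => Im (a n)) n).
  { induction n. now rewrite !sum_O. rewrite !sum_Sn, <- IHn. reflexivity. }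
  intros P [eps HP].
  assert (A : eventually (fun n => ball (Re l) eps (sum_n (fun n => Re (a n)) n))).
  { apply H1. now exists eps. }
  assert (B : eventually (fun n => ball (Im l) eps (sum_n (fun n => Im (a n)) n))).
  { apply H2. now exists eps. }
  unfold filtermap. generalize (filter_and _ _ A B). apply filter_imp. intros n [U V].
  apply HP. split.
  - change (ball (Re l) eps (Re (sum_n (G := C_AbelianMonoid) a n))). rewrite S1; exact U.
  - change (ball (Im l) eps (Im (sum_n (G := C_AbelianMonoid) a n))). rewrite S2; exact V.
Qed.

Lemma is_series_C_inv (a : nat -> C) (l : C) :
  is_series (K := C_AbsRing) (V := C_NormedModule) a l ->
  is_series (fun n => Re (a n)) (Re l) /\ is_series (fun n => Im (a n)) (Im l).
Proof.
  intros H.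
  assert (S1 : forall n, Re (sum_n (G := C_AbelianMonoid) a n) = sum_n (fun n => Re (a n)) n).
  { induction n. now rewrite !sum_O. rewrite !sum_Sn, <- IHn. reflexivity. }
  assert (S2 : forall n, Im (sum_n (G := C_AbelianMonoid) a n) = sum_n (fun n => Im (a n)) n).
  { induction n. now rewrite !sum_O. rewrite !sum_Sn, <- IHn. reflexivity. }
  split; intros P [eps HP].
  - assert (A : eventually (fun n => ball (M := C_UniformSpace) l eps (sum_n (G := C_AbelianMonoid) a n))).
    { apply H. now exists eps. }
    unfold filtermap. revert A. apply filter_imp. intros n [U V]. apply HP. rewrite <- S1. exact U.
  - assert (A : eventually (fun n => ball (M := C_UniformSpace) l eps (sum_n (G := C_AbelianMonoid) a n))).
    { apply H. now exists eps. }
    unfold filtermap. revert A. apply filter_imp. intros n [U V]. apply HP. rewrite <- S2. exact V.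
Qed.

Lemma CSeries_unique (a : nat -> C) (l : C) :
  is_series (K := C_AbsRing) (V := C_NormedModule) a l -> CSeries a = l.
Proof.
  intros H. destruct (is_series_C_inv _ _ H) as [A B].
  apply Ceq; simpl; now apply is_series_unique.
Qed.

Lemma CSeries_correct (a : nat -> C) :
  ex_series (K := C_AbsRing) (V := C_NormedModule) a ->
  is_series (K := C_AbsRing) (V := C_NormedModule) a (CSeries a).
Proof. intros [l Hl]. now rewrite (CSeries_unique _ _ Hl). Qed.

Lemma bern_cont m u : continuous (bern m) u.
Proof.
  revert u. induction m as [|m IH]; intros u.
  - apply continuous_const.
  - apply (ex_derive_continuous (bern (S m))). exists (bern m u). simpl.
    replace (bern m u) with (minus (bern m u) 0) by (unfold minus, plus, opp; simpl; ring).
    apply (is_derive_minus (V:=R_NormedModule)).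
    + apply is_derive_RInt with 0; [|apply IH].
      apply filter_forall. intros t. apply (RInt_correct (V:=R_CompleteNormedModule)), (ex_RInt_continuous (V:=R_CompleteNormedModule)). intros; apply IH.
    + apply (is_derive_const (V:=R_NormedModule)).
Qed.

Lemma bern_derive m u : is_derive (bern (S m)) u (bern m u).
Proof.
    replace (bern m u) with (minus (bern m u) 0) by (unfold minus, plus, opp; simpl; ring).
    apply (is_derive_minus (V:=R_NormedModule)).
    + apply is_derive_RInt with 0; [|apply bern_cont].
      apply filter_forall. intros t. apply (RInt_correct (V:=R_CompleteNormedModule)), (ex_RInt_continuous (V:=R_CompleteNormedModule)). intros; apply bern_cont.
    + apply (is_derive_const (V:=R_NormedModule)).
Qed.

Lemma bern_mean m : RInt (bern (S m)) 0 1 = 0.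
Proof.
  assert (H1 : forall m a b, ex_RInt (bern m) a b).
  { intros. apply (ex_RInt_continuous (V:=R_CompleteNormedModule)). intros; apply bern_cont. }
  set (c := RInt (fun v => RInt (bern m) 0 v) 0 1).
  assert (H2 : ex_RInt (fun v => RInt (bern m) 0 v) 0 1).
  { apply ex_RInt_ext with (fun v => plus (bern (S m) v) c).
    - intros x _. unfold plus; simpl. fold c. ring.
    - apply (ex_RInt_plus (V:=R_NormedModule)); [apply H1|apply ex_RInt_const]. }
  apply is_RInt_unique.
  apply is_RInt_ext with (fun v => minus (RInt (bern m) 0 v) c).
  { intros x _. reflexivity. }
  assert (Q : is_RInt (V:=R_NormedModule) (fun v => minus (RInt (bern m) 0 v) c) 0 1
            (minus c (scal (1 - 0) c))).
  { apply (is_RInt_minus (V:=R_NormedModule)).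
    - now apply (RInt_correct (V:=R_CompleteNormedModule)).
    - apply (is_RInt_const (V:=R_NormedModule)). }
  replace (minus c (scal (1 - 0) c)) with 0 in Q; [exact Q|].
  unfold minus, plus, opp, scal; simpl; unfold mult; simpl. ring.
Qed.

Lemma bern_diff m : bern (S m) 1 - bern (S m) 0 = RInt (bern m) 0 1.
Proof.
  simpl. rewrite (RInt_point (V:=R_CompleteNormedModule) 0 (bern m)). unfold zero; simpl. ring.
Qed.

Lemma bern_per m : bern (S (S m)) 1 = bern (S (S m)) 0.
Proof. generalize (bern_diff (S m)). rewrite bern_mean. lra. Qed.

Lemma bern_1 u : bern 1 u = u - 1/2.
Proof.
  simpl.
  assert (E : forall v, RInt (fun _ : R => 1) 0 v = v).
  { intros. rewrite RInt_const. unfold scal; simpl; unfold mult; simpl; ring. }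
  rewrite E. f_equal.
  apply is_RInt_unique.
  apply is_RInt_ext with (fun v => v). { intros; symmetry; apply E. }
  replace (1/2) with (minus (1^2/2) (0^2/2)) by (unfold minus, plus, opp; simpl; field).
  apply (is_RInt_derive (V:=R_CompleteNormedModule) (fun v => v^2/2)).
  - intros. auto_derive; auto. field.
  - intros. apply continuous_id.
Qed.

Lemma bern_bounded m : exists M, 0 < M /\ forall u, 0 <= u <= 1 -> Rabs (bern m u) <= M.
Proof.
  destruct (continuity_ab_maj (fun u => Rabs (bern m u)) 0 1) as [x [H _]]; [lra| |].
  - intros c _. apply continuity_pt_filterlim.
    apply (continuous_comp (bern m) Rabs); [apply bern_cont|apply continuous_Rabs].
  - exists (Rabs (bern m x) + 1). split; [pose proof (Rabs_pos (bern m x)); lra|].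
    intros u Hu. specialize (H u Hu). lra.
Qed.

Local Notation is_CInt := (is_RInt (V := C_R_NormedModule)).
Local Notation is_Cser := (is_series (K := C_AbsRing) (V := C_NormedModule)).

Local Ltac toC := match goal with |- @eq _ ?a ?b => change (@eq C a b) end.

Lemma minus_CR (a b : C) : minus (G := C_R_CompleteNormedModule) a b = (a - b)%C.
Proof. reflexivity. Qed.

Lemma is_CInt_Cmult (f : R -> C) a b (l c : C) :
  is_CInt f a b l -> is_CInt (fun u => (c * f u)%C) a b (c * l)%C.
Proof.
  intros H.
  pose proof (is_RInt_fct_extend_fst (U:=R_NormedModule) (V:=R_NormedModule) f a b l H) as H1.
  pose proof (is_RInt_fct_extend_snd (U:=R_NormedModule) (V:=R_NormedModule) f a b l H) as H2.
  apply (is_RInt_fct_extend_pair (U:=R_NormedModule) (V:=R_NormedModule)).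
  - apply (is_RInt_minus (V:=R_NormedModule)
     (fun t => scal (fst c) (fst (f t))) (fun t => scal (snd c) (snd (f t)))); apply (is_RInt_scal (V:=R_NormedModule)); assumption.
  - apply (is_RInt_plus (V:=R_NormedModule)
     (fun t => scal (fst c) (snd (f t))) (fun t => scal (snd c) (fst (f t)))); apply (is_RInt_scal (V:=R_NormedModule)); assumption.
Qed.

Lemma is_derive_Rcpow_shift N w u : 0 < N + u ->
  is_derive (K := R_AbsRing) (V := C_R_NormedModule)
    (fun t => Rcpow (N + t) w) u (w * Rcpow (N + u) (w - 1))%C.
Proof.
  intros H.
  pose proof (is_derive_comp (K := R_AbsRing) (V := C_R_NormedModule)
    (fun t => Rcpow t w) (fun t => N + t) u _ 1 (is_derive_Rcpow (N + u) w H)) as D.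
  rewrite (scal_one (V := C_R_ModuleSpace)) in D. apply D.
  auto_derive; auto; ring.
Qed.

Lemma continuous_Rcpow_shift N w u : 0 < N + u ->
  continuous (U := C_R_NormedModule) (fun t => Rcpow (N + t) w) u.
Proof.
  intros H. apply (ex_derive_continuous (V := C_R_NormedModule)).
  eexists. now apply is_derive_Rcpow_shift.
Qed.

Lemma continuous_Cmul_l (c : C) (f : R -> C) u :
  continuous (U := C_R_NormedModule) f u ->
  continuous (U := C_R_NormedModule) (fun t => (c * f t)%C) u.
Proof.
  intros H.
  assert (H1 : continuous (fun t => fst (f t)) u).
  { apply (continuous_comp f fst); auto. destruct (f u) as [p q]; apply (continuous_fst p q). }
  assert (H2 : continuous (fun t => snd (f t)) u).
  { apply (continuous_comp f snd); auto. destruct (f u) as [p q]; apply (continuous_snd p q). }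
  intros P HP. 
  assert (E1 : continuous (fun t => fst c * fst (f t) - snd c * snd (f t)) u).
  { apply (continuous_minus (V:=R_NormedModule)); apply (continuous_scal_r (V:=R_NormedModule)); auto. }
  assert (E2 : continuous (fun t => fst c * snd (f t) + snd c * fst (f t)) u).
  { apply (continuous_plus (V:=R_NormedModule)); apply (continuous_scal_r (V:=R_NormedModule)); auto. }
  destruct HP as [eps HP].
  assert (A1 := E1 _ (ex_intro _ eps (fun y h => h))).
  assert (A2 := E2 _ (ex_intro _ eps (fun y h => h))).
  unfold filtermap in *.
  generalize (filter_and _ _ A1 A2). apply filter_imp. intros t [U V].
  apply HP. split; assumption.
Qed.

Lemma continuous_bern_mul m (f : R -> C) u :
  continuous (U := C_R_NormedModule) f u ->
  continuous (U := C_R_NormedModule) (fun t => (RtoC (bern m t) * f t)%C) u.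
Proof.
  intros H.
  apply continuous_ext with (fun t => scal (V := C_R_ModuleSpace) (bern m t) (f t)).
  { intros t. apply scal_R_Cmult. }
  apply (continuous_scal (V := C_R_NormedModule)); [apply bern_cont|exact H].
Qed.

Lemma Spos n : 1 <= INR (S n).
Proof. apply (le_INR 1). lia. Qed.

Lemma EM_term_correct m s n :
  is_CInt (fun u => (RtoC (bern m u) * Rcpow (INR (S n) + u) (- (s + RtoC (INR m))))%C) 0 1
    (EM_term m s n).
Proof.
  apply (RInt_correct (V := C_R_CompleteNormedModule)).
  apply (ex_RInt_continuous (V := C_R_CompleteNormedModule)).
  intros z Hz. rewrite Rmin_left, Rmax_right in Hz by lra.
  apply continuous_bern_mul, continuous_Rcpow_shift.
  pose proof (Spos n). lra.
Qed.

Lemma EM_rec m s n :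
  EM_term m s n =
  (RtoC (bern (S m) 1) * Rcpow (INR (S (S n))) (- (s + RtoC (INR m)))
   - RtoC (bern (S m) 0) * Rcpow (INR (S n)) (- (s + RtoC (INR m)))
   + (s + RtoC (INR m)) * EM_term (S m) s n)%C.
Proof.
  set (w := (- (s + RtoC (INR m)))%C).
  pose proof (Spos n) as Hn.
  assert (Hpos : forall t, Rmin 0 1 <= t <= Rmax 0 1 -> 0 < INR (S n) + t).
  { intros t Ht. rewrite Rmin_left, Rmax_right in Ht by lra. lra. }
  pose proof (is_RInt_scal_derive_l (V := C_R_CompleteNormedModule)
    (bern (S m)) (fun t => Rcpow (INR (S n) + t) w)
    (bern m) (fun t => (w * Rcpow (INR (S n) + t) (w - 1))%C) 0 1
    (w * EM_term (S m) s n)%C) as H.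
  apply (is_RInt_unique (V := C_R_CompleteNormedModule)).
  assert (G : is_RInt (V := C_R_CompleteNormedModule) (fun t => scal (bern m t) (Rcpow (INR (S n) + t) w)) 0 1
     (minus (minus (scal (bern (S m) 1) (Rcpow (INR (S n) + 1) w))
        (scal (bern (S m) 0) (Rcpow (INR (S n) + 0) w))) (w * EM_term (S m) s n)%C)).
  { apply H.
    - intros; apply bern_derive.
    - intros; apply is_derive_Rcpow_shift; auto.
    - intros; apply bern_cont.
    - intros. apply continuous_Cmul_l, continuous_Rcpow_shift; auto.
    - apply is_RInt_ext with (fun u => (w * (RtoC (bern (S m) u) * Rcpow (INR (S n) + u) (- (s + RtoC (INR (S m))))))%C).
      + intros x _. rewrite scal_R_Cmult.
        replace (- (s + RtoC (INR (S m))))%C with (w - 1)%C.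
        toC. ring. unfold w. rewrite S_INR, RtoC_plus. ring.
      + apply is_CInt_Cmult, EM_term_correct. }
  rewrite !scal_R_Cmult in G.
  rewrite Rplus_0_r, <- S_INR in G.
  match goal with |- is_RInt _ _ _ ?l => match type of G with is_RInt _ _ _ ?l' => replace l with l' end end.
  - eapply is_RInt_ext; [|exact G]. intros; apply scal_R_Cmult.
  - etransitivity; [apply minus_CR|]. rewrite (minus_CR (RtoC (bern (S m) 1) * _)%C). unfold w. toC. ring.
Qed.

Lemma EM_0 s n : s <> RtoC 1 ->
  EM_term 0 s n = ((Rcpow (INR (S n)) (1 - s) - Rcpow (INR (S (S n))) (1 - s)) / (s - 1))%C.
Proof.
  intros Hs.
  assert (Hs' : (s - 1)%C <> 0).
  { intros E. apply Hs. now apply Ceq_minus. }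
  pose proof (Spos n) as Hn.
  assert (Hpos : forall t, Rmin 0 1 <= t <= Rmax 0 1 -> 0 < INR (S n) + t).
  { intros t Ht. rewrite Rmin_left, Rmax_right in Ht by lra. lra. }
  apply (is_RInt_unique (V := C_R_CompleteNormedModule)).
  assert (G : is_CInt (fun t => ((1 - s) * Rcpow (INR (S n) + t) (1 - s - 1))%C) 0 1
    (Rcpow (INR (S n) + 1) (1 - s) - Rcpow (INR (S n) + 0) (1 - s))%C).
  { apply (is_RInt_derive (V := C_R_CompleteNormedModule) (fun t => Rcpow (INR (S n) + t) (1-s))).
    - intros; apply is_derive_Rcpow_shift; auto.
    - intros. apply continuous_Cmul_l, continuous_Rcpow_shift; auto. }
  rewrite Rplus_0_r, <- S_INR in G.
  apply (is_CInt_Cmult _ _ _ _ (/ (1 - s))%C) in G.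
  assert (Hs2 : (1 - s)%C <> 0).
  { intros E. apply Hs. symmetry. now apply Ceq_minus. }
  match goal with |- is_RInt _ _ _ ?l => match type of G with is_RInt _ _ _ ?l' => replace l with l' end end.
  - eapply is_RInt_ext; [|exact G]. intros x _. simpl bern. cbv beta.
    replace (1 - s - 1)%C with (- (s + RtoC (INR 0)))%C by (simpl; ring).
    toC. field. exact Hs2.
  - toC. field. split; auto.
Qed.

Lemma Cball_of_Cmod (l z : C) eps : Cmod (z - l) < eps -> ball (M := C_UniformSpace) l eps z.
Proof. apply C_NormedModule_mixin_compat1. Qed.

Lemma Rcpow_lim0 w : Re w < 0 ->
  filterlim (fun n => Rcpow (INR (S n)) w) eventually (locally (T := C_NormedModule) (RtoC 0)).
Proof.
  intros Hw P [eps HP].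
  destruct (INR_unbounded (exp (ln eps / Re w))) as [N HN].
  exists N. intros n Hn. apply HP, Cball_of_Cmod.
  replace (Rcpow (INR (S n)) w - RtoC 0)%C with (Rcpow (INR (S n)) w) by (toC; ring).
  rewrite Cmod_Rcpow.
  destruct eps as [e He]; simpl in *.
  apply Rlt_le_trans with (exp (ln e)); [|rewrite exp_ln; lra].
  apply exp_increasing.
  assert (Hl : ln e / Re w < ln (INR (S n))).
  { rewrite <- (ln_exp (ln e / Re w)). apply ln_increasing; [apply exp_pos|].
    apply Rlt_le_trans with (1 := HN). apply le_INR. lia. }
  change (match n with | 0%nat => 1 | S _ => INR n + 1 end) with (INR (S n)) in *.
  replace (ln e) with (Re w * (ln e / Re w)) by (field; lra).
  apply Rmult_lt_gt_compat_neg_l; auto.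
Qed.

Lemma telescope {K : AbsRing} {V : NormedModule K} (u : nat -> V) :
  filterlim u eventually (locally (zero : V)) ->
  is_series (fun n => minus (u (S n)) (u n)) (opp (u 0%nat)).
Proof.
  intros H. unfold is_series.
  apply filterlim_ext with (fun n => minus (u (S n)) (u 0%nat)).
  { induction x as [|n IH].
    - now rewrite sum_O.
    - rewrite sum_Sn, <- IH, (minus_trans (u (S n))). apply plus_comm. }
  replace (opp (u 0%nat)) with (minus zero (u 0%nat)) by (unfold minus; now rewrite plus_zero_l).
  unfold minus.
  eapply (filterlim_comp_2 (F := eventually) (G := locally (zero : V)) (H := locally (opp (u 0%nat)))).
  - intros P HP. specialize (H P HP). destruct H as [N HN]. exists N. intros n Hn. apply HN. lia.
  - apply filterlim_const.
  - apply (filterlim_plus (V := V)).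
Qed.

Lemma ex_inv_sq : ex_series (fun n => / INR (S n) ^ 2).
Proof.
  apply (ex_series_le (K := R_AbsRing) (V := R_CompleteNormedModule) _
     (fun n => 2 * - (/ INR (S (S n)) - / INR (S n)))).
  - intros n. pose proof (Spos n). rewrite (S_INR (S n)). set (x := INR (S n)) in *.
    change (Rabs (/ x ^ 2) <= 2 * - (/ (x + 1) - / x)).
    rewrite Rabs_pos_eq.
    + replace (2 * - (/ (x+1) - / x)) with (2 / (x * (x + 1))) by (field; lra).
      apply Rmult_le_reg_r with (x^2 * (x+1)).
      { apply Rmult_lt_0_compat; [apply pow_lt|]; lra. }
      replace (/ x ^ 2 * (x^2 * (x+1))) with (x + 1) by (field; lra).
      replace (2 / (x * (x + 1)) * (x ^ 2 * (x + 1))) with (2 * x) by (field; lra). lra.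
    + left. apply Rinv_0_lt_compat, pow_lt. lra.
  - apply (ex_series_scal_l (V := R_NormedModule) 2 (fun n => - (/ INR (S (S n)) - / INR (S n)))).
    exists (opp (opp (/ INR 1))). apply (is_series_opp (V := R_NormedModule)).
    apply (telescope (V := R_NormedModule) (fun n => / INR (S n))).
    change (is_lim_seq (fun n => / INR (S n)) 0).
    apply (is_lim_seq_incr_1 (fun n => / INR n)).
    replace (Finite 0) with (Rbar_inv p_infty) by reflexivity.
    apply is_lim_seq_inv; [apply is_lim_seq_INR|discriminate].
Qed.

Lemma Rcpow_bound x w p : 1 <= x -> Re w <= - INR p -> Cmod (Rcpow x w) <= / x ^ p.
Proof.
  intros Hx Hw. rewrite Cmod_Rcpow.
  rewrite <- (Rpower_pow p x) by lra. rewrite <- Rpower_Ropp. unfold Rpower.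
  destruct (Req_dec x 1) as [->|].
  - rewrite ln_1, !Rmult_0_r. lra.
  - assert (0 < ln x) by (rewrite <- ln_1; apply ln_increasing; lra).
    
    destruct (Req_dec (Re w) (- INR p)) as [->|]; [lra|].
    left. apply exp_increasing. apply Rmult_lt_compat_r; lra.
Qed.

Lemma inv_pow_le x y p : 0 < x <= y -> / y ^ p <= / x ^ p.
Proof.
  intros H. apply Rinv_le_contravar; [apply pow_lt; lra|]. apply pow_incr. lra.
Qed.

Lemma CInt_bound (f : R -> C) l M : is_CInt f 0 1 l ->
  (forall u, 0 <= u <= 1 -> Cmod (f u) <= M) -> Cmod l <= M.
Proof.
  intros H B. rewrite <- norm_CR.
  replace M with ((1 - 0) * M) by ring.
  apply (norm_RInt_le_const (V := C_R_NormedModule) f); [lra| |exact H].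
  intros x Hx. rewrite norm_CR. auto.
Qed.

Lemma EM_ex m s : 2 <= Re s + INR m ->
  ex_series (K := C_AbsRing) (V := C_NormedModule) (EM_term m s).
Proof.
  intros H. destruct (bern_bounded m) as [M [HM HB]].
  apply (ex_series_le (K := C_AbsRing) (V := C_CompleteNormedModule) _ (fun n => M * / INR (S n) ^ 2)).
  - intros n. change (Cmod (EM_term m s n) <= M * / INR (S n) ^ 2).
    apply (CInt_bound _ _ _ (EM_term_correct m s n)). intros u Hu.
    pose proof (Spos n).
    rewrite Cmod_mult, Cmod_R.
    apply Rmult_le_compat; auto using Rabs_pos, Cmod_ge_0.
    eapply Rle_trans; [apply Rcpow_bound with (p := 2%nat); [lra|]|apply inv_pow_le; lra].
    rewrite re_opp, re_plus, re_RtoC. simpl; lra.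
  - apply (ex_series_scal_l (V := R_NormedModule) M (fun n => / INR (S n) ^ 2)), ex_inv_sq.
Qed.

Lemma is_Cser_plus a b la lb : is_Cser a la -> is_Cser b lb ->
  is_Cser (fun n => (a n + b n)%C) (la + lb)%C.
Proof. apply (is_series_plus (V := C_NormedModule)). Qed.

Lemma is_Cser_scal c a la : is_Cser a la -> is_Cser (fun n => (c * a n)%C) (c * la)%C.
Proof. apply (is_series_scal (V := C_NormedModule) c). Qed.

Lemma is_Cser_ext a b l : (forall n, a n = b n) -> is_Cser a l -> is_Cser b l.
Proof. apply (is_series_ext (V := C_NormedModule)). Qed.

Lemma is_Cser_tele w : Re w < 0 ->
  is_Cser (fun n => (Rcpow (INR (S (S n))) w - Rcpow (INR (S n)) w)%C) (- (1))%C.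
Proof.
  intros Hw.
  pose proof (telescope (K := C_AbsRing) (V := C_NormedModule) _ (Rcpow_lim0 w Hw)) as H.
  cbv beta in H. change (INR 1) with 1 in H. rewrite Rcpow_1_l in H. exact H.
Qed.

Lemma EM_step m s : 2 <= Re s + INR (S (S m)) -> 0 < Re s + INR (S m) ->
  is_Cser (EM_term (S m) s)
   (- RtoC (bern (S (S m)) 1) + (s + RtoC (INR (S m))) * CSeries (EM_term (S (S m)) s))%C.
Proof.
  intros H H0.
  set (w := (- (s + RtoC (INR (S m))))%C).
  assert (Hw : Re w < 0).
  { unfold w. rewrite re_opp, re_plus, re_RtoC. lra. }
  apply is_Cser_ext with (fun n => (RtoC (bern (S (S m)) 1) *
     (Rcpow (INR (S (S n))) w - Rcpow (INR (S n)) w) + (s + RtoC (INR (S m))) * EM_term (S (S m)) s n)%C).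
  { intros n. rewrite (EM_rec (S m)). fold w. rewrite bern_per. toC. ring. }
  replace (- RtoC (bern (S (S m)) 1))%C with (RtoC (bern (S (S m)) 1) * - (1))%C by ring.
  apply is_Cser_plus; apply is_Cser_scal.
  - now apply is_Cser_tele.
  - now apply CSeries_correct, EM_ex.
Qed.

Lemma zeta_EM_S m s : 2 <= Re s + INR (S m) -> zeta_EM m s = zeta_EM (S m) s.
Proof.
  intros H.
  assert (E : CSeries (EM_term (S m) s) = 
   (- RtoC (bern (S (S m)) 1) + (s + RtoC (INR (S m))) * CSeries (EM_term (S (S m)) s))%C).
  { apply CSeries_unique, EM_step; rewrite ?(S_INR (S m)); lra. }
  unfold zeta_EM. rewrite E, sum_Sn.
  change (Cpoch s (S (S m))) with (Cpoch s (S m) * (s + RtoC (INR (S m))))%C.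
  set (A := sum_n _ m).
  change (plus (G := C_AbelianMonoid)) with Cplus. 
  set (P := Cpoch s (S m)). set (B := RtoC (bern (S (S m)) 1)). set (J := CSeries _). set (t := RtoC (INR _)).
  change (/ (s - 1) + A - P * (- B + (s + t) * J) = / (s - 1) + Cplus A (B * P) - P * (s + t) * J)%C.
  toC. ring.
Qed.

Lemma zeta_EM_add m k s : 2 <= Re s + INR (S m) -> zeta_EM m s = zeta_EM (k + m) s.
Proof.
  intros H. induction k as [|k IH]; [reflexivity|].
  rewrite IH. apply zeta_EM_S.
  apply Rle_trans with (1 := H). apply Rplus_le_compat_l, le_INR. lia.
Qed.

Lemma zeta_eq_EM m s : 2 <= Re s + INR (S m) -> zeta s = zeta_EM m s.
Proof.
  intros H. unfold zeta. set (m0 := S _).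
  rewrite (zeta_EM_add m m0 s H), Nat.add_comm.
  apply zeta_EM_add. unfold m0. rewrite !S_INR.
  pose proof (archimed (- Re s)) as [A _].
  assert (IZR (up (- Re s)) <= INR (Z.to_nat (up (- Re s)))).
  { rewrite INR_IZR_INZ. apply IZR_le. lia. }
  lra.
Qed.

Lemma zeta_Dirichlet (s : C) : 1 < Re s ->
  is_series (K := C_AbsRing) (V := C_NormedModule) (fun n => Rcpow (INR (S n)) (- s)) (zeta s).
Proof.
  intros Hs.
  assert (Hs1 : s <> RtoC 1). { intros ->. simpl in Hs. lra. }
  assert (Hs2 : (s - 1)%C <> 0). { intros E. apply Hs1. now apply Ceq_minus. }
  rewrite (zeta_eq_EM 1) by (simpl; lra).
  assert (H0 : is_Cser (EM_term 0 s) (/ (s - 1))%C).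
  { apply is_Cser_ext with (fun n => ((- / (s - 1)) * (Rcpow (INR (S (S n))) (1 - s) - Rcpow (INR (S n)) (1 - s)))%C).
    - intros n. rewrite EM_0 by auto. toC. field. auto.
    - assert (Hw : Re (1 - s) < 0).
      { unfold Cminus. rewrite re_plus, re_opp, re_RtoC. lra. }
      pose proof (is_Cser_scal (- / (s - 1))%C _ _ (is_Cser_tele _ Hw)) as G.
      replace (- / (s - 1) * - (1))%C with (/ (s - 1))%C in G by ring. exact G. }
  assert (H1 := EM_step 0 s). 
  specialize (H1 ltac:(simpl; lra) ltac:(simpl; lra)).
  assert (HT := is_Cser_tele (- s)%C ltac:(rewrite re_opp; lra)).
  apply is_Cser_ext with (fun n => (EM_term 0 s n + (- s) * EM_term 1 s n
      + (- RtoC (1/2)) * (Rcpow (INR (S (S n))) (- s) - Rcpow (INR (S n)) (- s)))%C).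
  { intros n. rewrite (EM_rec 0). rewrite !bern_1.
    change (INR 0) with 0. replace (s + 0)%C with s by ring.
    replace (1 - 1/2) with (1/2) by field. replace (0 - 1/2) with (-(1/2)) by field.
    rewrite RtoC_opp.
    transitivity ((RtoC (1/2) + RtoC (1/2)) * Rcpow (INR (S n)) (- s))%C; [toC; ring|].
    rewrite <- RtoC_plus. replace (1/2+1/2) with 1 by field. toC. ring. }
  pose proof (is_Cser_plus _ _ _ _ (is_Cser_plus _ _ _ _ H0 (is_Cser_scal (- s)%C _ _ H1))
     (is_Cser_scal (- RtoC (1/2))%C _ _ HT)) as H.
  match type of H with is_series _ ?l => replace (zeta_EM 1 s) with l; [exact H|] end.
  unfold zeta_EM. rewrite sum_Sn, sum_O.
  change (plus (G := C_AbelianMonoid)) with Cplus.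
  rewrite (bern_1 1). replace (1 - 1/2) with (1/2) by field.
  simpl Cpoch. simpl INR. toC. 
  set (J := CSeries _). set (B := bern 2 1). ring.
Qed.

Lemma is_derive_Cexp_line z t :
  is_derive (K := R_AbsRing) (V := C_R_NormedModule)
    (fun t => Cexp (RtoC t * z)) t (z * Cexp (RtoC t * z))%C.
Proof.
  destruct z as [a b]. apply Cderive_pair; unfold Cexp; simpl;
  auto_derive; auto; unfold Rminus; ring.
Qed.

Lemma Cmod_Cexp_le z t : 0 <= t <= 1 -> Cmod (Cexp (RtoC t * z)) <= exp (Cmod z).
Proof.
  intros Ht. rewrite Cmod_Cexp.
  assert (Re (RtoC t * z) <= Cmod z).
  { rewrite re_scal_l. pose proof (re_le_Cmod z). pose proof (Rle_abs (Re z)).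
    pose proof (Cmod_ge_0 z). nra. }
  destruct (Req_dec (Re (RtoC t * z)) (Cmod z)) as [->|]; [lra|].
  left. apply exp_increasing. lra.
Qed.

Lemma Cexp_line_int z : is_CInt (fun t => (z * Cexp (RtoC t * z))%C) 0 1 (Cexp z - 1)%C.
Proof.
  replace (Cexp z - 1)%C with (Cexp (RtoC 1 * z) - Cexp (RtoC 0 * z))%C.
  - apply (is_RInt_derive (V := C_R_CompleteNormedModule) (fun t => Cexp (RtoC t * z))).
    + intros; apply is_derive_Cexp_line.
    + intros. apply continuous_Cmul_l.
      apply (ex_derive_continuous (V := C_R_NormedModule)).
      eexists. apply is_derive_Cexp_line.
  - rewrite Cmult_1_l, Cmult_0_l, Cexp_0. reflexivity.
Qed.

Lemma Cexp_bound1 z : Cmod (Cexp z - 1) <= Cmod z * exp (Cmod z).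
Proof.
  apply (CInt_bound _ _ _ (Cexp_line_int z)). intros u Hu.
  rewrite Cmod_mult. apply Rmult_le_compat_l; [apply Cmod_ge_0|now apply Cmod_Cexp_le].
Qed.

Lemma Cexp_bound2 z : Cmod (Cexp z - 1 - z) <= Cmod z ^ 2 * exp (Cmod z).
Proof.
  assert (H : is_CInt (fun t => (z * Cexp (RtoC t * z) - z)%C) 0 1 (Cexp z - 1 - z)%C).
  { pose proof (is_RInt_minus (V := C_R_NormedModule) _ _ 0 1 _ _ (Cexp_line_int z)
      (is_RInt_const (V := C_R_NormedModule) 0 1 z)) as G.
    rewrite (scal_R_Cmult (1 - 0)), Rminus_0_r, Cmult_1_l in G. exact G. }
  apply (CInt_bound _ _ _ H). intros u Hu.
  replace (z * Cexp (RtoC u * z) - z)%C with (z * (Cexp (RtoC u * z) - 1))%C by ring.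
  rewrite Cmod_mult.
  assert (B := Cexp_bound1 (RtoC u * z)).
  rewrite Cmod_mult, Cmod_R, Rabs_pos_eq in B by lra.
  pose proof (Cmod_ge_0 z). pose proof (exp_pos (Cmod z)).
  assert (u * Cmod z <= Cmod z) by nra.
  assert (exp (u * Cmod z) <= exp (Cmod z)).
  { destruct (Req_dec (u * Cmod z) (Cmod z)) as [->|]; [lra|]. left; apply exp_increasing; lra. }
  pose proof (exp_pos (u * Cmod z)).
  simpl. rewrite Rmult_1_r, Rmult_assoc. apply Rmult_le_compat_l; auto.
  apply Rle_trans with (1 := B). apply Rmult_le_compat; try lra. nra.
Qed.

Lemma ln_bounds x : 1 <= x -> 0 <= ln x <= x.
Proof.
  intros H. split.
  - destruct (Req_dec x 1) as [->|]; [rewrite ln_1; lra|].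
    rewrite <- ln_1; left; apply ln_increasing; lra.
  - pose proof (exp_ineq1_le (ln x)). rewrite exp_ln in H0 by lra. lra.
Qed.

Lemma Rcpow_quad x w h : 1 <= x -> Re w <= - 5 -> Cmod h <= 1 ->
  Cmod (Rcpow x (w - h) - Rcpow x w - h * (RtoC (- ln x) * Rcpow x w)) <= Cmod h ^ 2 * / x ^ 2.
Proof.
  intros Hx Hw Hh.
  set (z := (- h * RtoC (ln x))%C).
  replace (Rcpow x (w - h) - Rcpow x w - h * (RtoC (- ln x) * Rcpow x w))%C
    with (Rcpow x w * (Cexp z - 1 - z))%C.
  2:{ change (w - h)%C with (w + - h)%C. rewrite Rcpow_plus. rewrite RtoC_opp.
      change (Rcpow x (- h)) with (Cexp z). unfold z. ring. }
  destruct (ln_bounds x Hx) as [L0 L1].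
  assert (Hz : Cmod z = Cmod h * ln x).
  { unfold z. rewrite Cmod_mult, Cmod_opp, Cmod_R, Rabs_pos_eq; auto. }
  assert (H1 : Cmod (Rcpow x w) <= / x ^ 5) by (apply Rcpow_bound; simpl; lra).
  assert (H2 : Cmod (Cexp z - 1 - z) <= Cmod h ^ 2 * x ^ 3).
  { apply Rle_trans with (1 := Cexp_bound2 z). rewrite Hz.
    pose proof (Cmod_ge_0 h).
    assert (exp (Cmod h * ln x) <= x).
    { rewrite <- (exp_ln x) at 2 by lra.
      destruct (Req_dec (Cmod h * ln x) (ln x)) as [->|]; [lra|]. left; apply exp_increasing; nra. }
    replace ((Cmod h * ln x) ^ 2 * exp (Cmod h * ln x)) with (Cmod h ^ 2 * (ln x ^ 2 * exp (Cmod h * ln x))) by ring.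
    apply Rmult_le_compat_l; [apply pow_le; auto|].
    replace (x ^ 3) with (x ^ 2 * x) by ring.
    apply Rmult_le_compat; auto.
    - apply pow_le; auto.
    - left; apply exp_pos.
    - apply pow_incr; auto. }
  rewrite Cmod_mult.
  replace (Cmod h ^ 2 * / x ^ 2) with (/ x ^ 5 * (Cmod h ^ 2 * x ^ 3)) by (field; lra).
  apply Rmult_le_compat; auto using Cmod_ge_0.
Qed.

Definition EM_dterm (m : nat) (s : C) (n : nat) : C :=
  RInt (V := C_R_CompleteNormedModule)
    (fun u => (RtoC (bern m u) * (RtoC (- ln (INR (S n) + u)) *
               Rcpow (INR (S n) + u) (- (s + RtoC (INR m)))))%C) 0 1.

Lemma EM_dterm_correct m s n :
  is_CInt (fun u => (RtoC (bern m u) * (RtoC (- ln (INR (S n) + u)) *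
               Rcpow (INR (S n) + u) (- (s + RtoC (INR m)))))%C) 0 1
    (EM_dterm m s n).
Proof.
  apply (RInt_correct (V := C_R_CompleteNormedModule)).
  apply (ex_RInt_continuous (V := C_R_CompleteNormedModule)).
  intros z Hz. rewrite Rmin_left, Rmax_right in Hz by lra.
  pose proof (Spos n).
  apply continuous_bern_mul.
  apply continuous_ext with (fun t => scal (V := C_R_ModuleSpace) (- ln (INR (S n) + t)) (Rcpow (INR (S n) + t) (- (s + RtoC (INR m))))).
  { intros t. apply scal_R_Cmult. }
  apply (continuous_scal (V := C_R_NormedModule)).
  - apply (ex_derive_continuous (fun t => - ln (INR (S n) + t))). generalize (INR (S n)) H. intros N HN. auto_derive. lra.
  - apply continuous_Rcpow_shift. lra.
Qed.

Lemma EM_quad m s : 5 <= Re s + INR m -> exists M, 0 < M /\ forall h n, Cmod h <= 1 ->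
  Cmod (EM_term m (s + h) n - EM_term m s n - h * EM_dterm m s n) <= M * Cmod h ^ 2 * / INR (S n) ^ 2.
Proof.
  intros H. destruct (bern_bounded m) as [M [HM HB]].
  exists M. split; auto. intros h n Hh. pose proof (Spos n).
  pose proof (is_RInt_minus (V := C_R_NormedModule) _ _ 0 1 _ _
   (is_RInt_minus (V := C_R_NormedModule) _ _ 0 1 _ _ (EM_term_correct m (s + h) n) (EM_term_correct m s n))
   (is_CInt_Cmult _ _ _ _ h (EM_dterm_correct m s n))) as G.
  apply (CInt_bound _ _ _ G). intros u Hu.
  set (x := INR (S n) + u). set (w := (- (s + RtoC (INR m)))%C).
  match goal with |- Cmod ?a <= _ => replace a with
   (RtoC (bern m u) * (Rcpow x (w - h) - Rcpow x w - h * (RtoC (- ln x) * Rcpow x w)))%C end.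
  2:{ change (RtoC (bern m u) * (Rcpow x (w - h) - Rcpow x w - h * (RtoC (- ln x) * Rcpow x w))
     = RtoC (bern m u) * Rcpow x (- (s + h + RtoC (INR m))) - RtoC (bern m u) * Rcpow x w
       - h * (RtoC (bern m u) * (RtoC (- ln x) * Rcpow x w)))%C.
     replace (- (s + h + RtoC (INR m)))%C with (w - h)%C by (unfold w; ring). ring. }
  rewrite Cmod_mult, Cmod_R, Rmult_assoc.
  apply Rmult_le_compat; auto using Rabs_pos, Cmod_ge_0.
  eapply Rle_trans; [apply Rcpow_quad|]; auto.
  - unfold x; lra.
  - unfold w. rewrite re_opp, re_plus, re_RtoC. lra.
  - apply Rmult_le_compat_l; [apply pow_le, Cmod_ge_0|]. apply inv_pow_le. unfold x; lra.
Qed.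

Lemma EM_d_ex m s : 5 <= Re s + INR m ->
  ex_series (K := C_AbsRing) (V := C_NormedModule) (EM_dterm m s).
Proof.
  intros H. destruct (bern_bounded m) as [M [HM HB]].
  apply (ex_series_le (K := C_AbsRing) (V := C_CompleteNormedModule) _ (fun n => M * / INR (S n) ^ 2)).
  - intros n. change (Cmod (EM_dterm m s n) <= M * / INR (S n) ^ 2).
    apply (CInt_bound _ _ _ (EM_dterm_correct m s n)). intros u Hu.
    pose proof (Spos n). set (x := INR (S n) + u).
    assert (Hx : 1 <= x) by (unfold x; lra).
    rewrite Cmod_mult, Cmod_R.
    apply Rmult_le_compat; auto using Rabs_pos, Cmod_ge_0.
    apply Rle_trans with (/ x ^ 2); [|apply inv_pow_le; unfold x; lra].
    destruct (ln_bounds x Hx) as [L0 L1].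
    rewrite Cmod_mult, Cmod_R, Rabs_Ropp, Rabs_pos_eq by auto.
    replace (/ x ^ 2) with (x * / x ^ 3) by (field; lra).
    apply Rmult_le_compat; auto using Cmod_ge_0.
    apply Rcpow_bound; auto. rewrite re_opp, re_plus, re_RtoC. simpl; lra.
  - apply (ex_series_scal_l (V := R_NormedModule) M (fun n => / INR (S n) ^ 2)), ex_inv_sq.
Qed.

Lemma Cser_bound (a : nat -> C) l K : is_Cser a l ->
  (forall n, Cmod (a n) <= K * / INR (S n) ^ 2) ->
  Cmod l <= 2 * (K * Series (fun n => / INR (S n) ^ 2)).
Proof.
  intros H B. destruct (is_series_C_inv _ _ H) as [A1 A2].
  assert (EK : ex_series (fun n => K * / INR (S n) ^ 2)).
  { apply (ex_series_scal_l (V := R_NormedModule) K (fun n => / INR (S n) ^ 2)), ex_inv_sq. }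
  assert (T : forall (p : C -> R) r, (forall z, Rabs (p z) <= Cmod z) -> is_series (fun n => p (a n)) r ->
     Rabs r <= K * Series (fun n => / INR (S n) ^ 2)).
  { intros p r Hp Hr. rewrite <- (is_series_unique _ _ Hr), <- Series_scal_l.
    eapply Rle_trans; [apply Series_Rabs|].
    - apply (ex_series_le (V := R_CompleteNormedModule) _ (fun n => K * / INR (S n) ^ 2)); auto.
      intros n. change (Rabs (Rabs (p (a n))) <= K * / INR (S n) ^ 2). rewrite Rabs_Rabsolu.
      eapply Rle_trans; [apply Hp|apply B].
    - apply Series_le; auto. intros n. split; [apply Rabs_pos|].
      eapply Rle_trans; [apply Hp|apply B]. }
  assert (Cmod l <= Rabs (Re l) + Rabs (Im l)).
  { replace l with (RtoC (Re l) + Ci * RtoC (Im l))%C at 1 by (apply Ceq; simpl; ring).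
    eapply Rle_trans; [apply Cmod_triangle|]. rewrite Cmod_mult, Cmod_Ci, !Cmod_R. lra. }
  pose proof (T Re _ re_le_Cmod A1).
  assert (Him : forall z, Rabs (Im z) <= Cmod z).
  { intros z. eapply Rle_trans; [apply Rmax_r|apply Rmax_Cmod]. }
  pose proof (T Im _ Him A2). lra.
Qed.

Lemma Cderive_quad (f : C -> C) z l K d : 0 < d ->
  (forall h, Cmod h <= d -> Cmod (f (z + h) - f z - h * l) <= K * Cmod h ^ 2)%C ->
  is_derive (K := C_AbsRing) (V := C_NormedModule) f z l.
Proof.
  intros Hd H. split; [apply (is_linear_scal_l (V := C_NormedModule))|].
  intros y Hy. apply (is_filter_lim_locally_unique (V := AbsRing_NormedModule C_AbsRing)) in Hy. rewrite <- Hy.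
  intros [e He].
  assert (HK : 0 < Rabs K + 1) by (pose proof (Rabs_pos K); lra).
  assert (Hr : 0 < Rmin d (e / (Rabs K + 1))).
  { apply Rmin_case; auto. now apply Rdiv_lt_0_compat. }
  exists (mkposreal _ Hr). intros t Ht.
  change (Cmod (t - z) < Rmin d (e / (Rabs K + 1))) in Ht.
  change (Cmod (f t - f z - (t - z) * l) <= e * Cmod (t - z)).
  assert (H1 := Rmin_l d (e / (Rabs K + 1))). assert (H2 := Rmin_r d (e / (Rabs K + 1))).
  specialize (H (t - z)%C ltac:(lra)).
  assert (E : forall a b : C, (a + (b - a))%C = b) by (intros; ring). rewrite (E z t) in H.
  apply Rle_trans with (1 := H).
  pose proof (Cmod_ge_0 (t - z)). pose proof (Rle_abs K).
  assert (Cmod (t - z) * (Rabs K + 1) <= e).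
  { apply Rle_trans with (e / (Rabs K + 1) * (Rabs K + 1)).
    - apply Rmult_le_compat_r; lra.
    - right. field. lra. }
  simpl. nra.
Qed.

Lemma Cdiff_EM m s : 5 < Re s + INR m -> Cdifferentiable (fun t => CSeries (EM_term m t)) s.
Proof.
  intros H. destruct (EM_quad m s) as [M [HM Q]]; [lra|].
  exists (CSeries (EM_dterm m s)).
  apply Cderive_quad with (K := 2 * (M * Series (fun n => / INR (S n) ^ 2))) (d := 1); [lra|].
  intros h Hh.
  assert (E1 : is_Cser (EM_term m (s + h)) (CSeries (EM_term m (s + h)))).
  { apply CSeries_correct, EM_ex. rewrite re_plus.
    pose proof (re_le_Cmod h). pose proof (Rle_abs (- Re h)). rewrite Rabs_Ropp in *. lra. }
  assert (E2 : is_Cser (EM_term m s) (CSeries (EM_term m s))).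
  { apply CSeries_correct, EM_ex. lra. }
  assert (E3 : is_Cser (EM_dterm m s) (CSeries (EM_dterm m s))).
  { apply CSeries_correct, EM_d_ex. lra. }
  pose proof (is_Cser_plus _ _ _ _ (is_Cser_plus _ _ _ _ E1 (is_Cser_scal (- (1))%C _ _ E2)) (is_Cser_scal (- h)%C _ _ E3)) as G.
  replace (CSeries (EM_term m (s + h)) - CSeries (EM_term m s) - h * CSeries (EM_dterm m s))%C
   with (CSeries (EM_term m (s + h)) + - (1) * CSeries (EM_term m s) + - h * CSeries (EM_dterm m s))%C by ring.
  eapply Rle_trans; [apply (Cser_bound _ _ (M * Cmod h ^ 2) G)|].
  - intros n.
    replace (EM_term m (s + h) n + - (1) * EM_term m s n + - h * EM_dterm m s n)%C with
     (EM_term m (s + h) n - EM_term m s n - h * EM_dterm m s n)%C by ring.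
    now apply Q.
  - right. ring.
Qed.

Lemma Cdiff_const c s : Cdifferentiable (fun _ => c) s.
Proof. exists zero. apply (is_derive_const (V := C_NormedModule)). Qed.

Lemma is_derive_C_abs (f : C -> C) z l :
  is_derive (K := C_AbsRing) (V := AbsRing_NormedModule C_AbsRing) f z l <->
  is_derive (K := C_AbsRing) (V := C_NormedModule) f z l.
Proof.
  split; intros [_ H]; split; try exact H.
  - apply (is_linear_scal_l (V := C_NormedModule)).
  - apply (is_linear_scal_l (V := AbsRing_NormedModule C_AbsRing)).
Qed.

Lemma Cdiff_id s : Cdifferentiable (fun t => t) s.
Proof. exists one. apply is_derive_C_abs, (is_derive_id (K := C_AbsRing)). Qed.

Lemma Cdiff_plus f g s : Cdifferentiable f s -> Cdifferentiable g s ->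
  Cdifferentiable (fun t => f t + g t)%C s.
Proof. apply (ex_derive_plus (V := C_NormedModule)). Qed.

Lemma Cdiff_mult f g s : Cdifferentiable f s -> Cdifferentiable g s ->
  Cdifferentiable (fun t => f t * g t)%C s.
Proof.
  intros [lf Hf] [lg Hg]. eexists. apply is_derive_C_abs.
  apply is_derive_C_abs in Hf. apply is_derive_C_abs in Hg.
  apply (is_derive_mult (K := C_AbsRing) f g s lf lg Hf Hg).
  intros. apply Cmult_comm.
Qed.

Lemma Cdiff_opp f s : Cdifferentiable f s -> Cdifferentiable (fun t => - f t)%C s.
Proof. apply (ex_derive_opp (V := C_NormedModule)). Qed.

Lemma Cdiff_inv s : s <> RtoC 1 -> Cdifferentiable (fun t => / (t - 1))%C s.
Proof.
  intros Hs.
  assert (Hs2 : (s - 1)%C <> 0). { intros E. apply Hs. now apply Ceq_minus. }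
  assert (Hr : 0 < Cmod (s - 1)) by now apply Cmod_gt_0.
  set (r := Cmod (s - 1)) in *.
  exists (- / ((s - 1) * (s - 1)))%C.
  apply Cderive_quad with (K := 2 / r ^ 3) (d := r / 2); [lra|].
  intros h Hh.
  assert (B : r / 2 <= Cmod (s + h - 1)).
  { assert (T := Cmod_triangle (s + h - 1) (- h)).
    replace (s + h - 1 + - h)%C with (s - 1)%C in T by ring. rewrite Cmod_opp in T. fold r in T. lra. }
  assert (N : (s + h - 1)%C <> 0). { apply Cmod_gt_0. lra. }
  replace (/ (s + h - 1) - / (s - 1) - h * - / ((s - 1) * (s - 1)))%C
    with (h * h * / ((s - 1) * (s - 1) * (s + h - 1)))%C by (field; auto).
  rewrite !Cmod_mult, Cmod_inv by (repeat apply Cmult_neq_0; auto).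
  rewrite !Cmod_mult. fold r.
  rewrite Rmult_comm. simpl (Cmod h ^ 2). rewrite Rmult_1_r.
  apply Rmult_le_compat_r; [apply Rmult_le_pos; apply Cmod_ge_0|].
  replace (2 / r ^ 3) with (/ (r * r * (r / 2))) by (field; lra).
  apply Rinv_le_contravar; [repeat apply Rmult_lt_0_compat; lra|].
  apply Rmult_le_compat_l; auto. nra.
Qed.

Lemma Cdiff_poch k s : Cdifferentiable (fun t => Cpoch t k) s.
Proof.
  induction k as [|k IH]; simpl.
  - apply Cdiff_const.
  - apply Cdiff_mult; [exact IH|]. apply Cdiff_plus; [apply Cdiff_id|apply Cdiff_const].
Qed.

Lemma Cdiff_zeta_EM m s : s <> RtoC 1 -> 5 < Re s + INR (S m) -> Cdifferentiable (zeta_EM m) s.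
Proof.
  intros Hs H. unfold zeta_EM, Cminus at 2. apply Cdiff_plus; [apply Cdiff_plus|].
  - now apply Cdiff_inv.
  - generalize m. clear. induction m as [|m IH].
    + apply (ex_derive_ext (V := C_NormedModule) (fun t => RtoC (bern 1 1) * Cpoch t 0)%C).
      { intros t. now rewrite sum_O. }
      apply Cdiff_mult; [apply Cdiff_const|apply Cdiff_poch].
    + apply (ex_derive_ext (V := C_NormedModule) (fun t => sum_n (G := C_AbelianMonoid)
       (fun k => RtoC (bern (S k) 1) * Cpoch t k)%C m + RtoC (bern (S (S m)) 1) * Cpoch t (S m))%C).
      { intros t. now rewrite sum_Sn. }
      apply Cdiff_plus; auto. apply Cdiff_mult; [apply Cdiff_const|apply Cdiff_poch].
  - apply Cdiff_opp, Cdiff_mult; [apply (Cdiff_poch (S m))|]. now apply Cdiff_EM.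
Qed.

Lemma zeta_Cdifferentiable (s : C) : s <> RtoC 1 -> Cdifferentiable zeta s.
Proof.
  intros Hs. destruct (INR_unbounded (5 - Re s)) as [m Hm].
  assert (Hm' : 5 < Re s + INR (S m)) by (rewrite S_INR; lra).
  apply (ex_derive_ext_loc (V := C_NormedModule) (zeta_EM m)); [|now apply Cdiff_zeta_EM].
  exists (mkposreal 1 Rlt_0_1). intros t Ht. change (Cmod (t - s) < 1) in Ht.
  symmetry. apply zeta_eq_EM.
  pose proof (re_le_Cmod (t - s)) as A. unfold Cminus in A. rewrite re_plus, re_opp in A.
  fold (t - s)%C in A. pose proof (Rle_abs (- (Re t + - Re s))) as B. rewrite Rabs_Ropp in B. 
  lra.
Qed.

End ZetaContinuation.

Theorem zeta_analytic_continuation :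
  (forall s : C, s <> RtoC 1 -> Cdifferentiable zeta s) /\
  (forall s : C, 1 < Re s ->
     is_series (K := C_AbsRing) (V := C_NormedModule)
       (fun n => Rcpow (INR (S n)) (- s)) (zeta s)).
Proof.
  split.
  - exact ZetaContinuation.zeta_Cdifferentiable.
  - exact ZetaContinuation.zeta_Dirichlet.
Qed.

Definition holomorphic_at (f : C -> C) (p : C) : Prop :=
  locally (T := C_UniformSpace) p (Cdifferentiable f).

Definition meromorphic_at (f : C -> C) (p : C) : Prop :=
  exists (N : nat) (g : C -> C),
    holomorphic_at g p /\
    locally' (T := C_UniformSpace) p (fun z => f z = g z / (z - p) ^ N)%C.

Definition has_pole_of_order (N : nat) (f : C -> C) (p : C) : Prop :=
  exists g : C -> C,
    holomorphic_at g p /\ g p <> RtoC 0 /\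
    locally' (T := C_UniformSpace) p (fun z => f z = g z / (z - p) ^ N)%C.

(* At a pole (or regular point) p: r is the coefficient of (z - p)^(-1) in the
   principal part c_0 (z-p)^(-1) + ... + c_N (z-p)^(-N-1). *)
Definition is_residue (f : C -> C) (p r : C) : Prop :=
  exists (N : nat) (c : nat -> C) (g : C -> C),
    holomorphic_at g p /\ c O = r /\
    locally' (T := C_UniformSpace) p (fun z =>
      f z = sum_n (G := C_AbelianMonoid) (fun j => c j / (z - p) ^ S j) N + g z)%C.

(* 2 pi i k / log beta *)
Definition freq (beta : R) (k : Z) : C :=
  (RtoC (2 * PI) * Ci * RtoC (IZR k) / RtoC (ln beta))%C.

(* - (beta - 1) / (2 pi i k) * (1 + 2 pi i k / log beta)^(-1)
   * zeta (2 pi i k / log beta) *)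
Definition c_beta_nonzero (beta : R) (k : Z) : C :=
  (- (RtoC (beta - 1) / (RtoC (2 * PI) * Ci * RtoC (IZR k)))
   * / (1 + freq beta k) * zeta (freq beta k))%C.

Definition c_beta_zero (beta : R) : R :=
  (beta - 1) / (2 * ln beta) * (ln (2 * PI) - 1) - (beta + 1) / 4.

Definition c_beta (beta : R) (k : Z) : C :=
  if Z.eq_dec k 0 then RtoC (c_beta_zero beta) else c_beta_nonzero beta k.

Definition h_beta (beta x : R) : C :=
  CZseries (fun k =>
    c_beta beta k * Cexp (RtoC (2 * PI) * Ci * RtoC (IZR k) * RtoC x))%C.

Definition S_beta (beta : R) (n : nat) : C :=
  (RtoC ((beta - 1) / (2 * ln beta) * INR n * ln (INR n))
   + h_beta beta (ln (INR n) / ln beta) * RtoC (INR n))%C.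

(* Main.v *)
Require Import Defs.
From Stdlib Require Import Reals ZArith Lra Lia.
From Coquelicot Require Import Coquelicot.
Import ZetaContinuation.
Open Scope R_scope.

(** With [g] the periodic function [({x}^2 - {x}) / 2], the formula
    [zeta s = (s + 1) / (2 (s - 1)) - s (s + 1) int_1^oo g(x) x^(-s - 2) dx], valid for [Re s > -1],
    shows that the [c_beta k] are the Fourier coefficients of an explicit function of Delange type, a
    two-sided sum of dilates of [g].  That function is Holder of every exponent below 1.  By
    Bernstein's theorem its Fourier series converges absolutely, so it equals [h_beta]; and
    [sum S(n) n^(-s)] differs from [int S(x) x^(-s) dx] by a function holomorphic on [Re s > 1].
    The integral is [A / (s - 2)^2 + sum_k c_beta(k) / (s - 2 - i t_k)], which displays the poles.
    They are genuine because [zeta (i t) <> 0] for real [t <> 0]: this follows from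
    [zeta (1 + i t) <> 0] (the 3-4-1 inequality) and a functional equation
    [zeta w / (w (w + 1)) = P(w) zeta (1 - w) / (2 pi^2)], where [P(w)] stays away from zero as
    [Re w] tends to 0 from below, as one sees by testing the same Mellin transform on a
    periodised bump. *)

(** Three obstacles shape the argument. Bounding the coefficients directly would need growth
    estimates for [zeta] on the imaginary axis; reading them as Fourier coefficients of a Holder
    function avoids these, and any exponent above 1/2 then gives absolute convergence. The abscissa
    1, on the other hand, uses all exponents below 1: exponent [1 - th] makes [S(n) - S(n + u)] of
    size [n ^ th], so that sum minus integral is holomorphic for [Re s > 1 + th], for every small
    [th > 0]. Finally, [P(w)] is the integral of [(1 - cos (2 pi y)) y^(-2-w)] over the half-line, a
    Gamma factor in disguise. It is never evaluated: by scaling, it is a common factor of the Mellin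
    transforms of all cosine series, so one test function whose transform is visibly bounded below,
    and whose coefficient sum is bounded above, keeps it away from zero. The argument lives at
    [Re w < 0], where the Dirichlet series of [zeta (1 - w)] converges, and reaches the axis only
    through the differentiability of [zeta] at [i t] and [1 - i t]. *)

Notation is_CInt := (is_RInt (V := C_R_NormedModule)).
Notation is_Cser := (is_series (K := C_AbsRing) (V := C_NormedModule)).

(** * Dominated series in normed modules *)

Section NormedSeries.
Context {K : AbsRing} {V : NormedModule K}.

Lemma norm_sum_n_m_le (a : nat -> V) (b : nat -> R) n m :
  (forall k, norm (a k) <= b k) -> norm (sum_n_m a n m) <= sum_n_m b n m.
Proof.
  intros H. eapply Rle_trans; [apply (norm_sum_n_m a)|].
  apply (sum_n_m_le (fun k => norm (a k)) b n m H).
Qed.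

Lemma norm_series_le (a : nat -> V) l (b : nat -> R) B :
  is_series a l -> is_series b B -> (forall n, norm (a n) <= b n) -> norm l <= B.
Proof.
  intros Ha Hb H.
  apply (is_lim_seq_le (fun n => norm (sum_n a n)) (sum_n b) (norm l) B).
  - intros n. now apply norm_sum_n_m_le.
  - apply (filterlim_comp _ _ _ (sum_n a) norm _ (locally l)); [exact Ha|].
    apply filterlim_norm.
  - exact Hb.
Qed.

Lemma series_tail_le (a : nat -> V) l (b : nat -> R) B n :
  is_series a l -> is_series b B -> (forall n, norm (a n) <= b n) ->
  norm (minus l (sum_n a n)) <= B - sum_n b n.
Proof.
  intros Ha Hb H.
  apply (is_lim_seq_le_loc (fun m => norm (minus (sum_n a m) (sum_n a n)))
    (fun m => sum_n b m - sum_n b n) (norm (minus l (sum_n a n))) (B - sum_n b n)).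
  - exists n. intros m Hm.
    destruct (Nat.eq_dec m n) as [->|Hne].
    + rewrite minus_eq_zero. apply Req_le. rewrite Rminus_diag. apply (norm_zero (V := V)).
    + replace (minus (sum_n a m) (sum_n a n)) with (sum_n_m a (S n) m)
        by (apply (sum_n_m_sum_n (G := V) a n m); lia).
      replace (sum_n b m - sum_n b n) with (sum_n_m b (S n) m).
      * now apply norm_sum_n_m_le.
      * apply (sum_n_m_sum_n b n m). lia.
  - apply (filterlim_comp _ _ _ (fun m => minus (sum_n a m) (sum_n a n)) norm _ (locally (minus l (sum_n a n)))).
    + unfold minus. eapply filterlim_comp_2;
      [exact Ha|apply filterlim_const|apply (filterlim_plus (V := V))].
    + apply filterlim_norm.
  - apply (is_lim_seq_minus' (sum_n b) (fun _ => sum_n b n)); [exact Hb|apply is_lim_seq_const].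
Qed.

Lemma series_tail_small (b : nat -> R) B (eps : posreal) :
  is_series b B -> exists n, forall m, (n <= m)%nat -> Rabs (B - sum_n b m) < eps.
Proof.
  intros Hb. destruct (Hb (ball B eps) (locally_ball B eps)) as [n Hn].
  exists n. intros m Hm. specialize (Hn m Hm).
  rewrite Rabs_minus_sym. exact Hn.
Qed.

Lemma norm_minus_via (x y z t : V) :
  norm (minus x t) <= norm (minus x y) + norm (minus y z) + norm (minus t z).
Proof.
  rewrite (minus_trans y x t), (minus_trans z y t).
  eapply Rle_trans; [apply (norm_triangle (V := V))|].
  rewrite Rplus_assoc. apply Rplus_le_compat_l.
  eapply Rle_trans; [apply (norm_triangle (V := V))|].
  apply Rplus_le_compat_l. rewrite <- norm_opp, opp_minus. apply Rle_refl.
Qed.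

(** Dominated convergence for series: one cut-off [n] makes the tails of all [u N] and of [v]
    smaller than [eps / 4] at once, and the finitely many remaining terms converge one by one. It
    exchanges the limit of truncated Mellin integrals with a sum over frequencies in
    [cosine_mellin]. *)
Lemma tannery (u : nat -> nat -> V) (v S : nat -> V) (T : V) (b : nat -> R) :
  (forall n, filterlim (fun N => u N n) eventually (locally (v n))) ->
  (forall N n, norm (u N n) <= b n) -> (forall n, norm (v n) <= b n) -> ex_series b ->
  (forall N, is_series (u N) (S N)) -> is_series v T ->
  filterlim S eventually (locally T).
Proof.
  intros Hu Hb Hv [B HB] HS HT.
  apply (filterlim_locally_ball_norm (U := V)). intros eps.
  assert (He : 0 < eps / 4) by (destruct eps; simpl; lra).
  destruct (series_tail_small b B (mkposreal _ He) HB) as [n Hn].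
  specialize (Hn n (Nat.le_refl n)). simpl in Hn. apply Rabs_lt_between in Hn.
  assert (L : filterlim (fun N => sum_n (u N) n) eventually (locally (sum_n v n))).
  { clear Hn. induction n as [|n IH].
    - apply filterlim_ext with (fun N => u N O); [intros; now rewrite sum_O|].
      rewrite sum_O. apply Hu.
    - apply filterlim_ext with (fun N => plus (sum_n (u N) n) (u N (Datatypes.S n)));
        [intros; now rewrite sum_Sn|].
      rewrite sum_Sn.
      eapply filterlim_comp_2; [exact IH|apply Hu|apply (filterlim_plus (V := V))]. }
  apply (filterlim_locally_ball_norm (U := V)) with (eps := mkposreal _ He) in L.
  revert L. apply filter_imp. intros N HN. unfold ball_norm in *. simpl in HN.
  pose proof (series_tail_le _ _ _ _ n (HS N) HB (Hb N)) as T1.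
  pose proof (series_tail_le _ _ _ _ n HT HB Hv) as T2.
  eapply Rle_lt_trans; [apply (norm_minus_via _ (sum_n (u N) n) (sum_n v n))|].
  lra.
Qed.

End NormedSeries.

Lemma series_continuous {U : UniformSpace} {K : AbsRing} {V : NormedModule K}
  (F : nat -> U -> V) (f : U -> V) (b : nat -> R) x :
  (forall k, continuous (F k) x) -> (forall k y, norm (F k y) <= b k) -> ex_series b ->
  (forall y, is_series (fun k => F k y) (f y)) -> continuous f x.
Proof.
  intros HF Hb [B HB] Hf.
  apply (filterlim_locally_ball_norm (U := V)). intros eps.
  assert (He : 0 < eps / 4) by (destruct eps; simpl; lra).
  destruct (series_tail_small b B (mkposreal _ He) HB) as [n Hn].
  specialize (Hn n (Nat.le_refl n)). simpl in Hn. apply Rabs_lt_between in Hn.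
  assert (L : continuous (fun y => sum_n (fun k => F k y) n) x).
  { clear Hn. induction n as [|n IH].
    - apply continuous_ext with (F O); [intros; now rewrite sum_O|apply HF].
    - apply continuous_ext with (fun y => plus (sum_n (fun k => F k y) n) (F (S n) y));
        [intros; now rewrite sum_Sn|].
      apply (continuous_plus (V := V)); auto. }
  apply (filterlim_locally_ball_norm (U := V)) with (eps := mkposreal _ He) in L.
  unfold filtermap in *.
  revert L. apply filter_imp. intros y HN. unfold ball_norm in *. simpl in HN.
  pose proof (series_tail_le _ _ _ _ n (Hf y) HB (fun k => Hb k y)) as T1.
  pose proof (series_tail_le _ _ _ _ n (Hf x) HB (fun k => Hb k x)) as T2.
  eapply Rle_lt_trans;
    [apply (norm_minus_via _ (sum_n (fun k => F k y) n) (sum_n (fun k => F k x) n))|].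
  lra.
Qed.

Lemma is_RInt_sum_n {V : NormedModule R_AbsRing} (F : nat -> R -> V) (I : nat -> V) a b n :
  (forall k, is_RInt (F k) a b (I k)) ->
  is_RInt (fun x => sum_n (fun k => F k x) n) a b (sum_n I n).
Proof.
  intros H. induction n as [|n IH].
  - rewrite sum_O. apply is_RInt_ext with (F O); [intros; now rewrite sum_O|apply H].
  - rewrite sum_Sn. apply is_RInt_ext with (fun y => plus (sum_n (fun k => F k y) n) (F (S n) y));
        [intros; now rewrite sum_Sn|].
    apply (is_RInt_plus (V := V)); auto.
Qed.

(** The domination makes the convergence uniform on [[x, y]], so the integrated remainder is at most
    the length times a tail of [b]. Integrability of [f] is assumed: in the applications [f] is
    known to be continuous beforehand. *)
Lemma RInt_series {V : NormedModule R_AbsRing} (F : nat -> R -> V) (f : R -> V)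
  (I : nat -> V) L (b : nat -> R) x y :
  x <= y -> (forall k, is_RInt (F k) x y (I k)) -> is_RInt f x y L ->
  (forall t, x <= t <= y -> is_series (fun k => F k t) (f t)) ->
  (forall k t, x <= t <= y -> norm (F k t) <= b k) -> ex_series b ->
  is_series I L.
Proof.
  intros Hxy HF Hf Hs Hb [B HB].
  apply (filterlim_locally_ball_norm (U := V)). intros eps.
  (* The [+ 1] keeps the quotient meaningful when [x = y]. *)
  assert (He : 0 < eps / (y - x + 1)) by (apply Rdiv_lt_0_compat; [apply cond_pos|lra]).
  destruct (series_tail_small b B (mkposreal _ He) HB) as [n Hn].
  exists n. intros m Hm. specialize (Hn m Hm). simpl in Hn. apply Rabs_lt_between in Hn.
  unfold ball_norm.
  rewrite <- norm_opp, opp_minus.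
  pose proof (is_RInt_minus (V := V) _ _ x y _ _ Hf (is_RInt_sum_n F I x y m HF)) as G.
  apply Rle_lt_trans with ((y - x) * (B - sum_n b m)).
  - apply (norm_RInt_le_const (V := V) _ x y _ _ Hxy) with (2 := G).
    intros t Ht.
    apply (series_tail_le (fun k => F k t) (f t) b B m); auto.
  - apply Rle_lt_trans with ((y - x) * (eps / (y - x + 1))).
    + apply Rmult_le_compat_l; lra.
    + apply Rmult_lt_reg_r with (y - x + 1); [lra|].
      replace ((y - x) * (eps / (y - x + 1)) * (y - x + 1)) with ((y - x) * eps) by (field; lra).
      pose proof (cond_pos eps). nra.
Qed.

Lemma is_series_single {K : AbsRing} {V : NormedModule K} (j : nat) (v : V) :
  is_series (fun k => if Nat.eqb k j then v else zero) v.
Proof.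
  apply filterlim_ext_loc with (fun _ => v); [|apply filterlim_const].
  exists j. intros n Hn. induction Hn as [|n Hn IH].
  - destruct j as [|j].
    + now rewrite sum_O.
    + rewrite sum_Sn, Nat.eqb_refl.
      unfold sum_n. rewrite (sum_n_m_ext_loc _ (fun _ => zero)).
      * rewrite sum_n_m_const_zero, plus_zero_l. reflexivity.
      * intros k Hk. destruct (Nat.eqb_spec k (S j)); [lia|reflexivity].
  - rewrite sum_Sn, <- IH. destruct (Nat.eqb_spec (S n) j); [lia|]. now rewrite plus_zero_r.
Qed.

(** * Uniqueness of Fourier series *)

Lemma ex_RInt_cont (f : R -> R) a b : (forall x, continuous f x) -> ex_RInt f a b.
Proof. intros H. apply (ex_RInt_continuous (V := R_CompleteNormedModule)). auto. Qed.

Lemma is_RInt_cont (f : R -> R) a b : (forall x, continuous f x) -> is_RInt f a b (RInt f a b).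
Proof. intros H. apply (RInt_correct (V := R_CompleteNormedModule)), ex_RInt_cont, H. Qed.

Lemma continuous_Rmult (f g : R -> R) x :
  continuous f x -> continuous g x -> continuous (fun t => f t * g t) x.
Proof. apply (continuous_mult (K := R_AbsRing)). Qed.

Lemma continuous_Rplus (f g : R -> R) x :
  continuous f x -> continuous g x -> continuous (fun t => f t + g t) x.
Proof. apply (continuous_plus (V := R_NormedModule)). Qed.

Lemma continuous_Rminus (f g : R -> R) x :
  continuous f x -> continuous g x -> continuous (fun t => f t - g t) x.
Proof. apply (continuous_minus (V := R_NormedModule)). Qed.

Lemma continuous_cosw w x : continuous (fun t => cos (w * t)) x.
Proof. apply (ex_derive_continuous (fun t => cos (w * t))). auto_derive; auto. Qed.

Lemma continuous_sinw w x : continuous (fun t => sin (w * t)) x.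
Proof. apply (ex_derive_continuous (fun t => sin (w * t))). auto_derive; auto. Qed.

Lemma continuous_Rconst (c : R) x : continuous (fun _ : R => c) x.
Proof. apply continuous_const. Qed.

Lemma continuous_Rid (x : R) : continuous (fun t : R => t) x.
Proof. apply continuous_id. Qed.

Ltac toR := match goal with |- @eq _ ?a ?b => change (@eq R a b) end.

Create HintDb rcont.
Hint Resolve continuous_Rmult continuous_Rplus continuous_Rminus continuous_cosw
  continuous_sinw continuous_Rconst continuous_Rid : rcont.

Lemma cos_add_period x k : cos (x + 2 * PI * IZR k) = cos x.
Proof.
  destruct (Z_le_dec 0 k) as [Hk|Hk].
  - rewrite <- (Z2Nat.id k Hk), <- INR_IZR_INZ.
    replace (2 * PI * INR (Z.to_nat k)) with (2 * INR (Z.to_nat k) * PI) by ring. apply cos_period.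
  - rewrite <- (cos_period (x + 2 * PI * IZR k) (Z.to_nat (- k))). f_equal.
    rewrite INR_IZR_INZ, Z2Nat.id, opp_IZR by lia. ring.
Qed.

Lemma sin_add_period x k : sin (x + 2 * PI * IZR k) = sin x.
Proof.
  destruct (Z_le_dec 0 k) as [Hk|Hk].
  - rewrite <- (Z2Nat.id k Hk), <- INR_IZR_INZ.
    replace (2 * PI * INR (Z.to_nat k)) with (2 * INR (Z.to_nat k) * PI) by ring. apply sin_period.
  - rewrite <- (sin_period (x + 2 * PI * IZR k) (Z.to_nat (- k))). f_equal.
    rewrite INR_IZR_INZ, Z2Nat.id, opp_IZR by lia. ring.
Qed.

Definition cosk (k : Z) (x : R) : R := cos (2 * PI * IZR k * x).
Definition sink (k : Z) (x : R) : R := sin (2 * PI * IZR k * x).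

Lemma continuous_cosk k x : continuous (cosk k) x.
Proof. apply continuous_cosw. Qed.

Lemma continuous_sink k x : continuous (sink k) x.
Proof. apply continuous_sinw. Qed.

Hint Resolve continuous_cosk continuous_sink : rcont.

Lemma cosk_opp k x : cosk (- k) x = cosk k x.
Proof. unfold cosk. rewrite opp_IZR, <- (cos_neg (2 * PI * IZR k * x)). f_equal. ring. Qed.

Lemma sink_opp k x : sink (- k) x = - sink k x.
Proof. unfold sink. rewrite opp_IZR, <- sin_neg. f_equal. ring. Qed.

Lemma cosk_cosk j k x : cosk j x * cosk k x = (cosk (j + k) x + cosk (j - k) x) / 2.
Proof.
  unfold cosk. rewrite plus_IZR, minus_IZR.
  replace (2 * PI * (IZR j + IZR k) * x) with (2 * PI * IZR j * x + 2 * PI * IZR k * x) by ring.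
  replace (2 * PI * (IZR j - IZR k) * x) with (2 * PI * IZR j * x - 2 * PI * IZR k * x) by ring.
  rewrite cos_plus, cos_minus. field.
Qed.

Lemma sink_sink j k x : sink j x * sink k x = (cosk (j - k) x - cosk (j + k) x) / 2.
Proof.
  unfold cosk, sink. rewrite plus_IZR, minus_IZR.
  replace (2 * PI * (IZR j + IZR k) * x) with (2 * PI * IZR j * x + 2 * PI * IZR k * x) by ring.
  replace (2 * PI * (IZR j - IZR k) * x) with (2 * PI * IZR j * x - 2 * PI * IZR k * x) by ring.
  rewrite cos_plus, cos_minus. field.
Qed.

Lemma sink_cosk j k x : sink j x * cosk k x = (sink (j + k) x + sink (j - k) x) / 2.
Proof.
  unfold cosk, sink. rewrite plus_IZR, minus_IZR.
  replace (2 * PI * (IZR j + IZR k) * x) with (2 * PI * IZR j * x + 2 * PI * IZR k * x) by ring.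
  replace (2 * PI * (IZR j - IZR k) * x) with (2 * PI * IZR j * x - 2 * PI * IZR k * x) by ring.
  rewrite sin_plus, sin_minus. field.
Qed.

Lemma cosk_add_Z k x m : cosk k (x + IZR m) = cosk k x.
Proof.
  unfold cosk. rewrite <- (cos_add_period (2 * PI * IZR k * x) (k * m)). f_equal.
  rewrite mult_IZR. ring.
Qed.

Lemma sink_add_Z k x m : sink k (x + IZR m) = sink k x.
Proof.
  unfold sink. rewrite <- (sin_add_period (2 * PI * IZR k * x) (k * m)). f_equal.
  rewrite mult_IZR. ring.
Qed.

Lemma cosk_0 x : cosk 0 x = 1.
Proof. unfold cosk. rewrite Rmult_0_r, Rmult_0_l. apply cos_0. Qed.

Lemma sink_0 x : sink 0 x = 0.
Proof. unfold sink. rewrite Rmult_0_r, Rmult_0_l. apply sin_0. Qed.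

Lemma Rabs_cosk k x : Rabs (cosk k x) <= 1.
Proof. unfold cosk. apply Rabs_le. pose proof (COS_bound (2 * PI * IZR k * x)). lra. Qed.

Lemma Rabs_sink k x : Rabs (sink k x) <= 1.
Proof. unfold sink. apply Rabs_le. pose proof (SIN_bound (2 * PI * IZR k * x)). lra. Qed.

Lemma is_RInt_eq (f : R -> R) a b (l l' : R) : is_RInt f a b l -> l = l' -> is_RInt f a b l'.
Proof. now intros H <-. Qed.

Lemma is_RInt_cosk k a : is_RInt (cosk k) a (a + 1) (if Z.eq_dec k 0 then 1 else 0).
Proof.
  destruct (Z.eq_dec k 0) as [->|Hk].
  - apply is_RInt_ext with (fun _ => 1); [intros; now rewrite cosk_0|].
    eapply is_RInt_eq; [apply (is_RInt_const (V := R_NormedModule))|].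
    unfold scal; simpl; unfold mult; simpl. ring.
  - assert (Hk' : IZR k <> 0) by now apply not_0_IZR. pose proof PI_RGT_0.
    eapply is_RInt_eq; [apply (is_RInt_derive (V := R_CompleteNormedModule) (fun x => sink k x / (2 * PI * IZR k)))|].
    + intros x _. unfold sink, cosk. auto_derive; auto. field. split; lra.
    + intros; apply continuous_cosk.
    + rewrite (sink_add_Z k a 1). unfold minus, plus, opp; simpl; ring.
Qed.

Lemma is_RInt_sink k a : is_RInt (sink k) a (a + 1) 0.
Proof.
  destruct (Z.eq_dec k 0) as [->|Hk].
  - apply is_RInt_ext with (fun _ => 0); [intros; now rewrite sink_0|].
    eapply is_RInt_eq; [apply (is_RInt_const (V := R_NormedModule))|].
    unfold scal; simpl; unfold mult; simpl. ring.
  - assert (Hk' : IZR k <> 0) by now apply not_0_IZR. pose proof PI_RGT_0.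
    eapply is_RInt_eq; [apply (is_RInt_derive (V := R_CompleteNormedModule) (fun x => - cosk k x / (2 * PI * IZR k)))|].
    + intros x _. unfold sink, cosk. auto_derive; auto. field. split; lra.
    + intros; apply continuous_sink.
    + rewrite (cosk_add_Z k a 1). unfold minus, plus, opp; simpl; ring.
Qed.

Lemma is_RInt_lin2 (f g : R -> R) (c d : R) a b (lf lg : R) :
  is_RInt f a b lf -> is_RInt g a b lg ->
  is_RInt (fun x => c * f x + d * g x) a b (c * lf + d * lg).
Proof.
  intros Hf Hg.
  exact (is_RInt_plus (V := R_NormedModule) _ _ _ _ _ _
    (is_RInt_scal (V := R_NormedModule) f a b c lf Hf)
    (is_RInt_scal (V := R_NormedModule) g a b d lg Hg)).
Qed.

Lemma RInt_ge_const (f : R -> R) a b c : a <= b -> (forall x, continuous f x) ->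
  (forall x, a < x < b -> c <= f x) -> (b - a) * c <= RInt f a b.
Proof.
  intros Hab Hc H. replace ((b - a) * c) with (RInt (fun _ => c) a b)
    by (rewrite RInt_const; reflexivity).
  apply RInt_le; auto using ex_RInt_cont. apply ex_RInt_const.
Qed.

Section Uniqueness.
Variable a : R.

Definition fourier_null (D : R -> R) : Prop :=
  forall k : Z, is_RInt (fun x => D x * cosk k x) a (a + 1) 0 /\
                is_RInt (fun x => D x * sink k x) a (a + 1) 0.

Lemma fourier_null_nat (D : R -> R) :
  (forall k : nat, is_RInt (fun x => D x * cosk (Z.of_nat k) x) a (a + 1) 0 /\
                   is_RInt (fun x => D x * sink (Z.of_nat k) x) a (a + 1) 0) ->
  fourier_null D.
Proof.
  intros H k. destruct (Z_le_dec 0 k) as [Hk|Hk].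
  - specialize (H (Z.to_nat k)). now rewrite Z2Nat.id in H.
  - specialize (H (Z.to_nat (- k))). rewrite Z2Nat.id in H by lia. destruct H as [H1 H2].
    split.
    + eapply is_RInt_ext; [|exact H1]. intros x _. toR. simpl. now rewrite cosk_opp.
    + apply (is_RInt_opp (V := R_NormedModule)) in H2. unfold opp in H2; simpl in H2.
      rewrite Ropp_0 in H2. eapply is_RInt_ext; [|exact H2]. intros x _. toR. simpl.
      rewrite sink_opp. ring.
Qed.

(** By the product formulas, multiplying by a trigonometric polynomial of degree one only mixes the
    coefficients of index [k - 1], [k] and [k + 1], all zero. Both [p] and [q] are kept because the
    peak used below is centred at an arbitrary point. *)
Lemma fourier_null_mult (D : R -> R) c p q :
  fourier_null D -> fourier_null (fun x => D x * (c + p * cosk 1 x + q * sink 1 x)).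
Proof.
  intros H k. destruct (H k) as [Hc Hs], (H (k + 1)%Z) as [Hc1 Hs1], (H (k - 1)%Z) as [Hc2 Hs2].
  split.
  - eapply is_RInt_ext; [|eapply is_RInt_eq;
      [exact (is_RInt_lin2 _ _ 1 1 _ _ _ _ (is_RInt_lin2 _ _ c (p/2) _ _ _ _ Hc Hc1)
        (is_RInt_lin2 _ _ 1 1 _ _ _ _ (is_RInt_lin2 _ _ (p/2) (q/2) _ _ _ _ Hc2 Hs1)
         (is_RInt_lin2 _ _ (-q/2) 0 _ _ _ _ Hs2 Hs2)))|ring]].
    intros x _. toR. simpl.
    transitivity (D x * (c * cosk k x + p * (cosk k x * cosk 1 x) + q * (sink 1 x * cosk k x))); [|ring].
    rewrite cosk_cosk, sink_cosk.
    replace (1 - k)%Z with (- (k - 1))%Z by lia. rewrite sink_opp, (Z.add_comm 1 k). field.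
  - eapply is_RInt_ext; [|eapply is_RInt_eq;
      [exact (is_RInt_lin2 _ _ 1 1 _ _ _ _ (is_RInt_lin2 _ _ c (p/2) _ _ _ _ Hs Hs1)
        (is_RInt_lin2 _ _ 1 1 _ _ _ _ (is_RInt_lin2 _ _ (p/2) (q/2) _ _ _ _ Hs2 Hc2)
         (is_RInt_lin2 _ _ (-q/2) 0 _ _ _ _ Hc1 Hs2)))|ring]].
    intros x _. toR. simpl.
    transitivity (D x * (c * sink k x + p * (sink k x * cosk 1 x) + q * (sink k x * sink 1 x))); [|ring].
    rewrite sink_sink, sink_cosk. field.
Qed.

Lemma fourier_null_pow (D : R -> R) c p q n :
  fourier_null D -> fourier_null (fun x => D x * (c + p * cosk 1 x + q * sink 1 x) ^ n).
Proof.
  intros H. induction n as [|n IH].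
  - intros k. destruct (H k) as [H1 H2]. split; [eapply is_RInt_ext; [|exact H1]|eapply is_RInt_ext; [|exact H2]];
    intros x _; toR; simpl; ring.
  - intros k. destruct (fourier_null_mult _ c p q IH k) as [H1 H2].
    split; [eapply is_RInt_ext; [|exact H1]|eapply is_RInt_ext; [|exact H2]];
    intros x _; toR; simpl; ring.
Qed.

(* If [D x0 > 0], the powers of [1 + cos (2 pi (x - x0)) - cos (2 pi d)] grow exponentially
   near [x0] and stay bounded by 1 away from it, so [D] cannot be orthogonal to all of them. *)
Lemma fourier_null_not_pos (D : R -> R) x0 :
  (forall x, continuous D x) -> fourier_null D -> a < x0 < a + 1 -> D x0 <= 0.
Proof.
  intros HD H0 Hx0. apply Rnot_lt_le. intros Hpos.
  assert (HE : exists d, 0 < d /\ d <= 1/4 /\ a < x0 - d /\ x0 + d < a + 1 /\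
    forall x, Rabs (x - x0) <= d -> D x0 / 2 <= D x).
  { assert (He : 0 < D x0 / 2) by lra.
    destruct (HD x0 (ball (D x0) (mkposreal _ He)) (locally_ball _ _)) as [[d1 Hd1] H1].
    set (d := Rmin (d1 / 2) (Rmin (1/4) (Rmin ((x0 - a)/2) ((a + 1 - x0)/2)))).
    assert (A1 : d <= d1 / 2) by apply Rmin_l.
    assert (A2 : d <= Rmin (1/4) (Rmin ((x0 - a)/2) ((a + 1 - x0)/2))) by apply Rmin_r.
    assert (A3 := Rmin_l (1/4) (Rmin ((x0 - a)/2) ((a + 1 - x0)/2))).
    assert (A4 := Rmin_r (1/4) (Rmin ((x0 - a)/2) ((a + 1 - x0)/2))).
    assert (A5 := Rmin_l ((x0 - a)/2) ((a + 1 - x0)/2)).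
    assert (A6 := Rmin_r ((x0 - a)/2) ((a + 1 - x0)/2)).
    exists d. repeat split; try lra.
    - unfold d. repeat apply Rmin_case; lra.
    - intros x Hx. specialize (H1 x). unfold ball in H1; simpl in H1; unfold AbsRing_ball in H1.
      assert (B : Rabs (x - x0) < d1) by lra.
      specialize (H1 B). unfold abs, minus, plus, opp in H1; simpl in H1.
      apply Rabs_lt_between in H1. lra. }
  destruct HE as [d [Hd0 [Hd4 [Hda [Hdb HDd]]]]].
  destruct (continuity_ab_maj (fun u => Rabs (D u)) a (a + 1)) as [xm [HM _]]; [lra| |].
  { intros c _. apply continuity_pt_filterlim.
    apply (continuous_comp D Rabs); [apply HD|apply continuous_Rabs]. }
  set (M := Rabs (D xm)) in *.
  assert (HM0 : 0 <= M) by apply Rabs_pos.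
  pose proof PI_RGT_0 as Hpi.
  set (T := fun x => 1 + cos (2 * PI * (x - x0)) - cos (2 * PI * d)).
  (* The value of [T] at distance [d / 2] from [x0]: within that distance [T ^ n] grows at least
     like [tau ^ n]. *)
  set (tau := 1 + cos (PI * d) - cos (2 * PI * d)).
  assert (Htau : 1 < tau).
  { unfold tau. assert (cos (2 * PI * d) < cos (PI * d)); [|lra]. apply cos_decreasing_1; nra. }
  assert (Hcd : 0 <= cos (2 * PI * d)) by (apply cos_ge_0; nra).
  assert (Heven : forall y, cos (2 * PI * y) = cos (2 * PI * Rabs y)).
  { intros y. unfold Rabs. destruct (Rcase_abs y); [|reflexivity].
    rewrite <- cos_neg. f_equal. ring. }
  assert (Hdec : forall u v, 0 <= u -> u <= v -> v <= 1 / 2 -> cos (2 * PI * v) <= cos (2 * PI * u)).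
  { intros u v H1 H2 H3. apply cos_decr_1; nra. }
  assert (T1 : forall x, Rabs (x - x0) <= d -> 1 <= T x).
  { intros x Hx. unfold T. assert (cos (2 * PI * d) <= cos (2 * PI * (x - x0))); [|lra].
    rewrite (Heven (x - x0)). pose proof (Rabs_pos (x - x0)). apply Hdec; lra. }
  assert (T2 : forall x, Rabs (x - x0) <= d / 2 -> tau <= T x).
  { intros x Hx. unfold T, tau. assert (cos (PI * d) <= cos (2 * PI * (x - x0))); [|lra].
    rewrite (Heven (x - x0)). replace (PI * d) with (2 * PI * (d / 2)) by field.
    pose proof (Rabs_pos (x - x0)). apply Hdec; lra. }
  (* Inside the period the distance to [x0] lies between [d] and [1 - d], where the cosine does not
     exceed its common value [cos (2 * PI * d)] at the two ends. *)
  assert (T3 : forall x, a <= x <= a + 1 -> d <= Rabs (x - x0) -> Rabs (T x) <= 1).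
  { intros x Hx Hx'. assert (Hub : Rabs (x - x0) <= 1 - d) by (apply Rabs_le; lra).
    apply Rabs_le. unfold T. rewrite (Heven (x - x0)). set (y := Rabs (x - x0)) in *.
    pose proof (COS_bound (2 * PI * y)). pose proof (COS_bound (2 * PI * d)). split; [lra|].
    assert (cos (2 * PI * y) <= cos (2 * PI * d)); [|lra].
    destruct (Rle_dec y (1/2)) as [Hy|Hy].
    - apply Hdec; lra.
    - replace (cos (2 * PI * d)) with (cos (2 * PI * (1 - d))).
      + apply cos_incr_1; nra.
      + rewrite <- (cos_neg (2 * PI * d)), <- (cos_add_period (- (2 * PI * d)) 1). f_equal.
        simpl. ring. }
  assert (Hint : forall n, is_RInt (fun x => D x * T x ^ n) a (a + 1) 0).
  { intros n. destruct (fourier_null_pow D (1 - cos (2 * PI * d)) (cos (2 * PI * x0))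
      (sin (2 * PI * x0)) n H0 0%Z) as [G _].
    eapply is_RInt_ext; [|exact G]. intros x _. toR. simpl. rewrite cosk_0, Rmult_1_r. f_equal. f_equal.
    unfold T, cosk, sink. rewrite Rmult_1_r.
    replace (2 * PI * (x - x0)) with (2 * PI * x - 2 * PI * x0) by ring.
    rewrite cos_minus. ring. }
  assert (HTc : forall n x, continuous (fun x => D x * T x ^ n) x).
  { intros n x. apply continuous_Rmult; [apply HD|].
    apply (ex_derive_continuous (fun x => T x ^ n)). unfold T. auto_derive; auto. }
  assert (Hlow : forall n x, a <= x <= a + 1 -> - M <= D x * T x ^ n).
  { intros n x Hx. destruct (Rle_dec (Rabs (x - x0)) d) as [Hd|Hd].
    - apply Rle_trans with 0; [lra|]. specialize (HDd x Hd). specialize (T1 x Hd).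
      apply Rmult_le_pos; [lra|]. apply pow_le. lra.
    - specialize (T3 x Hx ltac:(lra)). specialize (HM x Hx).
      assert (Rabs (D x * T x ^ n) <= M * 1).
      { rewrite Rabs_mult. apply Rmult_le_compat; auto using Rabs_pos.
        rewrite <- RPow_abs. rewrite <- (pow1 n). apply pow_incr. split; auto using Rabs_pos. }
      apply Rabs_le_between in H. lra. }
  (* The integral vanishes; its middle part, of length [d], is bounded below by the left-hand side,
     and the two outer parts, of total length [1 - d], by [- M] per unit length. *)
  assert (Hbig : forall n, d * (D x0 / 2 * tau ^ n) <= M).
  { intros n. set (F := fun x => D x * T x ^ n).
    assert (E : RInt F a (a + 1) = 0) by (apply is_RInt_unique, Hint).
    rewrite <- (RInt_Chasles F a (x0 - d/2) (a + 1)) in E by (apply ex_RInt_cont, HTc).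
    rewrite <- (RInt_Chasles F (x0 - d/2) (x0 + d/2) (a + 1)) in E by (apply ex_RInt_cont, HTc).
    unfold plus in E; simpl in E.
    assert (E1 : (x0 - d/2 - a) * (- M) <= RInt F a (x0 - d/2)).
    { apply RInt_ge_const; [lra|apply HTc|].
      intros x Hx. apply Hlow. lra. }
    assert (E3 : (a + 1 - (x0 + d/2)) * (- M) <= RInt F (x0 + d/2) (a + 1)).
    { apply RInt_ge_const; [lra|apply HTc|].
      intros x Hx. apply Hlow. lra. }
    assert (E2 : (x0 + d/2 - (x0 - d/2)) * (D x0 / 2 * tau ^ n) <= RInt F (x0 - d/2) (x0 + d/2)).
    { apply RInt_ge_const; [lra|apply HTc|].
      intros x Hx. assert (Hx' : Rabs (x - x0) <= d / 2) by (apply Rabs_le; lra).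
      apply Rmult_le_compat; [lra| | |].
      - apply pow_le; lra.
      - apply HDd; lra.
      - apply pow_incr. split; [lra|]. now apply T2. }
    replace (x0 + d/2 - (x0 - d/2)) with d in E2 by field. nra. }
  destruct (Pow_x_infinity tau) with (b := (M + 1) / (d * (D x0 / 2))) as [N HN].
  { rewrite Rabs_pos_eq; lra. }
  specialize (HN N (Nat.le_refl N)). specialize (Hbig N).
  assert (0 < d * (D x0 / 2)) by (apply Rmult_lt_0_compat; lra).
  rewrite Rabs_pos_eq in HN by (apply pow_le; lra). apply Rge_le in HN.
  apply Rmult_le_compat_l with (r := d * (D x0 / 2)) in HN; [|lra].
  replace (d * (D x0 / 2) * ((M + 1) / (d * (D x0 / 2)))) with (M + 1) in HN by (field; lra).
  lra.
Qed.

(** The one-sided result applies to [D] and [- D] at interior points. [D] is not assumed periodic,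
    and the two end points follow by continuity. *)
Lemma fourier_null_zero (D : R -> R) x :
  (forall x, continuous D x) -> fourier_null D -> a <= x <= a + 1 -> D x = 0.
Proof.
  intros HD H0.
  assert (Hint : forall y, a < y < a + 1 -> D y = 0).
  { intros y Hy. apply Rle_antisym; [now apply fourier_null_not_pos|].
    apply Ropp_le_cancel. rewrite Ropp_0.
    apply (fourier_null_not_pos (fun z => - D z)); auto.
    - intros z. apply (continuous_opp (V := R_NormedModule)), HD.
    - intros k. destruct (H0 k) as [H1 H2].
      apply (is_RInt_opp (V := R_NormedModule)) in H1, H2. unfold opp in *; simpl in *.
      rewrite Ropp_0 in *.
      split; [eapply is_RInt_ext; [|exact H1]|eapply is_RInt_ext; [|exact H2]];
      intros; toR; simpl; ring. }
  intros Hx.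
  destruct (Req_dec (D x) 0) as [|Hne]; [assumption|exfalso].
  assert (He : 0 < Rabs (D x)) by now apply Rabs_pos_lt.
  destruct (HD x (ball (D x) (mkposreal _ He)) (locally_ball _ _)) as [[d Hd] H1].
  assert (Hy : exists y, a < y < a + 1 /\ Rabs (y - x) < d).
  { set (e := Rmin (d / 2) (1 / 2)).
    assert (0 < e) by (apply Rmin_case; lra).
    assert (e <= d / 2) by apply Rmin_l. assert (e <= 1 / 2) by apply Rmin_r.
    destruct (Rle_dec x (a + 1/2)).
    - exists (x + e/2). rewrite Rabs_pos_eq by lra. lra.
    - exists (x - e/2). rewrite Rabs_left by lra. lra. }
  destruct Hy as [y [Hy1 Hy2]]. specialize (H1 y Hy2). rewrite (Hint y Hy1) in H1.
  unfold ball in H1; simpl in H1; unfold AbsRing_ball, abs, minus, plus, opp in H1; simpl in H1.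
  rewrite Rplus_0_l, Rabs_Ropp in H1. lra.
Qed.

(** The sum [s] of the series is continuous, and by orthogonality [f + A O - s] has only zero
    coefficients. The extra [A O] on the right appears because the index 0 is weighted by 2 like all
    the others. *)
Lemma fourier_series_eq (f : R -> R) (A B : nat -> R) :
  (forall x, continuous f x) ->
  (forall k, is_RInt (fun x => f x * cosk (Z.of_nat k) x) a (a + 1) (A k)) ->
  (forall k, is_RInt (fun x => f x * sink (Z.of_nat k) x) a (a + 1) (B k)) ->
  ex_series (fun k => Rabs (A k)) -> ex_series (fun k => Rabs (B k)) ->
  forall x, a <= x <= a + 1 ->
  is_series (fun k => 2 * (A k * cosk (Z.of_nat k) x + B k * sink (Z.of_nat k) x)) (f x + A O).
Proof.
  intros Hf HA HB SA SB.
  set (F := fun (k : nat) x => 2 * (A k * cosk (Z.of_nat k) x + B k * sink (Z.of_nat k) x)).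
  set (bd := fun k => 2 * (Rabs (A k) + Rabs (B k))).
  assert (Sbd : ex_series bd).
  { apply (ex_series_scal_l (V := R_NormedModule) 2). now apply (ex_series_plus (V := R_NormedModule)). }
  assert (HF : forall k x, Rabs (F k x) <= bd k).
  { intros k x. unfold F, bd. rewrite Rabs_mult, (Rabs_pos_eq 2) by lra.
    apply Rmult_le_compat_l; [lra|]. eapply Rle_trans; [apply Rabs_triang|]. rewrite !Rabs_mult.
    pose proof (Rabs_cosk (Z.of_nat k) x). pose proof (Rabs_sink (Z.of_nat k) x).
    pose proof (Rabs_pos (A k)). pose proof (Rabs_pos (B k)). nra. }
  assert (Hser : forall x, is_series (fun k => F k x) (Series (fun k => F k x))).
  { intros x. apply Series_correct.
    apply (ex_series_le (V := R_CompleteNormedModule) _ bd); [|exact Sbd]. intros k. apply HF. }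
  assert (Fc : forall k x, continuous (F k) x).
  { intros k x. unfold F. auto 10 with rcont. }
  set (s := fun x => Series (fun k => F k x)).
  assert (Hs : forall x, continuous s x).
  { intros x. apply (series_continuous (V := R_NormedModule) F s bd x); auto. }
  assert (Hcs : forall (e : R -> R) (I : nat -> R), (forall x, continuous e x) ->
     (forall x, Rabs (e x) <= 1) -> (forall k, is_RInt (fun x => F k x * e x) a (a + 1) (I k)) ->
     is_series I (RInt (fun x => s x * e x) a (a + 1))).
  { intros e I He He1 HI.
    apply (RInt_series (V := R_NormedModule) (fun k x => F k x * e x) (fun x => s x * e x) I _ bd a (a + 1));
      auto; [lra| | |].
    - apply is_RInt_cont. intros; auto with rcont.
    - intros t _. apply (is_series_scal_r (e t) (fun k => F k t) (s t)), Hser.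
    - intros k t _. change (Rabs (F k t * e t) <= bd k). rewrite Rabs_mult.
      pose proof (HF k t). pose proof (He1 t). pose proof (Rabs_pos (F k t)). pose proof (Rabs_pos (e t)). nra. }
  assert (Hnull : fourier_null (fun x => f x + A O - s x)).
  { apply fourier_null_nat. intros j. split.
    - assert (E : RInt (fun x => s x * cosk (Z.of_nat j) x) a (a + 1) =
        A j + A O * (if Z.eq_dec (Z.of_nat j) 0 then 1 else 0)).
      { set (I := fun k => if Nat.eqb k j then A j + A O * (if Z.eq_dec (Z.of_nat j) 0 then 1 else 0) else 0).
        assert (HI := Hcs (cosk (Z.of_nat j)) I).
        transitivity (Series I).
        - symmetry. apply is_series_unique, HI; auto using continuous_cosk, Rabs_cosk.
          intros k.
          eapply is_RInt_ext; [|eapply is_RInt_eq;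
            [exact (is_RInt_lin2 _ _ (A k) (B k) _ _ _ _
               (is_RInt_lin2 _ _ 1 1 _ _ _ _ (is_RInt_cosk (Z.of_nat k + Z.of_nat j) a) (is_RInt_cosk (Z.of_nat k - Z.of_nat j) a))
               (is_RInt_lin2 _ _ 1 1 _ _ _ _ (is_RInt_sink (Z.of_nat k + Z.of_nat j) a) (is_RInt_sink (Z.of_nat k - Z.of_nat j) a)))|]].
          + intros x _. toR. simpl. unfold F.
            transitivity (2 * A k * (cosk (Z.of_nat k) x * cosk (Z.of_nat j) x) +
               2 * B k * (sink (Z.of_nat k) x * cosk (Z.of_nat j) x)); [|ring].
            rewrite cosk_cosk, sink_cosk. field.
          + unfold I. destruct (Nat.eqb_spec k j) as [->|Hkj].
            * destruct (Z.eq_dec (Z.of_nat j + Z.of_nat j) 0), (Z.eq_dec (Z.of_nat j - Z.of_nat j) 0),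
                (Z.eq_dec (Z.of_nat j) 0); try lia; try ring.
              replace j with O by lia. ring.
            * destruct (Z.eq_dec (Z.of_nat k + Z.of_nat j) 0), (Z.eq_dec (Z.of_nat k - Z.of_nat j) 0); try lia; ring.
        - apply is_series_unique, (is_series_single (V := R_NormedModule)). }
      assert (G := is_RInt_lin2 _ _ 1 1 _ _ _ _ (is_RInt_lin2 _ _ 1 (A O) _ _ _ _ (HA j) (is_RInt_cosk (Z.of_nat j) a))
        (is_RInt_lin2 _ _ (-1) 0 _ _ _ _ (is_RInt_cont (fun x => s x * cosk (Z.of_nat j) x) a (a + 1) ltac:(intros; auto with rcont)) (HA j))).
      eapply is_RInt_ext; [|eapply is_RInt_eq; [exact G|]].
      + intros x _. toR. simpl. ring.
      + rewrite E. destruct (Z.eq_dec (Z.of_nat j) 0); ring.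
    - assert (E : RInt (fun x => s x * sink (Z.of_nat j) x) a (a + 1) = B j).
      { set (I := fun k => if Nat.eqb k j then B j else 0).
        assert (HI := Hcs (sink (Z.of_nat j)) I).
        transitivity (Series I).
        - symmetry. apply is_series_unique, HI; auto using continuous_sink, Rabs_sink.
          intros k.
          eapply is_RInt_ext; [|eapply is_RInt_eq;
            [exact (is_RInt_lin2 _ _ (A k) (B k) _ _ _ _
               (is_RInt_lin2 _ _ 1 1 _ _ _ _ (is_RInt_sink (Z.of_nat j + Z.of_nat k) a) (is_RInt_sink (Z.of_nat j - Z.of_nat k) a))
               (is_RInt_lin2 _ _ 1 (-1) _ _ _ _ (is_RInt_cosk (Z.of_nat k - Z.of_nat j) a) (is_RInt_cosk (Z.of_nat k + Z.of_nat j) a)))|]].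
          + intros x _. toR. simpl. unfold F.
            transitivity (2 * A k * (sink (Z.of_nat j) x * cosk (Z.of_nat k) x) +
               2 * B k * (sink (Z.of_nat k) x * sink (Z.of_nat j) x)); [|ring].
            rewrite sink_sink, sink_cosk. field.
          + unfold I. destruct (Nat.eqb_spec k j) as [->|Hkj].
            * destruct (Z.eq_dec (Z.of_nat j + Z.of_nat j) 0), (Z.eq_dec (Z.of_nat j - Z.of_nat j) 0); try lia; try ring.
              (* At frequency 0 the orthogonality integral is 0, so the claim reduces to [B O = 0],
                 which holds since [sink 0] vanishes identically. *)
              assert (Hj : j = O) by lia. rewrite Hj in *.
              assert (HB0 := is_RInt_unique _ _ _ _ (HB O)).
              assert (Z0 : B O = 0).
              { rewrite <- HB0. apply is_RInt_unique.
                apply is_RInt_ext with (sink 0).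
                - intros x _. toR. simpl. rewrite sink_0. ring.
                - apply is_RInt_sink. }
              rewrite Z0. ring.
            * destruct (Z.eq_dec (Z.of_nat k + Z.of_nat j) 0), (Z.eq_dec (Z.of_nat k - Z.of_nat j) 0); try lia; ring.
        - apply is_series_unique, (is_series_single (V := R_NormedModule)). }
      assert (G := is_RInt_lin2 _ _ 1 1 _ _ _ _ (is_RInt_lin2 _ _ 1 (A O) _ _ _ _ (HB j) (is_RInt_sink (Z.of_nat j) a))
        (is_RInt_lin2 _ _ (-1) 0 _ _ _ _ (is_RInt_cont (fun x => s x * sink (Z.of_nat j) x) a (a + 1) ltac:(intros; auto with rcont)) (HB j))).
      eapply is_RInt_ext; [|eapply is_RInt_eq; [exact G|]].
      + intros x _. toR. simpl. ring.
      + rewrite E. ring. }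
  intros x Hx.
  assert (Z0 : f x + A O - s x = 0).
  { apply (fourier_null_zero (fun x => f x + A O - s x)); auto.
    intros y. auto with rcont. }
  replace (f x + A O) with (s x) by lra. apply Hser.
Qed.

End Uniqueness.

(** * Bernstein's theorem *)

Lemma sum_n_m_le_loc (a b : nat -> R) n m :
  (forall k, (n <= k <= m)%nat -> a k <= b k) -> sum_n_m a n m <= sum_n_m b n m.
Proof.
  intros H.
  rewrite (sum_n_m_ext_loc a (fun k => if andb (Nat.leb n k) (Nat.leb k m) then a k else b k)).
  - apply sum_n_m_le. intros k.
    destruct (Nat.leb_spec n k), (Nat.leb_spec k m); simpl; try apply Rle_refl. now apply H.
  - intros k Hk. destruct (Nat.leb_spec n k), (Nat.leb_spec k m); simpl; try lia; reflexivity.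
Qed.

Lemma sum_n_m_ge_0 (a : nat -> R) n m : (forall k, 0 <= a k) -> 0 <= sum_n_m a n m.
Proof.
  intros H. apply Rle_trans with (sum_n_m (fun _ => 0) n m).
  - rewrite sum_n_m_const. lra.
  - now apply sum_n_m_le.
Qed.

Section Bessel.
Variables (f : R -> R) (A B : nat -> R).
Hypothesis f_cont : forall x, continuous f x.
Hypothesis f_cos : forall k, is_RInt (fun x => f x * cosk (Z.of_nat k) x) 0 1 (A k).
Hypothesis f_sin : forall k, is_RInt (fun x => f x * sink (Z.of_nat k) x) 0 1 (B k).

(** Only the harmonics 1 to [n] are removed; the mean value stays in, and this is why Bessel's
    inequality below sums from 1. *)
Fixpoint fourier_residual (n : nat) (x : R) : R :=
  match n with
  | O => f x
  | S n => fourier_residual n x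
           - 2 * (A (S n) * cosk (Z.of_nat (S n)) x + B (S n) * sink (Z.of_nat (S n)) x)
  end.

Lemma is_RInt_cosk_cosk j k : is_RInt (fun x => cosk j x * cosk k x) 0 1
  (((if Z.eq_dec (j + k) 0 then 1 else 0) + (if Z.eq_dec (j - k) 0 then 1 else 0)) / 2).
Proof.
  pose proof (is_RInt_cosk (j + k) 0) as H1. pose proof (is_RInt_cosk (j - k) 0) as H2.
  rewrite Rplus_0_l in H1, H2.
  eapply is_RInt_ext; [|eapply is_RInt_eq; [exact (is_RInt_lin2 _ _ (1/2) (1/2) _ _ _ _ H1 H2)|]].
  - intros x _. toR. rewrite cosk_cosk. field.
  - destruct (Z.eq_dec (j + k) 0), (Z.eq_dec (j - k) 0); field.
Qed.

Lemma is_RInt_sink_sink j k : is_RInt (fun x => sink j x * sink k x) 0 1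
  (((if Z.eq_dec (j - k) 0 then 1 else 0) - (if Z.eq_dec (j + k) 0 then 1 else 0)) / 2).
Proof.
  pose proof (is_RInt_cosk (j + k) 0) as H1. pose proof (is_RInt_cosk (j - k) 0) as H2.
  rewrite Rplus_0_l in H1, H2.
  eapply is_RInt_ext; [|eapply is_RInt_eq; [exact (is_RInt_lin2 _ _ (-1/2) (1/2) _ _ _ _ H1 H2)|]].
  - intros x _. toR. rewrite sink_sink. field.
  - destruct (Z.eq_dec (j + k) 0), (Z.eq_dec (j - k) 0); field.
Qed.

Lemma is_RInt_sink_cosk j k : is_RInt (fun x => sink j x * cosk k x) 0 1 0.
Proof.
  pose proof (is_RInt_sink (j + k) 0) as H1. pose proof (is_RInt_sink (j - k) 0) as H2.
  rewrite Rplus_0_l in H1, H2.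
  eapply is_RInt_ext; [|eapply is_RInt_eq; [exact (is_RInt_lin2 _ _ (1/2) (1/2) _ _ _ _ H1 H2)|]].
  - intros x _. toR. rewrite sink_cosk. field.
  - field.
Qed.

Lemma fourier_residual_coef n k : (n < k)%nat ->
  is_RInt (fun x => fourier_residual n x * cosk (Z.of_nat k) x) 0 1 (A k) /\
  is_RInt (fun x => fourier_residual n x * sink (Z.of_nat k) x) 0 1 (B k).
Proof.
  induction n as [|n IH]; intros Hk.
  - split; [apply f_cos|apply f_sin].
  - destruct IH as [H1 H2]; [lia|]. cbn [fourier_residual].
    set (j := Z.of_nat (S n)). set (k' := Z.of_nat k) in *.
    assert (Hjk : (j + k' <> 0 /\ j - k' <> 0 /\ k' - j <> 0)%Z) by (unfold j, k'; lia).
    split.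
    + eapply is_RInt_ext; [|eapply is_RInt_eq; [exact (is_RInt_lin2 _ _ 1 (-2) _ _ _ _ H1
        (is_RInt_lin2 _ _ (A (S n)) (B (S n)) _ _ _ _ (is_RInt_cosk_cosk j k') (is_RInt_sink_cosk j k')))|]].
      * intros x _. toR. simpl. ring.
      * destruct (Z.eq_dec (j + k') 0), (Z.eq_dec (j - k') 0); try lia. field.
    + eapply is_RInt_ext; [|eapply is_RInt_eq; [exact (is_RInt_lin2 _ _ 1 (-2) _ _ _ _ H2
        (is_RInt_lin2 _ _ (A (S n)) (B (S n)) _ _ _ _ (is_RInt_sink_cosk k' j) (is_RInt_sink_sink j k')))|]].
      * intros x _. toR. simpl. ring.
      * destruct (Z.eq_dec (j + k') 0), (Z.eq_dec (j - k') 0); try lia. field.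
Qed.

(** Pythagoras, one harmonic at a time: the residual still has the coefficients [A (S n)] and
    [B (S n)] of [f], and removing that harmonic lowers the squared norm by [2 * (A ^ 2 + B ^ 2)].
    Bessel's inequality is the positivity of what remains. *)
Lemma fourier_residual_norm n :
  is_RInt (fun x => fourier_residual n x ^ 2) 0 1
    (RInt (fun x => f x ^ 2) 0 1 - sum_n_m (fun k => 2 * (A k ^ 2 + B k ^ 2)) 1 n).
Proof.
  induction n as [|n IH].
  - rewrite sum_n_m_zero by lia. unfold zero; simpl. rewrite Rminus_0_r.
    apply is_RInt_cont. intros. auto with rcont.
  - rewrite sum_n_Sm by lia. unfold plus; simpl AbelianMonoid.plus.
    destruct (fourier_residual_coef n (S n)) as [H1 H2]; [lia|].
    cbn [fourier_residual]. set (j := Z.of_nat (S n)) in *.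
    assert (Hj : (j + j <> 0 /\ j - j = 0)%Z) by (unfold j; lia).
    assert (Q := is_RInt_lin2 _ _ 1 4 _ _ _ _
        (is_RInt_lin2 _ _ 1 (-4) _ _ _ _ IH (is_RInt_lin2 _ _ (A (S n)) (B (S n)) _ _ _ _ H1 H2))
        (is_RInt_lin2 _ _ 1 (2 * A (S n) * B (S n)) _ _ _ _
          (is_RInt_lin2 _ _ (A (S n) ^ 2) (B (S n) ^ 2) _ _ _ _ (is_RInt_cosk_cosk j j) (is_RInt_sink_sink j j))
          (is_RInt_sink_cosk j j))).
    eapply is_RInt_ext; [|eapply is_RInt_eq; [exact Q|]].
    + intros x _. toR. simpl. ring.
    + destruct (Z.eq_dec (j + j) 0), (Z.eq_dec (j - j) 0); try lia.
      set (SS := sum_n_m _ 1 n). set (I := RInt _ 0 1).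
      change (sum_n_m (G := R_AbelianMonoid) (fun k => 2 * (A k ^ 2 + B k ^ 2)) 1 n) with SS.
      field.
Qed.

Lemma bessel n : sum_n_m (fun k => 2 * (A k ^ 2 + B k ^ 2)) 1 n <= RInt (fun x => f x ^ 2) 0 1.
Proof.
  assert (H := is_RInt_ge_0 _ 0 1 _ Rle_0_1 (fourier_residual_norm n)).
  assert (0 <= RInt (fun x => f x ^ 2) 0 1 - sum_n_m (fun k => 2 * (A k ^ 2 + B k ^ 2)) 1 n); [|lra].
  apply H. intros x _. apply pow2_ge_0.
Qed.

End Bessel.

Lemma block_summable (x : nat -> R) c q : 0 <= q < 1 ->
  (forall m, sum_n_m (fun k => Rabs (x k)) (2 ^ m) (2 ^ S m - 1) <= c * q ^ m) ->
  ex_series (fun k => Rabs (x k)).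
Proof.
  intros Hq Hb.
  assert (P2 : forall m, (1 <= 2 ^ m)%nat) by (intros m; induction m; simpl; lia).
  assert (Hc : 0 <= c).
  { specialize (Hb O). simpl in Hb. rewrite Rmult_1_r in Hb.
    eapply Rle_trans; [|exact Hb]. apply sum_n_m_ge_0. intros; apply Rabs_pos. }
  assert (Hpart : forall M, sum_n_m (fun k => Rabs (x k)) 1 (2 ^ M - 1) <= c * ((1 - q ^ M) / (1 - q))).
  { induction M as [|M IH].
    - simpl. rewrite sum_n_m_zero by lia. unfold zero; simpl. rewrite Rminus_diag. unfold Rdiv. lra.
    - rewrite (sum_n_m_Chasles _ 1 (2 ^ M - 1)) by (simpl; specialize (P2 M); lia).
      replace (S (2 ^ M - 1)) with (2 ^ M)%nat by (specialize (P2 M); lia).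
      unfold plus; simpl AbelianMonoid.plus.
      apply Rle_trans with (c * ((1 - q ^ M) / (1 - q)) + c * q ^ M).
      + apply Rplus_le_compat; [exact IH|apply Hb].
      + right. simpl. field. lra. }
  assert (HM : forall n, sum_n (fun k => Rabs (x k)) n <= Rabs (x O) + c / (1 - q)).
  { intros n. apply Rle_trans with (Rabs (x O) + sum_n_m (fun k => Rabs (x k)) 1 n).
    - unfold sum_n. rewrite (sum_n_m_Chasles _ 0 0 n) by lia.
      rewrite sum_n_n. apply Rle_refl.
    - apply Rplus_le_compat_l.
      assert (Hn : (n <= 2 ^ n - 1)%nat).
      { clear - P2. induction n; [simpl; lia|]. specialize (P2 n). simpl. lia. }
      apply Rle_trans with (sum_n_m (fun k => Rabs (x k)) 1 (2 ^ n - 1)).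
      + rewrite (sum_n_m_Chasles _ 1 n (2 ^ n - 1)) by lia.
        match goal with |- _ <= plus ?u ?v => assert (0 <= v) by (apply sum_n_m_ge_0; intros; apply Rabs_pos);
          change (u <= u + v) end. lra.
      + eapply Rle_trans; [apply Hpart|]. apply Rmult_le_compat_l; auto.
        apply Rmult_le_reg_r with (1 - q); [lra|].
        replace ((1 - q ^ n) / (1 - q) * (1 - q)) with (1 - q ^ n) by (field; lra).
        rewrite Rinv_l by lra. pose proof (pow_le q n ltac:(lra)). lra. }
  destruct (ex_finite_lim_seq_incr (sum_n (fun k => Rabs (x k))) (Rabs (x O) + c / (1 - q))) as [l Hl].
  - intros n. rewrite sum_Sn. unfold plus; simpl. pose proof (Rabs_pos (x (S n))). lra.
  - exact HM.
  - now exists l.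
Qed.

Lemma RInt_periodic_shift (P : R -> R) d : (forall x, continuous P x) ->
  (forall x, P (x + 1) = P x) -> RInt (fun x => P (x + d)) 0 1 = RInt P 0 1.
Proof.
  intros Hc Hp.
  assert (Sh : forall c a b, RInt (fun x => P (x + c)) a b = RInt P (a + c) (b + c)).
  { intros c a b. apply is_RInt_unique.
    apply is_RInt_ext with (fun x => scal 1 (P (1 * x + c))).
    - intros x _. unfold scal; simpl; unfold mult; simpl. rewrite !Rmult_1_l. reflexivity.
    - apply (is_RInt_comp_lin P 1 c a b). rewrite !Rmult_1_l. now apply is_RInt_cont. }
  rewrite Sh, Rplus_0_l.
  assert (E1 : RInt P 0 (1 + d) = RInt P 0 d + RInt P d (1 + d)).
  { symmetry. apply (RInt_Chasles P); now apply ex_RInt_cont. }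
  assert (E2 : RInt P 0 (1 + d) = RInt P 0 1 + RInt P 1 (1 + d)).
  { symmetry. apply (RInt_Chasles P); now apply ex_RInt_cont. }
  assert (E3 : RInt P 1 (1 + d) = RInt P 0 d).
  { replace (RInt P 1 (1 + d)) with (RInt P (0 + 1) (d + 1)) by (f_equal; ring).
    rewrite <- Sh. apply RInt_ext. intros x _. apply Hp. }
  lra.
Qed.

Section Bernstein.
Variables (H : R -> R) (A B : nat -> R) (C : R).
Hypothesis H_cont : forall x, continuous H x.
Hypothesis H_per : forall x, H (x + 1) = H x.
Hypothesis H_cos : forall k, is_RInt (fun x => H x * cosk (Z.of_nat k) x) 0 1 (A k).
Hypothesis H_sin : forall k, is_RInt (fun x => H x * sink (Z.of_nat k) x) 0 1 (B k).
Hypothesis H_holder : forall x d, 0 < d <= 1 -> Rabs (H (x + d) - H x) <= C * Rpower d (3/4).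

Lemma cosk_minus k x d : cosk k (x - d) = cosk k x * cosk k d + sink k x * sink k d.
Proof.
  unfold cosk, sink. replace (2 * PI * IZR k * (x - d)) with (2 * PI * IZR k * x - 2 * PI * IZR k * d) by ring.
  apply cos_minus.
Qed.

Lemma sink_minus k x d : sink k (x - d) = sink k x * cosk k d - cosk k x * sink k d.
Proof.
  unfold cosk, sink. replace (2 * PI * IZR k * (x - d)) with (2 * PI * IZR k * x - 2 * PI * IZR k * d) by ring.
  apply sin_minus.
Qed.

Lemma continuous_shift (f : R -> R) d x : (forall y, continuous f y) -> continuous (fun t => f (t + d)) x.
Proof.
  intros Hf. apply (continuous_comp (fun t => t + d) f); [auto with rcont|apply Hf].
Qed.

Lemma shifted_cos k d : is_RInt (fun x => H (x + d) * cosk (Z.of_nat k) x) 0 1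
  (A k * cosk (Z.of_nat k) d + B k * sink (Z.of_nat k) d).
Proof.
  set (P := fun x => H x * cosk (Z.of_nat k) (x - d)).
  assert (Pc : forall x, continuous P x).
  { intros x. apply continuous_Rmult; auto.
    apply (continuous_shift (cosk (Z.of_nat k)) (- d)). auto with rcont. }
  eapply is_RInt_ext; [|eapply is_RInt_eq; [apply (is_RInt_cont (fun x => P (x + d)))|]].
  - intros x _. toR. unfold P. f_equal. f_equal. ring.
  - intros x. now apply continuous_shift.
  - rewrite RInt_periodic_shift; auto.
    + apply is_RInt_unique.
      eapply is_RInt_ext; [|eapply is_RInt_eq; [exact (is_RInt_lin2 _ _ (cosk (Z.of_nat k) d)
         (sink (Z.of_nat k) d) _ _ _ _ (H_cos k) (H_sin k))|ring]].
      intros x _. toR. unfold P. rewrite cosk_minus. ring.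
    + intros x. unfold P. rewrite H_per. f_equal.
      replace (x + 1 - d) with (x - d + 1) by ring. apply (cosk_add_Z _ _ 1).
Qed.

Lemma shifted_sin k d : is_RInt (fun x => H (x + d) * sink (Z.of_nat k) x) 0 1
  (B k * cosk (Z.of_nat k) d - A k * sink (Z.of_nat k) d).
Proof.
  set (P := fun x => H x * sink (Z.of_nat k) (x - d)).
  assert (Pc : forall x, continuous P x).
  { intros x. apply continuous_Rmult; auto.
    apply (continuous_shift (sink (Z.of_nat k)) (- d)). auto with rcont. }
  eapply is_RInt_ext; [|eapply is_RInt_eq; [apply (is_RInt_cont (fun x => P (x + d)))|]].
  - intros x _. toR. unfold P. f_equal. f_equal. ring.
  - intros x. now apply continuous_shift.
  - rewrite RInt_periodic_shift; auto.
    + apply is_RInt_unique.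
      eapply is_RInt_ext; [|eapply is_RInt_eq; [exact (is_RInt_lin2 _ _ (- sink (Z.of_nat k) d)
         (cosk (Z.of_nat k) d) _ _ _ _ (H_cos k) (H_sin k))|ring]].
      intros x _. toR. unfold P. rewrite sink_minus. ring.
    + intros x. unfold P. rewrite H_per. f_equal.
      replace (x + 1 - d) with (x - d + 1) by ring. apply (sink_add_Z _ _ 1).
Qed.

(** Bessel's inequality for [H (x + d) - H x]. Translation rotates the pair [(A k, B k)] by the
    angle [2 pi k d], so the difference multiplies its squared length by [2 * (1 - cos (2 pi k d))];
    the Holder bound controls the square integral. *)
Lemma bessel_difference d n : 0 < d <= 1 ->
  sum_n_m (fun k => 4 * (1 - cosk (Z.of_nat k) d) * (A k ^ 2 + B k ^ 2)) 1 n <= C ^ 2 * Rpower d (3/2).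
Proof.
  intros Hd.
  set (f := fun x => H (x + d) - H x).
  set (A' := fun k => (A k * cosk (Z.of_nat k) d + B k * sink (Z.of_nat k) d) - A k).
  set (B' := fun k => (B k * cosk (Z.of_nat k) d - A k * sink (Z.of_nat k) d) - B k).
  assert (fc : forall x, continuous f x).
  { intros x. unfold f. apply continuous_Rminus; auto. now apply continuous_shift. }
  assert (E := bessel f A' B' fc).
  apply Rle_trans with (sum_n_m (fun k => 2 * (A' k ^ 2 + B' k ^ 2)) 1 n).
  { right. apply sum_n_m_ext. intros k. unfold A', B'.
    assert (T : cosk (Z.of_nat k) d ^ 2 + sink (Z.of_nat k) d ^ 2 = 1).
    { unfold cosk, sink. rewrite <- !Rsqr_pow2, Rplus_comm. apply sin2_cos2. }
    set (c := cosk _ d) in *. set (s := sink _ d) in *.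
    replace (2 * ((A k * c + B k * s - A k) ^ 2 + (B k * c - A k * s - B k) ^ 2)) with
      (2 * (A k ^ 2 + B k ^ 2) * (c ^ 2 + s ^ 2 - 2 * c + 1)) by ring.
    rewrite T. toR; ring. }
  eapply Rle_trans; [apply E|].
  - intros k. eapply is_RInt_ext; [|eapply is_RInt_eq; [exact (is_RInt_lin2 _ _ 1 (-1) _ _ _ _
      (shifted_cos k d) (H_cos k))|unfold A'; ring]]. intros x _. toR. unfold f. ring.
  - intros k. eapply is_RInt_ext; [|eapply is_RInt_eq; [exact (is_RInt_lin2 _ _ 1 (-1) _ _ _ _
      (shifted_sin k d) (H_sin k))|unfold B'; ring]]. intros x _. toR. unfold f. ring.
  - replace (C ^ 2 * Rpower d (3/2)) with ((1 - 0) * (C ^ 2 * Rpower d (3/2))) by ring.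
    replace ((1 - 0) * (C ^ 2 * Rpower d (3/2))) with (RInt (fun _ => C ^ 2 * Rpower d (3/2)) 0 1)
      by (rewrite RInt_const; reflexivity).
    apply RInt_le; [lra| |apply ex_RInt_const|].
    + apply ex_RInt_cont. intros x. change (continuous (fun y => f y * (f y * 1)) x). auto 6 with rcont.
    + intros x _. unfold f.
      replace (Rpower d (3/2)) with (Rpower d (3/4) ^ 2).
      2:{ simpl. rewrite Rmult_1_r, <- Rpower_plus. f_equal. field. }
      rewrite <- Rpow_mult_distr, <- (pow2_abs (H (x + d) - H x)).
      apply pow_incr. split; [apply Rabs_pos|now apply H_holder].
Qed.

(** With [d = 2 ^ (- (m + 2))], every [k] between [2 ^ m] and [2 ^ (m + 1)] has [k * d] in
    [[1/4, 1/2]]. There the cosine is not positive, so the weight in [bessel_difference] is at least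
    4. *)
Lemma bernstein_block m :
  sum_n_m (fun k => A k ^ 2 + B k ^ 2) (2 ^ m) (2 ^ S m - 1) <= C ^ 2 * Rpower 2 (- (3/2) * INR m).
Proof.
  set (d := / 2 ^ (m + 2)).
  assert (H2 : 0 < 2 ^ (m + 2)) by (apply pow_lt; lra).
  assert (Hd : 0 < d <= 1).
  { split; [now apply Rinv_0_lt_compat|]. unfold d. rewrite <- Rinv_1.
    apply Rinv_le_contravar; [lra|]. apply pow_R1_Rle. lra. }
  assert (P2 : (1 <= 2 ^ m)%nat) by (clear; induction m; simpl; lia).
  assert (Hc : forall k, 4 * (1 - cosk (Z.of_nat k) d) * (A k ^ 2 + B k ^ 2) >= 0).
  { intros k. pose proof (COS_bound (2 * PI * IZR (Z.of_nat k) * d)). unfold cosk.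
    pose proof (pow2_ge_0 (A k)). pose proof (pow2_ge_0 (B k)).
    apply Rle_ge, Rmult_le_pos; lra. }
  apply Rle_trans with (sum_n_m (fun k => 4 * (1 - cosk (Z.of_nat k) d) * (A k ^ 2 + B k ^ 2)) (2 ^ m) (2 ^ S m - 1)).
  - apply sum_n_m_le_loc. intros k Hk.
    assert (Hcos : cosk (Z.of_nat k) d <= 0).
    { unfold cosk. rewrite <- INR_IZR_INZ.
      assert (L1 : 2 ^ m <= INR k).
      { change 2 with (INR 2). rewrite <- pow_INR. apply le_INR. lia. }
      assert (L2 : INR k <= 2 * 2 ^ m).
      { change 2 with (INR 2). rewrite <- pow_INR, <- mult_INR. apply le_INR. simpl in *. lia. }
      assert (Hp : 0 < 2 ^ m) by (apply pow_lt; lra).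
      assert (Ed : d = / (4 * 2 ^ m)) by (unfold d; rewrite pow_add; f_equal; simpl; ring).
      assert (B1 : 1/4 <= INR k * d <= 1/2).
      { rewrite Ed. split.
        - apply Rmult_le_reg_r with (4 * 2 ^ m); [lra|].
          replace (INR k * / (4 * 2 ^ m) * (4 * 2 ^ m)) with (INR k) by (field; lra). lra.
        - apply Rmult_le_reg_r with (4 * 2 ^ m); [lra|].
          replace (INR k * / (4 * 2 ^ m) * (4 * 2 ^ m)) with (INR k) by (field; lra). lra. }
      replace (2 * PI * INR k * d) with (2 * PI * (INR k * d)) by ring.
      pose proof PI_RGT_0. apply cos_le_0; nra. }
    pose proof (pow2_ge_0 (A k)). pose proof (pow2_ge_0 (B k)). nra.
  - apply Rle_trans with (sum_n_m (fun k => 4 * (1 - cosk (Z.of_nat k) d) * (A k ^ 2 + B k ^ 2)) 1 (2 ^ S m - 1)).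
    + destruct (Nat.eq_dec m 0) as [->|Hm].
      * simpl. apply Rle_refl.
      * rewrite (sum_n_m_Chasles _ 1 (2 ^ m - 1) (2 ^ S m - 1)) by (simpl; lia).
        replace (S (2 ^ m - 1)) with (2 ^ m)%nat by lia.
        match goal with |- _ <= plus ?u ?v => assert (0 <= u) by (apply sum_n_m_ge_0; intros; apply Rge_le, Hc);
          change (v <= u + v) end. lra.
    + eapply Rle_trans; [now apply bessel_difference|].
      apply Rmult_le_compat_l; [apply pow2_ge_0|].
      unfold d. rewrite <- Rpower_pow, <- Rpower_Ropp, Rpower_mult by lra.
      apply Rle_Rpower; [lra|]. rewrite plus_INR. simpl. pose proof (pos_INR m). lra.
Qed.

(** A dyadic block has [2 ^ m] terms and square sum of order [2 ^ (- 3 m / 2)], so Cauchy-Schwarz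
    bounds its absolute sum by a multiple of [2 ^ (- m / 4)]. The sequence [x] will be [A] and then
    [B]. *)
Lemma bernstein (x : nat -> R) : (forall k, x k ^ 2 <= A k ^ 2 + B k ^ 2) ->
  ex_series (fun k => Rabs (x k)).
Proof.
  intros Hx.
  set (q := Rpower 2 (- (1/4))).
  assert (Hq : 0 <= q < 1).
  { unfold q. split; [left; apply exp_pos|]. apply Rlt_le_trans with (Rpower 2 0).
    - apply Rpower_lt; lra.
    - rewrite Rpower_O; lra. }
  assert (Hqm : forall m, q ^ m = Rpower 2 (- (1/4) * INR m)).
  { intros m. unfold q. rewrite <- Rpower_pow by apply exp_pos. apply Rpower_mult. }
  apply (block_summable x ((C ^ 2 + 1) / 2) q Hq). intros m.
  (* This weight balances the two halves of the AM-GM bound: [la * 2 ^ (- 3 m / 2)] and [2 ^ m / la]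
     both equal [q ^ m]. *)
  set (la := Rpower 2 (5/4 * INR m)).
  assert (Hla : 0 < la) by apply exp_pos.
  apply Rle_trans with (sum_n_m (fun k => plus (mult (la / 2) (A k ^ 2 + B k ^ 2)) (/ (2 * la))) (2 ^ m) (2 ^ S m - 1)).
  - apply sum_n_m_le. intros k. unfold plus, mult; simpl AbelianMonoid.plus; simpl Ring.mult.
    specialize (Hx k). rewrite <- (pow2_abs (x k)) in Hx. set (y := Rabs (x k)) in *.
    (* AM-GM: 2 y <= la y^2 + 1 / la *)
    assert (Q : 0 <= (la * y - 1) ^ 2) by apply pow2_ge_0.
    apply Rmult_le_reg_r with (2 * la); [lra|].
    change (y * (2 * la) <= (la / 2 * (A k ^ 2 + B k ^ 2) + / (2 * la)) * (2 * la)).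
    replace ((la / 2 * (A k ^ 2 + B k ^ 2) + / (2 * la)) * (2 * la)) with (la ^ 2 * (A k ^ 2 + B k ^ 2) + 1) by (field; lra).
    assert (la ^ 2 * y ^ 2 <= la ^ 2 * (A k ^ 2 + B k ^ 2)) by (apply Rmult_le_compat_l; [apply pow2_ge_0|exact Hx]).
    nra.
  - rewrite sum_n_m_plus, sum_n_m_mult_l, sum_n_m_const.
    assert (P2 : (1 <= 2 ^ m)%nat) by (clear; induction m; simpl; lia).
    replace (S (2 ^ S m - 1) - 2 ^ m)%nat with (2 ^ m)%nat by (rewrite Nat.pow_succ_r'; lia).
    unfold plus, mult; simpl AbelianMonoid.plus; simpl Ring.mult.
    change (la / 2 * sum_n_m (fun k => A k ^ 2 + B k ^ 2) (2 ^ m) (2 ^ S m - 1) + INR (2 ^ m) * / (2 * la)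
      <= (C ^ 2 + 1) / 2 * q ^ m).
    pose proof (bernstein_block m) as Hb.
    rewrite pow_INR. change (INR 2) with 2. rewrite <- (Rpower_pow m 2) by lra.
    assert (E1 : la * Rpower 2 (- (3/2) * INR m) = q ^ m).
    { rewrite Hqm. unfold la. rewrite <- Rpower_plus. f_equal. field. }
    assert (E2 : Rpower 2 (INR m) * / la = q ^ m).
    { rewrite Hqm. unfold la. rewrite <- Rpower_Ropp, <- Rpower_plus. f_equal. field. }
    replace (Rpower 2 (INR m) * / (2 * la)) with (q ^ m / 2) by (rewrite <- E2; field; lra).
    apply Rle_trans with (la / 2 * (C ^ 2 * Rpower 2 (- (3/2) * INR m)) + q ^ m / 2).
    + apply Rplus_le_compat_r, Rmult_le_compat_l; lra.
    + right. rewrite <- E1. field.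
Qed.

Lemma bernstein_fourier_series :
  ex_series (fun k => Rabs (A k)) /\ ex_series (fun k => Rabs (B k)) /\
  forall x, is_series (fun k => 2 * (A k * cosk (Z.of_nat k) x + B k * sink (Z.of_nat k) x)) (H x + A O).
Proof.
  assert (SA : ex_series (fun k => Rabs (A k))).
  { apply bernstein. intros k. pose proof (pow2_ge_0 (B k)). lra. }
  assert (SB : ex_series (fun k => Rabs (B k))).
  { apply bernstein. intros k. pose proof (pow2_ge_0 (A k)). lra. }
  split; [exact SA|]. split; [exact SB|]. intros x.
  set (n := Int_part x).
  assert (Hn : 0 <= x - IZR n <= 0 + 1).
  { destruct (base_Int_part x) as [H1 H2]. fold n in H1, H2. lra. }
  assert (HZ : forall (k : nat) y, H (y + INR k) = H y).
  { induction k as [|k IH]; intros y; [simpl; now rewrite Rplus_0_r|].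
    rewrite S_INR, <- Rplus_assoc, H_per. apply IH. }
  assert (E : H (x - IZR n) = H x).
  { destruct (Z_le_dec 0 n).
    - rewrite <- (HZ (Z.to_nat n) (x - IZR n)). f_equal. rewrite INR_IZR_INZ, Z2Nat.id by lia. ring.
    - rewrite <- (HZ (Z.to_nat (- n)) x). f_equal. rewrite INR_IZR_INZ, Z2Nat.id, opp_IZR by lia. ring. }
  assert (G := fourier_series_eq 0 H A B H_cont).
  rewrite Rplus_0_l in G.
  specialize (G H_cos H_sin SA SB (x - IZR n)).
  rewrite E in G. eapply is_series_ext; [|apply G; lra].
  intros k. toR. simpl. unfold Rminus.
  rewrite <- opp_IZR, cosk_add_Z, sink_add_Z. reflexivity.
Qed.

End Bernstein.

(** * Zeta and the periodic sawtooth integral *)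

Ltac toC := match goal with |- @eq _ ?a ?b => change (@eq C a b) end.

(* A periodic antiderivative of {x} - 1/2. *)
Definition sawq (x : R) : R := (frac_part x ^ 2 - frac_part x) / 2.

Lemma frac_part_cell m x : IZR m <= x < IZR m + 1 -> frac_part x = x - IZR m.
Proof.
  intros H. unfold frac_part. f_equal. f_equal. f_equal.
  unfold Int_part. rewrite <- (tech_up x (m + 1)); [lia| |]; rewrite plus_IZR; lra.
Qed.

(** The right end is included because [(t ^ 2 - t) / 2] vanishes at both 0 and 1; continuity of
    [sawq] comes from this. *)
Lemma sawq_cell m x : IZR m <= x <= IZR m + 1 -> sawq x = ((x - IZR m) ^ 2 - (x - IZR m)) / 2.
Proof.
  intros H. unfold sawq. destruct (Req_dec x (IZR m + 1)) as [->|Hx].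
  - rewrite (frac_part_cell (m + 1)) by (rewrite plus_IZR; lra). rewrite plus_IZR. field.
  - now rewrite (frac_part_cell m) by lra.
Qed.

Lemma sawq_01 x : 0 <= x <= 1 -> sawq x = (x ^ 2 - x) / 2.
Proof. intros H. rewrite (sawq_cell 0) by lra. f_equal. f_equal; [f_equal|]; ring. Qed.

Lemma ex_cell x : exists m, IZR m <= x < IZR m + 1.
Proof. exists (Int_part x). pose proof (base_Int_part x). lra. Qed.

Lemma sawq_add_Z x m : sawq (x + IZR m) = sawq x.
Proof.
  destruct (ex_cell x) as [k Hk].
  rewrite (sawq_cell (k + m)), (sawq_cell k) by (rewrite ?plus_IZR; lra).
  rewrite plus_IZR. f_equal. f_equal; [f_equal|]; ring.
Qed.

Lemma sawq_bounds x : - (1/8) <= sawq x <= 0.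
Proof.
  destruct (ex_cell x) as [k Hk]. rewrite (sawq_cell k) by lra.
  set (t := x - IZR k). assert (0 <= t <= 1) by (unfold t; lra). pose proof (pow2_ge_0 (t - 1/2)). split; nra.
Qed.

Lemma sawq_lower x : 0 <= x -> - (x / 2) <= sawq x.
Proof.
  intros Hx. destruct (Rle_dec x 1) as [H1|H1].
  - rewrite sawq_01 by lra. nra.
  - pose proof (sawq_bounds x). lra.
Qed.

Lemma sawq_lipschitz x y : Rabs (sawq x - sawq y) <= Rabs (x - y) / 2.
Proof.
  assert (W : forall x y, x <= y -> Rabs (sawq x - sawq y) <= (y - x) / 2).
  { clear. intros x y Hxy. destruct (Rle_dec 1 (y - x)) as [H1|H1].
    { pose proof (sawq_bounds x). pose proof (sawq_bounds y). apply Rabs_le. lra. }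
    destruct (ex_cell x) as [k Hk].
    destruct (Rle_dec y (IZR k + 1)) as [Hy|Hy].
    - rewrite !(sawq_cell k) by lra. apply Rabs_le.
      set (s := x - IZR k). set (t := y - IZR k). assert (y - x = t - s) by (unfold s, t; ring).
      assert (0 <= s <= t /\ t <= 1) by (unfold s, t; lra). nra.
    - rewrite (sawq_cell k x), (sawq_cell (k + 1) y) by (rewrite ?plus_IZR; lra). rewrite plus_IZR.
      set (s := x - IZR k). set (t := y - (IZR k + 1)). assert (y - x = t + (1 - s)) by (unfold s, t; ring).
      assert (0 <= s <= 1 /\ 0 <= t <= 1) by (unfold s, t; lra). apply Rabs_le. nra. }
  destruct (Rle_dec x y) as [H|H].
  - rewrite (Rabs_minus_sym x y), (Rabs_pos_eq (y - x)) by lra. now apply W.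
  - rewrite Rabs_minus_sym, (Rabs_pos_eq (x - y)) by lra. apply W. lra.
Qed.

Lemma lipschitz_continuous (f : R -> R) L x : (forall x y, Rabs (f x - f y) <= L * Rabs (x - y)) -> continuous f x.
Proof.
  intros H. apply (filterlim_locally_ball_norm (U := R_NormedModule)). intros [e He].
  assert (Hd : 0 < e / (Rabs L + 1)) by (apply Rdiv_lt_0_compat; pose proof (Rabs_pos L); lra).
  exists (mkposreal _ Hd). intros y Hy. change (Rabs (y - x) < e / (Rabs L + 1)) in Hy.
  change (Rabs (f y - f x) < e).
  apply Rle_lt_trans with (1 := H y x).
  apply Rle_lt_trans with (Rabs L * Rabs (y - x)).
  { apply Rmult_le_compat_r; [apply Rabs_pos|apply Rle_abs]. }
  pose proof (Rabs_pos L). pose proof (Rabs_pos (y - x)).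
  apply Rle_lt_trans with ((Rabs L + 1) * Rabs (y - x)); [nra|].
  apply Rlt_le_trans with ((Rabs L + 1) * (e / (Rabs L + 1))).
  - apply Rmult_lt_compat_l; lra.
  - right. field. lra.
Qed.

Lemma sawq_cont x : continuous sawq x.
Proof. apply (lipschitz_continuous _ (1/2)). intros. pose proof (sawq_lipschitz x0 y). lra. Qed.

Lemma ex_series_inv_sq_scal c : ex_series (fun k => c / INR (S k) ^ 2).
Proof. apply (ex_series_scal_l (V := R_NormedModule) c), ex_inv_sq. Qed.

(** The coefficients of [(x ^ 2 - x) / 2] are found by parts. Subtracting the expansion at [x] from
    that at 0, where the function vanishes, removes the mean value and produces the factors
    [1 - cos], which are of order [x ^ 2] at 0 and so have the Mellin transforms needed later. *)
Lemma sawq_fourier x :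
  is_series (fun n => (1 - cosk (Z.of_nat (S n)) x) / (2 * PI ^ 2 * INR (S n) ^ 2)) (- sawq x).
Proof.
  pose proof PI_RGT_0 as Hpi.
  set (A := fun k => match k with O => - (1/12) | S k => / (4 * PI ^ 2 * INR (S k) ^ 2) end).
  assert (Hf : forall x, continuous (fun x => (x ^ 2 - x) / 2) x).
  { intros y. apply (ex_derive_continuous (fun x => (x ^ 2 - x) / 2)). auto_derive; auto. }
  assert (HA : forall k, is_RInt (fun x => (x ^ 2 - x) / 2 * cosk (Z.of_nat k) x) 0 1 (A k)).
  { intros [|k].
    - eapply is_RInt_ext; [|eapply is_RInt_eq; [apply (is_RInt_derive (V := R_CompleteNormedModule)
        (fun x => x ^ 3 / 6 - x ^ 2 / 4) (fun x => (x ^ 2 - x) / 2))|]].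
      + intros y _. toR. simpl. rewrite cosk_0. ring.
      + intros y _. auto_derive; auto. field.
      + intros. apply Hf.
      + unfold minus, plus, opp; simpl. field.
    - assert (Hk : INR (S k) <> 0) by (pose proof (Spos k); lra).
      set (l := 2 * PI * INR (S k)).
      assert (Hl : l <> 0) by (apply Rgt_not_eq; pose proof (Spos k); unfold l; apply Rmult_gt_0_compat; lra).
      eapply is_RInt_eq; [apply (is_RInt_derive (V := R_CompleteNormedModule)
        (fun x => (x ^ 2 - x) / 2 * sin (l * x) / l + (2 * x - 1) / 2 * cos (l * x) / l ^ 2 - sin (l * x) / l ^ 3))|].
      + intros y _. unfold cosk. rewrite <- INR_IZR_INZ. fold l. auto_derive; auto. field. auto.
      + intros. auto with rcont.
      + rewrite Rmult_0_r, Rmult_1_r, sin_0, cos_0.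
        assert (E1 : sin l = 0).
        { unfold l. rewrite <- sin_0, <- (sin_add_period 0 (Z.of_nat (S k))), <- INR_IZR_INZ. f_equal. ring. }
        assert (E2 : cos l = 1).
        { unfold l. rewrite <- cos_0, <- (cos_add_period 0 (Z.of_nat (S k))), <- INR_IZR_INZ. f_equal. ring. }
        rewrite E1, E2. unfold minus, plus, opp; simpl Rplus.
        unfold A. transitivity (/ l ^ 2).
        * change (((1 ^ 2 - 1) / 2 * 0 / l + (2 * 1 - 1) / 2 * 1 / l ^ 2 - 0 / l ^ 3) -
           ((0 ^ 2 - 0) / 2 * 0 / l + (2 * 0 - 1) / 2 * 1 / l ^ 2 - 0 / l ^ 3) = / l ^ 2). field. auto.
        * unfold l. field. split; lra. }
  assert (HB : forall k, is_RInt (fun x => (x ^ 2 - x) / 2 * sink (Z.of_nat k) x) 0 1 0).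
  { intros [|k].
    - apply is_RInt_ext with (sink 0).
      + intros y _. toR. simpl. rewrite sink_0. ring.
      + generalize (is_RInt_sink 0 0). now rewrite Rplus_0_l.
    - assert (Hk : INR (S k) <> 0) by (pose proof (Spos k); lra).
      set (l := 2 * PI * INR (S k)).
      assert (Hl : l <> 0) by (apply Rgt_not_eq; pose proof (Spos k); unfold l; apply Rmult_gt_0_compat; lra).
      eapply is_RInt_eq; [apply (is_RInt_derive (V := R_CompleteNormedModule)
        (fun x => - (x ^ 2 - x) / 2 * cos (l * x) / l + (2 * x - 1) / 2 * sin (l * x) / l ^ 2 + cos (l * x) / l ^ 3))|].
      + intros y _. unfold sink. rewrite <- INR_IZR_INZ. fold l. auto_derive; auto. field. auto.
      + intros. auto with rcont.
      + rewrite Rmult_0_r, Rmult_1_r, sin_0, cos_0.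
        assert (E1 : sin l = 0).
        { unfold l. rewrite <- sin_0, <- (sin_add_period 0 (Z.of_nat (S k))), <- INR_IZR_INZ. f_equal. ring. }
        assert (E2 : cos l = 1).
        { unfold l. rewrite <- cos_0, <- (cos_add_period 0 (Z.of_nat (S k))), <- INR_IZR_INZ. f_equal. ring. }
        rewrite E1, E2.
        change ((- (1 ^ 2 - 1) / 2 * 1 / l + (2 * 1 - 1) / 2 * 0 / l ^ 2 + 1 / l ^ 3) -
           (- (0 ^ 2 - 0) / 2 * 1 / l + (2 * 0 - 1) / 2 * 0 / l ^ 2 + 1 / l ^ 3) = 0). field. auto. }
  assert (SA : ex_series (fun k => Rabs (A k))).
  { apply ex_series_incr_1. apply (ex_series_le (V := R_CompleteNormedModule) _ (fun k => / (4 * PI ^ 2) / INR (S k) ^ 2)).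
    - intros k. change (Rabs (Rabs (A (S k))) <= / (4 * PI ^ 2) / INR (S k) ^ 2).
      rewrite Rabs_Rabsolu. unfold A. pose proof (Spos k).
      assert (0 < 4 * PI ^ 2 * INR (S k) ^ 2)
        by (apply Rmult_lt_0_compat; [apply Rmult_lt_0_compat; [|apply pow_lt]|apply pow_lt]; lra).
      rewrite Rabs_pos_eq by (left; now apply Rinv_0_lt_compat).
      right. field. split; lra.
    - apply ex_series_inv_sq_scal. }
  assert (SB : ex_series (fun k : nat => Rabs 0)).
  (* The zero series is seen as a series with a single term, equal to 0. *)
  { exists 0. rewrite Rabs_R0. apply (is_series_ext (fun k => if Nat.eqb k 0 then 0 else 0)).
    - intros [|n]; reflexivity.
    - apply (is_series_single (V := R_NormedModule)). }
  assert (F : forall x, 0 <= x <= 1 -> is_series (fun k => 2 * A (S k) * cosk (Z.of_nat (S k)) x) ((x ^ 2 - x) / 2 - A O)).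
  { intros y Hy.
    pose proof (fourier_series_eq 0 (fun x => (x ^ 2 - x) / 2) A (fun _ => 0) Hf) as G.
    rewrite Rplus_0_l in G. specialize (G HA HB SA SB y Hy). cbv beta in G.
    apply (is_series_ext (fun k => 2 * (A (S k) * cosk (Z.of_nat (S k)) y + 0 * sink (Z.of_nat (S k)) y))).
    { intros n. toR. ring. }
    apply (is_series_incr_1 (fun k => 2 * (A k * cosk (Z.of_nat k) y + 0 * sink (Z.of_nat k) y))).
    match type of G with is_series _ ?l => match goal with |- is_series _ ?l' => replace l' with l; [exact G|] end end.
    change (Z.of_nat 0) with 0%Z. rewrite cosk_0.
    change ((y ^ 2 - y) / 2 + A O = (y ^ 2 - y) / 2 - A O + 2 * (A O * 1 + 0 * sink 0 y)). ring. }
  assert (W : forall x, 0 <= x <= 1 ->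
    is_series (fun n => (1 - cosk (Z.of_nat (S n)) x) / (2 * PI ^ 2 * INR (S n) ^ 2)) (- ((x ^ 2 - x) / 2))).
  { intros y Hy.
    assert (G := is_series_minus (V := R_NormedModule) _ _ _ _ (F 0 ltac:(lra)) (F y Hy)).
    match type of G with is_series _ ?l => replace (- ((y ^ 2 - y) / 2)) with l end.
    - eapply is_series_ext; [|exact G]. intros n. unfold minus, plus, opp; simpl plus.
      change (2 * A (S n) * cosk (Z.of_nat (S n)) 0 - 2 * A (S n) * cosk (Z.of_nat (S n)) y =
        (1 - cosk (Z.of_nat (S n)) y) / (2 * PI ^ 2 * INR (S n) ^ 2)).
      replace (cosk (Z.of_nat (S n)) 0) with 1 by (unfold cosk; now rewrite Rmult_0_r, cos_0).
      unfold A. pose proof (Spos n). field. split; lra.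
    - unfold minus, plus, opp; simpl. field. }
  destruct (ex_cell x) as [m Hm].
  rewrite (sawq_cell m) by lra.
  eapply is_series_ext; [|apply W; lra].
  intros n. toR. cbv beta. replace (x - IZR m) with (x + IZR (- m)) by (rewrite opp_IZR; ring).
  now rewrite cosk_add_Z.
Qed.

Lemma bern_2 u : bern 2 u = (u ^ 2 - u) / 2 + bern 2 0.
Proof.
  assert (E : RInt (bern 1) 0 u = (u ^ 2 - u) / 2).
  { apply is_RInt_unique.
    eapply is_RInt_eq; [apply (is_RInt_derive (V := R_CompleteNormedModule) (fun x => (x ^ 2 - x) / 2))|].
    - intros x _. rewrite bern_1. auto_derive; auto. field.
    - intros. apply bern_cont.
    - unfold minus, plus, opp; simpl. field. }
  change (bern 2 u) with (RInt (bern 1) 0 u - RInt (fun v => RInt (bern 1) 0 v) 0 1).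
  change (bern 2 0) with (RInt (bern 1) 0 0 - RInt (fun v => RInt (bern 1) 0 v) 0 1).
  rewrite E, (RInt_point (V := R_CompleteNormedModule) 0 (bern 1)). unfold zero; simpl. ring.
Qed.

Definition saw_term (s : C) (n : nat) : C :=
  RInt (V := C_R_CompleteNormedModule)
    (fun u => (RtoC (sawq u) * Rcpow (INR (S n) + u) (- (s + 2)))%C) 0 1.

Lemma continuous_Rmult_C (g : R -> R) (f : R -> C) u : continuous g u ->
  continuous (U := C_R_NormedModule) f u ->
  continuous (U := C_R_NormedModule) (fun t => (RtoC (g t) * f t)%C) u.
Proof.
  intros Hg H.
  apply continuous_ext with (fun t => scal (V := C_R_ModuleSpace) (g t) (f t)).
  { intros t. apply scal_R_Cmult. }
  now apply (continuous_scal (V := C_R_NormedModule)).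
Qed.

Lemma is_CInt_cont (f : R -> C) a b :
  (forall x, Rmin a b <= x <= Rmax a b -> continuous (U := C_R_NormedModule) f x) ->
  is_CInt f a b (RInt (V := C_R_CompleteNormedModule) f a b).
Proof.
  intros H. apply (RInt_correct (V := C_R_CompleteNormedModule)).
  apply (ex_RInt_continuous (V := C_R_CompleteNormedModule)). exact H.
Qed.

Lemma is_CInt_unique (f : R -> C) a b l :
  is_CInt f a b l -> RInt (V := C_R_CompleteNormedModule) f a b = l.
Proof. apply (is_RInt_unique (V := C_R_CompleteNormedModule)). Qed.

Lemma is_CInt_eq (f : R -> C) a b (l l' : C) : is_CInt f a b l -> l = l' -> is_CInt f a b l'.
Proof. now intros H <-. Qed.

Lemma is_CInt_plus (f g : R -> C) a b (lf lg : C) : is_CInt f a b lf -> is_CInt g a b lg ->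
  is_CInt (fun x => (f x + g x)%C) a b (lf + lg)%C.
Proof. apply (is_RInt_plus (V := C_R_NormedModule)). Qed.

Lemma is_CInt_minus (f g : R -> C) a b (lf lg : C) : is_CInt f a b lf -> is_CInt g a b lg ->
  is_CInt (fun x => (f x - g x)%C) a b (lf - lg)%C.
Proof. apply (is_RInt_minus (V := C_R_NormedModule)). Qed.

Lemma saw_term_correct s n :
  is_CInt (fun u => (RtoC (sawq u) * Rcpow (INR (S n) + u) (- (s + 2)))%C) 0 1 (saw_term s n).
Proof.
  apply is_CInt_cont. intros z Hz. rewrite Rmin_left, Rmax_right in Hz by lra.
  apply continuous_Rmult_C; [apply sawq_cont|]. apply continuous_Rcpow_shift.
  pose proof (Spos n). lra.
Qed.

(** On [[0, 1]] the polynomial [bern 2] is [sawq] plus the constant [bern 2 0], and the constant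
    contributes an integral of a pure power, that is, a term of order 0 at [s + 2]. *)
Lemma EM_term_2 s n :
  EM_term 2 s n = (saw_term s n + RtoC (bern 2 0) * EM_term 0 (s + 2) n)%C.
Proof.
  apply is_CInt_unique.
  assert (G := is_CInt_plus _ _ _ _ _ _ (saw_term_correct s n)
    (is_CInt_Cmult _ _ _ _ (RtoC (bern 2 0)) (EM_term_correct 0 (s + 2) n))).
  eapply is_RInt_ext; [|exact G].
  intros x Hx. rewrite Rmin_left, Rmax_right in Hx by lra. toC.
  rewrite (bern_2 x), (sawq_01 x) by lra. simpl (bern 0 x).
  replace (s + 2 + RtoC (INR 0))%C with (s + 2)%C by (simpl; ring).
  replace (RtoC (INR 2)) with (RtoC 2) by (simpl; f_equal; ring).
  rewrite RtoC_plus. ring.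
Qed.

Lemma Cneq_minus (a b : C) : a <> b -> (a - b)%C <> 0.
Proof. intros H E. apply H. now apply Ceq_minus. Qed.

Lemma EM_0_series s : 1 < Re s -> is_Cser (EM_term 0 s) (/ (s - 1))%C.
Proof.
  intros Hs.
  assert (Hs1 : s <> RtoC 1) by (intros ->; simpl in Hs; lra).
  pose proof (Cneq_minus _ _ Hs1) as Hs2.
  apply is_Cser_ext with (fun n => ((- / (s - 1)) * (Rcpow (INR (S (S n))) (1 - s) - Rcpow (INR (S n)) (1 - s)))%C).
  - intros n. rewrite EM_0 by auto. toC. field. auto.
  - assert (Hw : Re (1 - s) < 0).
    { unfold Cminus. rewrite re_plus, re_opp, re_RtoC. lra. }
    pose proof (is_Cser_scal (- / (s - 1))%C _ _ (is_Cser_tele _ Hw)) as G.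
    replace (- / (s - 1) * - (1))%C with (/ (s - 1))%C in G by ring. exact G.
Qed.

(** The Euler-Maclaurin formula with its Bernoulli constants eliminated: the constant part of
    [bern 2] telescopes to a multiple of [/ (s + 1)], and [EM_step] exchanges the third-order
    remainder for the second-order one. The region reaches left of the imaginary axis, as the
    functional equation requires. *)
Lemma zeta_saw s : -1 < Re s -> s <> RtoC 1 ->
  exists J, is_Cser (saw_term s) J /\
    zeta s = ((s + 1) / (2 * (s - 1)) - s * (s + 1) * J)%C.
Proof.
  intros Hs Hs1. pose proof (Cneq_minus _ _ Hs1) as Hs2.
  assert (Hs3 : (s + 1)%C <> 0).
  { intros E. assert (F : Re (s + 1) = Re 0) by now rewrite E. rewrite re_plus in F. simpl in F. lra. }
  assert (H2 : is_Cser (EM_term 2 s) (- RtoC (bern 3 1) + (s + 2) * CSeries (EM_term 3 s))%C).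
  { generalize (EM_step 1 s ltac:(simpl; lra) ltac:(simpl; lra)).
    replace (RtoC (INR 2)) with (RtoC 2) by (simpl; f_equal; ring). auto. }
  assert (H0 : is_Cser (EM_term 0 (s + 2)) (/ (s + 1))%C).
  { replace (/ (s + 1))%C with (/ (s + 2 - 1))%C.
    - apply EM_0_series. rewrite re_plus. simpl. lra.
    - f_equal. replace (RtoC 2) with (RtoC 1 + RtoC 1)%C by (rewrite <- RtoC_plus; f_equal; ring). ring. }
  set (L := (- RtoC (bern 3 1) + (s + 2) * CSeries (EM_term 3 s))%C) in *.
  exists (L - RtoC (bern 2 0) * / (s + 1))%C. split.
  - assert (G := is_Cser_plus _ _ _ _ H2 (is_Cser_scal (- RtoC (bern 2 0))%C _ _ H0)).
    replace (L - RtoC (bern 2 0) * / (s + 1))%C with (L + - RtoC (bern 2 0) * / (s + 1))%C by ring.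
    eapply is_Cser_ext; [|exact G]. intros n. toC. cbv beta. rewrite EM_term_2. ring.
  - rewrite (zeta_eq_EM 2) by (simpl; lra). unfold zeta_EM, L.
    rewrite !sum_Sn, sum_O. change (plus (G := C_AbelianMonoid)) with Cplus.
    rewrite <- (bern_per 0), (bern_1 1). simpl Cpoch.
    replace (RtoC (INR 2)) with (RtoC 2) by (simpl; f_equal; ring).
    change (INR 0) with 0. change (INR 1) with 1.
    replace (1 - 1/2) with (/2) by field. rewrite RtoC_inv by lra.
    set (b2 := RtoC (bern 2 1)). set (b3 := RtoC (bern 3 1)). set (J := CSeries _).
    replace (RtoC 2) with (RtoC 1 + RtoC 1)%C by (rewrite <- RtoC_plus; f_equal; ring).
    rewrite ?RtoC_plus. toC. field. repeat split; auto.
Qed.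

(** * Holder regularity of sums of dilated sawteeth *)

Lemma Cmod_Rcpow_Rpower x s : Cmod (Rcpow x s) = Rpower x (Re s).
Proof. apply Cmod_Rcpow. Qed.

Lemma is_RInt_Rpower a b r : 0 < a <= b -> r + 1 <> 0 ->
  is_RInt (fun x => Rpower x r) a b ((Rpower b (r + 1) - Rpower a (r + 1)) / (r + 1)).
Proof.
  intros Hab Hr.
  eapply is_RInt_eq; [apply (is_RInt_derive (V := R_CompleteNormedModule) (fun x => Rpower x (r + 1) / (r + 1)))|].
  - intros x Hx. rewrite Rmin_left, Rmax_right in Hx by lra.
    unfold Rpower. auto_derive; [lra|].
    replace ((r + 1) * ln x) with (r * ln x + ln x) by ring. rewrite exp_plus, exp_ln by lra. field. split; lra.
  - intros x Hx. rewrite Rmin_left, Rmax_right in Hx by lra.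
    apply (ex_derive_continuous (fun x => Rpower x r)). unfold Rpower. auto_derive. lra.
  - unfold minus, plus, opp; simpl. field. exact Hr.
Qed.

Lemma CInt_pow_bound (f : R -> C) a b l M r : 0 < a <= b -> r + 1 <> 0 ->
  (forall x, a <= x <= b -> Cmod (f x) <= M * Rpower x r) -> is_CInt f a b l ->
  Cmod l <= M * ((Rpower b (r + 1) - Rpower a (r + 1)) / (r + 1)).
Proof.
  intros Hab Hr H Hl. rewrite <- norm_CR.
  apply (norm_RInt_le (V := C_R_NormedModule) f (fun x => M * Rpower x r) a b); [lra| |exact Hl|].
  - intros x Hx. rewrite norm_CR. auto.
  - apply (is_RInt_scal (V := R_NormedModule) (fun x => Rpower x r)). now apply is_RInt_Rpower.
Qed.

Lemma Rpower_neg_small p eps : 0 < p -> 0 < eps ->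
  exists X0, 1 <= X0 /\ forall X, X0 <= X -> Rpower X (- p) < eps.
Proof.
  intros Hp He. exists (Rmax 1 (Rpower (eps / 2) (- / p))). split; [apply Rmax_l|].
  intros X HX. assert (H1 := Rmax_l 1 (Rpower (eps / 2) (- / p))).
  assert (H2 := Rmax_r 1 (Rpower (eps / 2) (- / p))).
  assert (H3 : Rpower (eps / 2) (- / p) <= X) by lra.
  assert (H4 : Rpower (Rpower (eps / 2) (- / p)) p <= Rpower X p).
  { apply Rle_Rpower_l; [lra|]. split; [apply exp_pos|exact H3]. }
  rewrite Rpower_mult in H4. replace (- / p * p) with (- (1)) in H4 by (field; lra).
  rewrite Rpower_Ropp, Rpower_1 in H4 by lra. rewrite Rpower_Ropp.
  apply Rle_lt_trans with (eps / 2); [|lra].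
  rewrite <- (Rinv_inv (eps / 2)). apply Rinv_le_contravar; [|exact H4].
  apply Rinv_0_lt_compat. lra.
Qed.

Lemma continuous_Rcpow w u : 0 < u -> continuous (U := C_R_NormedModule) (fun t => Rcpow t w) u.
Proof.
  intros H. apply (ex_derive_continuous (V := C_R_NormedModule)). eexists. now apply is_derive_Rcpow.
Qed.

Definition saw_int (s : C) (X : R) : C :=
  RInt (V := C_R_CompleteNormedModule) (fun x => (RtoC (sawq x) * Rcpow x (- (s + 2)))%C) 1 X.

Lemma saw_int_correct s a b : 0 < a -> 0 < b ->
  is_CInt (fun x => (RtoC (sawq x) * Rcpow x (- (s + 2)))%C) a b (saw_int s b - saw_int s a)%C.
Proof.
  intros Ha Hb. set (f := fun x => (RtoC (sawq x) * Rcpow x (- (s + 2)))%C).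
  assert (Hf : forall X, 0 < X -> is_CInt f 1 X (saw_int s X)).
  { intros X HX. apply is_CInt_cont. intros x Hx.
    assert (0 < x) by (destruct Hx as [Hx _]; apply Rlt_le_trans with (2 := Hx); apply Rmin_case; lra).
    apply continuous_Rmult_C; [apply sawq_cont|now apply continuous_Rcpow]. }
  pose proof (is_RInt_Chasles (V := C_R_NormedModule) f a 1 b _ _
    (is_RInt_swap (V := C_R_NormedModule) _ _ _ _ (Hf a Ha)) (Hf b Hb)) as G.
  eapply is_CInt_eq; [exact G|].
  change (- saw_int s a + saw_int s b = saw_int s b - saw_int s a)%C. ring.
Qed.

Lemma saw_int_1 s : saw_int s 1 = 0.
Proof. apply (RInt_point (V := C_R_CompleteNormedModule)). Qed.

Lemma saw_term_int s n : saw_term s n = (saw_int s (INR (S (S n))) - saw_int s (INR (S n)))%C.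
Proof.
  apply is_CInt_unique.
  pose proof (Spos n) as Hn. pose proof (Spos (S n)) as Hn'.
  assert (G := saw_int_correct s (INR (S n)) (INR (S (S n))) ltac:(lra) ltac:(lra)).
  replace (INR (S n)) with (1 * 0 + INR (S n)) in G at 1 by ring.
  replace (INR (S (S n))) with (1 * 1 + INR (S n)) in G at 1 by (rewrite (S_INR (S n)); ring).
  apply (is_RInt_comp_lin (V := C_R_NormedModule)) in G.
  eapply is_RInt_ext; [|exact G].
  intros x _. cbv beta. rewrite scal_R_Cmult. toC. rewrite Cmult_1_l.
  rewrite Rmult_1_l, (Rplus_comm x). f_equal. f_equal.
  rewrite Rplus_comm, INR_IZR_INZ. apply sawq_add_Z.
Qed.

Lemma saw_int_tail s X Y : -1 < Re s -> 1 <= X <= Y ->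
  Cmod (saw_int s Y - saw_int s X) <= Rpower X (- (1 + Re s)) / (1 + Re s).
Proof.
  intros Hs HXY.
  assert (G := saw_int_correct s X Y ltac:(lra) ltac:(lra)).
  assert (Er : - (Re s + 2) + 1 = - (1 + Re s)) by ring.
  eapply Rle_trans; [apply (CInt_pow_bound _ X Y _ 1 (- (Re s + 2))) with (4 := G)|].
  - lra.
  - lra.
  - intros x Hx. rewrite Cmod_mult, Cmod_R, Cmod_Rcpow_Rpower.
    replace (Re (- (s + 2))) with (- (Re s + 2)) by (rewrite re_opp, re_plus; reflexivity).
    apply Rmult_le_compat_r; [left; apply exp_pos|].
    pose proof (sawq_bounds x). apply Rabs_le. lra.
  - rewrite Er, Rmult_1_l.
    replace ((Rpower Y (- (1 + Re s)) - Rpower X (- (1 + Re s))) / - (1 + Re s))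
      with ((Rpower X (- (1 + Re s)) - Rpower Y (- (1 + Re s))) / (1 + Re s)) by (field; lra).
    apply Rmult_le_compat_r; [left; apply Rinv_0_lt_compat; lra|].
    pose proof (exp_pos (- (1 + Re s) * ln Y)). unfold Rpower at 2. lra.
Qed.

Lemma filterlim_C_eps {T : Type} (F : (T -> Prop) -> Prop) {FF : Filter F} (f : T -> C) (l : C) :
  (forall eps, 0 < eps -> F (fun x => Cmod (f x - l) < eps)) ->
  filterlim f F (locally (T := C_NormedModule) l).
Proof.
  intros H P [eps HP]. specialize (H eps (cond_pos eps)). unfold filtermap.
  revert H. apply filter_imp. intros x Hx. apply HP, Cball_of_Cmod, Hx.
Qed.

Lemma C_eps_filterlim {T : Type} (F : (T -> Prop) -> Prop) {FF : Filter F} (f : T -> C) (l : C) :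
  filterlim f F (locally (T := C_NormedModule) l) ->
  forall eps, 0 < eps -> F (fun x => Cmod (f x - l) < eps).
Proof.
  intros H eps He.
  apply (filterlim_locally_ball_norm (U := C_NormedModule)) with (eps := mkposreal _ He) in H.
  exact H.
Qed.

(** The limit is taken along all real [X], not only along integers, because it will be evaluated at
    the powers of [beta]. Between integers the tail bound [saw_int_tail] takes over. *)
Lemma saw_int_lim s J : -1 < Re s -> is_Cser (saw_term s) J ->
  filterlim (saw_int s) (Rbar_locally p_infty) (locally (T := C_NormedModule) J).
Proof.
  intros Hs HJ.
  assert (HS : forall n, sum_n (G := C_AbelianMonoid) (saw_term s) n = saw_int s (INR (S (S n)))).
  { induction n as [|n IH].
    - rewrite sum_O, saw_term_int. change (INR 1) with 1. rewrite saw_int_1. toC. ring.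
    - rewrite sum_Sn, IH, saw_term_int. unfold plus; simpl AbelianMonoid.plus.
      change (saw_int s (INR (S (S n))) + (saw_int s (INR (S (S (S n)))) - saw_int s (INR (S (S n)))) = saw_int s (INR (S (S (S n)))))%C.
      ring. }
  apply filterlim_C_eps; [apply Rbar_locally_filter|]. intros eps He.
  destruct (Rpower_neg_small (1 + Re s) (eps / 2 * (1 + Re s))) as [X0 [HX0 HX]]; [lra|nra|].
  exists X0. intros X HX1.
  assert (He2 : 0 < eps / 2) by lra.
  destruct (C_eps_filterlim _ _ _ HJ (eps / 2) He2) as [N HN].
  destruct (INR_unbounded X) as [M HM].
  specialize (HN (N + M)%nat ltac:(lia)). rewrite HS in HN.
  assert (HXY : X <= INR (S (S (N + M)))).
  { apply Rle_trans with (INR M); [lra|]. apply le_INR. lia. }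
  assert (T := saw_int_tail s X (INR (S (S (N + M)))) Hs ltac:(lra)).
  replace (saw_int s X - J)%C with (- (saw_int s (INR (S (S (N + M)))) - saw_int s X) + (saw_int s (INR (S (S (N + M)))) - J))%C by ring.
  eapply Rle_lt_trans; [apply Cmod_triangle|]. rewrite Cmod_opp.
  assert (Rpower X (- (1 + Re s)) / (1 + Re s) < eps / 2).
  { apply Rmult_lt_reg_r with (1 + Re s); [lra|]. 
    replace (Rpower X (- (1 + Re s)) / (1 + Re s) * (1 + Re s)) with (Rpower X (- (1 + Re s))) by (field; lra).
    apply HX. lra. }
  lra.
Qed.

(** A quantity below both [a] and [b] lies below their weighted geometric mean. This turns a
    Lipschitz bound and a decaying bound into a Holder bound that still decays. *)
Lemma le_Rpower_interpolate x a b al : x <= a -> x <= b -> 0 < a -> 0 < b -> 0 <= al <= 1 ->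
  x <= Rpower a al * Rpower b (1 - al).
Proof.
  intros Ha Hb Ha0 Hb0 Hal. destruct (Rle_dec x 0) as [Hx|Hx].
  - apply Rle_trans with 0; [exact Hx|]. apply Rmult_le_pos; left; apply exp_pos.
  - replace x with (Rpower x al * Rpower x (1 - al)).
    + apply Rmult_le_compat; try (left; apply exp_pos); apply Rle_Rpower_l; lra.
    + rewrite <- Rpower_plus. replace (al + (1 - al)) with 1 by ring. apply Rpower_1. lra.
Qed.

Lemma exp_lt_1 x : x < 0 -> exp x < 1.
Proof. intros H. rewrite <- exp_0. now apply exp_increasing. Qed.

Lemma freq_eq beta k : 1 < beta -> freq beta k = (0, 2 * PI * IZR k / ln beta).
Proof.
  intros Hb. assert (0 < ln beta) by (rewrite <- ln_1; apply ln_increasing; lra).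
  unfold freq. apply Ceq; simpl; field; lra.
Qed.

(** The character [exp (- 2 pi i k u)], with the sign for which integration against it yields the
    [k]-th Fourier coefficient. *)
Definition expk (k : Z) (u : R) : C := (cosk k u, - sink k u).

Section Delange.
Variable beta : R.
Hypothesis hbeta : 1 < beta.

Lemma ln_beta_pos : 0 < ln beta.
Proof. rewrite <- ln_1; apply ln_increasing; lra. Qed.

(** In the variable [v = log_beta x], dilation by [beta] becomes translation by 1. The function
    decays like [beta ^ (- v)] at plus infinity and tends to -1/2 at minus infinity. *)
Definition saw_log (v : R) : R := sawq (Rpower beta v) / Rpower beta v.

Lemma saw_log_bound v : Rabs (saw_log v) <= Rpower beta (- v) / 8.
Proof.
  unfold saw_log. rewrite Rpower_Ropp. pose proof (exp_pos (v * ln beta)) as Hp.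
  change (exp (v * ln beta)) with (Rpower beta v) in Hp.
  unfold Rdiv. rewrite Rabs_mult, (Rabs_pos_eq (/ _)) by (left; now apply Rinv_0_lt_compat).
  rewrite Rmult_comm. apply Rmult_le_compat_l; [left; now apply Rinv_0_lt_compat|].
  pose proof (sawq_bounds (Rpower beta v)). apply Rabs_le. lra.
Qed.

Lemma saw_log_neg v : saw_log v <= 0.
Proof.
  unfold saw_log. pose proof (exp_pos (v * ln beta)) as Hp.
  pose proof (sawq_bounds (Rpower beta v)). unfold Rdiv.
  assert (0 < / Rpower beta v) by now apply Rinv_0_lt_compat. nra.
Qed.

Lemma saw_log_half v : 0 <= saw_log v + 1/2 <= Rpower beta v / 2.
Proof.
  unfold saw_log. pose proof (exp_pos (v * ln beta)) as Hp.
  change (exp (v * ln beta)) with (Rpower beta v) in Hp. set (x := Rpower beta v) in *.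
  assert (E : sawq x / x + 1/2 = (sawq x + x / 2) / x) by (field; lra).
  split.
  - rewrite E. apply Rmult_le_pos; [pose proof (sawq_lower x); lra|left; now apply Rinv_0_lt_compat].
  - apply Rmult_le_reg_r with x; [exact Hp|]. rewrite E.
    replace ((sawq x + x / 2) / x * x) with (sawq x + x / 2) by (field; lra).
    destruct (Rle_dec x 1).
    + rewrite sawq_01 by lra. nra.
    + pose proof (sawq_bounds x). nra.
Qed.

Lemma saw_log_small v : v <= 0 -> saw_log v + 1/2 = Rpower beta v / 2.
Proof.
  intros Hv. unfold saw_log. pose proof (exp_pos (v * ln beta)) as Hp.
  change (exp (v * ln beta)) with (Rpower beta v) in Hp.
  assert (Rpower beta v <= 1).
  { rewrite <- (Rpower_O beta) by lra. apply Rle_Rpower; lra. }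
  rewrite sawq_01 by lra. field. lra.
Qed.

(** Formally the derivative in [v] is [ln beta * (sawq' x - sawq x / x)] with both terms at most 1/2
    in size. The proof is the finite-difference version: two bounds [(y - x) / (2 * y)], and [(y -
    x) / y = 1 - exp (- ln beta * (w - v))]. *)
Lemma saw_log_lipschitz v w : Rabs (saw_log v - saw_log w) <= ln beta * Rabs (v - w).
Proof.
  pose proof ln_beta_pos as HL.
  assert (W : forall v w, v <= w -> Rabs (saw_log v - saw_log w) <= ln beta * (w - v)).
  { clear v w. intros v w Hvw. unfold saw_log.
    pose proof (exp_pos (v * ln beta)) as Hx. pose proof (exp_pos (w * ln beta)) as Hy.
    assert (Exy : Rpower beta v = Rpower beta w * exp (- (ln beta * (w - v)))).
    { unfold Rpower. rewrite <- exp_plus. f_equal. ring. }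
    assert (Hle : 1 - ln beta * (w - v) <= exp (- (ln beta * (w - v)))).
    { pose proof (exp_ineq1_le (- (ln beta * (w - v)))). lra. }
    assert (Hxy : Rpower beta v <= Rpower beta w) by (apply Rle_Rpower; lra).
    change (exp (v * ln beta)) with (Rpower beta v) in Hx. change (exp (w * ln beta)) with (Rpower beta w) in Hy.
    set (x := Rpower beta v) in *. set (y := Rpower beta w) in *.
    replace (sawq x / x - sawq y / y) with ((sawq x - sawq y) / y + sawq x * ((y - x) / (x * y))) by (field; lra).
    apply Rle_trans with ((y - x) / y).
    2:{ apply Rmult_le_reg_r with y; [exact Hy|]. replace ((y - x) / y * y) with (y - x) by (field; lra).
        rewrite Exy. nra. }
    eapply Rle_trans; [apply Rabs_triang|].
    assert (Q1 : Rabs ((sawq x - sawq y) / y) <= (y - x) / (2 * y)).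
    { unfold Rdiv at 1. rewrite Rabs_mult, (Rabs_pos_eq (/ y)) by (left; now apply Rinv_0_lt_compat).
      replace ((y - x) / (2 * y)) with ((y - x) / 2 * / y) by (field; lra).
      apply Rmult_le_compat_r; [left; now apply Rinv_0_lt_compat|].
      pose proof (sawq_lipschitz x y) as Q. rewrite (Rabs_minus_sym x y), (Rabs_pos_eq (y - x)) in Q; lra. }
    assert (Q2 : Rabs (sawq x * ((y - x) / (x * y))) <= (y - x) / (2 * y)).
    { assert (P0 : 0 <= (y - x) / (x * y)).
      { apply Rmult_le_pos; [lra|]. left. apply Rinv_0_lt_compat. nra. }
      rewrite Rabs_mult, (Rabs_pos_eq ((y - x) / (x * y))) by exact P0.
      replace ((y - x) / (2 * y)) with (x / 2 * ((y - x) / (x * y))) by (field; lra).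
      apply Rmult_le_compat_r; [exact P0|].
      pose proof (sawq_lower x). pose proof (sawq_bounds x). apply Rabs_le. lra. }
    replace ((y - x) / y) with ((y - x) / (2 * y) + (y - x) / (2 * y)) by (field; lra). lra. }
  destruct (Rle_dec v w) as [H|H].
  - rewrite (Rabs_minus_sym v w), (Rabs_pos_eq (w - v)) by lra. now apply W.
  - rewrite Rabs_minus_sym, (Rabs_pos_eq (v - w)) by lra. apply W. lra.
Qed.

Definition saw_up (u : R) : R := Series (fun j => saw_log (u + INR j)).
Definition saw_down (u : R) : R := Series (fun j => saw_log (u - INR (S j)) + 1/2).

Lemma inv_beta : 0 < / beta < 1.
Proof.
  split; [apply Rinv_0_lt_compat; lra|]. rewrite <- Rinv_1. apply Rinv_lt_contravar; lra.
Qed.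

Lemma Rpower_minus_INR u j : Rpower beta (u - INR j) = Rpower beta u * (/ beta) ^ j.
Proof.
  unfold Rminus. rewrite Rpower_plus, Rpower_Ropp, Rpower_pow by lra. now rewrite pow_inv.
Qed.

Lemma ex_series_geom_scal c q : 0 <= q < 1 -> ex_series (fun j => c * q ^ j).
Proof.
  intros Hq. apply (ex_series_scal_l (V := R_NormedModule) c), ex_series_geom. rewrite Rabs_pos_eq; lra.
Qed.

Lemma saw_up_series u : is_series (fun j => saw_log (u + INR j)) (saw_up u).
Proof.
  apply Series_correct.
  apply (ex_series_le (V := R_CompleteNormedModule) _ (fun j => Rpower beta (- u) * (/ beta) ^ j)).
  - intros j. change (Rabs (saw_log (u + INR j)) <= Rpower beta (- u) * (/ beta) ^ j).
    rewrite <- Rpower_minus_INR. eapply Rle_trans; [apply saw_log_bound|].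
    replace (- (u + INR j)) with (- u - INR j) by ring.
    pose proof (exp_pos ((- u - INR j) * ln beta)). unfold Rpower. lra.
  - apply ex_series_geom_scal. pose proof inv_beta. lra.
Qed.

Lemma saw_down_series u : is_series (fun j => saw_log (u - INR (S j)) + 1/2) (saw_down u).
Proof.
  apply Series_correct.
  apply (ex_series_le (V := R_CompleteNormedModule) _ (fun j => Rpower beta u * (/ beta) ^ j)).
  - intros j. change (Rabs (saw_log (u - INR (S j)) + 1/2) <= Rpower beta u * (/ beta) ^ j).
    rewrite <- Rpower_minus_INR. pose proof (saw_log_half (u - INR (S j))) as Q.
    rewrite Rabs_pos_eq by lra.
    assert (Rpower beta (u - INR (S j)) <= Rpower beta (u - INR j)).
    { apply Rle_Rpower; [lra|]. rewrite S_INR. lra. }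
    pose proof (exp_pos ((u - INR j) * ln beta)). unfold Rpower in *. lra.
  - apply ex_series_geom_scal. pose proof inv_beta. lra.
Qed.

(** The two-sided sum of translates of [saw_log], renormalised: towards minus infinity each term
    needs [+ 1/2] to converge. Passing from [u] to [u + 1] moves one term into [saw_down] with its
    1/2, and [- u / 2] compensates, which restores the period 1. *)
Definition saw_sum (u : R) : R := saw_up u + saw_down u - u / 2.

Lemma saw_sum_per u : saw_sum (u + 1) = saw_sum u.
Proof.
  assert (E1 : saw_up u = saw_log u + saw_up (u + 1)).
  { apply is_series_unique. apply (is_series_decr_1 (fun j => saw_log (u + INR j))).
    match goal with |- is_series _ ?l => replace l with (saw_up (u + 1)) end.
    - eapply is_series_ext; [|apply saw_up_series]. intros n. cbv beta. rewrite S_INR. f_equal. ring.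
    - unfold plus, opp; simpl. rewrite Rplus_0_r. ring. }
  assert (E2 : saw_down (u + 1) = (saw_log u + 1/2) + saw_down u).
  { apply is_series_unique. apply (is_series_decr_1 (fun j => saw_log (u + 1 - INR (S j)) + 1/2)).
    match goal with |- is_series _ ?l => replace l with (saw_down u) end.
    - eapply is_series_ext; [|apply saw_down_series]. intros n. cbv beta. rewrite !(S_INR n), S_INR. f_equal. f_equal. 
      rewrite ?S_INR. ring.
    - unfold plus, opp; simpl. replace (u + 1 - 1) with u by ring. ring. }
  unfold saw_sum. rewrite E2. lra.
Qed.

(** Each difference is at most [ln beta * d] and at most [beta * (/ beta) ^ j]; interpolating with
    exponents [al] and [1 - al] leaves a geometric series of ratio [beta ^ (al - 1)]. Convergence
    requires [al < 1], whence the Holder exponents below 1. *)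
Lemma series_diff_holder (F : nat -> R -> R) (f : R -> R) u w d al :
  (forall j, Rabs (F j w - F j u) <= ln beta * d) ->
  (forall j, Rabs (F j w - F j u) <= beta * (/ beta) ^ j) ->
  is_series (fun j => F j u) (f u) -> is_series (fun j => F j w) (f w) -> 0 < d -> 0 < al < 1 ->
  Rabs (f w - f u) <= Rpower (ln beta) al * Rpower beta (1 - al) / (1 - Rpower (/ beta) (1 - al)) * Rpower d al.
Proof.
  intros H1 H2 Hu Hw Hd Hal. pose proof ln_beta_pos as HL. pose proof inv_beta as HI.
  assert (G := is_series_minus (V := R_NormedModule) _ _ _ _ Hw Hu).
  set (q := Rpower (/ beta) (1 - al)).
  assert (Hq : 0 <= q < 1).
  { unfold q. split; [left; apply exp_pos|]. apply exp_lt_1.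
    assert (ln (/ beta) < 0) by (rewrite ln_Rinv; lra). nra. }
  assert (B : is_series (fun j => Rpower (ln beta) al * Rpower beta (1 - al) * Rpower d al * q ^ j)
     (Rpower (ln beta) al * Rpower beta (1 - al) * Rpower d al * / (1 - q))).
  { apply (is_series_scal_l (Rpower (ln beta) al * Rpower beta (1 - al) * Rpower d al) (fun j => q ^ j)).
    apply is_series_geom. rewrite Rabs_pos_eq; lra. }
  assert (N := norm_series_le (V := R_NormedModule) _ _ _ _ G B).
  change (Rabs (f w - f u) <= Rpower (ln beta) al * Rpower beta (1 - al) * Rpower d al * / (1 - q)) with
    (norm (V := R_NormedModule) (minus (f w) (f u)) <= Rpower (ln beta) al * Rpower beta (1 - al) * Rpower d al * / (1 - q)) in *.
  replace (Rpower (ln beta) al * Rpower beta (1 - al) / (1 - q) * Rpower d al) with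
    (Rpower (ln beta) al * Rpower beta (1 - al) * Rpower d al * / (1 - q)) by (field; lra).
  apply N. intros j. change (Rabs (F j w - F j u) <= Rpower (ln beta) al * Rpower beta (1 - al) * Rpower d al * q ^ j).
  assert (Hj : 0 < (/ beta) ^ j) by (apply pow_lt; lra).
  eapply Rle_trans; [apply (le_Rpower_interpolate _ (ln beta * d) (beta * (/ beta) ^ j) al);
    [apply H1|apply H2|apply Rmult_lt_0_compat; lra|apply Rmult_lt_0_compat; lra|lra]|].
  right. rewrite <- !Rpower_mult_distr by (try apply Rmult_lt_0_compat; lra).
  unfold q. rewrite <- !(Rpower_pow j) by (try apply exp_pos; lra).
  rewrite !Rpower_mult, (Rmult_comm (INR j)). ring.
Qed.

Lemma saw_sum_holder al : 0 < al < 1 -> exists C, 0 < C /\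
  forall u d, 0 < d <= 1 -> Rabs (saw_sum (u + d) - saw_sum u) <= C * Rpower d al.
Proof.
  intros Hal. pose proof ln_beta_pos as HL.
  set (C0 := Rpower (ln beta) al * Rpower beta (1 - al) / (1 - Rpower (/ beta) (1 - al))).
  assert (W : forall u d, 0 <= u <= 1 -> 0 < d <= 1 ->
    Rabs (saw_sum (u + d) - saw_sum u) <= (2 * C0 + 1) * Rpower d al).
  { intros u d Hu Hd.
    assert (B1 : Rabs (saw_up (u + d) - saw_up u) <= C0 * Rpower d al).
    { apply (series_diff_holder (fun j u => saw_log (u + INR j))); auto using saw_up_series; try lra.
      - intros j. eapply Rle_trans; [apply saw_log_lipschitz|].
        replace (u + d + INR j - (u + INR j)) with d by ring. rewrite (Rabs_pos_eq d) by lra. lra.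
      - intros j.
        assert (Q : forall v, 0 <= v -> - (beta * (/ beta) ^ j) <= saw_log (v + INR j) <= 0).
        { intros v Hv. split; [|apply saw_log_neg].
          pose proof (saw_log_bound (v + INR j)) as Q. apply Rabs_le_between in Q.
          assert (Rpower beta (- (v + INR j)) <= (/ beta) ^ j).
          { replace (- (v + INR j)) with (- v - INR j) by ring. rewrite Rpower_minus_INR.
            rewrite <- (Rmult_1_l ((/ beta) ^ j)) at 2. apply Rmult_le_compat_r.
            - apply pow_le. pose proof inv_beta. lra.
            - rewrite <- (Rpower_O beta) by lra. apply Rle_Rpower; lra. }
          assert (0 <= (/ beta) ^ j) by (apply pow_le; pose proof inv_beta; lra). nra. }
        pose proof (Q u ltac:(lra)). pose proof (Q (u + d) ltac:(lra)). apply Rabs_le. lra. }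
    assert (B2 : Rabs (saw_down (u + d) - saw_down u) <= C0 * Rpower d al).
    { apply (series_diff_holder (fun j u => saw_log (u - INR (S j)) + 1/2)); auto using saw_down_series; try lra.
      - intros j. replace (saw_log (u + d - INR (S j)) + 1 / 2 - (saw_log (u - INR (S j)) + 1 / 2)) with
          (saw_log (u + d - INR (S j)) - saw_log (u - INR (S j))) by ring.
        eapply Rle_trans; [apply saw_log_lipschitz|].
        replace (u + d - INR (S j) - (u - INR (S j))) with d by ring. rewrite (Rabs_pos_eq d) by lra. lra.
      - intros j.
        assert (Q : forall v, v <= 2 -> 0 <= saw_log (v - INR (S j)) + 1/2 <= beta * (/ beta) ^ j).
        { intros v Hv. pose proof (saw_log_half (v - INR (S j))) as [Q1 Q2]. split; [exact Q1|].
          apply Rle_trans with (1 := Q2).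
          assert (Rpower beta (v - INR (S j)) <= beta * (/ beta) ^ j).
          { replace (v - INR (S j)) with ((v - 1) - INR j) by (rewrite S_INR; ring).
            rewrite Rpower_minus_INR. apply Rmult_le_compat_r.
            - apply pow_le. pose proof inv_beta. lra.
            - rewrite <- (Rpower_1 beta) at 2 by lra. apply Rle_Rpower; lra. }
          pose proof (exp_pos ((v - INR (S j)) * ln beta)). unfold Rpower in *. lra. }
        pose proof (Q u ltac:(lra)). pose proof (Q (u + d) ltac:(lra)). apply Rabs_le. lra. }
    assert (B3 : d <= Rpower d al).
    { rewrite <- (Rpower_1 d) at 1 by lra. unfold Rpower.
      assert (ln d <= 0).
      { destruct (Req_dec d 1) as [->|]; [rewrite ln_1; lra|].
        left. rewrite <- ln_1. apply ln_increasing; lra. }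
      destruct (Req_dec (1 * ln d) (al * ln d)) as [->|]; [lra|]. left. apply exp_increasing. nra. }
    replace (saw_sum (u + d) - saw_sum u) with ((saw_up (u + d) - saw_up u) + (saw_down (u + d) - saw_down u) - d / 2)
      by (unfold saw_sum; field).
    apply Rabs_le. apply Rabs_le_between in B1, B2. lra. }
  assert (HC0 : 0 < 2 * C0 + 1).
  { assert (0 <= C0); [|lra]. specialize (W 0 1 ltac:(lra) ltac:(lra)).
    unfold C0. apply Rmult_le_pos.
    - apply Rmult_le_pos; left; apply exp_pos.
    - left. apply Rinv_0_lt_compat. pose proof inv_beta.
      assert (Rpower (/ beta) (1 - al) < 1); [|lra]. apply exp_lt_1.
      rewrite ln_Rinv by lra. nra. }
  exists (2 * C0 + 1). split; [exact HC0|]. intros u d Hd.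
  destruct (ex_cell u) as [m Hm].
  assert (HZ : forall (k : nat) y, saw_sum (y + INR k) = saw_sum y).
  { induction k as [|k IH]; intros y; [simpl; now rewrite Rplus_0_r|].
    rewrite S_INR, <- Rplus_assoc, saw_sum_per. apply IH. }
  assert (E : forall y, saw_sum (y - IZR m) = saw_sum y).
  { intros y. destruct (Z_le_dec 0 m).
    - rewrite <- (HZ (Z.to_nat m) (y - IZR m)). f_equal. rewrite INR_IZR_INZ, Z2Nat.id by lia. ring.
    - rewrite <- (HZ (Z.to_nat (- m)) y). f_equal. rewrite INR_IZR_INZ, Z2Nat.id, opp_IZR by lia. ring. }
  rewrite <- (E (u + d)), <- (E u). replace (u + d - IZR m) with ((u - IZR m) + d) by ring.
  apply W; lra.
Qed.

Lemma holder_continuous (f : R -> R) C al x : 0 < al ->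
  (forall u d, 0 < d <= 1 -> Rabs (f (u + d) - f u) <= C * Rpower d al) -> continuous f x.
Proof.
  intros Hal Hf. apply (filterlim_locally_ball_norm (U := R_NormedModule)). intros [e He].
  set (C' := Rabs C + 1). assert (HC : 0 < C') by (unfold C'; pose proof (Rabs_pos C); lra).
  assert (HCC : C <= C') by (unfold C'; pose proof (Rle_abs C); lra).
  set (d0 := Rmin 1 (Rpower (e / C') (/ al))).
  assert (Hd0 : 0 < d0) by (apply Rmin_case; [lra|apply exp_pos]).
  assert (Q : forall u d, 0 < d < d0 -> Rabs (f (u + d) - f u) < e).
  { intros u d Hd. assert (d0 <= 1) by apply Rmin_l.
    assert (d0 <= Rpower (e / C') (/ al)) by apply Rmin_r.
    eapply Rle_lt_trans; [apply Hf; lra|].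
    assert (Rpower d al < e / C').
    { apply Rlt_le_trans with (Rpower (Rpower (e / C') (/ al)) al).
      - apply Rlt_Rpower_l; lra.
      - rewrite Rpower_mult, Rinv_l, Rpower_1 by (try lra; now apply Rdiv_lt_0_compat). lra. }
    pose proof (exp_pos (al * ln d)). change (exp (al * ln d)) with (Rpower d al) in *.
    apply Rle_lt_trans with (C' * Rpower d al); [nra|].
    apply Rlt_le_trans with (C' * (e / C')); [nra|]. right. field. lra. }
  exists (mkposreal _ Hd0). intros y Hy. change (Rabs (y - x) < d0) in Hy. change (Rabs (f y - f x) < e).
  destruct (Rtotal_order x y) as [H|[->|H]].
  - replace y with (x + (y - x)) by ring. apply Q. rewrite Rabs_pos_eq in Hy; lra.
  - rewrite Rminus_diag, Rabs_R0. exact He.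
  - rewrite Rabs_minus_sym. replace x with (y + (x - y)) by ring. apply Q. rewrite Rabs_left in Hy; lra.
Qed.

Lemma saw_sum_cont u : continuous saw_sum u.
Proof.
  destruct (saw_sum_holder (1/2) ltac:(lra)) as [C [_ HC]].
  apply (holder_continuous _ C (1/2)); [lra|exact HC].
Qed.

End Delange.

(** * The Delange function *)

Lemma continuous_expk k u : continuous (U := C_R_NormedModule) (expk k) u.
Proof.
  assert (E : exists l, is_derive (K := R_AbsRing) (V := C_R_NormedModule) (expk k) u l).
  { eexists. apply Cderive_pair with (l := (- (2 * PI * IZR k) * sink k u, - (2 * PI * IZR k) * cosk k u));
    unfold expk, cosk, sink; simpl; auto_derive; auto; ring. }
  apply (ex_derive_continuous (V := C_R_NormedModule)). exact E.
Qed.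

Lemma Cmod_expk k u : Cmod (expk k u) = 1.
Proof.
  unfold Cmod, expk, cosk, sink; simpl. transitivity (sqrt 1); [f_equal|apply sqrt_1].
  pose proof (sin2_cos2 (2 * PI * IZR k * u)) as H. unfold Rsqr in H. lra.
Qed.

Section Coefficients.
Variable beta : R.
Hypothesis hbeta : 1 < beta.

Let L := ln beta.

Lemma L_pos : 0 < L.
Proof. now apply ln_beta_pos. Qed.

Lemma Rcpow_freq k j u : Rcpow (Rpower beta (u + INR j)) (- freq beta k) = expk k u.
Proof.
  pose proof L_pos as HL. rewrite freq_eq by exact hbeta. unfold Rcpow, Rpower. rewrite ln_exp. fold L.
  unfold Cexp, expk. simpl.
  replace (- 0 * ((u + INR j) * L) - - (2 * PI * IZR k / L) * 0) with 0 by ring.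
  replace (- 0 * 0 + - (2 * PI * IZR k / L) * ((u + INR j) * L)) with (- (2 * PI * IZR k * (u + INR j))) by (field; lra).
  rewrite exp_0, cos_neg, sin_neg, !Rmult_1_l, INR_IZR_INZ.
  f_equal; [apply cosk_add_Z|f_equal; apply sink_add_Z].
Qed.

(** Substitute [x = beta ^ (u + j)]. Then [du = dx / (L x)], so [sawq x / x] turns into
    [sawq x * x ^ (-2)], and [expk k u] is [x ^ (- freq beta k)] whatever [j] is. *)
Lemma saw_log_piece k j : is_CInt (fun u => (RtoC (saw_log beta (u + INR j)) * expk k u)%C) 0 1
  ((saw_int (freq beta k) (beta ^ S j) - saw_int (freq beta k) (beta ^ j)) * / RtoC L)%C.
Proof.
  pose proof L_pos as HL. set (s := freq beta k).
  set (f := fun x => (RtoC (sawq x) * Rcpow x (- (s + 2)))%C).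
  assert (G := is_RInt_comp (V := C_R_CompleteNormedModule) f (fun u => Rpower beta (u + INR j))
     (fun u => L * Rpower beta (u + INR j)) 0 1).
  assert (E : RInt (V := C_R_CompleteNormedModule) f (Rpower beta (0 + INR j)) (Rpower beta (1 + INR j)) =
     (saw_int s (beta ^ S j) - saw_int s (beta ^ j))%C).
  { apply is_CInt_unique. rewrite Rplus_0_l, (Rplus_comm 1), <- S_INR, !Rpower_pow by lra.
    apply saw_int_correct; apply pow_lt; lra. }
  cbv beta in G. rewrite E in G. clear E.
  assert (G' : is_CInt (fun y => scal (L * Rpower beta (y + INR j)) (f (Rpower beta (y + INR j)))) 0 1
    (saw_int s (beta ^ S j) - saw_int s (beta ^ j))%C).
  { apply G.
    - intros x _. apply continuous_Rmult_C; [apply sawq_cont|apply continuous_Rcpow, exp_pos].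
    - intros x _. split.
      + unfold Rpower. auto_derive; auto. fold L. ring.
      + apply (ex_derive_continuous (fun u => L * Rpower beta (u + INR j))). unfold Rpower. auto_derive; auto. }
  apply (is_CInt_Cmult _ _ _ _ (/ RtoC L)%C) in G'.
  eapply is_CInt_eq; [eapply is_RInt_ext; [|exact G']|toC; ring].
  intros u _. cbv beta. rewrite scal_R_Cmult. unfold f, saw_log. toC.
  rewrite <- (Rcpow_freq k j u). fold s.
  replace (- (s + 2))%C with (- s + RtoC (-2))%C by (replace (-2) with (- (2)) by ring; rewrite RtoC_opp; ring).
  set (x := Rpower beta (u + INR j)). assert (Hx : 0 < x) by apply exp_pos.
  rewrite Rcpow_plus, Rcpow_R.
  replace (exp (-2 * ln x)) with (/ x ^ 2).
  2:{ replace (-2 * ln x) with (- (2 * ln x)) by ring. rewrite exp_Ropp. f_equal.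
      change (exp (2 * ln x)) with (Rpower x 2). change 2 with (INR 2). now rewrite Rpower_pow. }
  transitivity (RtoC (/ L * (L * x * (sawq x * / x ^ 2))) * Rcpow x (- s))%C.
  - rewrite !RtoC_mult, (RtoC_inv L) by lra. ring.
  - f_equal. f_equal. field. lra.
Qed.

(** All the arguments [u - (j + 1)] are at most 0, so [sawq] is evaluated on [(0, 1]], where it is a
    polynomial, and the series is geometric. *)
Lemma saw_down_01 u : 0 <= u <= 1 -> saw_down beta u = Rpower beta u / (2 * (beta - 1)).
Proof.
  intros Hu. apply is_series_unique.
  pose proof (inv_beta beta hbeta).
  assert (G := is_series_scal_l (Rpower beta u / 2 * / beta) _ _ (is_series_geom (/ beta) ltac:(rewrite Rabs_pos_eq; lra))).
  match type of G with is_series _ ?l => replace (Rpower beta u / (2 * (beta - 1))) with l end.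
  - eapply is_series_ext; [|exact G]. intros j. toR. cbv beta.
    rewrite saw_log_small; [|exact hbeta|pose proof (pos_INR j); rewrite S_INR; lra].
    rewrite Rpower_minus_INR by exact hbeta. unfold scal; simpl; unfold mult; simpl. toR. field. lra.
  - unfold scal; simpl; unfold mult; simpl. toR. field. repeat split; lra.
Qed.

(** On [[0, 1]] the integrand is [saw_up beta u * expk k u]; it is written through [saw_sum], whose
    continuity is known. The pieces [[beta ^ j, beta ^ (j + 1)]] of [saw_log_piece] fill [[1, oo)]
    and telescope to the full sawtooth integral. *)
Lemma saw_up_coef k J : is_Cser (saw_term (freq beta k)) J ->
  is_CInt (fun u => (RtoC (saw_sum beta u - Rpower beta u / (2 * (beta - 1)) + u / 2) * expk k u)%C) 0 1 (J * / RtoC L)%C.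
Proof.
  intros HJ. pose proof L_pos as HL. set (s := freq beta k) in *.
  assert (Hs : Re s = 0) by (unfold s; rewrite freq_eq; auto).
  set (f := fun u => (RtoC (saw_sum beta u - Rpower beta u / (2 * (beta - 1)) + u / 2) * expk k u)%C).
  assert (Hf : is_CInt f 0 1 (RInt (V := C_R_CompleteNormedModule) f 0 1)).
  { apply is_CInt_cont. intros u _. apply continuous_Rmult_C; [|apply continuous_expk].
    apply continuous_Rplus; [apply continuous_Rminus|].
    - now apply saw_sum_cont.
    - apply (ex_derive_continuous (fun u => Rpower beta u / (2 * (beta - 1)))). unfold Rpower. auto_derive; auto.
    - apply (ex_derive_continuous (fun u => u / 2)). auto_derive; auto. }
  eapply is_CInt_eq; [exact Hf|].
  pose proof (inv_beta beta hbeta) as HI.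
  assert (G : is_series (K := R_AbsRing) (V := C_R_NormedModule)
     (fun j => ((saw_int s (beta ^ S j) - saw_int s (beta ^ j)) * / RtoC L)%C) (RInt (V := C_R_CompleteNormedModule) f 0 1)).
  { apply (RInt_series (V := C_R_NormedModule) (fun j u => (RtoC (saw_log beta (u + INR j)) * expk k u)%C) f _ _
      (fun j => 1 * (/ beta) ^ j) 0 1); auto.
    - lra.
    - intros j. apply saw_log_piece.
    - intros t Ht.
      assert (E : saw_sum beta t - Rpower beta t / (2 * (beta - 1)) + t / 2 = saw_up beta t).
      { unfold saw_sum. rewrite saw_down_01 by lra. ring. }
      unfold f. rewrite E.
      assert (Q : is_Cser (fun j => RtoC (saw_log beta (t + INR j))) (RtoC (saw_up beta t))).
      { apply is_series_C; simpl.
        - now apply saw_up_series.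
        - apply (is_series_ext (fun k => if Nat.eqb k 0 then 0 else 0)).
          + intros [|n]; reflexivity.
          + apply (is_series_single (V := R_NormedModule)). }
      apply (is_Cser_scal (expk k t)) in Q.
      assert (Q' : is_Cser (fun j => (RtoC (saw_log beta (t + INR j)) * expk k t)%C) (RtoC (saw_up beta t) * expk k t)%C).
      { rewrite Cmult_comm. eapply is_Cser_ext; [|exact Q]. intros; apply Cmult_comm. }
      exact Q'.
    - intros j t Ht. rewrite norm_CR, Cmod_mult, Cmod_expk, Cmod_R, Rmult_1_r, Rmult_1_l.
      eapply Rle_trans; [now apply saw_log_bound|].
      replace (- (t + INR j)) with (- t - INR j) by ring. rewrite Rpower_minus_INR by exact hbeta.
      assert (Rpower beta (- t) <= 1).
      { apply Rle_trans with (Rpower beta 0); [apply Rle_Rpower; lra|rewrite Rpower_O; lra]. }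
      assert (0 <= (/ beta) ^ j) by (apply pow_le; lra).
      pose proof (exp_pos (- t * ln beta)). change (exp (- t * ln beta)) with (Rpower beta (- t)) in *. nra.
    - apply (ex_series_geom_scal 1). lra. }
  assert (G2 : filterlim (fun n => (saw_int s (beta ^ S n) * / RtoC L)%C) eventually
     (locally (T := C_NormedModule) (RInt (V := C_R_CompleteNormedModule) f 0 1))).
  { eapply filterlim_ext; [|exact G]. intros n. cbv beta.
    induction n as [|n IH].
    - rewrite sum_O. toC. simpl (beta ^ 0). rewrite saw_int_1. ring.
    - rewrite sum_Sn, IH. unfold plus; simpl AbelianMonoid.plus.
      change (saw_int s (beta ^ S n) * / L + (saw_int s (beta ^ S (S n)) - saw_int s (beta ^ S n)) * / L = saw_int s (beta ^ S (S n)) * / L)%C. ring. }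
  assert (G3 : filterlim (fun n => (saw_int s (beta ^ S n) * / RtoC L)%C) eventually
     (locally (T := C_NormedModule) (J * / RtoC L)%C)).
  { apply filterlim_C_eps; [apply eventually_filter|]. intros eps He.
    assert (HiL : 0 < Cmod (/ RtoC L)).
    { rewrite <- RtoC_inv, Cmod_R by lra. apply Rabs_pos_lt. apply Rinv_neq_0_compat. lra. }
    assert (HsJ := saw_int_lim s J ltac:(lra) HJ).
    assert (Hlim : filterlim (fun n => beta ^ S n) eventually (Rbar_locally p_infty)).
    { apply (is_lim_seq_incr_1 (fun n => beta ^ n) p_infty), is_lim_seq_geom_p, hbeta. }
    assert (Q := filterlim_comp _ _ _ _ _ _ _ _ Hlim HsJ).
    assert (Hep : 0 < eps / Cmod (/ RtoC L)) by now apply Rdiv_lt_0_compat.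
    generalize (C_eps_filterlim _ _ _ Q _ Hep). apply filter_imp. intros n Hn.
    replace (saw_int s (beta ^ S n) * / RtoC L - J * / RtoC L)%C with ((saw_int s (beta ^ S n) - J) * / RtoC L)%C by ring.
    rewrite Cmod_mult. apply Rmult_lt_reg_r with (/ Cmod (/ RtoC L)); [now apply Rinv_0_lt_compat|].
    rewrite Rmult_assoc, Rinv_r by lra. rewrite Rmult_1_r. exact Hn. }
  exact (filterlim_locally_unique (V := C_NormedModule) _ _ _ G2 G3).
Qed.

Lemma expk_Rpower_coef k : (1 - freq beta k)%C <> 0 ->
  is_CInt (fun u => (RtoC (Rpower beta u) * expk k u)%C) 0 1
  (RtoC (beta - 1) / ((1 - freq beta k) * RtoC L))%C.
Proof.
  intros H1. pose proof L_pos as HL. set (z := ((1 - freq beta k) * RtoC L)%C).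
  assert (Hz : z <> 0).
  { apply Cmult_neq_0; [exact H1|]. intros E. apply RtoC_inj in E. lra. }
  assert (Ez : z = (L, - (2 * PI * IZR k))).
  { unfold z. rewrite freq_eq by exact hbeta. fold L. apply Ceq; simpl; field; lra. }
  assert (E : forall u, Cexp (RtoC u * z) = (RtoC (Rpower beta u) * expk k u)%C).
  { intros u. rewrite Ez. unfold Cexp, expk, cosk, sink, Rpower. fold L. apply Ceq; simpl.
    - replace (u * L - 0 * - (2 * PI * IZR k)) with (u * L) by ring.
      replace (u * - (2 * PI * IZR k) + 0 * L) with (- (2 * PI * IZR k * u)) by ring. rewrite cos_neg. ring.
    - replace (u * L - 0 * - (2 * PI * IZR k)) with (u * L) by ring.
      replace (u * - (2 * PI * IZR k) + 0 * L) with (- (2 * PI * IZR k * u)) by ring. rewrite sin_neg. ring. }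
  assert (G := is_CInt_Cmult _ _ _ _ (/ z)%C (Cexp_line_int z)).
  eapply is_CInt_eq; [eapply is_RInt_ext; [|exact G]|].
  - intros u _. cbv beta. rewrite E. toC. field. exact Hz.
  - replace (Cexp z) with (RtoC beta).
    + rewrite RtoC_minus. toC. field. exact Hz.
    + rewrite <- (Cmult_1_l z), (E 1), Rpower_1 by lra.
      unfold expk, cosk, sink. rewrite Rmult_1_r.
      replace (2 * PI * IZR k) with (0 + 2 * PI * IZR k) by ring.
      rewrite cos_add_period, sin_add_period, cos_0, sin_0. apply Ceq; simpl; ring.
Qed.

Lemma expk_id_coef k : k <> 0%Z ->
  is_CInt (fun u => (RtoC u * expk k u)%C) 0 1 (0, / (2 * PI * IZR k)).
Proof.
  intros Hk. pose proof PI_RGT_0. assert (Hk' : IZR k <> 0) by now apply not_0_IZR.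
  set (l := 2 * PI * IZR k). assert (Hl : l <> 0).
  { unfold l. apply Rmult_integral_contrapositive_currified; [lra|exact Hk']. }
  assert (E1 : sin l = 0).
  { unfold l. rewrite <- sin_0, <- (sin_add_period 0 k). f_equal. ring. }
  assert (E2 : cos l = 1).
  { unfold l. rewrite <- cos_0, <- (cos_add_period 0 k). f_equal. ring. }
  apply (is_RInt_fct_extend_pair (U:=R_NormedModule) (V:=R_NormedModule)); simpl.
  - eapply is_RInt_ext; [|eapply is_RInt_eq; [apply (is_RInt_derive (V := R_CompleteNormedModule)
      (fun u => u * sin (l * u) / l + cos (l * u) / l ^ 2) (fun u => u * cos (l * u)))|]].
    + intros u _. toR. unfold cosk, sink. fold l. ring.
    + intros u _. auto_derive; auto. field. exact Hl.
    + intros. auto with rcont.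
    + rewrite !Rmult_1_r, Rmult_0_r, E1, E2, cos_0, sin_0. unfold minus, plus, opp; simpl. field. exact Hl.
  - eapply is_RInt_ext; [|eapply is_RInt_eq; [apply (is_RInt_derive (V := R_CompleteNormedModule)
      (fun u => u * cos (l * u) / l - sin (l * u) / l ^ 2) (fun u => - (1) * (u * sin (l * u))))|]].
    + intros u _. toR. unfold cosk, sink. fold l. ring.
    + intros u _. auto_derive; auto. field. exact Hl.
    + intros. auto with rcont.
    + rewrite !Rmult_1_r, Rmult_0_r, E1, E2, cos_0, sin_0. unfold minus, plus, opp; simpl. field. exact Hl.
Qed.

Lemma expk_const_coef k : is_CInt (expk k) 0 1 (RtoC (if Z.eq_dec k 0 then 1 else 0)).
Proof.
  pose proof (is_RInt_cosk k 0) as H1. pose proof (is_RInt_sink k 0) as H2. rewrite Rplus_0_l in H1, H2.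
  apply (is_RInt_fct_extend_pair (U:=R_NormedModule) (V:=R_NormedModule)); simpl.
  - exact H1.
  - apply (is_RInt_opp (V := R_NormedModule)) in H2. unfold opp in H2; simpl in H2. rewrite Ropp_0 in H2. exact H2.
Qed.

(** The additive constant is chosen so that the mean value is [c_beta_zero]; only the coefficients
    of nonzero index have to be computed. *)
Definition delange (u : R) : R :=
  (beta - 1) * saw_sum beta u + (c_beta_zero beta - (beta - 1) * RInt (saw_sum beta) 0 1).

Lemma delange_per u : delange (u + 1) = delange u.
Proof. unfold delange. now rewrite saw_sum_per. Qed.

Lemma delange_cont u : continuous delange u.
Proof. unfold delange. pose proof (saw_sum_cont beta hbeta). auto with rcont. Qed.

Lemma delange_holder al : 0 < al < 1 -> exists C, 0 < C /\
  forall u d, 0 < d <= 1 -> Rabs (delange (u + d) - delange u) <= C * Rpower d al.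
Proof.
  intros Hal. destruct (saw_sum_holder beta hbeta al Hal) as [C [HC HC']].
  exists ((beta - 1) * C). split; [apply Rmult_lt_0_compat; lra|]. intros u d Hd. unfold delange.
  match goal with |- Rabs ?e <= _ => replace e with ((beta - 1) * (saw_sum beta (u + d) - saw_sum beta u)) by ring end.
  rewrite Rabs_mult, (Rabs_pos_eq (beta - 1)), Rmult_assoc by lra.
  apply Rmult_le_compat_l; [lra|]. now apply HC'.
Qed.

Lemma freq_neq_0 k : k <> 0%Z -> freq beta k <> 0.
Proof.
  intros Hk E. rewrite freq_eq in E by exact hbeta. apply (f_equal Im) in E. simpl in E.
  pose proof L_pos. fold L in E. pose proof PI_RGT_0.
  assert (IZR k <> 0) by now apply not_0_IZR.
  assert (2 * PI * IZR k <> 0) by (apply Rmult_integral_contrapositive_currified; lra).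
  apply (Rmult_eq_compat_r L) in E. replace (2 * PI * IZR k / L * L) with (2 * PI * IZR k) in E by (field; lra).
  rewrite Rmult_0_l in E. auto.
Qed.

(** For [k <> 0] put [s = freq beta k]. By [zeta_saw] the sawtooth integral is
    [1 / (2 s (s - 1)) - zeta s / (s (s + 1))]; the contributions [1 / (2 (1 - s))] of [saw_down]
    and [1 / (2 s)] of [- u / 2] cancel the rational part, and only the term with [zeta]
    survives. *)
Lemma delange_coef k : is_CInt (fun u => (RtoC (delange u) * expk k u)%C) 0 1 (c_beta beta k).
Proof.
  pose proof L_pos as HL. unfold c_beta. destruct (Z.eq_dec k 0) as [->|Hk].
  - apply is_RInt_ext with (fun u => (RtoC (delange u))).
    { intros u _. toC. unfold expk. rewrite cosk_0, sink_0. apply Ceq; simpl; ring. }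
    apply (is_RInt_fct_extend_pair (U:=R_NormedModule) (V:=R_NormedModule)); simpl.
    + assert (Hs : is_RInt (saw_sum beta) 0 1 (RInt (saw_sum beta) 0 1)).
      { apply is_RInt_cont. now apply saw_sum_cont. }
      assert (G := is_RInt_lin2 _ _ (beta - 1) (c_beta_zero beta - (beta - 1) * RInt (saw_sum beta) 0 1) _ _ _ _ Hs
        (is_RInt_const (V := R_NormedModule) 0 1 1)).
      eapply is_RInt_ext; [|eapply is_RInt_eq; [exact G|]].
      * intros u _. toR. cbv beta. unfold delange. ring.
      * unfold scal; simpl; unfold mult; simpl. ring.
    + eapply is_RInt_eq; [apply (is_RInt_const (V := R_NormedModule))|].
      unfold scal; simpl; unfold mult; simpl. ring.
  - set (s := freq beta k).
    assert (Hs : Re s = 0) by (unfold s; rewrite freq_eq; auto).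
    assert (Hs0 : s <> 0) by now apply freq_neq_0.
    assert (Hs1 : s <> RtoC 1) by (intros E; rewrite E in Hs; simpl in Hs; lra).
    assert (Hs2 : (1 - s)%C <> 0) by (apply Cneq_minus; auto).
    assert (Hs3 : (1 + s)%C <> 0).
    { intros E. apply (f_equal Re) in E. rewrite re_plus, Hs in E. simpl in E. lra. }
    assert (HL' : RtoC L <> 0) by (intros E; apply RtoC_inj in E; lra).
    destruct (zeta_saw s ltac:(lra) Hs1) as [J [HJ Hz]].
    assert (G := is_CInt_plus _ _ _ _ _ _ (is_CInt_Cmult _ _ _ _ (RtoC (beta - 1))
      (is_CInt_minus _ _ _ _ _ _ (is_CInt_plus _ _ _ _ _ _ (saw_up_coef k J HJ)
        (is_CInt_Cmult _ _ _ _ (RtoC (/ (2 * (beta - 1)))) (expk_Rpower_coef k Hs2)))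
        (is_CInt_Cmult _ _ _ _ (RtoC (/ 2)) (expk_id_coef k Hk))))
      (is_CInt_Cmult _ _ _ _ (RtoC (c_beta_zero beta - (beta - 1) * RInt (saw_sum beta) 0 1)) (expk_const_coef k))).
    eapply is_CInt_eq; [eapply is_RInt_ext; [|exact G]|].
    + intros u _. cbv beta. toC. unfold delange.
      set (c0 := c_beta_zero beta - _). set (e := expk k u).
      transitivity (RtoC ((beta - 1) * (saw_sum beta u - Rpower beta u / (2 * (beta - 1)) + u / 2 +
        / (2 * (beta - 1)) * Rpower beta u - / 2 * u) + c0) * e)%C.
      * set (X := saw_sum beta u - Rpower beta u / (2 * (beta - 1)) + u / 2).
        rewrite (RtoC_plus _ c0), (RtoC_mult (beta - 1) (X + _ - _)), (RtoC_minus (X + _)), (RtoC_plus X), !RtoC_mult.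
        ring.
      * f_equal. f_equal. field. lra.
    + destruct (Z.eq_dec k 0) as [|_]; [contradiction|].
      unfold c_beta_nonzero. fold s. rewrite Hz.
      assert (Ez : (RtoC (2 * PI) * Ci * RtoC (IZR k))%C = (s * RtoC L)%C).
      { unfold s, freq. fold L. field. exact HL'. }
      assert (Ei : ((0, / (2 * PI * IZR k)) : C) = (- / (s * RtoC L))%C).
      { rewrite <- Ez. pose proof PI_RGT_0. assert (Hk' : IZR k <> 0) by now apply not_0_IZR.
        apply Ceq; simpl; field; lra. }
      rewrite Ei, Ez. fold s.
      replace (RtoC (/ (2 * (beta - 1)))) with (/ RtoC 2 * / RtoC (beta - 1))%C.
      2:{ rewrite <- !RtoC_inv, <- RtoC_mult by lra. f_equal. field. lra. }
      rewrite RtoC_inv by lra.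
      replace (RtoC 2) with (RtoC 1 + RtoC 1)%C by (rewrite <- RtoC_plus; f_equal; ring).
      assert (Hb : RtoC (beta - 1) <> 0) by (intros E; apply RtoC_inj in E; lra).
      assert (Hs4 : (s - 1)%C <> 0) by (apply Cneq_minus; auto).
      set (b := RtoC (beta - 1)) in *. set (c0 := RtoC (c_beta_zero beta - _)).
      toC. field. repeat split; auto.
Qed.

End Coefficients.

(** * Fourier expansion of [h_beta] *)

Lemma is_series_shift (a : nat -> R) (l : R) : is_series a l -> is_series (fun n => a (S n)) (l - a O).
Proof.
  intros H. apply (is_series_incr_1 a). 
  match goal with |- is_series _ ?l' => replace l' with l; [exact H|] end.
  change (l = l - a O + a O). ring.
Qed.

Lemma is_Cser_unique a (l l' : C) : is_Cser a l -> is_Cser a l' -> l = l'.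
Proof. intros H1 H2. now rewrite <- (CSeries_unique _ _ H1), <- (CSeries_unique _ _ H2). Qed.

Lemma Cmod_le_abs (z : C) : Cmod z <= Rabs (Re z) + Rabs (Im z).
Proof.
  replace z with (RtoC (Re z) + Ci * RtoC (Im z))%C at 1 by (apply Ceq; simpl; ring).
  eapply Rle_trans; [apply Cmod_triangle|]. rewrite Cmod_mult, Cmod_Ci, !Cmod_R. lra.
Qed.

Lemma ex_Cser_le (a : nat -> C) b : (forall n, Cmod (a n) <= b n) -> ex_series b ->
  is_Cser a (CSeries a).
Proof.
  intros H Hb. apply CSeries_correct. now apply (ex_series_le (V := C_CompleteNormedModule) a b).
Qed.

Lemma Cmod_conj z : Cmod (Cconj z) = Cmod z.
Proof. unfold Cmod; simpl. f_equal. ring. Qed.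

Section Summability.
Variable beta : R.
Hypothesis hbeta : 1 < beta.

Let c := c_beta beta.
Let D := delange beta.

Lemma c_cos k : is_RInt (fun u => D u * cosk k u) 0 1 (Re (c k)).
Proof.
  pose proof (is_RInt_fct_extend_fst (U:=R_NormedModule) (V:=R_NormedModule) _ 0 1 _ (delange_coef beta hbeta k)) as H.
  eapply is_RInt_ext; [|exact H]. intros u _. toR. unfold D. simpl. ring.
Qed.

Lemma c_sin k : is_RInt (fun u => D u * sink k u) 0 1 (- Im (c k)).
Proof.
  pose proof (is_RInt_fct_extend_snd (U:=R_NormedModule) (V:=R_NormedModule) _ 0 1 _ (delange_coef beta hbeta k)) as H.
  apply (is_RInt_opp (V := R_NormedModule)) in H.
  eapply is_RInt_ext; [|exact H]. intros u _. unfold opp; simpl. toR. unfold D. ring.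
Qed.

Lemma c_opp k : c (- k) = Cconj (c k).
Proof.
  apply Ceq; simpl.
  - change (Re (c (- k)) = Re (c k)).
    rewrite <- (is_RInt_unique _ _ _ _ (c_cos (- k))), <- (is_RInt_unique _ _ _ _ (c_cos k)).
    apply RInt_ext. intros u _. now rewrite cosk_opp.
  - change (Im (c (- k)) = - Im (c k)).
    rewrite <- (is_RInt_unique _ _ _ _ (c_sin k)), <- (Ropp_involutive (Im (c (- k)))).
    rewrite <- (is_RInt_unique _ _ _ _ (c_sin (- k))). rewrite <- (RInt_opp (V := R_CompleteNormedModule)).
    + apply RInt_ext. intros u _. rewrite sink_opp. unfold opp; simpl. toR. ring.
    + eexists. apply c_sin.
Qed.

Lemma c_bernstein :
  ex_series (fun k => Rabs (Re (c (Z.of_nat k)))) /\ ex_series (fun k => Rabs (- Im (c (Z.of_nat k)))) /\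
  forall x, is_series (fun k => 2 * (Re (c (Z.of_nat k)) * cosk (Z.of_nat k) x
     + - Im (c (Z.of_nat k)) * sink (Z.of_nat k) x)) (D x + Re (c 0%Z)).
Proof.
  destruct (delange_holder beta hbeta (3/4) ltac:(lra)) as [C [_ HC]].
  exact (bernstein_fourier_series D (fun k => Re (c (Z.of_nat k))) (fun k => - Im (c (Z.of_nat k))) C
    (delange_cont beta hbeta) (delange_per beta hbeta) (fun k => c_cos (Z.of_nat k)) (fun k => c_sin (Z.of_nat k)) HC).
Qed.

Lemma ex_series_c : ex_series (fun n => Cmod (c (Z.of_nat n))).
Proof.
  destruct c_bernstein as [H1 [H2 _]].
  apply (ex_series_le (V := R_CompleteNormedModule) _ _) with (2 := ex_series_plus (V := R_NormedModule) _ _ H1 H2).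
  intros n. change (Rabs (Cmod (c (Z.of_nat n))) <= Rabs (Re (c (Z.of_nat n))) + Rabs (- Im (c (Z.of_nat n)))).
  rewrite (Rabs_pos_eq (Cmod _)), Rabs_Ropp by apply Cmod_ge_0. apply Cmod_le_abs.
Qed.

Lemma ex_series_c_neg : ex_series (fun n => Cmod (c (- Z.of_nat (S n)))).
Proof.
  apply ex_series_ext with (fun n => Cmod (c (Z.of_nat (S n)))).
  - intros n. rewrite c_opp. symmetry. apply Cmod_conj.
  - apply (ex_series_incr_1 (fun n => Cmod (c (Z.of_nat n)))). apply ex_series_c.
Qed.

(** The pairing of [n] with [- (n + 1)] is that of [CZseries]: it lists every integer exactly
    once. *)
Definition c_pair_norm (n : nat) : R := Cmod (c (Z.of_nat n)) + Cmod (c (- Z.of_nat (S n))).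

Lemma ex_series_c_pair : ex_series c_pair_norm.
Proof. exact (ex_series_plus (V := R_NormedModule) _ _ ex_series_c ex_series_c_neg). Qed.

(** Since [c (- k)] is the conjugate of [c k], the pair of [n] and [- (n + 1)] has real part
    [t n + t (n + 1)] and imaginary part [y n - y (n + 1)]. The real parts count every [t] twice
    except [t 0], which cancels the extra [A O]; the imaginary parts telescope to [y 0 = 0]. *)
Lemma delange_series x :
  is_Cser (fun n => c (Z.of_nat n) * Cconj (expk (Z.of_nat n) x)
                  + c (- Z.of_nat (S n)) * Cconj (expk (- Z.of_nat (S n)) x))%C (RtoC (D x)).
Proof.
  destruct c_bernstein as [H1 [H2 H3]]. specialize (H3 x).
  set (A := fun k => Re (c (Z.of_nat k))) in *. set (B := fun k => - Im (c (Z.of_nat k))) in *.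
  set (t := fun k => A k * cosk (Z.of_nat k) x + B k * sink (Z.of_nat k) x).
  set (y := fun k => A k * sink (Z.of_nat k) x - B k * cosk (Z.of_nat k) x).
  assert (B0 : B O = 0).
  { unfold B, c, c_beta. simpl. ring. }
  assert (Ht : is_series t ((D x + A O) / 2)).
  { assert (G := is_series_scal_l (1/2) _ _ H3).
    match type of G with is_series _ ?l => replace ((D x + A O) / 2) with l end.
    - eapply is_series_ext; [|exact G]. intros n. unfold scal; simpl; unfold mult; simpl. toR. unfold t, A, B. field.
    - unfold scal; simpl; unfold mult; simpl. toR. unfold A. simpl. field. }
  assert (Hy : ex_series y).
  { apply (ex_series_le (V := R_CompleteNormedModule) _ _) with (2 := ex_series_plus (V := R_NormedModule) _ _ H1 H2).
    intros n. change (Rabs (y n) <= Rabs (A n) + Rabs (B n)). unfold y.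
    eapply Rle_trans; [apply Rabs_triang|]. rewrite Rabs_Ropp, !Rabs_mult.
    pose proof (Rabs_cosk (Z.of_nat n) x). pose proof (Rabs_sink (Z.of_nat n) x).
    pose proof (Rabs_pos (A n)). pose proof (Rabs_pos (B n)). nra. }
  destruct Hy as [Y Hy].
  assert (G1 := is_series_plus (V := R_NormedModule) _ _ _ _ Ht (is_series_shift _ _ Ht)).
  assert (G2 := is_series_minus (V := R_NormedModule) _ _ _ _ Hy (is_series_shift _ _ Hy)).
  assert (C1 : c (Z.of_nat 0) = (A O, - B O)) by (unfold A, B; apply Ceq; simpl; ring).
  apply is_series_C.
  - match type of G1 with is_series _ ?l => replace (Re (RtoC (D x))) with l end.
    + eapply is_series_ext; [|exact G1]. intros n. rewrite (c_opp (Z.of_nat (S n))).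
      unfold t, A, B, expk. rewrite cosk_opp, sink_opp.
      generalize (c (Z.of_nat n)) (c (Z.of_nat (S n))). intros [p1 p2] [q1 q2].
      unfold plus; simpl. toR. ring.
    + unfold plus; simpl. unfold t. simpl Z.of_nat. rewrite cosk_0, sink_0. field.
  - match type of G2 with is_series _ ?l => replace (Im (RtoC (D x))) with l end.
    + eapply is_series_ext; [|exact G2]. intros n. rewrite (c_opp (Z.of_nat (S n))).
      unfold y, A, B, expk. rewrite cosk_opp, sink_opp.
      generalize (c (Z.of_nat n)) (c (Z.of_nat (S n))). intros [p1 p2] [q1 q2].
      unfold minus, plus, opp; simpl. toR. ring.
    + unfold minus, plus, opp; simpl. unfold y. simpl Z.of_nat. rewrite cosk_0, sink_0, B0. ring.
Qed.

Lemma Cexp_expk k x : Cexp (RtoC (2 * PI) * Ci * RtoC (IZR k) * RtoC x) = Cconj (expk k x).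
Proof.
  unfold Cexp, Cconj, expk, cosk, sink. simpl.
  match goal with |- (exp ?a * cos ?b, _) = _ => replace a with 0 by ring; replace b with (2 * PI * IZR k * x) by ring end.
  rewrite exp_0. f_equal; ring.
Qed.

(** [CZseries] sums the two half-lines separately, so each half is first shown to converge; then the
    two values of [CSeries] are genuine sums that may be added. *)
Lemma h_beta_delange x : h_beta beta x = RtoC (D x).
Proof.
  unfold h_beta, CZseries.
  assert (P1 : is_Cser (fun n => c (Z.of_nat n) * Cconj (expk (Z.of_nat n) x))%C
     (CSeries (fun n => c (Z.of_nat n) * Cconj (expk (Z.of_nat n) x))%C)).
  { apply ex_Cser_le with (2 := ex_series_c). intros n.
    rewrite Cmod_mult, Cmod_conj, Cmod_expk. lra. }
  assert (P2 : is_Cser (fun n => c (- Z.of_nat (S n)) * Cconj (expk (- Z.of_nat (S n)) x))%C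
     (CSeries (fun n => c (- Z.of_nat (S n)) * Cconj (expk (- Z.of_nat (S n)) x))%C)).
  { apply ex_Cser_le with (2 := ex_series_c_neg). intros n.
    rewrite Cmod_mult, Cmod_conj, Cmod_expk. lra. }
  rewrite <- (is_Cser_unique _ _ _ (is_Cser_plus _ _ _ _ P1 P2) (delange_series x)).
  f_equal; apply CSeries_unique.
  - eapply is_Cser_ext; [|exact P1]. intros n. now rewrite Cexp_expk.
  - eapply is_Cser_ext; [|exact P2]. intros n. now rewrite Cexp_expk.
Qed.

End Summability.

(** * Termwise complex differentiation and series of Mellin type *)

Lemma Rpower_summable p : 1 < p -> ex_series (fun n => Rpower (INR (S n)) (- p)).
Proof.
  intros Hp. destruct (is_series_C_inv _ _ (zeta_Dirichlet (RtoC p) Hp)) as [H _].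
  eexists. eapply is_series_ext; [|exact H]. intros n. toR. cbv beta.
  rewrite <- RtoC_opp, Rcpow_R. reflexivity.
Qed.

(** Second-order remainders dominated by a summable [b] add up to a second-order remainder for the
    sum. This gives holomorphy without contour integrals, provided each term is estimated
    explicitly. *)
Lemma Cdiff_series (f : nat -> C -> C) (f' : nat -> C) (b : nat -> R) s d :
  0 < d -> ex_series b ->
  (forall n h, Cmod h <= d -> Cmod (f n (s + h) - f n s - h * f' n)%C <= b n * Cmod h ^ 2) ->
  is_Cser f' (CSeries f') ->
  (forall h, Cmod h <= d -> is_Cser (fun n => f n (s + h)%C) (CSeries (fun n => f n (s + h)%C))) ->
  Cdifferentiable (fun z => CSeries (fun n => f n z)) s.
Proof.
  intros Hd [B HB] Hq Hf' Hf. exists (CSeries f').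
  apply Cderive_quad with (K := B) (d := d); [exact Hd|]. intros h Hh.
  assert (Hf0 : is_Cser (fun n => f n s) (CSeries (fun n => f n s))).
  { specialize (Hf 0 ltac:(rewrite Cmod_0; lra)). rewrite Cplus_0_r in Hf. exact Hf. }
  assert (G := is_Cser_plus _ _ _ _ (is_Cser_plus _ _ _ _ (Hf h Hh) (is_Cser_scal (- (1))%C _ _ Hf0))
     (is_Cser_scal (- h)%C _ _ Hf')).
  match goal with |- Cmod ?e <= _ => match type of G with is_series _ ?l => replace e with l by ring end end.
  rewrite (Rmult_comm B).
  apply (norm_series_le (V := C_NormedModule) _ _ _ _ G (is_series_scal_l (Cmod h ^ 2) _ _ HB)).
  intros n. match goal with |- norm ?e <= ?r => change (Cmod e <= Cmod h ^ 2 * b n); replace e with (f n (s + h) - f n s - h * f' n)%C by ring end.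
  rewrite Rmult_comm. now apply Hq.
Qed.

Lemma ln_le_Rpower x e : 1 <= x -> 0 < e -> ln x <= / e * Rpower x e.
Proof.
  intros Hx He. apply Rmult_le_reg_l with e; [exact He|].
  rewrite <- Rmult_assoc, Rinv_r, Rmult_1_l by lra. unfold Rpower.
  pose proof (exp_ineq1_le (e * ln x)). lra.
Qed.

Section Mellin.
Variables (a : nat -> R -> R) (Ca th : R).
Hypothesis Hth : -1 < th.
Hypothesis a_cont : forall n u, 0 <= u <= 1 -> continuous (a n) u.
Hypothesis a_bound : forall n u, 0 <= u <= 1 -> Rabs (a n u) <= Ca * Rpower (INR (S n)) th.

Definition mellin_term (s : C) (n : nat) : C :=
  RInt (V := C_R_CompleteNormedModule) (fun u => (RtoC (a n u) * Rcpow (INR (S n) + u) (- s))%C) 0 1.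

Definition mellin_dterm (s : C) (n : nat) : C :=
  RInt (V := C_R_CompleteNormedModule)
   (fun u => (RtoC (a n u) * (RtoC (- ln (INR (S n) + u)) * Rcpow (INR (S n) + u) (- s)))%C) 0 1.

Lemma mellin_term_correct s n :
  is_CInt (fun u => (RtoC (a n u) * Rcpow (INR (S n) + u) (- s))%C) 0 1 (mellin_term s n).
Proof.
  apply is_CInt_cont. intros z Hz. rewrite Rmin_left, Rmax_right in Hz by lra.
  apply continuous_Rmult_C; [now apply a_cont|]. apply continuous_Rcpow_shift.
  pose proof (Spos n). lra.
Qed.

Lemma mellin_dterm_correct s n :
  is_CInt (fun u => (RtoC (a n u) * (RtoC (- ln (INR (S n) + u)) * Rcpow (INR (S n) + u) (- s)))%C) 0 1 (mellin_dterm s n).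
Proof.
  apply is_CInt_cont. intros z Hz. rewrite Rmin_left, Rmax_right in Hz by lra. pose proof (Spos n).
  apply continuous_Rmult_C; [now apply a_cont|]. apply continuous_Rmult_C.
  - apply (ex_derive_continuous (fun t => - ln (INR (S n) + t))). generalize (INR (S n)) H. intros N HN. auto_derive. lra.
  - apply continuous_Rcpow_shift. lra.
Qed.

Lemma mellin_bound (f : R -> C) n l K p : th - p <= - (1) -> 0 <= K ->
  is_CInt (fun u => (RtoC (a n u) * f u)%C) 0 1 l ->
  (forall u, 0 <= u <= 1 -> Cmod (f u) <= K * Rpower (INR (S n) + u) (- p)) ->
  Cmod l <= Ca * K * Rpower (INR (S n)) (th - p).
Proof.
  intros Hp HK Hl Hf. apply (CInt_bound _ _ _ Hl). intros u Hu. pose proof (Spos n) as Hn.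
  rewrite Cmod_mult, Cmod_R.
  replace (Ca * K * Rpower (INR (S n)) (th - p)) with
    ((Ca * Rpower (INR (S n)) th) * (K * Rpower (INR (S n)) (- p))).
  2:{ unfold Rminus. rewrite Rpower_plus. ring. }
  apply Rmult_le_compat; auto using Rabs_pos, Cmod_ge_0.
  eapply Rle_trans; [now apply Hf|]. apply Rmult_le_compat_l; [exact HK|].
  rewrite !Rpower_Ropp. apply Rinv_le_contravar; [apply exp_pos|].
  apply Rle_Rpower_l; lra.
Qed.

Lemma mellin_ex s : th + 1 < Re s -> is_Cser (mellin_term s) (CSeries (mellin_term s)).
Proof.
  intros Hs. apply ex_Cser_le with (fun n => Ca * 1 * Rpower (INR (S n)) (- (Re s - th))).
  - intros n. replace (- (Re s - th)) with (th - Re s) by ring.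
    apply (mellin_bound _ n _ 1 (Re s)) with (3 := mellin_term_correct s n); [lra|lra|].
    intros u _. rewrite Cmod_Rcpow_Rpower, re_opp. lra.
  - apply (ex_series_scal_l (V := R_NormedModule) (Ca * 1)), Rpower_summable. lra.
Qed.

(** The remainder of [x ^ (- s - h)] after its linear part in [h] is at most
    [|h| ^ 2 (ln x) ^ 2 x ^ |h|] times [x ^ (- Re s)], so a small loss in the exponent pays for
    differentiability. *)
Lemma mellin_diff s : th + 1 < Re s -> Cdifferentiable (fun z => CSeries (mellin_term z)) s.
Proof.
  (* Of the margin [4 * eta], one [eta] absorbs [(ln x) ^ 2], one absorbs [x ^ |h|], and the other
     two leave the summable exponent [- (1 + 2 * eta)]. *)
  intros Hs. set (eta := (Re s - th - 1) / 4). assert (Heta : 0 < eta) by (unfold eta; lra).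
  set (K := (/ (eta / 2)) ^ 2). assert (HK : 0 <= K) by apply pow2_ge_0.
  assert (Hi : 0 < / (eta / 2)) by (apply Rinv_0_lt_compat; lra).
  apply (Cdiff_series (fun n z => mellin_term z n) (mellin_dterm s)
    (fun n => Ca * K * Rpower (INR (S n)) (- (1 + 2 * eta))) s eta Heta).
  - apply (ex_series_scal_l (V := R_NormedModule) (Ca * K)), Rpower_summable. lra.
  - intros n h Hh.
    assert (G := is_CInt_minus _ _ _ _ _ _ (is_CInt_minus _ _ _ _ _ _ (mellin_term_correct (s + h) n) (mellin_term_correct s n))
      (is_CInt_Cmult _ _ _ _ h (mellin_dterm_correct s n))).
    set (F := fun u => (Rcpow (INR (S n) + u) (- (s + h)) - Rcpow (INR (S n) + u) (- s)
       - h * (RtoC (- ln (INR (S n) + u)) * Rcpow (INR (S n) + u) (- s)))%C).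
    assert (G' : is_CInt (fun u => (RtoC (a n u) * F u)%C) 0 1 (mellin_term (s + h) n - mellin_term s n - h * mellin_dterm s n)%C).
    { eapply is_RInt_ext; [|exact G]. intros u _. toC. cbv beta. unfold F. ring. }
    replace (Ca * K * Rpower (INR (S n)) (- (1 + 2 * eta)) * Cmod h ^ 2) with
      (Ca * (K * Cmod h ^ 2) * Rpower (INR (S n)) (th - (Re s - 2 * eta))).
    2:{ replace (th - (Re s - 2 * eta)) with (- (1 + 2 * eta)) by (unfold eta; field). ring. }
    apply mellin_bound with (3 := G'); [unfold eta in *; lra|apply Rmult_le_pos; [exact HK|apply pow2_ge_0]|].
    intros u Hu. pose proof (Spos n). set (x := INR (S n) + u). assert (Hx : 1 <= x) by (unfold x; lra).
    set (z := (- h * RtoC (ln x))%C).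
    replace (F u) with (Rcpow x (- s) * (Cexp z - 1 - z))%C.
    2:{ unfold F. fold x. replace (- (s + h))%C with (- s + - h)%C by ring. rewrite Rcpow_plus, RtoC_opp.
        change (Rcpow x (- h)) with (Cexp z). unfold z. ring. }
    destruct (ln_bounds x Hx) as [L0 _].
    rewrite Cmod_mult, Cmod_Rcpow_Rpower, re_opp.
    assert (Hz : Cmod z = Cmod h * ln x).
    { unfold z. rewrite Cmod_mult, Cmod_opp, Cmod_R, Rabs_pos_eq; auto. }
    pose proof (Cmod_ge_0 h) as Hh0.
    assert (B1 : ln x ^ 2 <= K * Rpower x eta).
    { unfold K. replace (Rpower x eta) with (Rpower x (eta / 2) ^ 2).
      - rewrite <- Rpow_mult_distr. apply pow_incr. split; [exact L0|]. apply ln_le_Rpower; lra.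
      - simpl. rewrite Rmult_1_r, <- Rpower_plus. f_equal. field. }
    assert (B2 : exp (Cmod z) <= Rpower x eta).
    { unfold Rpower. rewrite Hz. destruct (Req_dec (Cmod h * ln x) (eta * ln x)) as [->|]; [lra|].
      left. apply exp_increasing. assert (Cmod h * ln x <= eta * ln x) by (apply Rmult_le_compat_r; lra). lra. }
    apply Rle_trans with (Rpower x (- Re s) * ((Cmod h ^ 2 * (K * Rpower x eta)) * Rpower x eta)).
    + apply Rmult_le_compat_l; [left; apply exp_pos|].
      eapply Rle_trans; [apply Cexp_bound2|].
      apply Rmult_le_compat; [apply pow2_ge_0|left; apply exp_pos| |exact B2].
      rewrite Hz, Rpow_mult_distr. apply Rmult_le_compat_l; [apply pow2_ge_0|exact B1].
    + right. replace (- (Re s - 2 * eta)) with (- Re s + (eta + eta)) by ring.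
      rewrite !Rpower_plus. ring.
  - apply ex_Cser_le with (fun n => Ca * / eta * Rpower (INR (S n)) (- (1 + 3 * eta))).
    + intros n. replace (- (1 + 3 * eta)) with (th - (Re s - eta)) by (unfold eta; field).
      apply (mellin_bound _ n _ (/ eta)) with (3 := mellin_dterm_correct s n).
      * unfold eta in *. lra.
      * left. now apply Rinv_0_lt_compat.
      * intros u Hu. pose proof (Spos n). set (x := INR (S n) + u). assert (Hx : 1 <= x) by (unfold x; lra).
        destruct (ln_bounds x Hx) as [L0 _].
        rewrite Cmod_mult, Cmod_R, Rabs_Ropp, Rabs_pos_eq, Cmod_Rcpow_Rpower, re_opp by exact L0.
        replace (- (Re s - eta)) with (eta + - Re s) by ring. rewrite Rpower_plus, <- Rmult_assoc.
        apply Rmult_le_compat_r; [left; apply exp_pos|]. now apply ln_le_Rpower.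
    + apply (ex_series_scal_l (V := R_NormedModule) (Ca * / eta)), Rpower_summable. lra.
  - intros h Hh. apply mellin_ex. rewrite re_plus. pose proof (re_le_Cmod h). pose proof (Rle_abs (- Re h)).
    rewrite Rabs_Ropp in *. unfold eta in *. lra.
Qed.

End Mellin.

(** * Sums over the poles *)

(** Balls of [C_UniformSpace] are squares, and the factor 2 passes from a square to a disc. *)
Lemma Cball_Cmod (l z : C) eps : ball (M := C_UniformSpace) l eps z -> Cmod (z - l) < 2 * eps.
Proof.
  intros [H1 H2]. change (Rabs (Re z - Re l) < eps) in H1. change (Rabs (Im z - Im l) < eps) in H2.
  eapply Rle_lt_trans; [apply Cmod_le_abs|].
  unfold Cminus. rewrite re_plus, re_opp. simpl (Im _). fold (Im z) (Im l). unfold Rminus in *. lra.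
Qed.

Lemma locally_Cmod (p : C) (P : C -> Prop) e : 0 < e -> (forall z, Cmod (z - p) < e -> P z) ->
  locally (T := C_UniformSpace) p P.
Proof.
  intros He H. assert (He2 : 0 < e / 2) by lra. exists (mkposreal _ He2). intros z Hz.
  apply H. apply Cball_Cmod in Hz. simpl in Hz. lra.
Qed.

Lemma locally'_Cmod (p : C) (P : C -> Prop) e : 0 < e ->
  (forall z, Cmod (z - p) < e -> z <> p -> P z) -> locally' (T := C_UniformSpace) p P.
Proof.
  intros He H. apply (locally_Cmod p _ e He). exact H.
Qed.

Section PoleTerm.
Variables (c q : C) (r : R).
Hypothesis Hr : 0 < r.
Hypothesis Hq : c = 0 \/ r <= Cmod q.

(** The alternative [c = 0] lets the same estimates cover a sum with one pole deleted, evaluated at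
    that very pole. *)
Lemma pole_term_shift h : Cmod h <= r / 2 -> c = 0 \/ r / 2 <= Cmod (q + h).
Proof.
  intros Hh. destruct Hq as [|H]; [now left|right].
  assert (T := Cmod_triangle (q + h) (- h)). replace (q + h + - h)%C with q in T by ring.
  rewrite Cmod_opp in T. lra.
Qed.

Lemma pole_term_bound : Cmod (c / q) <= / r * Cmod c.
Proof.
  destruct Hq as [->|H].
  - unfold Cdiv. rewrite Cmult_0_l, Cmod_0. lra.
  - rewrite Cmod_div by (apply Cmod_gt_0; lra). unfold Rdiv. rewrite Rmult_comm.
    apply Rmult_le_compat_r; [apply Cmod_ge_0|]. apply Rinv_le_contravar; lra.
Qed.

Lemma pole_term_dbound : Cmod (- (c / (q * q))) <= / r ^ 2 * Cmod c.
Proof.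
  rewrite Cmod_opp. destruct Hq as [->|H].
  - unfold Cdiv. rewrite Cmult_0_l, Cmod_0. lra.
  - assert (q <> 0) by (apply Cmod_gt_0; lra).
    rewrite Cmod_div, Cmod_mult by now apply Cmult_neq_0. unfold Rdiv. rewrite Rmult_comm.
    apply Rmult_le_compat_r; [apply Cmod_ge_0|]. apply Rinv_le_contravar; [now apply pow_lt|]. nra.
Qed.

Lemma pole_term_quad h : Cmod h <= r / 2 ->
  Cmod (c / (q + h) - c / q - h * - (c / (q * q))) <= 2 / r ^ 3 * Cmod c * Cmod h ^ 2.
Proof.
  intros Hh. assert (Hs := pole_term_shift h Hh). destruct Hq as [->|H].
  - unfold Cdiv. rewrite !Cmult_0_l, Cmod_0, Rmult_0_r, Rmult_0_l.
    replace (RtoC 0 - RtoC 0 - h * - RtoC 0)%C with (RtoC 0) by ring. rewrite Cmod_0. lra.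
  - destruct Hs as [->|Hs].
    { unfold Cdiv. rewrite !Cmult_0_l, Cmod_0, Rmult_0_r, Rmult_0_l.
      replace (RtoC 0 - RtoC 0 - h * - RtoC 0)%C with (RtoC 0) by ring. rewrite Cmod_0. lra. }
    assert (Hq0 : q <> 0) by (apply Cmod_gt_0; lra). assert (Hqh : (q + h)%C <> 0) by (apply Cmod_gt_0; lra).
    replace (c / (q + h) - c / q - h * - (c / (q * q)))%C with (c * (h * h) * / (q * q * (q + h)))%C by (field; auto).
    rewrite !Cmod_mult, Cmod_inv by (repeat apply Cmult_neq_0; auto). rewrite !Cmod_mult.
    assert (I : / (Cmod q * Cmod q * Cmod (q + h)) <= 2 / r ^ 3).
    { replace (2 / r ^ 3) with (/ (r * r * (r / 2))) by (field; lra).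
      apply Rinv_le_contravar; [apply Rmult_lt_0_compat; nra|].
      apply Rmult_le_compat; try nra. }
    pose proof (Cmod_ge_0 c). pose proof (Cmod_ge_0 h).
    replace (2 / r ^ 3 * Cmod c * Cmod h ^ 2) with (Cmod c * (Cmod h * Cmod h) * (2 / r ^ 3)) by ring.
    apply Rmult_le_compat_l; [nra|exact I].
Qed.

End PoleTerm.

Section Poles.
Variable beta : R.
Hypothesis hbeta : 1 < beta.

Let c := c_beta beta.

Definition pole (k : Z) : C := (2 + freq beta k)%C.

(** The coefficients are a parameter, so that the full sum and the sum without one pole are
    instances of the same function; both are dominated by the absolutely summable [c]. *)
Definition pole_sum (c' : Z -> C) (z : C) : C :=
  CSeries (fun n => c' (Z.of_nat n) / (z - pole (Z.of_nat n))
                  + c' (- Z.of_nat (S n))%Z / (z - pole (- Z.of_nat (S n))))%C.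

Lemma pole_sum_ex (c' : Z -> C) s r : 0 < r -> (forall k, Cmod (c' k) <= Cmod (c k)) ->
  (forall k, c' k = 0 \/ r <= Cmod (s - pole k)) ->
  is_Cser (fun n => c' (Z.of_nat n) / (s - pole (Z.of_nat n))
                  + c' (- Z.of_nat (S n))%Z / (s - pole (- Z.of_nat (S n))))%C (pole_sum c' s).
Proof.
  intros Hr Hc' Hd. apply ex_Cser_le with (fun n => / r * c_pair_norm beta n).
  - intros n. eapply Rle_trans; [apply Cmod_triangle|]. unfold c_pair_norm. rewrite Rmult_plus_distr_l.
    assert (0 < / r) by now apply Rinv_0_lt_compat.
    apply Rplus_le_compat; (eapply Rle_trans; [apply (pole_term_bound _ _ r); auto|]);
      (apply Rmult_le_compat_l; [lra|apply Hc']).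
  - apply (ex_series_scal_l (V := R_NormedModule) (/ r)), ex_series_c_pair, hbeta.
Qed.

Lemma pole_sum_diff (c' : Z -> C) s r : 0 < r -> (forall k, Cmod (c' k) <= Cmod (c k)) ->
  (forall k, c' k = 0 \/ r <= Cmod (s - pole k)) -> Cdifferentiable (pole_sum c') s.
Proof.
  intros Hr Hc' Hd.
  set (t := fun (k : Z) (z : C) => (c' k / (z - pole k))%C).
  set (t' := fun k : Z => (- (c' k / ((s - pole k) * (s - pole k))))%C).
  assert (Hir : 0 < / r) by now apply Rinv_0_lt_compat.
  assert (Hq : forall k h, Cmod h <= r / 2 -> Cmod (t k (s + h) - t k s - h * t' k)%C <= 2 / r ^ 3 * Cmod (c k) * Cmod h ^ 2).
  { intros k h Hh. unfold t, t'. replace (s + h - pole k)%C with (s - pole k + h)%C by ring.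
    eapply Rle_trans; [apply (pole_term_quad _ _ r); auto|].
    apply Rmult_le_compat_r; [apply pow2_ge_0|]. apply Rmult_le_compat_l; [|apply Hc'].
    apply Rmult_le_pos; [lra|]. left. apply Rinv_0_lt_compat. now apply pow_lt. }
  apply (Cdiff_series (fun n z => t (Z.of_nat n) z + t (- Z.of_nat (S n))%Z z)%C
    (fun n => t' (Z.of_nat n) + t' (- Z.of_nat (S n))%Z)%C
    (fun n => 2 / r ^ 3 * c_pair_norm beta n) s (r / 2)); [lra| | | |].
  - apply (ex_series_scal_l (V := R_NormedModule) (2 / r ^ 3)), ex_series_c_pair, hbeta.
  - intros n h Hh.
    match goal with |- Cmod ?e <= _ => replace e with
      ((t (Z.of_nat n) (s + h) - t (Z.of_nat n) s - h * t' (Z.of_nat n)) +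
       (t (- Z.of_nat (S n))%Z (s + h) - t (- Z.of_nat (S n))%Z s - h * t' (- Z.of_nat (S n))%Z))%C by ring end.
    eapply Rle_trans; [apply Cmod_triangle|]. unfold c_pair_norm. rewrite Rmult_plus_distr_l, Rmult_plus_distr_r.
    apply Rplus_le_compat; now apply Hq.
  - apply ex_Cser_le with (fun n => / r ^ 2 * c_pair_norm beta n).
    + intros n. eapply Rle_trans; [apply Cmod_triangle|]. unfold c_pair_norm. rewrite Rmult_plus_distr_l.
      assert (0 < / r ^ 2) by now apply Rinv_0_lt_compat, pow_lt.
      apply Rplus_le_compat; (eapply Rle_trans; [apply (pole_term_dbound _ _ r); auto|]);
        (apply Rmult_le_compat_l; [lra|apply Hc']).
    + apply (ex_series_scal_l (V := R_NormedModule) (/ r ^ 2)), ex_series_c_pair, hbeta.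
  - intros h Hh. apply (pole_sum_ex c' (s + h) (r / 2)); [lra|exact Hc'|].
    intros k. replace (s + h - pole k)%C with (s - pole k + h)%C by ring.
    now apply pole_term_shift.
Qed.

Lemma pole_sum_holo (c' : Z -> C) s r : 0 < r -> (forall k, Cmod (c' k) <= Cmod (c k)) ->
  (forall k, c' k = 0 \/ r <= Cmod (s - pole k)) -> holomorphic_at (pole_sum c') s.
Proof.
  intros Hr Hc' Hd. apply (locally_Cmod s _ (r / 2)); [lra|]. intros z Hz.
  apply (pole_sum_diff c' z (r / 2)); [lra|exact Hc'|].
  intros k. replace (z - pole k)%C with (s - pole k + (z - s))%C by ring.
  apply pole_term_shift; auto. lra.
Qed.

Lemma pole_dist (k : Z) (s : C) : Cmod (s - pole k) >= Rabs (Re s - 2) /\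
  Cmod (s - pole k) >= Rabs (Im s - 2 * PI * IZR k / ln beta).
Proof.
  destruct s as [x y]. unfold pole. rewrite freq_eq by exact hbeta. split; apply Rle_ge.
  - replace (Re (x, y) - 2) with (Re ((x, y) - (2 + (0, 2 * PI * IZR k / ln beta)))) by (simpl; ring). apply re_le_Cmod.
  - replace (Im (x, y) - 2 * PI * IZR k / ln beta) with (Im ((x, y) - (2 + (0, 2 * PI * IZR k / ln beta)))) by (simpl; ring).
    eapply Rle_trans; [apply Rmax_r|apply Rmax_Cmod].
Qed.

Definition gap : R := 2 * PI / ln beta.

Lemma gap_pos : 0 < gap.
Proof. unfold gap. pose proof PI_RGT_0. apply Rdiv_lt_0_compat; [lra|now apply ln_beta_pos]. Qed.

Lemma pole_dist_pole m k : k <> m -> gap <= Cmod (pole m - pole k).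
Proof.
  intros Hk. destruct (pole_dist k (pole m)) as [_ H]. apply Rge_le in H. apply Rle_trans with (2 := H).
  unfold pole. rewrite freq_eq by exact hbeta. simpl (Im _).
  replace (0 + 2 * PI * IZR m / ln beta - 2 * PI * IZR k / ln beta) with (gap * IZR (m - k)).
  2:{ unfold gap. rewrite minus_IZR. pose proof (ln_beta_pos beta hbeta). field. lra. }
  rewrite Rabs_mult, (Rabs_pos_eq gap), <- abs_IZR by (left; apply gap_pos).
  rewrite <- (Rmult_1_r gap) at 1. apply Rmult_le_compat_l; [left; apply gap_pos|].
  apply (IZR_le 1). lia.
Qed.

(** The poles are equally spaced on the line [Re s = 2]. Off that line the horizontal distance
    serves for all of them; on it, the distance to the two neighbouring poles. *)
Lemma not_pole_dist s : (forall m, s <> pole m) -> exists r, 0 < r /\ forall k, r <= Cmod (s - pole k).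
Proof.
  intros Hs. pose proof (ln_beta_pos beta hbeta) as HL. pose proof gap_pos as Hg.
  destruct (Req_dec (Re s) 2) as [H2|H2].
  - destruct (ex_cell (Im s / gap)) as [m Hm].
    assert (Ei : forall k, Im s - 2 * PI * IZR k / ln beta = gap * (Im s / gap - IZR k)).
    { intros k. unfold gap. pose proof PI_RGT_0. field. lra. }
    assert (Hne : Im s / gap <> IZR m).
    { intros E. apply (Hs m). unfold pole. rewrite freq_eq by exact hbeta. apply Ceq; simpl.
      - rewrite Rplus_0_r. exact H2.
      - specialize (Ei m). rewrite E, Rminus_diag, Rmult_0_r in Ei. lra. }
    set (t := Im s / gap) in *.
    exists (gap * Rmin (t - IZR m) (IZR m + 1 - t)). split.
    + apply Rmult_lt_0_compat; [exact Hg|]. apply Rmin_case; lra.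
    + intros k. destruct (pole_dist k s) as [_ H]. apply Rge_le in H. apply Rle_trans with (2 := H).
      rewrite Ei, Rabs_mult, (Rabs_pos_eq gap) by lra. apply Rmult_le_compat_l; [lra|].
      destruct (Z_le_dec k m) as [Hk|Hk].
      * apply Rle_trans with (t - IZR m); [apply Rmin_l|]. apply IZR_le in Hk.
        rewrite Rabs_pos_eq by lra. lra.
      * apply Rle_trans with (IZR m + 1 - t); [apply Rmin_r|].
        assert (Hk' : (m + 1 <= k)%Z) by lia. apply IZR_le in Hk'. rewrite plus_IZR in Hk'.
        rewrite Rabs_left1 by lra. lra.
  - exists (Rabs (Re s - 2)). split; [apply Rabs_pos_lt; lra|].
    intros k. apply Rge_le. apply (pole_dist k s).
Qed.

Definition c_without (m k : Z) : C := if Z.eq_dec k m then RtoC 0 else c k.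

Lemma c_without_le m k : Cmod (c_without m k) <= Cmod (c k).
Proof.
  unfold c_without. destruct (Z.eq_dec k m); [rewrite Cmod_0; apply Cmod_ge_0|lra].
Qed.

Lemma pole_sum_split m z : (forall k, z <> pole k) ->
  pole_sum c z = (c m / (z - pole m) + pole_sum (c_without m) z)%C.
Proof.
  intros Hz. destruct (not_pole_dist z Hz) as [r [Hr Hd]].
  assert (H1 := pole_sum_ex c z r Hr (fun k => Rle_refl _) (fun k => or_intror (Hd k))).
  assert (H2 := pole_sum_ex (c_without m) z r Hr (c_without_le m) (fun k => or_intror (Hd k))).
  (* The index of the pair containing [m]: its first member is [j], its second [- (j + 1)]. *)
  set (j := if Z_le_dec 0 m then Z.to_nat m else Z.to_nat (- m - 1)).
  assert (H3 := is_series_single (K := C_AbsRing) (V := C_NormedModule) j (c m / (z - pole m))%C).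
  assert (G := is_Cser_plus _ _ _ _ H3 H2).
  apply (is_Cser_unique _ _ _ H1). eapply is_Cser_ext; [|exact G].
  intros n. cbv beta. toC. unfold c_without.
  assert (E0 : forall w : C, (RtoC 0 / w)%C = 0) by (intros; unfold Cdiv; ring).
  destruct (Nat.eqb_spec n j) as [->|Hn].
  - unfold j. destruct (Z_le_dec 0 m) as [Hm|Hm].
    + rewrite Z2Nat.id by lia.
      destruct (Z.eq_dec m m); [|lia]. destruct (Z.eq_dec (- Z.of_nat (S (Z.to_nat m))) m); [lia|].
      rewrite E0. ring.
    + replace (- Z.of_nat (S (Z.to_nat (- m - 1))))%Z with m by lia.
      destruct (Z.eq_dec m m); [|lia]. destruct (Z.eq_dec (Z.of_nat (Z.to_nat (- m - 1))) m); [lia|].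
      rewrite E0. ring.
  - assert (Z.of_nat n <> m /\ (- Z.of_nat (S n) <> m)%Z) as [N1 N2].
    { unfold j in Hn. destruct (Z_le_dec 0 m); lia. }
    destruct (Z.eq_dec (Z.of_nat n) m); [contradiction|].
    destruct (Z.eq_dec (- Z.of_nat (S n)) m); [contradiction|].
    change (zero : C_NormedModule) with (RtoC 0). toC. ring.
Qed.

End Poles.

(** * The Dirichlet series *)

Section Summatory.
Variable beta : R.
Hypothesis hbeta : 1 < beta.

Let c := c_beta beta.
Let D := delange beta.
Let L := ln beta.
Let A0 := (beta - 1) / (2 * ln beta).

Definition S_real (x : R) : R := A0 * x * ln x + x * D (ln x / L).

Lemma L_gt_0 : 0 < L.
Proof. now apply ln_beta_pos. Qed.

Lemma A0_gt_0 : 0 < A0.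
Proof. unfold A0. fold L. pose proof L_gt_0. apply Rdiv_lt_0_compat; lra. Qed.

Lemma S_beta_real n : S_beta beta n = RtoC (S_real (INR n)).
Proof.
  unfold S_beta, S_real. rewrite h_beta_delange by exact hbeta. rewrite RtoC_plus, (RtoC_mult (INR n)).
  unfold D, L, A0. ring.
Qed.

Lemma S_real_cont x : 0 < x -> continuous S_real x.
Proof.
  intros Hx. pose proof L_gt_0. unfold S_real. apply continuous_Rplus.
  - apply (ex_derive_continuous (fun x => A0 * x * ln x)). auto_derive. exact Hx.
  - apply continuous_Rmult; [apply continuous_Rid|].
    apply (continuous_comp (fun x => ln x / L) D); [|now apply delange_cont].
    apply (ex_derive_continuous (fun x => ln x / L)). auto_derive. exact Hx.
Qed.

Lemma Rpower_le_1 d al : 0 < d <= 1 -> 0 <= al -> Rpower d al <= 1.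
Proof.
  intros Hd Hal. rewrite <- (Rpower_1 1) by lra. replace (Rpower 1 1) with (Rpower 1 al).
  - apply Rle_Rpower_l; lra.
  - unfold Rpower. rewrite ln_1. f_equal. ring.
Qed.

Lemma delange_bound : exists M, 0 < M /\ forall u, Rabs (D u) <= M.
Proof.
  destruct (delange_holder beta hbeta (1/2) ltac:(lra)) as [K [HK Hh]].
  exists (Rabs (D 0) + K + 1). split; [pose proof (Rabs_pos (D 0)); lra|]. intros u.
  assert (HZ : forall (k : nat) y, D (y + INR k) = D y).
  { induction k as [|k IH]; intros y; [simpl; now rewrite Rplus_0_r|].
    rewrite S_INR, <- Rplus_assoc. unfold D at 1. rewrite delange_per by exact hbeta. apply IH. }
  destruct (ex_cell u) as [m Hm].
  assert (E : D (u - IZR m) = D u).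
  { destruct (Z_le_dec 0 m).
    - rewrite <- (HZ (Z.to_nat m) (u - IZR m)). f_equal. rewrite INR_IZR_INZ, Z2Nat.id by lia. ring.
    - rewrite <- (HZ (Z.to_nat (- m)) u). f_equal. rewrite INR_IZR_INZ, Z2Nat.id, opp_IZR by lia. ring. }
  rewrite <- E. set (d := u - IZR m). destruct (Req_dec d 0) as [->|Hd]; [lra|].
  assert (Hd' : 0 < d <= 1) by (unfold d in *; lra).
  specialize (Hh 0 d Hd'). rewrite Rplus_0_l in Hh. fold D in Hh.
  pose proof (Rpower_le_1 d (1/2) Hd' ltac:(lra)).
  pose proof (Rabs_triang_inv (D d) (D 0)). nra.
Qed.

Lemma delange_holder_all al : 0 < al < 1 -> exists K, 0 < K /\
  forall u d, 0 < d -> Rabs (D (u + d) - D u) <= K * Rpower d al.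
Proof.
  intros Hal. destruct (delange_holder beta hbeta al Hal) as [K [HK Hh]].
  destruct delange_bound as [M [HM HB]].
  exists (K + 2 * M). split; [lra|]. intros u d Hd. pose proof (exp_pos (al * ln d)) as Hp.
  change (exp (al * ln d)) with (Rpower d al) in Hp.
  destruct (Rle_dec d 1) as [H1|H1].
  - specialize (Hh u d ltac:(lra)). fold D in Hh. nra.
  - assert (1 <= Rpower d al).
    { rewrite <- (Rpower_O d) by lra. apply Rle_Rpower; lra. }
    assert (Rabs (D (u + d) - D u) <= 2 * M).
    { eapply Rle_trans; [apply Rabs_triang|]. rewrite Rabs_Ropp.
      pose proof (HB (u + d)). pose proof (HB u). lra. }
    nra.
Qed.

Definition step_diff (n : nat) (u : R) : R := S_real (INR (S n)) - S_real (INR (S n) + u).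
Definition step_lin (n : nat) (u : R) : R := S_real (INR (S n)) * (1 - u).

Lemma one_le_Rpower x th : 1 <= x -> 0 <= th -> 1 <= Rpower x th.
Proof. intros Hx Hth. rewrite <- (Rpower_O x) by lra. apply Rle_Rpower; lra. Qed.

Lemma ln_diff_bound x u : 1 <= x -> 0 <= u -> 0 <= ln (x + u) - ln x <= u / x.
Proof.
  intros Hx Hu. replace (ln (x + u) - ln x) with (ln (1 + u / x)).
  - assert (0 <= u / x) by (apply Rmult_le_pos; [lra|left; apply Rinv_0_lt_compat; lra]).
    split.
    + rewrite <- ln_1. destruct (Req_dec (1 + u / x) 1) as [->|]; [lra|]. left. apply ln_increasing; lra.
    + pose proof (exp_ineq1_le (ln (1 + u / x))) as H1. rewrite exp_ln in H1 by lra. lra.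
  - rewrite <- ln_div by lra. f_equal. field. lra.
Qed.

(** The argument of [D] moves by at most [1 / (N L)], so Holder exponent [1 - th] bounds [N] times
    the increment of [D] by a multiple of [N * N ^ (th - 1) = N ^ th]. The part [x ln x] contributes
    [O(ln N)], which is also [O(N ^ th)]. *)
Lemma step_diff_bound th : 0 < th < 1 -> exists K, 0 < K /\
  forall n u, 0 <= u <= 1 -> Rabs (step_diff n u) <= K * Rpower (INR (S n)) th.
Proof.
  intros Hth. pose proof L_gt_0 as HL. pose proof A0_gt_0 as HA.
  destruct (delange_holder_all (1 - th) ltac:(lra)) as [K [HK Hh]].
  destruct delange_bound as [M [HM HB]].
  set (K2 := K * Rpower (/ L) (1 - th)). assert (HK2 : 0 < K2) by (apply Rmult_lt_0_compat; [exact HK|apply exp_pos]).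
  exists (A0 * (2 + / th) + M + K2). split.
  { assert (0 < / th) by (apply Rinv_0_lt_compat; lra).
    assert (0 < A0 * (2 + / th)) by (apply Rmult_lt_0_compat; lra). lra. }
  intros n u Hu. unfold step_diff. pose proof (Spos n) as HN. set (N := INR (S n)) in *.
  destruct (ln_diff_bound N u HN ltac:(lra)) as [Hd0 Hd1].
  set (del := ln (N + u) - ln N) in *.
  assert (P1 : 1 <= Rpower N th) by (apply one_le_Rpower; lra).
  assert (HdN : del <= / N).
  { apply Rle_trans with (1 := Hd1). rewrite <- (Rmult_1_l (/ N)).
    apply Rmult_le_compat_r; [left; apply Rinv_0_lt_compat|]; lra. }
  assert (HNd : 0 <= N * del <= 1).
  { split; [apply Rmult_le_pos; lra|]. apply Rle_trans with (N * / N).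
    - apply Rmult_le_compat_l; lra.
    - rewrite Rinv_r; lra. }
  assert (E : S_real N - S_real (N + u) = - (A0 * (N * del + u * (ln N + del)) +
    (u * D (ln N / L + del / L) + N * (D (ln N / L + del / L) - D (ln N / L))))).
  { unfold S_real. replace (ln (N + u)) with (ln N + del) by (unfold del; ring).
    replace ((ln N + del) / L) with (ln N / L + del / L) by (field; lra). ring. }
  rewrite E, Rabs_Ropp.
  destruct (ln_bounds N HN) as [L0 _].
  assert (Q1 : 0 <= N * del + u * (ln N + del) <= (2 + / th) * Rpower N th).
  { pose proof (ln_le_Rpower N th HN ltac:(lra)).
    assert (/ N <= 1) by (rewrite <- Rinv_1; apply Rinv_le_contravar; lra).
    split; [assert (0 <= u * (ln N + del)) by (apply Rmult_le_pos; lra); lra|].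
    assert (u * (ln N + del) <= ln N + del) by nra. nra. }
  assert (Q2 : Rabs (u * D (ln N / L + del / L)) <= M).
  { rewrite Rabs_mult, (Rabs_pos_eq u) by lra. pose proof (HB (ln N / L + del / L)).
    pose proof (Rabs_pos (D (ln N / L + del / L))). nra. }
  assert (Q3 : Rabs (N * (D (ln N / L + del / L) - D (ln N / L))) <= K2 * Rpower N th).
  { destruct (Req_dec del 0) as [->|Hdel].
    - replace (0 / L) with 0 by (field; lra). rewrite Rplus_0_r, Rminus_diag, Rmult_0_r, Rabs_R0.
      apply Rmult_le_pos; lra.
    - rewrite Rabs_mult, (Rabs_pos_eq N) by lra.
      apply Rle_trans with (N * (K * Rpower (del / L) (1 - th))).
      + apply Rmult_le_compat_l; [lra|]. apply Hh. apply Rdiv_lt_0_compat; lra.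
      + apply Rle_trans with (N * (K * Rpower (/ N * / L) (1 - th))).
        * apply Rmult_le_compat_l; [lra|]. apply Rmult_le_compat_l; [lra|].
          assert (0 < / L) by (apply Rinv_0_lt_compat; lra).
          apply Rle_Rpower_l; [lra|]. split; [apply Rmult_lt_0_compat; lra|].
          apply Rmult_le_compat_r; lra.
        * right. rewrite <- Rpower_mult_distr by (apply Rinv_0_lt_compat; lra).
          assert (EN : Rpower (/ N) (1 - th) = / N * Rpower N th).
          { unfold Rpower. rewrite ln_Rinv by lra. replace ((1 - th) * - ln N) with (- ln N + th * ln N) by ring.
            rewrite exp_plus, exp_Ropp, exp_ln by lra. reflexivity. }
          rewrite EN. unfold K2. field. lra. }
  eapply Rle_trans; [apply Rabs_triang|].
  rewrite Rabs_mult, (Rabs_pos_eq A0), (Rabs_pos_eq (N * del + _)) by lra.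
  assert (Q4 := Rabs_triang (u * D (ln N / L + del / L)) (N * (D (ln N / L + del / L) - D (ln N / L)))).
  assert (A0 * (N * del + u * (ln N + del)) <= A0 * ((2 + / th) * Rpower N th)) by (apply Rmult_le_compat_l; lra).
  assert (M <= M * Rpower N th) by nra. lra.
Qed.

Lemma step_lin_bound th : 0 < th < 1 -> exists K, 0 < K /\
  forall n u, 0 <= u <= 1 -> Rabs (step_lin n u) <= K * Rpower (INR (S n)) (1 + th).
Proof.
  intros Hth. pose proof L_gt_0 as HL. pose proof A0_gt_0 as HA.
  destruct delange_bound as [M [HM HB]].
  assert (Hit : 0 < / th) by (apply Rinv_0_lt_compat; lra).
  exists (A0 * / th + M). split.
  { assert (0 < A0 * / th) by (apply Rmult_lt_0_compat; lra). lra. }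
  intros n u Hu. unfold step_lin. pose proof (Spos n) as HN. set (N := INR (S n)) in *.
  assert (P1 : 1 <= Rpower N th) by (apply one_le_Rpower; lra).
  destruct (ln_bounds N HN) as [L0 _]. pose proof (ln_le_Rpower N th HN ltac:(lra)) as L1.
  rewrite Rabs_mult, (Rabs_pos_eq (1 - u)) by lra.
  apply Rle_trans with (Rabs (S_real N)); [pose proof (Rabs_pos (S_real N)); nra|].
  unfold S_real. rewrite Rpower_plus, Rpower_1 by lra.
  replace (A0 * N * ln N + N * D (ln N / L)) with (N * (A0 * ln N + D (ln N / L))) by ring.
  rewrite Rabs_mult, (Rabs_pos_eq N) by lra.
  replace ((A0 * / th + M) * (N * Rpower N th)) with (N * (A0 * (/ th * Rpower N th) + M * Rpower N th)) by ring.
  apply Rmult_le_compat_l; [lra|]. eapply Rle_trans; [apply Rabs_triang|].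
  apply Rplus_le_compat.
  - rewrite Rabs_pos_eq by (apply Rmult_le_pos; lra). apply Rmult_le_compat_l; lra.
  - pose proof (HB (ln N / L)). nra.
Qed.

Lemma step_diff_cont n u : 0 <= u <= 1 -> continuous (step_diff n) u.
Proof.
  intros Hu. pose proof (Spos n). apply continuous_Rminus; [apply continuous_Rconst|].
  apply (continuous_comp (fun u => INR (S n) + u) S_real); [auto with rcont|]. apply S_real_cont. lra.
Qed.

Lemma step_lin_cont n u : 0 <= u <= 1 -> continuous (step_lin n) u.
Proof. intros Hu. unfold step_lin. auto with rcont. Qed.

(** The sum over [N >= 1] of [S(N) N^(-z)] minus the integral of [S(x) x^(-z)] over [[N, N + 1]].
    The first series replaces [S(x)] by [S(N)], the second replaces the mean of [x^(-z)] by
    [N^(-z)]. The latter has amplitude [N ^ (1 + th)] but exponent [z + 1], so both converge for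
    [Re z > 1 + th]. *)
Definition reg_part (z : C) : C :=
  (CSeries (mellin_term step_diff z) + z * CSeries (mellin_term step_lin (z + 1)))%C.

Lemma reg_part_diff s : 1 < Re s -> Cdifferentiable reg_part s.
Proof.
  (* Small enough for [1 + th < Re s], and below 1 for the Holder bound. *)
  intros Hs. set (th := Rmin (1/2) ((Re s - 1) / 2)).
  assert (Hth : 0 < th < 1).
  { unfold th. split; [apply Rmin_case; lra|]. eapply Rle_lt_trans; [apply Rmin_l|lra]. }
  assert (Hth2 : th + 1 < Re s) by (pose proof (Rmin_r (1/2) ((Re s - 1) / 2)); unfold th; lra).
  destruct (step_diff_bound th Hth) as [K1 [HK1 H1]]. destruct (step_lin_bound th Hth) as [K2 [HK2 H2]].
  apply Cdiff_plus; [|apply Cdiff_mult; [apply Cdiff_id|]].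
  - apply (mellin_diff step_diff K1 th); auto using step_diff_cont. lra.
  - assert (Dm : Cdifferentiable (fun z => CSeries (mellin_term step_lin z)) (s + 1)).
    { apply (mellin_diff step_lin K2 (1 + th)); auto using step_lin_cont; [lra|].
      rewrite re_plus. simpl. lra. }
    destruct Dm as [l Hl]. exists (scal one l).
    apply (is_derive_comp (K := C_AbsRing) (V := C_NormedModule) (fun z => CSeries (mellin_term step_lin z)) (fun z => (z + 1)%C) s l one); [exact Hl|].
    assert (Hid : is_derive (K := C_AbsRing) (V := AbsRing_NormedModule C_AbsRing) (fun z : C => z) s one)
      by apply (is_derive_id (K := C_AbsRing)).
    assert (Hc := is_derive_const (K := C_AbsRing) (V := AbsRing_NormedModule C_AbsRing) (RtoC 1) s).
    assert (Hp := is_derive_plus (K := C_AbsRing) (V := AbsRing_NormedModule C_AbsRing) _ _ _ _ _ Hid Hc).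
    rewrite plus_zero_r in Hp. exact Hp.
Qed.

Section Series.
Variable s : C.
Hypothesis Hs : 2 < Re s.

Definition exponent (k : Z) : C := (2 - s + freq beta k)%C.

Lemma exponent_pole k : exponent k = (- (s - pole beta k))%C.
Proof. unfold exponent, pole. ring. Qed.

Lemma exponent_re k : Re (exponent k) = 2 - Re s.
Proof. unfold exponent. rewrite freq_eq by exact hbeta. destruct s; simpl; ring. Qed.

Lemma exponent_mod k : Re s - 2 <= Cmod (exponent k).
Proof.
  pose proof (re_le_Cmod (exponent k)) as H. rewrite exponent_re, Rabs_left in H by lra. lra.
Qed.

Lemma exponent_neq k : exponent k <> 0.
Proof. apply Cmod_gt_0. pose proof (exponent_mod k). lra. Qed.

Lemma two_s_neq : (2 - s)%C <> 0.
Proof.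
  intros E. apply (f_equal Re) in E. unfold Cminus in E. rewrite re_plus, re_opp in E. simpl in E. lra.
Qed.

Lemma is_CInt_Rcpow (w : C) a b : 0 < a <= b -> w <> 0 ->
  is_CInt (fun x => Rcpow x (w - 1)) a b ((Rcpow b w - Rcpow a w) / w)%C.
Proof.
  intros Hab Hw.
  assert (G : is_CInt (fun x => (w * Rcpow x (w - 1))%C) a b (Rcpow b w - Rcpow a w)%C).
  { apply (is_RInt_derive (V := C_R_CompleteNormedModule) (fun x => Rcpow x w)).
    - intros x Hx. rewrite Rmin_left, Rmax_right in Hx by lra. apply is_derive_Rcpow. lra.
    - intros x Hx. rewrite Rmin_left, Rmax_right in Hx by lra. apply continuous_Cmul_l, continuous_Rcpow. lra. }
  apply (is_CInt_Cmult _ _ _ _ (/ w)%C) in G.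
  eapply is_CInt_eq; [eapply is_RInt_ext; [|exact G]|toC; field; exact Hw].
  intros x _. cbv beta. toC. field. exact Hw.
Qed.

Lemma Rcpow_freq_expk x k : Rcpow x (freq beta k) = Cconj (expk k (ln x / L)).
Proof.
  rewrite <- Cexp_expk. unfold Rcpow, freq. f_equal. fold L.
  rewrite RtoC_div by (pose proof L_gt_0; lra). field. intros E. apply RtoC_inj in E. pose proof L_gt_0. lra.
Qed.

Definition prim_term (x : R) (k : Z) : C := (c k * (Rcpow x (exponent k) / exponent k))%C.

(** The termwise antiderivative of [D (ln x / L) * x ^ (1 - s)] that vanishes at infinity. Its value
    at 1 is minus the sum over the poles, since [exponent k] is minus the distance vector from
    [pole k] to [s]. *)
Definition prim (x : R) : C :=
  CSeries (fun n => prim_term x (Z.of_nat n) + prim_term x (- Z.of_nat (S n)))%C.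

Lemma prim_term_bound x k : Cmod (prim_term x k) <= Rpower x (2 - Re s) / (Re s - 2) * Cmod (c k).
Proof.
  unfold prim_term. rewrite Cmod_mult, Cmod_div, Cmod_Rcpow_Rpower, exponent_re by apply exponent_neq.
  rewrite Rmult_comm. apply Rmult_le_compat_r; [apply Cmod_ge_0|].
  apply Rmult_le_compat_l; [left; apply exp_pos|]. apply Rinv_le_contravar; [lra|apply exponent_mod].
Qed.

Lemma prim_pair_bound x n : Cmod (prim_term x (Z.of_nat n) + prim_term x (- Z.of_nat (S n)))
   <= Rpower x (2 - Re s) / (Re s - 2) * c_pair_norm beta n.
Proof.
  eapply Rle_trans; [apply Cmod_triangle|]. unfold c_pair_norm. rewrite Rmult_plus_distr_l.
  apply Rplus_le_compat; apply prim_term_bound.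
Qed.

Lemma prim_series x : is_Cser (fun n => prim_term x (Z.of_nat n) + prim_term x (- Z.of_nat (S n)))%C (prim x).
Proof.
  apply ex_Cser_le with (1 := prim_pair_bound x).
  apply (ex_series_scal_l (V := R_NormedModule) _), ex_series_c_pair, hbeta.
Qed.

Lemma prim_bound x : Cmod (prim x) <= Rpower x (2 - Re s) / (Re s - 2) * Series (c_pair_norm beta).
Proof.
  apply (norm_series_le (V := C_NormedModule) _ _ _ _ (prim_series x)
    (is_series_scal_l (Rpower x (2 - Re s) / (Re s - 2)) _ _ (Series_correct _ (ex_series_c_pair beta hbeta)))).
  apply prim_pair_bound.
Qed.

Lemma prim_1 : prim 1 = (- pole_sum beta c s)%C.
Proof.
  assert (Hd : forall k, Re s - 2 <= Cmod (s - pole beta k)).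
  { intros k. rewrite <- Cmod_opp, <- exponent_pole. apply exponent_mod. }
  assert (H := pole_sum_ex beta hbeta c s (Re s - 2) ltac:(lra) (fun k => Rle_refl _)
    (fun k => or_intror (Hd k))).
  apply (is_Cser_scal (- (1))%C) in H.
  replace (- pole_sum beta c s)%C with (- (1) * pole_sum beta c s)%C by ring.
  apply (is_Cser_unique _ _ _ (prim_series 1)). eapply is_Cser_ext; [|exact H].
  intros n. cbv beta. toC. unfold prim_term. rewrite !Rcpow_1_l, !exponent_pole.
  assert (N : forall k, (s - pole beta k)%C <> 0).
  { intros k E. apply (exponent_neq k). rewrite exponent_pole, E. ring. }
  field. split; apply N.
Qed.

Lemma delange_prim a b : 0 < a <= b ->
  is_CInt (fun x => (RtoC (D (ln x / L)) * Rcpow x (1 - s))%C) a b (prim b - prim a)%C.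
Proof.
  intros Hab.
  set (f := fun x => (RtoC (D (ln x / L)) * Rcpow x (1 - s))%C).
  assert (Hf : is_CInt f a b (RInt (V := C_R_CompleteNormedModule) f a b)).
  { apply is_CInt_cont. intros x Hx. rewrite Rmin_left, Rmax_right in Hx by lra.
    apply continuous_Rmult_C; [|apply continuous_Rcpow; lra].
    apply (continuous_comp (fun x => ln x / L) D); [|now apply delange_cont].
    apply (ex_derive_continuous (fun x => ln x / L)). auto_derive. lra. }
  eapply is_CInt_eq; [exact Hf|].
  assert (Ex : forall x k, 0 < x -> (Cconj (expk k (ln x / L)) * Rcpow x (1 - s))%C = Rcpow x (exponent k - 1)).
  { intros x k Hx. rewrite <- Rcpow_freq_expk, <- Rcpow_plus. f_equal. unfold exponent.
    replace (RtoC 2) with (RtoC 1 + RtoC 1)%C by (rewrite <- RtoC_plus; f_equal; ring). ring. }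
  assert (Hmax : exists Mx, 0 <= Mx /\ forall t, a <= t <= b -> Rpower t (1 - Re s) <= Mx).
  { exists (Rpower a (1 - Re s)). split; [left; apply exp_pos|]. intros t Ht.
    replace (1 - Re s) with (- (Re s - 1)) by ring. rewrite !Rpower_Ropp.
    apply Rinv_le_contravar; [apply exp_pos|]. apply Rle_Rpower_l; lra. }
  destruct Hmax as [Mx [HMx0 HMx]].
  assert (G : is_Cser (fun n => (prim_term b (Z.of_nat n) + prim_term b (- Z.of_nat (S n)))
       - (prim_term a (Z.of_nat n) + prim_term a (- Z.of_nat (S n))))%C (RInt (V := C_R_CompleteNormedModule) f a b)).
  { refine (RInt_series (V := C_R_NormedModule) (fun n x => ((c (Z.of_nat n) * Cconj (expk (Z.of_nat n) (ln x / L))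
                  + c (- Z.of_nat (S n)) * Cconj (expk (- Z.of_nat (S n)) (ln x / L))) * Rcpow x (1 - s))%C) f _ _
      (fun n => Mx * c_pair_norm beta n) a b _ _ Hf _ _ _).
    - lra.
    - intros n.
      assert (P := is_CInt_plus _ _ _ _ _ _
        (is_CInt_Cmult _ _ _ _ (c (Z.of_nat n)) (is_CInt_Rcpow (exponent (Z.of_nat n)) a b Hab (exponent_neq _)))
        (is_CInt_Cmult _ _ _ _ (c (- Z.of_nat (S n))) (is_CInt_Rcpow (exponent (- Z.of_nat (S n))) a b Hab (exponent_neq _)))).
      eapply is_CInt_eq; [eapply is_RInt_ext; [|exact P]|].
      + intros x Hx. rewrite Rmin_left, Rmax_right in Hx by lra. cbv beta. toC.
        rewrite <- !Ex by lra. ring.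
      + toC. unfold prim_term. field. split; apply exponent_neq.
    - intros t Ht.
      assert (Q := is_Cser_scal (Rcpow t (1 - s)) _ _ (delange_series beta hbeta (ln t / L))).
      assert (Q' : is_Cser (fun n => ((c (Z.of_nat n) * Cconj (expk (Z.of_nat n) (ln t / L))
                  + c (- Z.of_nat (S n)) * Cconj (expk (- Z.of_nat (S n)) (ln t / L))) * Rcpow t (1 - s))%C) (f t)).
      { unfold f. rewrite Cmult_comm. eapply is_Cser_ext; [|exact Q]. intros n. cbv beta. toC. fold c. ring. }
      exact Q'.
    - intros n t Ht. rewrite norm_CR, Cmod_mult, Cmod_Rcpow_Rpower, Rmult_comm.
      replace (Re (1 - s)) with (1 - Re s) by (unfold Cminus; rewrite re_plus, re_opp; reflexivity).
      apply Rmult_le_compat; [left; apply exp_pos|apply Cmod_ge_0|now apply HMx|].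
      eapply Rle_trans; [apply Cmod_triangle|]. rewrite !Cmod_mult, !Cmod_conj, !Cmod_expk. unfold c_pair_norm. fold c. lra.
    - apply (ex_series_scal_l (V := R_NormedModule) Mx), ex_series_c_pair, hbeta. }
  apply (is_Cser_unique _ _ _ G).
  assert (G2 := is_Cser_plus _ _ _ _ (prim_series b) (is_Cser_scal (- (1))%C _ _ (prim_series a))).
  replace (prim b - prim a)%C with (prim b + - (1) * prim a)%C by ring.
  eapply is_Cser_ext; [|exact G2]. intros n. cbv beta. toC. ring.
Qed.

(** The antiderivative of [ln x * x ^ (1 - s)] that vanishes at infinity; its value
    [- 1 / (2 - s) ^ 2] at 1 is the origin of the double pole. *)
Definition log_prim (x : R) : C :=
  (RtoC (ln x) * (Rcpow x (2 - s) / (2 - s)) - Rcpow x (2 - s) / ((2 - s) * (2 - s)))%C.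

Lemma log_prim_int a b : 0 < a <= b ->
  is_CInt (fun x => (RtoC (ln x) * Rcpow x (1 - s))%C) a b (log_prim b - log_prim a)%C.
Proof.
  intros Hab. pose proof two_s_neq as H2.
  assert (Hpos : forall t, Rmin a b <= t <= Rmax a b -> 0 < t).
  { intros t Ht. rewrite Rmin_left, Rmax_right in Ht by lra. lra. }
  assert (E1 : (2 - s - 1)%C = (1 - s)%C).
  { replace (RtoC 2) with (RtoC 1 + RtoC 1)%C by (rewrite <- RtoC_plus; f_equal; ring). ring. }
  assert (G := is_RInt_scal_derive_r (V := C_R_CompleteNormedModule) ln (fun t => (/ (2 - s) * Rcpow t (2 - s))%C)
    (fun t => / t) (fun t => Rcpow t (1 - s)) a b ((Rcpow b (2 - s) - Rcpow a (2 - s)) / ((2 - s) * (2 - s)))%C).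
  assert (G' : is_CInt (fun t => scal (ln t) (Rcpow t (1 - s))) a b
     (minus (minus (scal (ln b) (/ (2 - s) * Rcpow b (2 - s))%C) (scal (ln a) (/ (2 - s) * Rcpow a (2 - s))%C))
       ((Rcpow b (2 - s) - Rcpow a (2 - s)) / ((2 - s) * (2 - s)))%C)).
  { apply G.
    - intros t Ht. apply is_derive_Reals, derivable_pt_lim_ln. now apply Hpos.
    - intros t Ht.
      assert (Dr := is_derive_Rcpow t (2 - s) (Hpos t Ht)). rewrite E1 in Dr.
      replace (Rcpow t (1 - s)) with (/ (2 - s) * ((2 - s) * Rcpow t (1 - s)))%C by (field; exact H2).
      set (w := (/ (2 - s))%C) in *. set (l := ((2 - s) * Rcpow t (1 - s))%C) in *.
      (* The constant [w] is complex while the scalars of the module are real, so the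
         differentiability estimate is scaled by hand; [Cmod w + 1] avoids dividing by zero. *)
      destruct Dr as [_ Dr]. split; [apply (is_linear_scal_l (V := C_R_NormedModule))|].
      intros y Hy [e He].
      assert (Hw : 0 < Cmod w + 1) by (pose proof (Cmod_ge_0 w); lra).
      assert (He' : 0 < e / (Cmod w + 1)) by now apply Rdiv_lt_0_compat.
      generalize (Dr y Hy (mkposreal _ He')). apply filter_imp. intros x Hx.
      change (norm (V := C_R_NormedModule) (minus (minus (Rcpow x (2 - s)) (Rcpow y (2 - s))) (scal (minus x y) l))
        <= e / (Cmod w + 1) * norm (minus x y)) in Hx.
      change (norm (V := C_R_NormedModule) (minus (minus (w * Rcpow x (2 - s)) (w * Rcpow y (2 - s))) (scal (minus x y) (w * l)))%C
        <= e * norm (minus x y)).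
      rewrite scal_R_Cmult in *. rewrite norm_CR in *.
      match type of Hx with Cmod ?u <= _ => set (v := u) in * end.
      match goal with |- Cmod ?u <= _ => replace u with (w * v)%C end.
      2:{ unfold v. generalize (Rcpow x (2 - s)) (Rcpow y (2 - s)) (minus x y). intros a' b' d.
          change (w * ((a' - b') - RtoC d * l) = (w * a' - w * b') - RtoC d * (w * l))%C. ring. }
      rewrite Cmod_mult. pose proof (Cmod_ge_0 w). pose proof (Cmod_ge_0 v).
      pose proof (norm_ge_0 (V := R_NormedModule) (minus x y)) as Hn.
      change (norm (minus x y)) with (norm (V := R_NormedModule) (minus x y)) in *.
      apply Rle_trans with ((Cmod w + 1) * (e / (Cmod w + 1) * norm (V := R_NormedModule) (minus x y))).
      + apply Rmult_le_compat; lra.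
      + right. field. lra.
    - intros t Ht. apply (ex_derive_continuous (fun t => / t)). auto_derive. specialize (Hpos t Ht). lra.
    - intros t Ht. apply continuous_Rcpow. now apply Hpos.
    - assert (P := is_CInt_Cmult _ _ _ _ (/ (2 - s))%C (is_CInt_Rcpow (2 - s) a b Hab H2)).
      eapply is_CInt_eq; [eapply is_RInt_ext; [|exact P]|toC; field; exact H2].
      intros x Hx. cbv beta. rewrite scal_R_Cmult. toC.
      rewrite Rmin_left, Rmax_right in Hx by lra.
      unfold Cminus at 2. rewrite (Rcpow_plus x (2 - s) (- (1))), <- RtoC_opp, Rcpow_R.
      replace (exp (- (1) * ln x)) with (/ x).
      + ring.
      + replace (- (1) * ln x) with (- ln x) by ring. rewrite exp_Ropp, exp_ln by lra. reflexivity. }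
  eapply is_CInt_eq; [eapply is_RInt_ext; [|exact G']|].
  - intros x _. apply scal_R_Cmult.
  - rewrite !scal_R_Cmult.
    change ((RtoC (ln b) * (/ (2 - s) * Rcpow b (2 - s)) - RtoC (ln a) * (/ (2 - s) * Rcpow a (2 - s)))
      - (Rcpow b (2 - s) - Rcpow a (2 - s)) / ((2 - s) * (2 - s)) = log_prim b - log_prim a)%C.
    unfold log_prim. field. exact H2.
Qed.

Definition full_prim (x : R) : C := (RtoC A0 * log_prim x + prim x)%C.

Lemma full_prim_int a b : 0 < a <= b ->
  is_CInt (fun x => (RtoC (S_real x) * Rcpow x (- s))%C) a b (full_prim b - full_prim a)%C.
Proof.
  intros Hab.
  assert (P := is_CInt_plus _ _ _ _ _ _ (is_CInt_Cmult _ _ _ _ (RtoC A0) (log_prim_int a b Hab)) (delange_prim a b Hab)).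
  eapply is_CInt_eq; [eapply is_RInt_ext; [|exact P]|].
  - intros x Hx. rewrite Rmin_left, Rmax_right in Hx by lra. cbv beta. toC.
    unfold Cminus. rewrite (Rcpow_plus x 1 (- s)), Rcpow_R, Rmult_1_l, exp_ln by lra.
    unfold S_real. rewrite RtoC_plus, !RtoC_mult. ring.
  - toC. unfold full_prim. ring.
Qed.

Lemma full_prim_lim : filterlim (fun n => full_prim (INR (S n))) eventually (locally (T := C_NormedModule) (RtoC 0)).
Proof.
  set (p := Re s - 2). assert (Hp : 0 < p) by (unfold p; lra). pose proof A0_gt_0 as HA.
  (* The summands bound the two terms of [log_prim] and then [prim]. Half of the decay [x ^ (- p)]
     is given up to absorb the factor [ln x]. *)
  set (K := A0 * (/ (p / 2) * / p + / p ^ 2) + / p * Series (c_pair_norm beta)).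
  assert (Hip : 0 < / p) by now apply Rinv_0_lt_compat.
  assert (Hip2 : 0 < / (p / 2)) by (apply Rinv_0_lt_compat; lra).
  assert (Hip3 : 0 < / p ^ 2) by (apply Rinv_0_lt_compat; now apply pow_lt).
  assert (HS : 0 <= Series (c_pair_norm beta)).
  { pose proof (prim_bound 1) as Q. pose proof (Cmod_ge_0 (prim 1)) as Q0. fold p in Q.
    assert (Hk : 0 < Rpower 1 (2 - Re s) / p) by (apply Rdiv_lt_0_compat; [apply exp_pos|exact Hp]).
    apply Rmult_le_reg_l with (1 := Hk). rewrite Rmult_0_r. lra. }
  assert (HK : 0 <= K).
  { unfold K. apply Rplus_le_le_0_compat; apply Rmult_le_pos; try lra.
    assert (0 < / (p / 2) * / p) by (apply Rmult_lt_0_compat; lra). lra. }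
  assert (B : forall x, 1 <= x -> Cmod (full_prim x) <= K * Rpower x (- (p / 2))).
  { intros x Hx. destruct (ln_bounds x Hx) as [L0 _].
    assert (Hw : p <= Cmod (2 - s)).
    { pose proof (re_le_Cmod (2 - s)) as Q. unfold Cminus in Q at 1. rewrite re_plus, re_opp, re_RtoC in Q.
      rewrite Rabs_left in Q by lra. unfold p. lra. }
    assert (Hre : Re (2 - s) = - p) by (unfold Cminus, p; rewrite re_plus, re_opp, re_RtoC; ring).
    assert (X1 : Rpower x (- p) <= Rpower x (- (p / 2))) by (apply Rle_Rpower; lra).
    assert (X2 : ln x * Rpower x (- p) <= / (p / 2) * Rpower x (- (p / 2))).
    { replace (- (p / 2)) with (p / 2 + - p) by field. rewrite Rpower_plus, <- Rmult_assoc.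
      apply Rmult_le_compat_r; [left; apply exp_pos|]. apply ln_le_Rpower; lra. }
    pose proof (exp_pos (- p * ln x)) as Xp. change (exp (- p * ln x)) with (Rpower x (- p)) in Xp.
    assert (I1 : / Cmod (2 - s) <= / p) by (apply Rinv_le_contravar; lra).
    assert (Ipos : 0 < / Cmod (2 - s)) by (apply Rinv_0_lt_compat; lra).
    assert (N2 : (2 - s)%C <> 0) by apply two_s_neq.
    assert (Bl : Cmod (log_prim x) <= (/ (p / 2) * / p + / p ^ 2) * Rpower x (- (p / 2))).
    { unfold log_prim, Cminus at 1. eapply Rle_trans; [apply Cmod_triangle|]. rewrite Cmod_opp.
      rewrite Cmod_mult, Cmod_R, (Rabs_pos_eq (ln x)), !Cmod_div, Cmod_mult, Cmod_Rcpow_Rpower, Hre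
        by (auto; now apply Cmult_neq_0).
      rewrite Rmult_plus_distr_r. apply Rplus_le_compat.
      - unfold Rdiv. rewrite <- Rmult_assoc.
        replace (/ (p * / 2) * / p * Rpower x (- (p * / 2))) with ((/ (p / 2) * Rpower x (- (p / 2))) * / p) by (unfold Rdiv; ring).
        apply Rmult_le_compat; try lra. apply Rmult_le_pos; lra.
      - unfold Rdiv at 1. rewrite Rmult_comm. apply Rmult_le_compat; try lra.
        + left. apply Rinv_0_lt_compat. nra.
        + apply Rinv_le_contravar; [now apply pow_lt|]. nra. }
    unfold full_prim. eapply Rle_trans; [apply Cmod_triangle|].
    rewrite Cmod_mult, Cmod_R, (Rabs_pos_eq A0) by lra.
    unfold K. rewrite Rmult_plus_distr_r. apply Rplus_le_compat.
    - rewrite Rmult_assoc. apply Rmult_le_compat_l; lra.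
    - eapply Rle_trans; [apply prim_bound|]. replace (2 - Re s) with (- p) by (unfold p; ring). fold p.
      replace (Rpower x (- p) / p * Series (c_pair_norm beta)) with (/ p * Series (c_pair_norm beta) * Rpower x (- p)) by (unfold Rdiv; ring).
      apply Rmult_le_compat_l; [apply Rmult_le_pos; lra|exact X1]. }
  apply filterlim_C_eps; [apply eventually_filter|]. intros eps He.
  assert (Heps : 0 < eps / (K + 1)) by (apply Rdiv_lt_0_compat; lra).
  destruct (Rpower_neg_small (p / 2) (eps / (K + 1)) ltac:(lra) Heps) as [X0 [HX0 HX]].
  destruct (INR_unbounded X0) as [N HN]. exists N. intros n Hn.
  replace (full_prim (INR (S n)) - RtoC 0)%C with (full_prim (INR (S n))) by ring.
  eapply Rle_lt_trans; [apply B, Spos|].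
  assert (HX' : X0 <= INR (S n)) by (apply Rle_trans with (INR N); [lra|apply le_INR; lia]).
  specialize (HX _ HX'). pose proof (exp_pos (- (p / 2) * ln (INR (S n)))) as Xp.
  change (exp (- (p / 2) * ln (INR (S n)))) with (Rpower (INR (S n)) (- (p / 2))) in Xp.
  apply Rle_lt_trans with ((K + 1) * Rpower (INR (S n)) (- (p / 2))); [nra|].
  apply Rlt_le_trans with ((K + 1) * (eps / (K + 1))); [apply Rmult_lt_compat_l; lra|].
  right. field. lra.
Qed.

Lemma full_prim_1 : full_prim 1 = (- (RtoC A0 / (s - 2) ^ 2 + pole_sum beta c s))%C.
Proof.
  unfold full_prim, log_prim. rewrite prim_1, ln_1, !Rcpow_1_l. simpl (Cpow _ _).
  pose proof two_s_neq as H2. assert (H3 : (s - 2)%C <> 0).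
  { intros E. apply H2. replace (2 - s)%C with (- (s - 2))%C by ring. rewrite E. ring. }
  field. split; auto.
Qed.

(** The last two terms are the integral of [S(x) x^(-z)] over [[1, oo)], that is, minus the value of
    the antiderivative [full_prim] at 1. *)
Definition G_fun (z : C) : C := (reg_part z + RtoC A0 / (z - 2) ^ 2 + pole_sum beta c z)%C.

Lemma G_series : is_Cser (fun n => S_beta beta (S n) * Rcpow (INR (S n)) (- s))%C (G_fun s).
Proof.
  assert (T := telescope (K := C_AbsRing) (V := C_NormedModule) _ full_prim_lim). cbv beta in T.
  change (INR 1) with 1 in T. rewrite full_prim_1 in T.
  assert (T' : is_Cser (fun n => full_prim (INR (S (S n))) - full_prim (INR (S n)))%C (RtoC A0 / (s - 2) ^ 2 + pole_sum beta c s)%C).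
  { replace (RtoC A0 / (s - 2) ^ 2 + pole_sum beta c s)%C with (- - (RtoC A0 / (s - 2) ^ 2 + pole_sum beta c s))%C by ring.
    exact T. }
  destruct (step_diff_bound (1/2) ltac:(lra)) as [K1 [HK1 H1]]. destruct (step_lin_bound (1/2) ltac:(lra)) as [K2 [HK2 H2]].
  assert (M1 := mellin_ex step_diff K1 (1/2) ltac:(lra) step_diff_cont H1 s ltac:(lra)).
  assert (M2 := mellin_ex step_lin K2 (1 + 1/2) ltac:(lra) step_lin_cont H2 (s + 1)%C ltac:(rewrite re_plus; simpl; lra)).
  assert (Q := is_Cser_plus _ _ _ _ (is_Cser_plus _ _ _ _ M1 (is_Cser_scal s _ _ M2)) T').
  match type of Q with is_series _ ?l => replace (G_fun s) with l by (unfold G_fun, reg_part; ring) end.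
  eapply is_Cser_ext; [|exact Q]. intros n. cbv beta. toC. rewrite S_beta_real.
  pose proof (Spos n) as Hn. set (N := INR (S n)) in *.
  assert (EN : INR (S (S n)) = N + 1) by (rewrite (S_INR (S n)); reflexivity). rewrite EN.
  (* integration by parts turns N^-s - int x^-s into s int (1 - u) x^(-s-1) *)
  assert (I1 := mellin_term_correct step_diff step_diff_cont s n).
  assert (I2 := mellin_term_correct step_lin step_lin_cont (s + 1)%C n). fold N in I1, I2.
  assert (I3 : is_CInt (fun u => (RtoC (S_real (N + u)) * Rcpow (N + u) (- s))%C) 0 1 (full_prim (N + 1) - full_prim N)%C).
  { assert (P := full_prim_int N (N + 1) ltac:(lra)).
    replace N with (1 * 0 + N) in P at 1 by ring. replace (N + 1) with (1 * 1 + N) in P at 1 by ring.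
    apply (is_RInt_comp_lin (V := C_R_NormedModule)) in P.
    eapply is_RInt_ext; [|exact P]. intros x _. cbv beta. rewrite scal_R_Cmult, Rmult_1_l, (Rplus_comm x). toC. ring. }
  (* The same integral is computed twice: here as the two terms of [reg_part] plus the increment of
     [full_prim], and in [I5], by parts, as [S(N) N^(-s)]. *)
  assert (I4 : is_CInt (fun u => (RtoC (S_real N) * Rcpow (N + u) (- s) + s * (RtoC (step_lin n u) * Rcpow (N + u) (- (s + 1))))%C) 0 1
     (mellin_term step_diff s n + s * mellin_term step_lin (s + 1) n + (full_prim (N + 1) - full_prim N))%C).
  { assert (P := is_CInt_plus _ _ _ _ _ _ (is_CInt_plus _ _ _ _ _ _ I1 (is_CInt_Cmult _ _ _ _ s I2)) I3).
    eapply is_RInt_ext; [|exact P]. intros u _. cbv beta. toC. unfold step_diff. fold N.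
    rewrite RtoC_minus. ring. }
  assert (I5 : is_CInt (fun u => (RtoC (S_real N) * Rcpow (N + u) (- s) + s * (RtoC (step_lin n u) * Rcpow (N + u) (- (s + 1))))%C) 0 1
     (RtoC (S_real N) * Rcpow N (- s))%C).
  { assert (P := is_RInt_scal_derive_r (V := C_R_CompleteNormedModule) (fun u => 1 - u) (fun u => Rcpow (N + u) (- s))
       (fun _ => -1) (fun u => (- s * Rcpow (N + u) (- s - 1))%C) 0 1
       (- (RInt (V := C_R_CompleteNormedModule) (fun u => Rcpow (N + u) (- s)) 0 1))%C).
    assert (Hpos : forall t, Rmin 0 1 <= t <= Rmax 0 1 -> 0 < N + t).
    { intros t Ht. rewrite Rmin_left, Rmax_right in Ht by lra. lra. }
    assert (I0 : is_CInt (fun u => Rcpow (N + u) (- s)) 0 1 (RInt (V := C_R_CompleteNormedModule) (fun u => Rcpow (N + u) (- s)) 0 1)).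
    { apply is_CInt_cont. intros t Ht. apply continuous_Rcpow_shift. now apply Hpos. }
    set (J := RInt (V := C_R_CompleteNormedModule) _ 0 1) in *.
    assert (P' : is_CInt (fun u => scal (1 - u) (- s * Rcpow (N + u) (- s - 1))%C) 0 1
      (minus (minus (scal (1 - 1) (Rcpow (N + 1) (- s))) (scal (1 - 0) (Rcpow (N + 0) (- s)))) (- J)%C)).
    { apply P.
      - intros t _. auto_derive; [exact I|lra].
      - intros t Ht. apply is_derive_Rcpow_shift. now apply Hpos.
      - intros t _. apply continuous_const.
      - intros t Ht. apply continuous_Cmul_l, continuous_Rcpow_shift. now apply Hpos.
      - apply (is_CInt_Cmult _ _ _ _ (- (1))%C) in I0.
        eapply is_CInt_eq; [eapply is_RInt_ext; [|exact I0]|toC; ring].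
        intros u _. cbv beta. rewrite scal_R_Cmult. toC. replace (-1) with (- (1)) by ring. rewrite RtoC_opp. ring. }
    rewrite !scal_R_Cmult in P'.
    assert (P2 := is_CInt_Cmult _ _ _ _ (RtoC (S_real N)) (is_CInt_minus _ _ _ _ _ _ I0 P')).
    eapply is_CInt_eq; [eapply is_RInt_ext; [|exact P2]|].
    - intros u _. cbv beta. rewrite scal_R_Cmult. toC. unfold step_lin. fold N. rewrite RtoC_mult.
      replace (- (s + 1))%C with (- s - 1)%C by ring. ring.
    - rewrite Rminus_diag, Rminus_0_r, Rplus_0_r. toC.
      change (RtoC (S_real N) * (J - ((RtoC 0 * Rcpow (N + 1) (- s) - RtoC 1 * Rcpow N (- s)) - - J)) = RtoC (S_real N) * Rcpow N (- s))%C.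
      ring. }
  rewrite <- (is_CInt_unique _ _ _ _ I4). apply (is_CInt_unique _ _ _ _ I5).
Qed.

End Series.
End Summatory.

(** * Zeta on the line of real part one *)

(** Decides whether [n] has no divisor between 2 and [N]; the test [Nat.eqb M 0] skips the divisor
    1. For [N >= 1], [rough N (S N)] says that [S N] is prime. *)
Fixpoint rough (N n : nat) : bool :=
  match N with
  | O => true
  | S M => andb (rough M n) (orb (Nat.eqb M 0) (negb (Nat.eqb (n mod S M) 0)))
  end.

Lemma rough_spec N n :
  rough N n = true <-> forall d, (2 <= d <= N)%nat -> ~ Nat.divide d n.
Proof.
  induction N as [|M IH]; simpl; [split; [intros _ d Hd; lia|reflexivity]|].
  rewrite Bool.andb_true_iff, IH. split.
  - intros [H1 H2] d Hd. destruct (Nat.eq_dec d (S M)) as [->|Hne]; [|apply H1; lia].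
    destruct (Nat.eqb_spec M 0); [lia|]. simpl in H2.
    rewrite Bool.negb_true_iff, Nat.eqb_neq in H2.
    intros Hdiv. apply H2. change (n mod S M = 0)%nat. now apply Nat.Lcm0.mod_divide.
  - intros H. split; [intros d Hd; apply H; lia|].
    destruct (Nat.eqb_spec M 0); [reflexivity|]. simpl.
    rewrite Bool.negb_true_iff, Nat.eqb_neq. intros E.
    apply (H (S M)); [lia|]. now apply Nat.Lcm0.mod_divide.
Qed.

Lemma rough_divides N m n : Nat.divide m n -> rough N n = true -> rough N m = true.
Proof.
  rewrite !rough_spec. intros Hm H d Hd Hdm. apply (H d Hd). now apply Nat.divide_trans with m.
Qed.

(** A divisor [d <= N] of the product is coprime to [S N], because their gcd divides [S N] and is at
    most [N]; by Gauss's lemma [d] divides [m]. *)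
Lemma rough_mul_prime N m : rough N (S N) = true -> rough N m = true -> rough N (S N * m) = true.
Proof.
  rewrite !rough_spec. intros Hp Hm d Hd Hdiv. apply (Hm d Hd).
  apply Nat.gauss with (S N); [exact Hdiv|].
  set (g := Nat.gcd d (S N)).
  assert (G1 : Nat.divide g d) by apply Nat.gcd_divide_l.
  assert (G2 : Nat.divide g (S N)) by apply Nat.gcd_divide_r.
  assert (g <= d)%nat by (apply Nat.divide_pos_le; [lia|exact G1]).
  destruct (Nat.eq_dec g 0) as [E|E]; [rewrite E in G1; destruct G1; lia|].
  destruct (Nat.eq_dec g 1) as [E1|E1]; [exact E1|].
  exfalso. apply (Hp g); [lia|exact G2].
Qed.

Definition ind (b : bool) : C := if b then RtoC 1 else RtoC 0.

Definition nterm (s : C) (n : nat) : C := Rcpow (INR n) (- s).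

Lemma Rcpow_mult x y s : 0 < x -> 0 < y -> Rcpow (x * y) s = (Rcpow x s * Rcpow y s)%C.
Proof.
  intros Hx Hy. unfold Rcpow. rewrite ln_mult, RtoC_plus, <- Cexp_plus by assumption. f_equal. ring.
Qed.

(** The sum over indices below [n], so that [psum a 0] is empty. With this convention spreading a
    sequence over the multiples of [p] replaces [n] exactly by [n / p]. *)
Fixpoint psum (a : nat -> C) (n : nat) : C :=
  match n with O => RtoC 0 | S m => (psum a m + a m)%C end.

Lemma sum_n_psum (a : nat -> C) n : sum_n (G := C_AbelianMonoid) a n = psum a (S n).
Proof.
  induction n as [|n IH]; [rewrite sum_O; simpl; toC; ring|].
  rewrite sum_Sn, IH. reflexivity.
Qed.

Lemma is_Cser_psum a l : is_Cser a l <-> forall eps, 0 < eps -> eventually (fun n => Cmod (psum a n - l) < eps).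
Proof.
  split.
  - intros H eps He. destruct (C_eps_filterlim _ _ _ H eps He) as [N HN]. exists (S N). intros [|n] Hn; [lia|].
    rewrite <- sum_n_psum. apply HN. lia.
  - intros H. apply filterlim_C_eps; [apply eventually_filter|]. intros eps He. destruct (H eps He) as [N HN].
    exists N. intros n Hn. rewrite sum_n_psum. apply HN. lia.
Qed.

Lemma psum_sparse (a : nat -> C) p n : (p <> 0)%nat ->
  psum (fun n => if Nat.eqb (S n mod p) 0 then a (S n / p - 1)%nat else RtoC 0) n = psum a (n / p).
Proof.
  intros Hp. induction n as [|n IH]; [now rewrite Nat.Div0.div_0_l|]. simpl psum. rewrite IH.
  destruct (Nat.eqb_spec (S n mod p) 0) as [E|E].
  - assert (S n / p = S (n / p))%nat as ->.
    { pose proof (Nat.div_mod_eq n p). pose proof (Nat.div_mod_eq (S n) p). pose proof (Nat.mod_upper_bound n p Hp).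
      rewrite E, Nat.add_0_r in *. set (a1 := (n / p)%nat) in *. set (b1 := (S n / p)%nat) in *.
      set (r := (n mod p)%nat) in *. assert (p * b1 = p * a1 + S r)%nat by lia.
      assert (b1 > a1)%nat by nia. assert (b1 < a1 + 2)%nat by nia. lia. }
    simpl. now rewrite Nat.sub_0_r.
  - assert (S n / p = n / p)%nat as ->.
    { symmetry. pose proof (Nat.div_mod_eq n p) as E1. pose proof (Nat.mod_upper_bound n p Hp).
      apply Nat.div_unique with (S (n mod p)); [|lia].
      destruct (Nat.eq_dec (S (n mod p)) p) as [E2|E2]; [|lia].
      exfalso. apply E. replace (S n) with ((n / p + 1) * p)%nat by nia. apply Nat.Div0.mod_mul. }
    ring.
Qed.

Lemma is_Cser_sparse (a : nat -> C) p l : (p <> 0)%nat -> is_Cser a l ->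
  is_Cser (fun n => if Nat.eqb (S n mod p) 0 then a (S n / p - 1)%nat else RtoC 0) l.
Proof.
  intros Hp. rewrite !is_Cser_psum. intros H eps He. destruct (H eps He) as [N HN].
  exists (N * p)%nat. intros n Hn. rewrite psum_sparse by exact Hp. apply HN.
  apply Nat.div_le_lower_bound; lia.
Qed.

Section Sieve.
Variable s : C.
Hypothesis Hs : 1 < Re s.

Definition rough_zeta (N : nat) : C := CSeries (fun n => ind (rough N (S n)) * nterm s (S n))%C.

Lemma nterm_mod n : Cmod (nterm s (S n)) = Rpower (INR (S n)) (- Re s).
Proof. unfold nterm. now rewrite Cmod_Rcpow_Rpower, re_opp. Qed.

Lemma ind_le b z : Cmod (ind b * z) <= Cmod z.
Proof. destruct b; simpl; [rewrite Cmult_1_l; lra|rewrite Cmult_0_l, Cmod_0; apply Cmod_ge_0]. Qed.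

Lemma rough_zeta_series N : is_Cser (fun n => ind (rough N (S n)) * nterm s (S n))%C (rough_zeta N).
Proof.
  apply ex_Cser_le with (fun n => Rpower (INR (S n)) (- Re s)); [|now apply Rpower_summable].
  intros n. rewrite <- nterm_mod. apply ind_le.
Qed.

Definition euler_factor (N : nat) : C :=
  if andb (Nat.leb 1 N) (rough N (S N)) then (1 - nterm s (S N))%C else RtoC 1.

(** One step of the sieve of Eratosthenes. If [S N] is prime, the rough numbers that drop out are
    [S N] times the rough numbers, which removes [(S N) ^ (- s)] times the sum. If it is composite,
    its small divisor has already removed its multiples. *)
Lemma rough_zeta_S N : rough_zeta (S N) = (rough_zeta N * euler_factor N)%C.
Proof.
  unfold euler_factor. destruct (Nat.leb_spec 1 N) as [HN|HN].
  2:{ replace N with O by lia. simpl. rewrite Cmult_1_r. reflexivity. }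
  cbn [andb]. destruct (rough N (S N)) eqn:Hp.
  - assert (H1 := rough_zeta_series (S N)).
    assert (H2 := is_Cser_scal (nterm s (S N)) _ _ (is_Cser_sparse _ (S N) _ ltac:(lia) (rough_zeta_series N))).
    assert (H3 := is_Cser_plus _ _ _ _ H1 H2).
    assert (E : rough_zeta N = (rough_zeta (S N) + nterm s (S N) * rough_zeta N)%C).
    { apply (is_Cser_unique _ _ _ (rough_zeta_series N)). eapply is_Cser_ext; [|exact H3].
      intros n. cbv beta. toC. cbn [rough].
      destruct (Nat.eqb_spec N 0); [lia|]. cbn [orb].
      destruct (Nat.eqb_spec (S n mod S N) 0) as [E|E]; cbn [negb].
      - rewrite Bool.andb_false_r. cbn [ind].
        set (m := (S n / S N)%nat).
        assert (Em : S n = (S N * m)%nat).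
        { pose proof (Nat.div_mod_eq (S n) (S N)) as Q. fold m in Q. lia. }
        assert (Hm : (m <> 0)%nat) by (intros Z; rewrite Z in Em; lia).
        replace (S (m - 1)) with m by lia.
        assert (Er : rough N m = rough N (S n)).
        { destruct (rough N m) eqn:R1, (rough N (S n)) eqn:R2; auto.
          - rewrite Em in R2. now rewrite rough_mul_prime in R2.
          - rewrite (rough_divides N m (S n)) in R1; auto. rewrite Em. apply Nat.divide_factor_r. }
        rewrite Er. unfold nterm. rewrite Em, mult_INR, Rcpow_mult.
        + ring.
        + apply lt_0_INR. lia.
        + apply lt_0_INR. lia.
      - rewrite Bool.andb_true_r. ring. }
    replace (rough_zeta (S N)) with (rough_zeta N - nterm s (S N) * rough_zeta N)%C.
    + ring.
    + rewrite E at 1. ring.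
  - rewrite Cmult_1_r.
    apply (is_Cser_unique _ _ _ (rough_zeta_series (S N))).
    eapply is_Cser_ext; [|exact (rough_zeta_series N)]. intros n. cbv beta. f_equal. f_equal.
    cbn [rough]. destruct (Nat.eqb_spec N 0); [lia|]. cbn [orb].
    destruct (Nat.eqb_spec (S n mod S N) 0) as [E|E]; cbn [negb]; [|now rewrite Bool.andb_true_r].
    rewrite Bool.andb_false_r. destruct (rough N (S n)) eqn:R; [|reflexivity].
    rewrite (rough_divides N (S N) (S n)) in Hp; [discriminate| |exact R].
    now apply Nat.Lcm0.mod_divide.
Qed.

Fixpoint euler_prod (N : nat) : C :=
  match N with O => RtoC 1 | S M => (euler_prod M * euler_factor M)%C end.

Lemma rough_zeta_euler N : rough_zeta N = (zeta s * euler_prod N)%C.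
Proof.
  induction N as [|N IH].
  - simpl. rewrite Cmult_1_r. apply CSeries_unique.
    eapply is_Cser_ext; [|exact (zeta_Dirichlet s Hs)]. intros n. cbn [rough ind]. unfold nterm. toC. ring.
  - rewrite rough_zeta_S, IH. simpl. ring.
Qed.

(** Apart from 1, every number up to [N] is removed as a divisor of itself, so what is left is
    dominated by a tail of a convergent series. Together with [rough_zeta_euler] this replaces the
    Euler product by finite products. *)
Lemma rough_zeta_lim : filterlim rough_zeta eventually (locally (T := C_NormedModule) (RtoC 1)).
Proof.
  destruct (Rpower_summable (Re s) Hs) as [B HB].
  apply filterlim_C_eps; [apply eventually_filter|]. intros eps He.
  destruct (series_tail_small _ _ (mkposreal _ He) HB) as [M HM]. cbn [pos] in HM.
  exists (M + 2)%nat. intros N HN. specialize (HM (N - 1)%nat ltac:(lia)).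
  assert (H3 := is_Cser_plus _ _ _ _ (rough_zeta_series N)
    (is_Cser_scal (- (1))%C _ _ (is_series_single (K := C_AbsRing) (V := C_NormedModule) 0 (RtoC 1)))).
  cbv beta in H3.
  match type of H3 with is_series ?a ?l => set (f := a) in H3; replace l with (rough_zeta N - RtoC 1)%C in H3 by ring end.
  assert (Hf : forall n, (n <= N - 1)%nat -> f n = 0).
  { intros [|n] Hn; unfold f.
    - simpl Nat.eqb. cbn [andb]. assert (R : rough N 1 = true).
      { apply rough_spec. intros d Hd Hd1. apply Nat.divide_1_r in Hd1. lia. }
      rewrite R. unfold nterm. change (INR 1) with 1. rewrite Rcpow_1_l. simpl ind. ring.
    - simpl Nat.eqb. cbv iota. assert (R : rough N (S (S n)) = false).
      { destruct (rough N (S (S n))) eqn:R; [|reflexivity]. exfalso.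
        apply (proj1 (rough_spec _ _) R (S (S n))); [lia|apply Nat.divide_refl]. }
      rewrite R. simpl ind. change (zero : C_NormedModule) with (RtoC 0). toC. ring. }
  assert (Hb : forall n, norm (V := C_NormedModule) (f n) <= Rpower (INR (S n)) (- Re s)).
  { intros [|n].
    - rewrite Hf by lia. change (Cmod 0 <= Rpower (INR 1) (- Re s)). rewrite Cmod_0. left. apply exp_pos.
    - unfold f. simpl Nat.eqb. cbv iota. change (zero : C_NormedModule) with (RtoC 0).
      rewrite Cmult_0_r, Cplus_0_r. change (Cmod (ind (rough N (S (S n))) * nterm s (S (S n))) <= Rpower (INR (S (S n))) (- Re s)).
      rewrite <- nterm_mod. apply ind_le. }
  assert (T := series_tail_le (V := C_NormedModule) f _ _ _ (N - 1) H3 HB Hb).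
  assert (E0 : sum_n (G := C_AbelianMonoid) f (N - 1) = RtoC 0).
  { unfold sum_n. rewrite (sum_n_m_ext_loc f (fun _ => zero)).
    - apply (sum_n_m_const_zero (G := C_AbelianMonoid)).
    - intros k Hk. apply Hf. lia. }
  assert (T' : Cmod (rough_zeta N - 1 - sum_n (G := C_AbelianMonoid) f (N - 1)) <=
     B - sum_n (fun n => Rpower (INR (S n)) (- Re s)) (N - 1)) by exact T.
  rewrite E0 in T'. replace (rough_zeta N - 1 - 0)%C with (rough_zeta N - 1)%C in T' by ring.
  apply Rabs_lt_between in HM. lra.
Qed.

End Sieve.

(* The logarithmic derivative of the left-hand side in x is
   -2 * sum x^(k-1) * 2 (1 + cos (k th))^2; over a common denominator its numerator has
   nonnegative coefficients in x and 1 - x. *)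
Lemma three_four_one_real c x : -1 <= c <= 1 -> 0 <= x < 1 ->
  (1 - x) ^ 6 * (1 - 2 * x * c + x ^ 2) ^ 4 * (1 - 2 * x * (2 * c ^ 2 - 1) + x ^ 2) <= 1.
Proof.
  intros Hc Hx.
  set (f := fun x => (1 - x) ^ 6 * (1 - 2 * x * c + x ^ 2) ^ 4 * (1 - 2 * x * (2 * c ^ 2 - 1) + x ^ 2)).
  set (P := fun x => 3 * (1 - 2 * x * c + x ^ 2) * (1 - 2 * x * (2 * c ^ 2 - 1) + x ^ 2)
     + 4 * (c - x) * (1 - x) * (1 - 2 * x * (2 * c ^ 2 - 1) + x ^ 2)
     + (2 * c ^ 2 - 1 - x) * (1 - x) * (1 - 2 * x * c + x ^ 2)).
  assert (HP : forall y, 0 <= y <= 1 -> 0 <= P y).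
  { intros y Hy. set (w := 1 + c). set (u := 1 - c). set (e := 1 - y).
    replace (P y) with (2 * w ^ 2 * e ^ 4 + u * (4 - 14 * w + 20 * w ^ 2) * (e ^ 3 * y)
      + u * (8 - 4 * w + 16 * w ^ 2) * (e ^ 2 * y ^ 2) + 28 * u ^ 2 * w * (e * y ^ 3) + 24 * u ^ 2 * w * y ^ 4)
      by (unfold P, w, u, e; ring).
    assert (0 <= w) by (unfold w; lra). assert (0 <= u) by (unfold u; lra). assert (0 <= e) by (unfold e; lra).
    assert (0 <= 4 - 14 * w + 20 * w ^ 2) by (pose proof (pow2_ge_0 (w - 7/20)); nra).
    assert (0 <= 8 - 4 * w + 16 * w ^ 2) by (pose proof (pow2_ge_0 (w - 1/8)); nra).
    pose proof (pow_le e 2 ltac:(lra)). pose proof (pow_le e 3 ltac:(lra)). pose proof (pow_le e 4 ltac:(lra)).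
    pose proof (pow_le y 2 ltac:(lra)). pose proof (pow_le y 3 ltac:(lra)). pose proof (pow_le y 4 ltac:(lra)).
    pose proof (pow2_ge_0 w). pose proof (pow2_ge_0 u).
    repeat apply Rplus_le_le_0_compat; repeat apply Rmult_le_pos; lra. }
  assert (Hd : forall y, is_derive f y (- 2 * (1 - y) ^ 5 * (1 - 2 * y * c + y ^ 2) ^ 3 * P y)).
  { intros y. unfold f, P. auto_derive; auto. ring. }
  destruct (Req_dec x 0) as [->|Hx0]; [ring_simplify; lra|].
  destruct (MVT_gen f 0 x (fun y => - 2 * (1 - y) ^ 5 * (1 - 2 * y * c + y ^ 2) ^ 3 * P y)) as [y [Hy E]].
  - intros y _. apply Hd.
  - intros y _. apply continuity_pt_filterlim. apply (ex_derive_continuous f). eexists. apply Hd.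
  - rewrite Rmin_left, Rmax_right in Hy by lra.
    change (f x <= 1). assert (f 0 = 1) by (unfold f; ring).
    assert (0 <= (1 - y) ^ 5) by (apply pow_le; lra).
    assert (0 <= 1 - 2 * y * c + y ^ 2) by nra.
    assert (0 <= (1 - 2 * y * c + y ^ 2) ^ 3) by (apply pow_le; lra).
    pose proof (HP y ltac:(lra)).
    assert (0 <= (1 - y) ^ 5 * (1 - 2 * y * c + y ^ 2) ^ 3 * P y * x) by (repeat apply Rmult_le_pos; lra).
    nra.
Qed.

Lemma Cmod_sq z : Cmod z ^ 2 = Re z ^ 2 + Im z ^ 2.
Proof. unfold Cmod. rewrite <- Rsqr_pow2, Rsqr_sqrt; [reflexivity|]. pose proof (pow2_ge_0 (fst z)). pose proof (pow2_ge_0 (snd z)). lra. Qed.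

Lemma three_four_one r th : 0 <= r < 1 ->
  Cmod (1 - RtoC r) ^ 3 * Cmod (1 - RtoC r * (cos th, sin th)) ^ 4 * Cmod (1 - RtoC r * (cos (2 * th), sin (2 * th))) <= 1.
Proof.
  intros Hr.
  assert (Q : forall a, Cmod (1 - RtoC r * (cos a, sin a)) ^ 2 = 1 - 2 * r * cos a + r ^ 2).
  { intros a. rewrite Cmod_sq. simpl. pose proof (sin2_cos2 a) as H. unfold Rsqr in H. 
    transitivity (1 - 2 * r * cos a + r * r * (sin a * sin a + cos a * cos a)); [ring|rewrite H; ring]. }
  set (X := Cmod (1 - RtoC r)). set (Y := Cmod (1 - RtoC r * (cos th, sin th))).
  set (Z := Cmod (1 - RtoC r * (cos (2 * th), sin (2 * th)))).
  assert (HX : X = 1 - r).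
  { unfold X. rewrite <- RtoC_minus, Cmod_R. apply Rabs_pos_eq. lra. }
  assert (HY : Y ^ 2 = 1 - 2 * r * cos th + r ^ 2) by apply Q.
  assert (HZ : Z ^ 2 = 1 - 2 * r * (2 * cos th ^ 2 - 1) + r ^ 2).
  { unfold Z. rewrite Q, cos_2a_cos. ring. }
  assert (Sq : (X ^ 3 * Y ^ 4 * Z) ^ 2 <= 1 ^ 2).
  { replace ((X ^ 3 * Y ^ 4 * Z) ^ 2) with (X ^ 6 * (Y ^ 2) ^ 4 * Z ^ 2) by ring.
    rewrite HX, HY, HZ, pow1. apply three_four_one_real; [|exact Hr]. apply COS_bound. }
  assert (P0 : 0 <= X ^ 3 * Y ^ 4 * Z).
  { apply Rmult_le_pos; [apply Rmult_le_pos; apply pow_le|]; apply Cmod_ge_0. }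
  apply Rsqr_incr_0_var; [|lra]. rewrite !Rsqr_pow2. exact Sq.
Qed.

Lemma nterm_polar sg t n : (2 <= n)%nat ->
  nterm (sg, t) n = (RtoC (Rpower (INR n) (- sg)) * (cos (- t * ln (INR n)), sin (- t * ln (INR n))))%C.
Proof.
  intros Hn. unfold nterm, Rcpow, Cexp, Rpower. apply Ceq; simpl.
  - replace (- sg * ln (INR n) - - t * 0) with (- sg * ln (INR n)) by ring.
    replace (- sg * 0 + - t * ln (INR n)) with (- t * ln (INR n)) by ring. ring.
  - replace (- sg * ln (INR n) - - t * 0) with (- sg * ln (INR n)) by ring.
    replace (- sg * 0 + - t * ln (INR n)) with (- t * ln (INR n)) by ring. ring.
Qed.

Lemma euler_prod_341 sg t N : 1 < sg ->
  Cmod (euler_prod (sg, 0) N) ^ 3 * Cmod (euler_prod (sg, t) N) ^ 4 * Cmod (euler_prod (sg, 2 * t) N) <= 1.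
Proof.
  intros Hs. induction N as [|N IH].
  - simpl. rewrite Cmod_1. lra.
  - cbn [euler_prod]. rewrite !Cmod_mult.
    set (A := Cmod (euler_prod (sg, 0) N)) in *. set (B := Cmod (euler_prod (sg, t) N)) in *.
    set (D := Cmod (euler_prod (sg, 2 * t) N)) in *.
    assert (F : Cmod (euler_factor (sg, 0) N) ^ 3 * Cmod (euler_factor (sg, t) N) ^ 4 * Cmod (euler_factor (sg, 2 * t) N) <= 1).
    { unfold euler_factor. destruct (Nat.leb_spec 1 N) as [HN|HN]; cbn [andb]; [|rewrite Cmod_1; lra].
      destruct (rough N (S N)); [|rewrite Cmod_1; lra].
      rewrite !nterm_polar by lia. set (r := Rpower (INR (S N)) (- sg)). set (l := ln (INR (S N))).
      replace (- (0) * l) with 0 by ring. rewrite cos_0, sin_0.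
      replace (RtoC r * (1, 0))%C with (RtoC r) by (apply Ceq; simpl; ring).
      replace (- (2 * t) * l) with (2 * (- t * l)) by ring.
      apply three_four_one. split; [left; apply exp_pos|].
      unfold r, Rpower. apply exp_lt_1. fold l.
      assert (0 < l); [|nra]. unfold l. rewrite <- ln_1. apply ln_increasing; [lra|].
      apply (lt_INR 1). lia. }
    set (A' := Cmod (euler_factor (sg, 0) N)) in *. set (B' := Cmod (euler_factor (sg, t) N)) in *.
    set (D' := Cmod (euler_factor (sg, 2 * t) N)) in *.
    replace ((A * A') ^ 3 * (B * B') ^ 4 * (D * D')) with ((A ^ 3 * B ^ 4 * D) * (A' ^ 3 * B' ^ 4 * D')) by ring.
    assert (0 <= A' ^ 3 * B' ^ 4 * D').
    { apply Rmult_le_pos; [apply Rmult_le_pos; apply pow_le|]; apply Cmod_ge_0. }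
    assert (0 <= A ^ 3 * B ^ 4 * D).
    { apply Rmult_le_pos; [apply Rmult_le_pos; apply pow_le|]; apply Cmod_ge_0. }
    nra.
Qed.

(** The 3-4-1 combination of the numbers [zeta * euler_prod] tends to 1, and that of the finite
    products is at most 1, so that of the values of [zeta] is at least 1. *)
Lemma zeta_341 sg t : 1 < sg ->
  1 <= Cmod (zeta (sg, 0)) ^ 3 * Cmod (zeta (sg, t)) ^ 4 * Cmod (zeta (sg, 2 * t)).
Proof.
  intros Hs.
  assert (L : forall y, is_lim_seq (fun N => Cmod (rough_zeta (sg, y) N)) 1).
  { intros y. rewrite <- Cmod_1.
    apply (filterlim_comp _ _ _ (rough_zeta (sg, y)) Cmod _ (locally (T := C_NormedModule) (RtoC 1)) _).
    - now apply rough_zeta_lim.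
    - apply (filterlim_norm (V := C_NormedModule)). }
  assert (Lp : forall (u : nat -> R) k, is_lim_seq u 1 -> is_lim_seq (fun n => u n ^ k) 1).
  { intros u k Hu. induction k as [|k IH]; simpl; [apply is_lim_seq_const|].
    replace (Finite 1) with (Finite (1 * 1)) by (f_equal; ring). now apply is_lim_seq_mult'. }
  assert (LL : is_lim_seq (fun N => Cmod (rough_zeta (sg, 0) N) ^ 3 * Cmod (rough_zeta (sg, t) N) ^ 4 * Cmod (rough_zeta (sg, 2 * t) N)) 1).
  { replace (Finite 1) with (Finite (1 * 1 * 1)) by (f_equal; ring).
    apply is_lim_seq_mult'; [apply is_lim_seq_mult'; apply Lp|]; apply L. }
  refine (is_lim_seq_le _ (fun _ => _) 1 (Finite _) _ LL (is_lim_seq_const _)).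
  intros N. rewrite !rough_zeta_euler by exact Hs. rewrite !Cmod_mult.
  pose proof (euler_prod_341 sg t N Hs) as H.
  set (A := Cmod (euler_prod (sg, 0) N)) in *. set (B := Cmod (euler_prod (sg, t) N)) in *.
  set (D := Cmod (euler_prod (sg, 2 * t) N)) in *.
  set (A' := Cmod (zeta (sg, 0))) in *. set (B' := Cmod (zeta (sg, t))) in *. set (D' := Cmod (zeta (sg, 2 * t))) in *.
  replace ((A' * A) ^ 3 * (B' * B) ^ 4 * (D' * D)) with ((A' ^ 3 * B' ^ 4 * D') * (A ^ 3 * B ^ 4 * D)) by ring.
  assert (0 <= A' ^ 3 * B' ^ 4 * D').
  { apply Rmult_le_pos; [apply Rmult_le_pos; apply pow_le|]; apply Cmod_ge_0. }
  nra.
Qed.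

(** In [zeta_saw] the sawtooth integral has modulus at most 1 here, so the pole comes from the
    rational term alone. *)
Lemma zeta_near_1 : exists K, 0 < K /\ forall d, 0 < d <= 1 -> Cmod (zeta (RtoC (1 + d))) <= K / d.
Proof.
  exists 20. split; [lra|]. intros d Hd.
  assert (Hne : RtoC (1 + d) <> RtoC 1) by (intros E; apply (f_equal Re) in E; simpl in E; lra).
  destruct (zeta_saw (RtoC (1 + d)) ltac:(simpl; lra) Hne) as [J [HJ Hz]].
  assert (HJ1 : Cmod J <= 1).
  { assert (T := saw_int_lim (RtoC (1 + d)) J ltac:(simpl; lra) HJ).
    assert (Q : Rbar_le (Cmod J) 1).
    { apply (is_lim_le_loc (fun X => Cmod (saw_int (RtoC (1 + d)) X)) (fun _ => 1) p_infty).
      - exists 1. intros X HX. pose proof (saw_int_tail (RtoC (1 + d)) 1 X ltac:(simpl; lra) ltac:(lra)) as B.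
        rewrite saw_int_1 in B. replace (saw_int (RtoC (1 + d)) X - 0)%C with (saw_int (RtoC (1 + d)) X) in B by ring.
        apply Rle_trans with (1 := B). simpl. unfold Rpower. rewrite ln_1, Rmult_0_r, exp_0.
        apply Rmult_le_reg_r with (1 + (1 + d)); [lra|].
        replace (1 / (1 + (1 + d)) * (1 + (1 + d))) with 1 by (field; lra). lra.
      - apply (filterlim_comp _ _ _ (saw_int (RtoC (1 + d))) Cmod _ (locally (T := C_NormedModule) J) _).
        + exact T.
        + apply (filterlim_norm (V := C_NormedModule)).
      - apply is_lim_const. }
    exact Q. }
  rewrite Hz. unfold Cminus at 1. eapply Rle_trans; [apply Cmod_triangle|]. rewrite Cmod_opp, !Cmod_mult.
  replace (RtoC (1 + d) + 1)%C with (RtoC (2 + d)) by (apply Ceq; simpl; ring).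
  replace (RtoC (1 + d) - 1)%C with (RtoC d) by (apply Ceq; simpl; ring).
  rewrite <- RtoC_mult, <- RtoC_div, !Cmod_R by lra.
  rewrite !Rabs_pos_eq; try lra.
  2:{ apply Rmult_le_pos; [lra|]. left. apply Rinv_0_lt_compat. lra. }
  pose proof (Cmod_ge_0 J).
  apply Rmult_le_reg_r with d; [lra|].
  replace (((2 + d) / (2 * d) + (1 + d) * (2 + d) * Cmod J) * d) with ((2 + d) / 2 + (1 + d) * (2 + d) * d * Cmod J) by (field; lra).
  replace (20 / d * d) with 20 by (field; lra).
  assert ((1 + d) * (2 + d) * d <= 6) by nra.
  assert (0 <= (1 + d) * (2 + d) * d) by (repeat apply Rmult_le_pos; lra). nra.
Qed.

Lemma Cdiff_local_bound (f : C -> C) z : Cdifferentiable f z ->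
  exists K d, 0 < K /\ 0 < d /\ forall h, Cmod h < d -> Cmod (f (z + h) - f z)%C <= K * Cmod h.
Proof.
  intros [l [_ H]].
  specialize (H z (fun P HP => HP) (mkposreal 1 Rlt_0_1)). destruct H as [[d Hd] H].
  exists (Cmod l + 1), d. pose proof (Cmod_ge_0 l). repeat split; [lra|exact Hd|].
  intros h Hh. specialize (H (z + h)%C).
  assert (B : ball (M := AbsRing_UniformSpace C_AbsRing) z d (z + h)%C).
  { change (Cmod (z + h - z) < d). replace (z + h - z)%C with h by ring. exact Hh. }
  specialize (H B). simpl in H.
  change (Cmod (f (z + h) - f z - (z + h - z) * l)%C <= 1 * Cmod (z + h - z)%C) in H.
  replace (z + h - z)%C with h in H by ring.
  replace (f (z + h) - f z)%C with ((f (z + h) - f z - h * l) + h * l)%C by ring.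
  eapply Rle_trans; [apply Cmod_triangle|]. rewrite Cmod_mult. nra.
Qed.

(** A zero at [1 + i t] would make the fourth power [O(d ^ 4)] against a third power of order
    [d ^ (-3)] from the pole, so the product in [zeta_341] would tend to 0. *)
Lemma zeta_1_neq_0 t : t <> 0 -> zeta (1, t) <> 0.
Proof.
  intros Ht E.
  assert (N1 : (1, t) <> RtoC 1) by (intros Q; apply (f_equal Im) in Q; simpl in Q; lra).
  assert (N2 : (1, 2 * t) <> RtoC 1) by (intros Q; apply (f_equal Im) in Q; simpl in Q; lra).
  destruct zeta_near_1 as [K0 [HK0 H0]].
  destruct (Cdiff_local_bound zeta _ (zeta_Cdifferentiable _ N1)) as [K1 [d1 [HK1 [Hd1 H1]]]].
  destruct (Cdiff_local_bound zeta _ (zeta_Cdifferentiable _ N2)) as [K2 [d2 [HK2 [Hd2 H2]]]].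
  set (M := Cmod (zeta (1, 2 * t)) + K2).
  assert (HM : 0 < M) by (unfold M; pose proof (Cmod_ge_0 (zeta (1, 2 * t))); lra).
  set (Q := K0 ^ 3 * K1 ^ 4 * M).
  assert (HQ : 0 < Q) by (unfold Q; apply Rmult_lt_0_compat; [apply Rmult_lt_0_compat; apply pow_lt|]; assumption).
  (* The 3-4-1 product is at most [Q * d], and [d <= / (2 * Q)] brings it down to 1/2. *)
  set (d := Rmin (/ (2 * Q)) (Rmin 1 (Rmin (d1 / 2) (d2 / 2)))).
  assert (D1 : d <= / (2 * Q)) by apply Rmin_l.
  assert (D2 : d <= Rmin 1 (Rmin (d1 / 2) (d2 / 2))) by apply Rmin_r.
  pose proof (Rmin_l 1 (Rmin (d1 / 2) (d2 / 2))). pose proof (Rmin_r 1 (Rmin (d1 / 2) (d2 / 2))).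
  pose proof (Rmin_l (d1 / 2) (d2 / 2)). pose proof (Rmin_r (d1 / 2) (d2 / 2)).
  assert (Hd : 0 < d).
  { unfold d. repeat apply Rmin_case; try lra. apply Rinv_0_lt_compat. lra. }
  pose proof (zeta_341 (1 + d) t ltac:(lra)) as HZ.
  assert (B0 := H0 d ltac:(lra)). change (RtoC (1 + d)) with (1 + d, 0) in B0.
  assert (Ed : Cmod (RtoC d) = d) by (rewrite Cmod_R; apply Rabs_pos_eq; lra).
  assert (B1 : Cmod (zeta (1 + d, t)) <= K1 * d).
  { specialize (H1 (RtoC d) ltac:(lra)). rewrite E, Ed in H1.
    replace ((1, t) + RtoC d)%C with ((1 + d, t) : C) in H1 by (apply Ceq; simpl; ring).
    unfold Cminus in H1. rewrite Copp_0, Cplus_0_r in H1. exact H1. }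
  assert (B2 : Cmod (zeta (1 + d, 2 * t)) <= M).
  { specialize (H2 (RtoC d) ltac:(lra)). rewrite Ed in H2.
    replace ((1, (2 * t)%R) + RtoC d)%C with ((1 + d, 2 * t) : C) in H2 by (apply Ceq; simpl; ring).
    set (z1 := zeta (1 + d, 2 * t)) in *. set (z0 := zeta (1, 2 * t)) in *.
    replace z1 with (z0 + (z1 - z0))%C by ring.
    eapply Rle_trans; [apply Cmod_triangle|]. unfold M. fold z0. nra. }
  pose proof (Cmod_ge_0 (zeta (1 + d, 0))). pose proof (Cmod_ge_0 (zeta (1 + d, t))). pose proof (Cmod_ge_0 (zeta (1 + d, 2 * t))).
  assert (Cmod (zeta (1 + d, 0)) ^ 3 * Cmod (zeta (1 + d, t)) ^ 4 * Cmod (zeta (1 + d, 2 * t)) <= (K0 / d) ^ 3 * (K1 * d) ^ 4 * M).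
  { apply Rmult_le_compat; auto.
    - apply Rmult_le_pos; now apply pow_le.
    - apply Rmult_le_compat; try (now apply pow_le); apply pow_incr; lra. }
  replace ((K0 / d) ^ 3 * (K1 * d) ^ 4 * M) with (Q * d) in * by (unfold Q; field; lra).
  assert (Q * d <= Q * / (2 * Q)) by (apply Rmult_le_compat_l; lra).
  replace (Q * / (2 * Q)) with (1 / 2) in * by (field; lra). lra.
Qed.

(** * Mellin transforms of cosine series *)

Lemma one_minus_cos_le y : 0 <= 1 - cosk 1 y <= 2 * PI ^ 2 * y ^ 2.
Proof.
  unfold cosk. replace (2 * PI * 1 * y) with (2 * (PI * y)) by ring. rewrite cos_2a_sin.
  set (x := PI * y). replace (2 * PI ^ 2 * y ^ 2) with (2 * x ^ 2) by (unfold x; ring).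
  assert (sin x ^ 2 <= x ^ 2).
  { rewrite <- (pow2_abs (sin x)), <- (pow2_abs x). apply pow_incr. split; [apply Rabs_pos|].
    assert (P : forall z, 0 <= z -> Rabs (sin z) <= z).
    { intros z Hz. destruct (Req_dec z 0) as [->|Hz0]; [rewrite sin_0, Rabs_R0; lra|].
      pose proof (sin_lt_x z ltac:(lra)). apply Rabs_le. split; [|lra].
      destruct (Rle_dec z 1).
      - assert (0 <= sin z); [|lra]. apply sin_ge_0; pose proof PI2_1; lra.
      - pose proof (SIN_bound z). lra. }
    destruct (Rle_dec 0 x) as [Hx|Hx].
    - rewrite (Rabs_pos_eq x) by lra. now apply P.
    - rewrite <- Rabs_Ropp, <- sin_neg, (Rabs_left x) by lra. apply P. lra. }
  pose proof (pow2_ge_0 (sin x)). nra.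
Qed.

Lemma Rcpow_Rinv x v : 0 < x -> Rcpow (/ x) v = Rcpow x (- v).
Proof. intros Hx. unfold Rcpow. rewrite ln_Rinv, RtoC_opp by exact Hx. f_equal. ring. Qed.

Definition cos_int (w : C) (a b : R) : C :=
  RInt (V := C_R_CompleteNormedModule) (fun y => (RtoC (1 - cosk 1 y) * Rcpow y (- (2 + w)))%C) a b.

Section CosineMellin.
Variable w : C.
Hypothesis Hw : - (1/2) < Re w < 0.

Lemma cos_int_correct a b : 0 < a -> 0 < b ->
  is_CInt (fun y => (RtoC (1 - cosk 1 y) * Rcpow y (- (2 + w)))%C) a b (cos_int w a b).
Proof.
  intros Ha Hb. apply is_CInt_cont. intros x Hx.
  assert (0 < x) by (destruct Hx as [Hx _]; apply Rlt_le_trans with (2 := Hx); apply Rmin_case; lra).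
  apply continuous_Rmult_C; [auto with rcont|now apply continuous_Rcpow].
Qed.

Lemma re_2w : Re (- (2 + w)) = - 2 - Re w.
Proof. rewrite re_opp, re_plus, re_RtoC. ring. Qed.

Lemma cos_int_small a b : 0 < a <= b -> Cmod (cos_int w a b) <= 2 * PI ^ 2 * Rpower b (1 - Re w).
Proof.
  intros Hab.
  eapply Rle_trans; [apply (CInt_pow_bound _ a b _ (2 * PI ^ 2) (- Re w)) with (4 := cos_int_correct a b ltac:(lra) ltac:(lra)); [exact Hab|lra|]|].
  - intros x Hx. rewrite Cmod_mult, Cmod_R, Cmod_Rcpow_Rpower, re_2w.
    destruct (one_minus_cos_le x) as [H1 H2]. rewrite Rabs_pos_eq by lra.
    replace (2 * PI ^ 2 * Rpower x (- Re w)) with (2 * PI ^ 2 * x ^ 2 * Rpower x (- 2 - Re w)).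
    + apply Rmult_le_compat_r; [left; apply exp_pos|exact H2].
    + rewrite Rmult_assoc. f_equal. rewrite <- (Rpower_pow 2 x) by lra. rewrite <- Rpower_plus. f_equal. simpl; ring.
  - replace (- Re w + 1) with (1 - Re w) by ring.
    assert (HP : 0 <= 2 * PI ^ 2) by (pose proof (pow2_ge_0 PI); lra).
    apply Rmult_le_compat_l; [exact HP|].
    pose proof (exp_pos ((1 - Re w) * ln a)) as E1. pose proof (exp_pos ((1 - Re w) * ln b)) as E2.
    change (exp ((1 - Re w) * ln a)) with (Rpower a (1 - Re w)) in E1.
    change (exp ((1 - Re w) * ln b)) with (Rpower b (1 - Re w)) in E2.
    apply Rmult_le_reg_r with (1 - Re w); [lra|].
    replace ((Rpower b (1 - Re w) - Rpower a (1 - Re w)) / (1 - Re w) * (1 - Re w)) with (Rpower b (1 - Re w) - Rpower a (1 - Re w)) by (field; lra).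
    nra.
Qed.

Lemma pow_tail_le M a b : 0 <= M -> 0 < a <= b ->
  M * ((Rpower b (- 2 - Re w + 1) - Rpower a (- 2 - Re w + 1)) / (- 2 - Re w + 1)) <= 2 * M * Rpower a (- (1 + Re w)).
Proof.
  intros HM Hab. replace (- 2 - Re w + 1) with (- (1 + Re w)) by ring.
  rewrite (Rmult_comm 2 M), Rmult_assoc. apply Rmult_le_compat_l; [exact HM|].
  pose proof (exp_pos (- (1 + Re w) * ln a)) as E1. pose proof (exp_pos (- (1 + Re w) * ln b)) as E2.
  change (exp (- (1 + Re w) * ln a)) with (Rpower a (- (1 + Re w))) in E1.
  change (exp (- (1 + Re w) * ln b)) with (Rpower b (- (1 + Re w))) in E2.
  apply Rmult_le_reg_r with (1 + Re w); [lra|].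
  match goal with |- ?l <= _ => replace l with (Rpower a (- (1 + Re w)) - Rpower b (- (1 + Re w))) by (field; lra) end.
  nra.
Qed.

Lemma cos_int_large a b : 0 < a <= b -> Cmod (cos_int w a b) <= 4 * Rpower a (- (1 + Re w)).
Proof.
  intros Hab.
  eapply Rle_trans; [apply (CInt_pow_bound _ a b _ 2 (- 2 - Re w)) with (4 := cos_int_correct a b ltac:(lra) ltac:(lra)); [exact Hab|lra|]|].
  - intros x Hx. rewrite Cmod_mult, Cmod_R, Cmod_Rcpow_Rpower, re_2w.
    destruct (one_minus_cos_le x) as [H1 _]. rewrite Rabs_pos_eq by lra.
    apply Rmult_le_compat_r; [left; apply exp_pos|]. unfold cosk. pose proof (COS_bound (2 * PI * 1 * x)). lra.
  - eapply Rle_trans; [apply pow_tail_le; [lra|exact Hab]|lra].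
Qed.

Lemma cos_int_Chasles a b c : 0 < a -> 0 < b -> 0 < c -> cos_int w a c = (cos_int w a b + cos_int w b c)%C.
Proof.
  intros Ha Hb Hc. apply is_CInt_unique.
  apply (is_RInt_Chasles (V := C_R_NormedModule) _ a b c); now apply cos_int_correct.
Qed.

Definition cos_bd : R := 2 * PI ^ 2 + 4.

(** Near 0 the integrand is [O(y ^ (- Re w))] because [1 - cos] is quadratic, and at infinity it is
    [O(y ^ (- 2 - Re w))]. The bound does not depend on the truncation, which is what the domination
    in [cosine_mellin] uses. *)
Lemma cos_int_bounded a b : 0 < a <= b -> Cmod (cos_int w a b) <= cos_bd.
Proof.
  intros Hab. assert (HP : 0 <= 2 * PI ^ 2) by (pose proof (pow2_ge_0 PI); lra).
  assert (S1 : forall a b, 0 < a <= b -> b <= 1 -> Cmod (cos_int w a b) <= 2 * PI ^ 2).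
  { intros a' b' H1 H2. eapply Rle_trans; [now apply cos_int_small|].
    rewrite <- (Rmult_1_r (2 * PI ^ 2)) at 2. apply Rmult_le_compat_l; [exact HP|].
    apply Rpower_le_1; lra. }
  assert (S2 : forall a b, 1 <= a <= b -> Cmod (cos_int w a b) <= 4).
  { intros a' b' H1. eapply Rle_trans; [apply cos_int_large; lra|].
    rewrite <- (Rmult_1_r 4) at 2. apply Rmult_le_compat_l; [lra|].
    apply Rle_trans with (Rpower a' 0); [apply Rle_Rpower; lra|rewrite Rpower_O; lra]. }
  unfold cos_bd. destruct (Rle_dec b 1) as [H1|H1].
  - specialize (S1 a b Hab H1). lra.
  - destruct (Rle_dec 1 a) as [H2|H2].
    + specialize (S2 a b ltac:(lra)). lra.
    + rewrite (cos_int_Chasles a 1 b) by lra. eapply Rle_trans; [apply Cmod_triangle|].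
      specialize (S1 a 1 ltac:(lra) ltac:(lra)). specialize (S2 1 b ltac:(lra)). lra.
Qed.

Lemma cos_int_mod_sym a b : 0 < a -> 0 < b -> Cmod (cos_int w a b) = Cmod (cos_int w b a).
Proof.
  intros Ha Hb. rewrite <- (Cmod_opp (cos_int w b a)). f_equal. apply is_CInt_unique.
  apply (is_RInt_swap (V := C_R_NormedModule)). now apply cos_int_correct.
Qed.

Lemma cos_int_small_sym d a b : 0 < a <= d -> 0 < b <= d ->
  Cmod (cos_int w a b) <= 2 * PI ^ 2 * Rpower d (1 - Re w).
Proof.
  assert (W : forall a b, 0 < a <= b -> b <= d -> Cmod (cos_int w a b) <= 2 * PI ^ 2 * Rpower d (1 - Re w)).
  { intros x y H1 H2. eapply Rle_trans; [now apply cos_int_small|].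
    apply Rmult_le_compat_l; [pose proof (pow2_ge_0 PI); lra|]. apply Rle_Rpower_l; lra. }
  intros Ha Hb. destruct (Rle_dec a b) as [H|H].
  - apply W; lra.
  - rewrite cos_int_mod_sym by lra. apply W; lra.
Qed.

Lemma cos_int_large_sym X a b : 0 < X -> X <= a -> X <= b ->
  Cmod (cos_int w a b) <= 4 * Rpower X (- (1 + Re w)).
Proof.
  intros HX.
  assert (W : forall a b, X <= a -> a <= b -> Cmod (cos_int w a b) <= 4 * Rpower X (- (1 + Re w))).
  { intros x y H1 H2. eapply Rle_trans; [apply cos_int_large; lra|].
    apply Rmult_le_compat_l; [lra|]. rewrite !Rpower_Ropp. apply Rinv_le_contravar; [apply exp_pos|].
    apply Rle_Rpower_l; lra. }
  intros Ha Hb. destruct (Rle_dec a b) as [H|H].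
  - apply W; lra.
  - rewrite cos_int_mod_sym by lra. apply W; lra.
Qed.

Lemma cos_int_cauchy eps : 0 < eps -> exists d X, 0 < d /\ 1 <= X /\
  forall a b a' b', 0 < a < d -> 0 < a' < d -> X < b -> X < b' ->
    Cmod (cos_int w a' b' - cos_int w a b) < eps.
Proof.
  intros He. pose proof (pow2_ge_0 PI) as HPI.
  destruct (Rpower_neg_small (1 + Re w) (eps / 16) ltac:(lra) ltac:(lra)) as [X [HX1 HX]].
  destruct (Rpower_neg_small (1 - Re w) (eps / (4 * (2 * PI ^ 2 + 1))) ltac:(lra)) as [Y [HY1 HY]].
  { apply Rdiv_lt_0_compat; lra. }
  assert (HiY : 0 < / Y) by (apply Rinv_0_lt_compat; lra).
  exists (/ Y), X. split; [exact HiY|]. split; [exact HX1|].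
  intros a b a' b' Ha Ha' Hb Hb'.
  specialize (HX X ltac:(lra)). specialize (HY Y ltac:(lra)).
  assert (B1 := cos_int_small_sym (/ Y) a' a ltac:(lra) ltac:(lra)).
  assert (B2 := cos_int_large_sym X b b' ltac:(lra) ltac:(lra) ltac:(lra)).
  assert (EY : Rpower (/ Y) (1 - Re w) = Rpower Y (- (1 - Re w))).
  { unfold Rpower. rewrite ln_Rinv by lra. f_equal. ring. }
  rewrite EY in B1.
  rewrite (cos_int_Chasles a' a b'), (cos_int_Chasles a b b') by lra.
  replace (cos_int w a' a + (cos_int w a b + cos_int w b b') - cos_int w a b)%C with (cos_int w a' a + cos_int w b b')%C by ring.
  eapply Rle_lt_trans; [apply Cmod_triangle|].
  assert (2 * PI ^ 2 * Rpower Y (- (1 - Re w)) <= eps / 4).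
  { pose proof (exp_pos (- (1 - Re w) * ln Y)) as Ep. change (exp (- (1 - Re w) * ln Y)) with (Rpower Y (- (1 - Re w))) in Ep.
    apply Rle_trans with ((2 * PI ^ 2 + 1) * (eps / (4 * (2 * PI ^ 2 + 1)))).
    - apply Rmult_le_compat; lra.
    - right. field. lra. }
  lra.
Qed.

(** Scaling by the frequency [n + 1] turns the window [[1 / (N + 1), N + 1]] into the one displayed.
    All these windows exhaust the half-line, so the Cauchy estimate gives them a single limit [P],
    the full integral. *)
Lemma cos_int_lim : exists P : C, Cmod P <= cos_bd /\
  forall n : nat, filterlim (fun N => cos_int w (INR (S n) * / INR (S N)) (INR (S n) * INR (S N))) eventually
    (locally (T := C_NormedModule) P).
Proof.
  assert (Hab : forall n N, 0 < INR (S n) * / INR (S N) <= INR (S n) * INR (S N)).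
  { intros n N. pose proof (Spos n). pose proof (Spos N).
    assert (0 < / INR (S N)) by (apply Rinv_0_lt_compat; lra).
    assert (/ INR (S N) <= 1) by (rewrite <- Rinv_1; apply Rinv_le_contravar; lra).
    split; [apply Rmult_lt_0_compat; lra|]. apply Rmult_le_compat_l; lra. }
  assert (Hev : forall n d X, 0 < d -> 1 <= X -> eventually (fun N => 0 < INR (S n) * / INR (S N) < d /\ X < INR (S n) * INR (S N))).
  { intros n d X Hd HX. pose proof (Spos n) as Hn.
    destruct (INR_unbounded (Rmax X (INR (S n) / d))) as [M HM]. exists M. intros N HN.
    assert (HNM : INR M <= INR (S N)) by (apply le_INR; lia).
    assert (H1 := Rmax_l X (INR (S n) / d)). assert (H2 := Rmax_r X (INR (S n) / d)).
    pose proof (Spos N) as HSN. split; [split|].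
    - apply Hab.
    - apply Rmult_lt_reg_r with (INR (S N)); [lra|]. rewrite Rmult_assoc, Rinv_l, Rmult_1_r by lra.
      apply Rle_lt_trans with (d * (INR (S n) / d)); [right; field; lra|]. apply Rmult_lt_compat_l; lra.
    - nra. }
  set (u := fun N => cos_int w (INR 1 * / INR (S N)) (INR 1 * INR (S N))).
  destruct (proj1 (filterlim_locally_cauchy (U := C_R_CompleteNormedModule) (F := eventually) u)) as [P HP].
  { intros eps. destruct (cos_int_cauchy eps (cond_pos eps)) as [d [X [Hd [HX HC]]]].
    exists (fun N => 0 < INR 1 * / INR (S N) < d /\ X < INR 1 * INR (S N)). split; [now apply Hev|].
    intros N N' [H1 H2] [H3 H4]. apply Cball_of_Cmod. exact (HC _ _ _ _ H1 H3 H2 H4). }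
  assert (HP' : filterlim u eventually (locally (T := C_NormedModule) P)) by exact HP.
  exists P. split.
  - apply (is_lim_seq_le (fun N => Cmod (u N)) (fun _ => cos_bd) (Cmod P) cos_bd).
    + intros N. exact (cos_int_bounded _ _ (Hab O N)).
    + apply (filterlim_comp _ _ _ u Cmod _ (locally (T := C_NormedModule) P) _); [exact HP'|].
      apply (filterlim_norm (V := C_NormedModule)).
    + apply is_lim_seq_const.
  - intros n. apply filterlim_C_eps; [apply eventually_filter|]. intros eps He.
    destruct (cos_int_cauchy (eps / 2) ltac:(lra)) as [d [X [Hd [HX HC]]]].
    generalize (filter_and _ _ (filter_and _ _ (Hev O d X Hd HX) (Hev n d X Hd HX)) (C_eps_filterlim _ _ _ HP' (eps / 2) ltac:(lra))).
    apply filter_imp. intros N [[[H1 H2] [H3 H4]] H5].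
    specialize (HC _ _ _ _ H1 H3 H2 H4).
    match goal with |- Cmod (?q - P) < _ => replace (q - P)%C with ((q - u N) + (u N - P))%C by ring end.
    eapply Rle_lt_trans; [apply Cmod_triangle|]. unfold u at 1. lra.
Qed.

Lemma cos_int_scale n a b : 0 < a <= b ->
  is_CInt (fun x => (RtoC (1 - cosk (Z.of_nat (S n)) x) * Rcpow x (- (2 + w)))%C) a b
    (Rcpow (INR (S n)) (1 + w) * cos_int w (INR (S n) * a) (INR (S n) * b))%C.
Proof.
  intros Hab. pose proof (Spos n) as Hn. set (m := INR (S n)) in *.
  assert (G := cos_int_correct (m * a) (m * b) ltac:(nra) ltac:(nra)).
  rewrite <- (Rplus_0_r (m * a)), <- (Rplus_0_r (m * b)) in G at 1.
  apply (is_RInt_comp_lin (V := C_R_NormedModule)) in G.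
  apply (is_CInt_Cmult _ _ _ _ (Rcpow m (1 + w))) in G.
  eapply is_RInt_ext; [|exact G]. intros x Hx. rewrite Rmin_left, Rmax_right in Hx by lra.
  cbv beta. rewrite scal_R_Cmult, Rplus_0_r. toC.
  replace (cosk 1 (m * x)) with (cosk (Z.of_nat (S n)) x).
  2:{ unfold cosk. rewrite <- INR_IZR_INZ. fold m. f_equal. ring. }
  rewrite Rcpow_mult by lra.
  transitivity (RtoC m * (Rcpow m (1 + w) * Rcpow m (- (2 + w))) * (RtoC (1 - cosk (Z.of_nat (S n)) x) * Rcpow x (- (2 + w))))%C; [ring|].
  rewrite <- Rcpow_plus. replace (1 + w + - (2 + w))%C with (RtoC (- (1))).
  2:{ replace (RtoC 2) with (RtoC 1 + RtoC 1)%C by (rewrite <- RtoC_plus; f_equal; ring). rewrite RtoC_opp. ring. }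
  rewrite Rcpow_R. replace (exp (- (1) * ln m)) with (/ m).
  2:{ replace (- (1) * ln m) with (- ln m) by ring. rewrite exp_Ropp, exp_ln by lra. reflexivity. }
  rewrite <- RtoC_mult, Rinv_r by lra. ring.
Qed.

Definition trunc_mellin (f : R -> R) (N : nat) : C :=
  RInt (V := C_R_CompleteNormedModule) (fun x => (RtoC (f x) * Rcpow x (- (2 + w)))%C) (/ INR (S N)) (INR (S N)).

Lemma inv_le_self N : 0 < / INR (S N) <= INR (S N) /\ / INR (S N) <= 1.
Proof.
  pose proof (Spos N). assert (/ INR (S N) <= 1) by (rewrite <- Rinv_1; apply Rinv_le_contravar; lra).
  assert (0 < / INR (S N)) by (apply Rinv_0_lt_compat; lra). lra.
Qed.

Lemma mellin_int_correct f a b : (forall x, continuous f x) -> 0 < a -> 0 < b ->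
  is_CInt (fun x => (RtoC (f x) * Rcpow x (- (2 + w)))%C) a b
   (RInt (V := C_R_CompleteNormedModule) (fun x => (RtoC (f x) * Rcpow x (- (2 + w)))%C) a b).
Proof.
  intros Hf Ha Hb. apply is_CInt_cont. intros x Hx.
  assert (0 < x) by (destruct Hx as [Hx _]; apply Rlt_le_trans with (2 := Hx); apply Rmin_case; lra).
  apply continuous_Rmult_C; [apply Hf|now apply continuous_Rcpow].
Qed.

(* Mellin transform of a cosine series: scaling factors out one universal constant [P]. *)
Lemma cosine_mellin (P : C) (f : R -> R) (k : nat -> R) :
  Cmod P <= cos_bd ->
  (forall n : nat, filterlim (fun N => cos_int w (INR (S n) * / INR (S N)) (INR (S n) * INR (S N))) eventually
    (locally (T := C_NormedModule) P)) ->
  (forall x, continuous f x) ->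
  (forall x, is_series (fun n => k n * (1 - cosk (Z.of_nat (S n)) x)) (f x)) ->
  ex_series (fun n => Rabs (k n) * Rpower (INR (S n)) (1 + Re w)) ->
  filterlim (trunc_mellin f) eventually (locally (T := C_NormedModule)
    (P * CSeries (fun n => RtoC (k n) * Rcpow (INR (S n)) (1 + w)))%C).
Proof.
  intros HPb HP Hf Hser Hk.
  assert (Hre : Re (1 + w) = 1 + Re w) by (rewrite re_plus; reflexivity).
  assert (Hk1 : ex_series (fun n => Rabs (k n))).
  { apply (ex_series_le (V := R_CompleteNormedModule) _ _) with (2 := Hk). intros n.
    change (Rabs (Rabs (k n)) <= Rabs (k n) * Rpower (INR (S n)) (1 + Re w)). rewrite Rabs_Rabsolu.
    pose proof (one_le_Rpower (INR (S n)) (1 + Re w) (Spos n) ltac:(lra)). pose proof (Rabs_pos (k n)). nra. }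
  (* The data for [tannery]: [u N n] is the contribution of frequency [n + 1] to the truncated
     transform, [v n] its limit, [b n] a common bound. *)
  set (u := fun N n => (RtoC (k n) * (Rcpow (INR (S n)) (1 + w) * cos_int w (INR (S n) * / INR (S N)) (INR (S n) * INR (S N))))%C).
  set (v := fun n => (P * (RtoC (k n) * Rcpow (INR (S n)) (1 + w)))%C).
  set (b := fun n => Rabs (k n) * Rpower (INR (S n)) (1 + Re w) * cos_bd).
  assert (Hb : ex_series b) by (apply ex_series_scal_r; exact Hk).
  assert (Hu : forall N, is_Cser (u N) (trunc_mellin f N)).
  { intros N. destruct (inv_le_self N) as [HN _]. pose proof (Spos N) as HN1.
    set (a := / INR (S N)) in *.
    refine (RInt_series (V := C_R_NormedModule) (fun n x => (RtoC (k n * (1 - cosk (Z.of_nat (S n)) x)) * Rcpow x (- (2 + w)))%C)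
      (fun x => (RtoC (f x) * Rcpow x (- (2 + w)))%C) _ _ (fun n => 2 * Rpower a (- 2 - Re w) * Rabs (k n)) a (INR (S N)) _ _ _ _ _ _).
    - lra.
    - intros n. assert (G := is_CInt_Cmult _ _ _ _ (RtoC (k n)) (cos_int_scale n a (INR (S N)) HN)).
      eapply is_RInt_ext; [|exact G]. intros x _. cbv beta. toC. rewrite RtoC_mult. ring.
    - apply mellin_int_correct; [exact Hf|lra|lra].
    - intros t Ht.
      assert (Q : is_Cser (fun n => RtoC (k n * (1 - cosk (Z.of_nat (S n)) t))) (RtoC (f t))).
      { apply is_series_C; [apply Hser|]. 
        apply (is_series_ext (fun k => if Nat.eqb k 0 then 0 else 0)).
        - intros [|n]; reflexivity.
        - apply (is_series_single (V := R_NormedModule)). }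
      apply (is_Cser_scal (Rcpow t (- (2 + w)))) in Q.
      assert (Q' : is_Cser (fun n => (RtoC (k n * (1 - cosk (Z.of_nat (S n)) t)) * Rcpow t (- (2 + w)))%C) (RtoC (f t) * Rcpow t (- (2 + w)))%C).
      { rewrite Cmult_comm. eapply is_Cser_ext; [|exact Q]. intros; apply Cmult_comm. }
      exact Q'.
    - intros n t Ht. rewrite norm_CR, Cmod_mult, Cmod_R, Cmod_Rcpow_Rpower, re_2w, Rabs_mult.
      assert (B1 : Rabs (1 - cosk (Z.of_nat (S n)) t) <= 2).
      { pose proof (Rabs_cosk (Z.of_nat (S n)) t) as Q. apply Rabs_le_between in Q. apply Rabs_le. lra. }
      assert (B2 : Rpower t (- 2 - Re w) <= Rpower a (- 2 - Re w)).
      { replace (- 2 - Re w) with (- (2 + Re w)) by ring. rewrite !Rpower_Ropp.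
        apply Rinv_le_contravar; [apply exp_pos|]. apply Rle_Rpower_l; lra. }
      replace (2 * Rpower a (- 2 - Re w) * Rabs (k n)) with (Rabs (k n) * 2 * Rpower a (- 2 - Re w)) by ring.
      apply Rmult_le_compat; [apply Rmult_le_pos; apply Rabs_pos|left; apply exp_pos| |exact B2].
      apply Rmult_le_compat_l; [apply Rabs_pos|exact B1].
    - apply (ex_series_scal_l (V := R_NormedModule) (2 * Rpower a (- 2 - Re w))), Hk1. }
  assert (Hv : is_Cser v (P * CSeries (fun n => RtoC (k n) * Rcpow (INR (S n)) (1 + w)))%C).
  { apply is_Cser_scal. apply ex_Cser_le with (2 := Hk). intros n.
    rewrite Cmod_mult, Cmod_R, Cmod_Rcpow_Rpower, Hre. lra. }
  apply (tannery (K := C_AbsRing) (V := C_NormedModule) u v (trunc_mellin f) _ b); auto.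
  - intros n. apply filterlim_C_eps; [apply eventually_filter|]. intros eps He.
    set (q := (RtoC (k n) * Rcpow (INR (S n)) (1 + w))%C).
    assert (Hq : 0 < Cmod q + 1) by (pose proof (Cmod_ge_0 q); lra).
    assert (Heq : 0 < eps / (Cmod q + 1)) by now apply Rdiv_lt_0_compat.
    generalize (C_eps_filterlim _ _ _ (HP n) _ Heq). apply filter_imp. intros N HN.
    unfold u, v. fold q.
    set (ci := cos_int w (INR (S n) * / INR (S N)) (INR (S n) * INR (S N))) in *.
    replace (RtoC (k n) * (Rcpow (INR (S n)) (1 + w) * ci) - P * q)%C with (q * (ci - P))%C by (unfold q; ring).
    rewrite Cmod_mult. pose proof (Cmod_ge_0 q). pose proof (Cmod_ge_0 (ci - P)).
    apply Rle_lt_trans with ((Cmod q + 1) * Cmod (ci - P)); [nra|].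
    apply Rlt_le_trans with ((Cmod q + 1) * (eps / (Cmod q + 1))); [apply Rmult_lt_compat_l; lra|].
    right. field. lra.
  - intros N n. change (Cmod (u N n) <= b n). unfold u, b.
    rewrite !Cmod_mult, Cmod_R, Cmod_Rcpow_Rpower, Hre, <- Rmult_assoc.
    apply Rmult_le_compat_l; [apply Rmult_le_pos; [apply Rabs_pos|left; apply exp_pos]|].
    apply cos_int_bounded. destruct (inv_le_self N) as [HN _]. pose proof (Spos n).
    split; [apply Rmult_lt_0_compat; lra|apply Rmult_le_compat_l; lra].
  - intros n. change (Cmod (v n) <= b n). unfold v, b.
    rewrite !Cmod_mult, Cmod_R, Cmod_Rcpow_Rpower, Hre, Rmult_comm.
    apply Rmult_le_compat_l; [apply Rmult_le_pos; [apply Rabs_pos|left; apply exp_pos]|exact HPb].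
Qed.

End CosineMellin.

(** * A functional equation *)

Lemma filterlim_Cplus (u v : nat -> C) (a b : C) :
  filterlim u eventually (locally (T := C_NormedModule) a) ->
  filterlim v eventually (locally (T := C_NormedModule) b) ->
  filterlim (fun n => (u n + v n)%C) eventually (locally (T := C_NormedModule) (a + b)%C).
Proof.
  intros Hu Hv. eapply filterlim_comp_2; [exact Hu|exact Hv|]. apply (filterlim_plus (V := C_NormedModule)).
Qed.

Lemma filterlim_Cscal (c : C) (u : nat -> C) (a : C) :
  filterlim u eventually (locally (T := C_NormedModule) a) ->
  filterlim (fun n => (c * u n)%C) eventually (locally (T := C_NormedModule) (c * a)%C).
Proof.
  intros Hu. eapply filterlim_comp; [exact Hu|]. apply (filterlim_scal_r (V := C_NormedModule) c a).
Qed.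

Lemma filterlim_Cconst (c : C) : filterlim (fun _ : nat => c) eventually (locally (T := C_NormedModule) c).
Proof. apply filterlim_const. Qed.

Lemma filterlim_inv_Rcpow (c v : C) : 0 < Re v ->
  filterlim (fun N => (c - Rcpow (/ INR (S N)) v)%C) eventually (locally (T := C_NormedModule) c).
Proof.
  intros Hv.
  assert (L := filterlim_Cplus _ _ _ _ (filterlim_Cconst c)
    (filterlim_Cscal (- (1))%C _ _ (Rcpow_lim0 (- v)%C ltac:(rewrite re_opp; lra)))).
  replace (c + - (1) * RtoC 0)%C with c in L by ring.
  eapply filterlim_ext; [|exact L]. intros N. cbv beta. rewrite Rcpow_Rinv by (pose proof (Spos N); lra).
  toC. ring.
Qed.

Lemma C_2_eq : RtoC 2 = (1 + 1)%C.
Proof. rewrite <- RtoC_plus. f_equal. Qed.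

Section FunctionalEquation.
Variable w : C.
Hypothesis Hw : - (1/2) < Re w < 0.

Lemma w_neq_0 : w <> 0.
Proof. intros E. rewrite E in Hw. simpl in Hw. lra. Qed.

Lemma w_neq_1 : w <> RtoC 1.
Proof. intros E. rewrite E in Hw. simpl in Hw. lra. Qed.

Lemma w_neq_m1 : (w + 1)%C <> 0.
Proof. intros E. apply (f_equal Re) in E. rewrite re_plus in E. simpl in E. lra. Qed.

(** On [(0, 1)] the function is [(x - x ^ 2) / 2], whose transform for [Re w < 0] is
    [1 / (2 w (w - 1))]. This is the rational term of [zeta_saw] divided by [w (w + 1)], so both
    together make the integral over the whole half-line. *)
Lemma trunc_mellin_sawq :
  filterlim (trunc_mellin w (fun x => - sawq x)) eventually
    (locally (T := C_NormedModule) (zeta w / (w * (w + 1)))%C).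
Proof.
  pose proof w_neq_0 as N0. pose proof w_neq_1 as N1. pose proof w_neq_m1 as N2. pose proof (Cneq_minus _ _ N1) as N3.
  assert (N4 : (1 - w)%C <> 0) by (apply Cneq_minus; auto).
  assert (Nw : (- w)%C <> 0) by (intros Q; apply N0; replace w with (- - w)%C by ring; rewrite Q; ring).
  destruct (zeta_saw w ltac:(lra) N1) as [J [HJ Hz]].
  assert (LJ : filterlim (fun N => saw_int w (INR (S N))) eventually (locally (T := C_NormedModule) J)).
  { assert (HI : filterlim (fun N => INR (S N)) eventually (Rbar_locally p_infty)).
    { apply (is_lim_seq_incr_1 INR p_infty), is_lim_seq_INR. }
    exact (filterlim_comp _ _ _ _ _ _ _ _ HI (saw_int_lim w J ltac:(lra) HJ)). }
  assert (E : forall N, trunc_mellin w (fun x => - sawq x) N =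
     (- (1) * saw_int w (INR (S N)) + (/ 2 * / (- w) * (1 - Rcpow (/ INR (S N)) (- w)) + - / (2 * (1 - w)) * (1 - Rcpow (/ INR (S N)) (1 - w))))%C).
  { intros N. destruct (inv_le_self N) as [HN HN1]. pose proof (Spos N) as HS. set (X := INR (S N)) in *.
    apply is_CInt_unique. fold X.
    assert (I1 := is_CInt_Cmult _ _ _ _ (- (1))%C (saw_int_correct w 1 X ltac:(lra) ltac:(lra))).
    rewrite saw_int_1 in I1.
    assert (I2 := is_CInt_plus _ _ _ _ _ _
      (is_CInt_Cmult _ _ _ _ (/ 2)%C (is_CInt_Rcpow (- w) (/ X) 1 ltac:(lra) Nw))
      (is_CInt_Cmult _ _ _ _ (- / 2)%C (is_CInt_Rcpow (1 - w) (/ X) 1 ltac:(lra) N4))).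
    rewrite !Rcpow_1_l in I2.
    assert (N5 : RtoC 2 <> 0) by (intros Q; apply RtoC_inj in Q; lra).
    assert (I2' : is_CInt (fun x => (RtoC (- sawq x) * Rcpow x (- (2 + w)))%C) (/ X) 1
      (/ 2 * ((1 - Rcpow (/ X) (- w)) / - w) + - / 2 * ((1 - Rcpow (/ X) (1 - w)) / (1 - w)))%C).
    { eapply is_RInt_ext; [|exact I2]. intros x Hx. rewrite Rmin_left, Rmax_right in Hx by lra. cbv beta. toC.
      rewrite sawq_01 by lra.
      replace (- w - 1)%C with (RtoC 1 + - (2 + w))%C by (rewrite C_2_eq; ring).
      replace (1 - w - 1)%C with (RtoC 2 + - (2 + w))%C by (rewrite C_2_eq; ring).
      rewrite !Rcpow_plus, !Rcpow_R, Rmult_1_l, exp_ln by lra.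
      replace (exp (2 * ln x)) with (x ^ 2).
      2:{ change (exp (2 * ln x)) with (Rpower x 2). change 2 with (INR 2). rewrite Rpower_pow by lra. reflexivity. }
      replace (- ((x ^ 2 - x) / 2)) with (/ 2 * x - / 2 * x ^ 2) by field.
      rewrite RtoC_minus, !RtoC_mult, RtoC_inv by lra. ring. }
    assert (I1' : is_CInt (fun x => (RtoC (- sawq x) * Rcpow x (- (2 + w)))%C) 1 X (- (1) * (saw_int w X - 0))%C).
    { eapply is_RInt_ext; [|exact I1]. intros x _. cbv beta. toC. rewrite RtoC_opp, (Cplus_comm 2 w). ring. }
    eapply is_CInt_eq; [exact (is_RInt_Chasles (V := C_R_NormedModule) _ _ _ _ _ _ I2' I1')|].
    change (/ 2 * ((1 - Rcpow (/ X) (- w)) / - w) + - / 2 * ((1 - Rcpow (/ X) (1 - w)) / (1 - w)) + - (1) * (saw_int w X - 0) =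
      - (1) * saw_int w X + (/ 2 * / - w * (1 - Rcpow (/ X) (- w)) + - / (2 * (1 - w)) * (1 - Rcpow (/ X) (1 - w))))%C.
    field. repeat split; auto. }
  assert (LL := filterlim_Cplus _ _ _ _ (filterlim_Cscal (- (1))%C _ _ LJ)
    (filterlim_Cplus _ _ _ _ (filterlim_Cscal (/ 2 * / (- w))%C _ _ (filterlim_inv_Rcpow 1 (- w)%C ltac:(rewrite re_opp; lra)))
      (filterlim_Cscal (- / (2 * (1 - w)))%C _ _ (filterlim_inv_Rcpow 1 (1 - w)%C ltac:(unfold Cminus; rewrite re_plus, re_opp, re_RtoC; lra))))).
  match type of LL with filterlim _ _ (locally ?l) => replace (zeta w / (w * (w + 1)))%C with l end.
  - eapply filterlim_ext; [|exact LL]. intros N. symmetry. apply E.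
  - rewrite Hz, C_2_eq. toC. field. repeat split; auto.
Qed.

(** The transform of [- sawq] computed in two ways. In its cosine series the coefficient
    [1 / (2 pi^2 n^2)] times the scaling factor [n ^ (1 + w)] is a multiple of [n ^ (- (1 - w))],
    the general term of [zeta (1 - w)]. *)
Lemma zeta_functional (P : C) : Cmod P <= cos_bd ->
  (forall n : nat, filterlim (fun N => cos_int w (INR (S n) * / INR (S N)) (INR (S n) * INR (S N))) eventually
    (locally (T := C_NormedModule) P)) ->
  (zeta w / (w * (w + 1)) = P * (RtoC (/ (2 * PI ^ 2)) * zeta (1 - w)))%C.
Proof.
  intros HPb HP. pose proof PI_RGT_0 as Hpi.
  set (k := fun n => / (2 * PI ^ 2 * INR (S n) ^ 2)).
  assert (Hpos : forall n, 0 < 2 * PI ^ 2 * INR (S n) ^ 2).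
  { intros n. pose proof (Spos n). apply Rmult_lt_0_compat; [apply Rmult_lt_0_compat; [|apply pow_lt]|apply pow_lt]; lra. }
  assert (Ek : forall n, k n * Rpower (INR (S n)) (1 + Re w) = / (2 * PI ^ 2) * Rpower (INR (S n)) (- (1 - Re w))).
  { intros n. unfold k. pose proof (Spos n). rewrite <- (Rpower_pow 2 (INR (S n))) by lra.
    rewrite Rinv_mult, <- Rpower_Ropp, Rmult_assoc, <- Rpower_plus. f_equal. f_equal. simpl; ring. }
  assert (L := cosine_mellin w Hw P (fun x => - sawq x) k HPb HP).
  assert (L' : filterlim (trunc_mellin w (fun x => - sawq x)) eventually (locally (T := C_NormedModule)
    (P * CSeries (fun n => RtoC (k n) * Rcpow (INR (S n)) (1 + w)))%C)).
  { apply L.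
    - intros x. apply (continuous_opp (V := R_NormedModule)), sawq_cont.
    - intros x. eapply is_series_ext; [|apply (sawq_fourier x)]. intros n. toR. unfold k, Rdiv. ring.
    - apply ex_series_ext with (fun n => / (2 * PI ^ 2) * Rpower (INR (S n)) (- (1 - Re w))).
      + intros n. rewrite <- Ek. f_equal. symmetry. apply Rabs_pos_eq. left. apply Rinv_0_lt_compat, Hpos.
      + apply (ex_series_scal_l (V := R_NormedModule) (/ (2 * PI ^ 2))), Rpower_summable. lra. }
  assert (E : CSeries (fun n => RtoC (k n) * Rcpow (INR (S n)) (1 + w))%C = (RtoC (/ (2 * PI ^ 2)) * zeta (1 - w))%C).
  { apply CSeries_unique.
    assert (Z := is_Cser_scal (RtoC (/ (2 * PI ^ 2))) _ _ (zeta_Dirichlet (1 - w)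
       ltac:(unfold Cminus; rewrite re_plus, re_opp, re_RtoC; lra))).
    eapply is_Cser_ext; [|exact Z]. intros n. cbv beta. toC. pose proof (Spos n) as Hn.
    unfold k. rewrite (Rinv_mult (2 * PI ^ 2)), RtoC_mult.
    replace (1 + w)%C with (- (1 - w) + RtoC 2)%C by (rewrite C_2_eq; ring).
    rewrite Rcpow_plus, Rcpow_R. replace (exp (2 * ln (INR (S n)))) with (INR (S n) ^ 2).
    2:{ change (exp (2 * ln (INR (S n)))) with (Rpower (INR (S n)) (INR 2)). rewrite Rpower_pow by lra. reflexivity. }
    rewrite (RtoC_inv (INR (S n) ^ 2)) by (apply Rgt_not_eq, pow_lt; lra).
    field. intros Q. apply RtoC_inj in Q. pose proof (pow_lt (INR (S n)) 2 ltac:(lra)). lra. }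
  rewrite <- E. exact (filterlim_locally_unique (V := C_NormedModule) _ _ _ trunc_mellin_sawq L').
Qed.

End FunctionalEquation.

(** * A periodised bump as a test function *)

Section Bump.
Variable l : R.
Hypothesis Hl : 4 <= l.

(** The square makes the function continuously differentiable with a jump only in the second
    derivative. Its coefficients are then [O(n ^ (-3))], summable even after multiplication by [n],
    which dominates [n ^ (1 + Re w)] for all [Re w < 0] at once. As [l >= 4], the support fits
    inside one period. *)
Definition bump (x : R) : R := Rmax 0 (1 - l ^ 2 * x ^ 2) ^ 2.

Lemma bump_inside x : Rabs x <= / l -> bump x = (1 - l ^ 2 * x ^ 2) ^ 2.
Proof.
  intros Hx. unfold bump. rewrite Rmax_right; [reflexivity|].
  assert (Rabs x ^ 2 <= (/ l) ^ 2) by (apply pow_incr; split; [apply Rabs_pos|exact Hx]).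
  rewrite pow2_abs in H. assert (l ^ 2 * x ^ 2 <= l ^ 2 * (/ l) ^ 2) by (apply Rmult_le_compat_l; [apply pow2_ge_0|exact H]).
  replace (l ^ 2 * (/ l) ^ 2) with 1 in * by (field; lra). lra.
Qed.

Lemma bump_outside x : / l <= Rabs x -> bump x = 0.
Proof.
  intros Hx. unfold bump. rewrite Rmax_left; [ring|].
  assert (0 < / l) by (apply Rinv_0_lt_compat; lra).
  assert ((/ l) ^ 2 <= Rabs x ^ 2) by (apply pow_incr; lra).
  rewrite pow2_abs in *. assert (l ^ 2 * (/ l) ^ 2 <= l ^ 2 * x ^ 2) by (apply Rmult_le_compat_l; [apply pow2_ge_0|assumption]).
  replace (l ^ 2 * (/ l) ^ 2) with 1 in * by (field; lra). lra.
Qed.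

Lemma bump_range x : 0 <= bump x <= 1.
Proof.
  split; [apply pow2_ge_0|]. unfold bump. rewrite <- (pow1 2). apply pow_incr. split; [apply Rmax_l|].
  apply Rmax_lub; [lra|]. pose proof (pow2_ge_0 (l * x)). nra.
Qed.

Lemma bump_cont x : continuous bump x.
Proof.
  unfold bump.
  assert (H : continuous (fun x => Rmax 0 (1 - l ^ 2 * x ^ 2)) x).
  { apply (continuous_ext (fun x => (1 - l ^ 2 * x ^ 2 + Rabs (1 - l ^ 2 * x ^ 2)) / 2)).
    - intros y. unfold Rmax, Rabs. destruct (Rle_dec 0 (1 - l ^ 2 * y ^ 2)), (Rcase_abs (1 - l ^ 2 * y ^ 2)); lra.
    - assert (C1 : continuous (fun x => 1 - l ^ 2 * x ^ 2) x).
      { apply (ex_derive_continuous (fun x => 1 - l ^ 2 * x ^ 2)). auto_derive; auto. }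
      apply continuous_Rmult; [|apply continuous_Rconst]. apply continuous_Rplus; [exact C1|].
      apply (continuous_comp (fun x => 1 - l ^ 2 * x ^ 2) Rabs); [exact C1|apply continuous_Rabs]. }
  change (continuous (fun x => Rmax 0 (1 - l ^ 2 * x ^ 2) * (Rmax 0 (1 - l ^ 2 * x ^ 2) * 1)) x).
  auto with rcont.
Qed.

Lemma bump_int (g G : R -> R) : (forall x, continuous g x) ->
  (forall x, is_derive G x ((1 - l ^ 2 * x ^ 2) ^ 2 * g x)) ->
  is_RInt (fun x => bump x * g x) (- (1/2)) (1/2) (G (/ l) - G (- / l)).
Proof.
  intros Hg HG. assert (Hi : 0 < / l) by (apply Rinv_0_lt_compat; lra).
  assert (Hi2 : / l <= 1/4) by (replace (1/4) with (/ 4) by field; apply Rinv_le_contravar; lra).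
  assert (Hz : forall a b, (forall x, Rmin a b < x < Rmax a b -> / l <= Rabs x) -> is_RInt (fun x => bump x * g x) a b 0).
  { intros a b Hab. apply is_RInt_ext with (fun _ => 0).
    - intros x Hx. rewrite bump_outside by auto. toR. ring.
    - eapply is_RInt_eq; [apply (is_RInt_const (V := R_NormedModule))|]. unfold scal; simpl; unfold mult; simpl. ring. }
  assert (I1 : is_RInt (fun x => bump x * g x) (- (1/2)) (- / l) 0).
  { apply Hz. intros x Hx. rewrite Rmin_left, Rmax_right in Hx by lra. rewrite Rabs_left by lra. lra. }
  assert (I3 : is_RInt (fun x => bump x * g x) (/ l) (1/2) 0).
  { apply Hz. intros x Hx. rewrite Rmin_left, Rmax_right in Hx by lra. rewrite Rabs_pos_eq by lra. lra. }
  assert (I2 : is_RInt (fun x => bump x * g x) (- / l) (/ l) (G (/ l) - G (- / l))).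
  { apply is_RInt_ext with (fun x => (1 - l ^ 2 * x ^ 2) ^ 2 * g x).
    - intros x Hx. rewrite Rmin_left, Rmax_right in Hx by lra. rewrite bump_inside; [reflexivity|]. apply Rabs_le. lra.
    - apply (is_RInt_derive (V := R_CompleteNormedModule) G).
      + intros x _. apply HG.
      + intros x _. apply continuous_Rmult; [|apply Hg].
        apply (ex_derive_continuous (fun x => (1 - l ^ 2 * x ^ 2) ^ 2)). auto_derive; auto. }
  assert (I := is_RInt_Chasles (V := R_NormedModule) _ _ _ _ _ _ I1 (is_RInt_Chasles (V := R_NormedModule) _ _ _ _ _ _ I2 I3)).
  eapply is_RInt_eq; [exact I|]. unfold plus; simpl. ring.
Qed.

Definition bump_coef (n : nat) : R := RInt (fun x => bump x * cosk (Z.of_nat n) x) (- (1/2)) (1/2).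

Definition bump_const : R := 16 * l ^ 2 + 48 * l ^ 3 + 48 * l ^ 4.

(** Repeated integration by parts gives the antiderivative. At [/ l] and [- / l] the terms
    containing [1 - l ^ 2 * x ^ 2] vanish, and the others, being odd, double to the three constants
    collected in [bump_const]. *)
Lemma bump_coef_bound n : Rabs (bump_coef (S n)) <= bump_const / INR (S n) ^ 3.
Proof.
  pose proof PI_RGT_0. pose proof PI2_1 as HPI. pose proof (Spos n) as Hn. set (m := INR (S n)) in *.
  set (q := 2 * PI * m). assert (Hqm : m <= q) by (unfold q; nra). assert (Hq : 1 <= q) by lra.
  assert (I := bump_int (cosk (Z.of_nat (S n)))
    (fun x => (1 - l ^ 2 * x ^ 2) ^ 2 * sin (q * x) / q - 4 * l ^ 2 * x * (1 - l ^ 2 * x ^ 2) * cos (q * x) / q ^ 2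
       - (12 * l ^ 4 * x ^ 2 - 4 * l ^ 2) * sin (q * x) / q ^ 3 - 24 * l ^ 4 * x * cos (q * x) / q ^ 4 + 24 * l ^ 4 * sin (q * x) / q ^ 5)).
  unfold bump_coef. rewrite (is_RInt_unique _ _ _ _ (I ltac:(auto with rcont)
    ltac:(intros x; unfold cosk; rewrite <- INR_IZR_INZ; fold m; fold q; auto_derive; auto; field; lra))).
  replace (q * - / l) with (- (q * / l)) by ring. rewrite sin_neg, cos_neg.
  set (S1 := sin (q * / l)). set (C1 := cos (q * / l)).
  assert (B1 : -1 <= S1 <= 1) by apply SIN_bound. assert (B2 : -1 <= C1 <= 1) by apply COS_bound.
  match goal with |- Rabs ?e <= _ => replace e with (/ q ^ 3 * (- 16 * l ^ 2 * S1 - 48 * l ^ 3 * (C1 * / q) + 48 * l ^ 4 * (S1 * / q ^ 2))) by (field; lra) end.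
  assert (Hq3 : 0 < / q ^ 3) by (apply Rinv_0_lt_compat, pow_lt; lra).
  rewrite Rabs_mult, (Rabs_pos_eq (/ q ^ 3)) by lra. unfold Rdiv. rewrite Rmult_comm.
  assert (Hi : 0 < / q <= 1).
  { split; [apply Rinv_0_lt_compat; lra|]. rewrite <- Rinv_1. apply Rinv_le_contravar; lra. }
  assert (Hi2 : 0 < / q ^ 2 <= 1).
  { split; [apply Rinv_0_lt_compat, pow_lt; lra|]. rewrite <- Rinv_1. apply Rinv_le_contravar; [lra|]. nra. }
  pose proof (pow_lt l 2 ltac:(lra)). pose proof (pow_lt l 3 ltac:(lra)). pose proof (pow_lt l 4 ltac:(lra)).
  assert (X1 : -1 <= C1 * / q <= 1) by nra. assert (X2 : -1 <= S1 * / q ^ 2 <= 1) by nra.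
  apply Rmult_le_compat; [apply Rabs_pos|lra| |].
  - unfold bump_const. apply Rabs_le. split; nra.
  - apply Rinv_le_contravar; [apply pow_lt; lra|]. apply pow_incr; lra.
Qed.

Lemma ex_series_bump_coef : ex_series (fun n => Rabs (bump_coef (S n)) * INR (S n)).
Proof.
  apply (ex_series_le (V := R_CompleteNormedModule) _ (fun n => bump_const / INR (S n) ^ 2)); [|apply ex_series_inv_sq_scal].
  intros n. change (Rabs (Rabs (bump_coef (S n)) * INR (S n)) <= bump_const / INR (S n) ^ 2).
  pose proof (Spos n). rewrite Rabs_mult, Rabs_Rabsolu, (Rabs_pos_eq (INR (S n))) by lra.
  replace (bump_const / INR (S n) ^ 2) with (bump_const / INR (S n) ^ 3 * INR (S n)) by (field; lra).
  apply Rmult_le_compat_r; [lra|]. apply bump_coef_bound.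
Qed.

Lemma bump_sin n : is_RInt (fun x => bump x * sink (Z.of_nat n) x) (- (1/2)) (1/2) 0.
Proof.
  pose proof PI_RGT_0. destruct n as [|n].
  - apply is_RInt_ext with (fun _ => 0).
    + intros x _. simpl. rewrite sink_0. toR. ring.
    + eapply is_RInt_eq; [apply (is_RInt_const (V := R_NormedModule))|]. unfold scal; simpl; unfold mult; simpl. ring.
  - pose proof (Spos n) as Hn. set (m := INR (S n)) in *.
    set (q := 2 * PI * m). assert (Hq : 0 < q) by (unfold q; nra).
    assert (I := bump_int (sink (Z.of_nat (S n)))
      (fun x => - (1 - l ^ 2 * x ^ 2) ^ 2 * cos (q * x) / q - 4 * l ^ 2 * x * (1 - l ^ 2 * x ^ 2) * sin (q * x) / q ^ 2
         + (12 * l ^ 4 * x ^ 2 - 4 * l ^ 2) * cos (q * x) / q ^ 3 - 24 * l ^ 4 * x * sin (q * x) / q ^ 4 - 24 * l ^ 4 * cos (q * x) / q ^ 5)).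
    eapply is_RInt_eq; [apply I; [auto with rcont|]|].
    + intros x; unfold sink; rewrite <- INR_IZR_INZ; fold m; fold q; auto_derive; auto; field; lra.
    + replace (q * - / l) with (- (q * / l)) by ring. rewrite sin_neg, cos_neg. field. lra.
Qed.

(** One minus the periodised bump. Being a series in [1 - cos], it is an admissible input for
    [cosine_mellin] with the same [P] as [- sawq]. *)
Definition co_bump (x : R) : R := Series (fun n => 2 * bump_coef (S n) * (1 - cosk (Z.of_nat (S n)) x)).

Lemma ex_series_bump_abs : ex_series (fun n => Rabs (bump_coef (S n))).
Proof.
  apply (ex_series_le (V := R_CompleteNormedModule) _ _) with (2 := ex_series_bump_coef). intros n.
  change (Rabs (Rabs (bump_coef (S n))) <= Rabs (bump_coef (S n)) * INR (S n)). rewrite Rabs_Rabsolu.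
  pose proof (Spos n). pose proof (Rabs_pos (bump_coef (S n))). nra.
Qed.

Lemma co_bump_bd n x : Rabs (2 * bump_coef (S n) * (1 - cosk (Z.of_nat (S n)) x)) <= 4 * Rabs (bump_coef (S n)).
Proof.
  rewrite !Rabs_mult, (Rabs_pos_eq 2) by lra.
  assert (Rabs (1 - cosk (Z.of_nat (S n)) x) <= 2).
  { pose proof (Rabs_cosk (Z.of_nat (S n)) x) as Q. apply Rabs_le_between in Q. apply Rabs_le. lra. }
  pose proof (Rabs_pos (bump_coef (S n))). nra.
Qed.

Lemma co_bump_series x : is_series (fun n => 2 * bump_coef (S n) * (1 - cosk (Z.of_nat (S n)) x)) (co_bump x).
Proof.
  apply Series_correct.
  apply (ex_series_le (V := R_CompleteNormedModule) _ (fun n => 4 * Rabs (bump_coef (S n)))).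
  - intros n. apply co_bump_bd.
  - apply (ex_series_scal_l (V := R_NormedModule) 4), ex_series_bump_abs.
Qed.

Lemma co_bump_cont x : continuous co_bump x.
Proof.
  apply (series_continuous (V := R_NormedModule) (fun n x => 2 * bump_coef (S n) * (1 - cosk (Z.of_nat (S n)) x)) co_bump
    (fun n => 4 * Rabs (bump_coef (S n))) x).
  - intros k. auto 8 with rcont.
  - intros k y. apply co_bump_bd.
  - apply (ex_series_scal_l (V := R_NormedModule) 4), ex_series_bump_abs.
  - intros y. apply co_bump_series.
Qed.

Lemma co_bump_cell x : - (1/2) <= x <= 1/2 -> co_bump x = 1 - bump x.
Proof.
  intros Hx.
  assert (SA : ex_series (fun k => Rabs (bump_coef k))) by (apply ex_series_incr_1, ex_series_bump_abs).
  assert (SB : ex_series (fun k : nat => Rabs 0)).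
  { exists 0. rewrite Rabs_R0. apply (is_series_ext (fun k => if Nat.eqb k 0 then 0 else 0)).
    - intros [|n]; reflexivity.
    - apply (is_series_single (V := R_NormedModule)). }
  assert (F := fourier_series_eq (- (1/2)) bump bump_coef (fun _ => 0) bump_cont).
  replace (- (1/2) + 1) with (1/2) in F by field.
  assert (HA : forall k, is_RInt (fun x => bump x * cosk (Z.of_nat k) x) (- (1/2)) (1/2) (bump_coef k)).
  { intros k. apply is_RInt_cont. pose proof bump_cont. auto with rcont. }
  specialize (F HA bump_sin SA SB).
  assert (F0 := is_series_shift _ _ (F 0 ltac:(lra))). assert (Fx := is_series_shift _ _ (F x Hx)).
  cbv beta in F0, Fx.
  assert (G := is_series_minus (V := R_NormedModule) _ _ _ _ F0 Fx).
  apply is_series_unique. 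
  match type of G with is_series _ ?r => replace (1 - bump x) with r end.
  - eapply is_series_ext; [|exact G]. intros n. unfold minus, plus, opp; simpl plus.
    replace (cosk (Z.of_nat (S n)) 0) with 1 by (unfold cosk; now rewrite Rmult_0_r, cos_0).
    unfold minus, plus, opp; cbn -[Z.of_nat INR]. toR. ring.
  - assert (B0 : bump 0 = 1) by (unfold bump; rewrite Rmax_right by (simpl; lra); ring).
    unfold minus, plus, opp; simpl. rewrite B0, !cosk_0, !sink_0. ring.
Qed.

Lemma co_bump_range x : 0 <= co_bump x <= 1.
Proof.
  destruct (ex_cell (x + 1/2)) as [m Hm].
  assert (E : co_bump x = co_bump (x - IZR m)).
  { unfold co_bump. apply Series_ext. intros n. f_equal. f_equal.
    replace x with (x - IZR m + IZR m) at 1 by ring. apply cosk_add_Z. }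
  rewrite E, co_bump_cell by lra. pose proof (bump_range (x - IZR m)). lra.
Qed.

End Bump.

(** * Zeta on the imaginary axis *)

Section LowerBound.
Variables (w : C) (m : R).
Hypothesis Hw : - (1/2) < Re w < 0.
Hypothesis Hm : 2 <= m.
Hypothesis Hmt : 9 * ((2 + Rabs (Im w)) * (2 + Rabs (Im w)) * (4 + Rabs (Im w))) <= 8 * m.

Let l := m ^ 2.

Lemma l_ge_4 : 4 <= l.
Proof. unfold l. nra. Qed.

(** The integral of [co_bump l] up to 1/2: on [(0, / l)] the function is [2 l^2 x^2 - l^4 x^4], on
    [(/ l, 1/2)] it is 1. The parameters [A1] and [A3] let the formula serve both the truncated
    integral and its limit. *)
Definition main_part (A1 A3 : C) : C :=
  (RtoC (2 * l ^ 2) * (A1 / (1 - w)) + (- RtoC (l ^ 4)) * (A3 / (3 - w))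
   + (Rcpow (1/2) (- (1 + w)) - Rcpow (/ l) (- (1 + w))) / - (1 + w))%C.

Lemma one_w_neq : (1 + w)%C <> 0.
Proof. rewrite Cplus_comm. now apply w_neq_m1. Qed.

Lemma one_minus_w_neq : (1 - w)%C <> 0.
Proof. apply Cneq_minus. intros E. now apply (w_neq_1 w Hw). Qed.

Lemma three_minus_w_neq : (3 - w)%C <> 0.
Proof.
  intros E. apply (f_equal Re) in E. unfold Cminus in E. rewrite re_plus, re_opp, !re_RtoC in E. lra.
Qed.

(** What is left is the integral from 1/2 on, where [co_bump] lies between 0 and 1; it is at most
    [2 * (1/2) ^ (- (1 + Re w))], hence at most 4. *)
Lemma trunc_mellin_co_bump N : l <= INR (S N) ->
  Cmod (trunc_mellin w (co_bump l) N
    - main_part (Rcpow (/ l) (1 - w) - Rcpow (/ INR (S N)) (1 - w)) (Rcpow (/ l) (3 - w) - Rcpow (/ INR (S N)) (3 - w)))%C <= 4.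
Proof.
  intros HN. pose proof l_ge_4 as Hl. pose proof (Spos N) as HN1. set (X := INR (S N)) in *.
  assert (HX : 0 < / X) by (apply Rinv_0_lt_compat; lra).
  assert (HXl : / X <= / l) by (apply Rinv_le_contravar; lra).
  assert (Hil : / l <= 1/4) by (replace (1/4) with (/ 4) by field; apply Rinv_le_contravar; lra).
  pose proof one_w_neq as N1. pose proof one_minus_w_neq as N2. pose proof three_minus_w_neq as N3.
  assert (N1' : (- (1 + w))%C <> 0).
  { intros E. apply N1. replace (1 + w)%C with (- - (1 + w))%C by ring. rewrite E. ring. }
  assert (C3 : RtoC 3 = (1 + 1 + 1)%C) by (rewrite <- !RtoC_plus; f_equal; ring).
  set (F := fun x => (RtoC (co_bump l x) * Rcpow x (- (2 + w)))%C).
  assert (I1 : is_CInt F (/ X) (/ l) (RtoC (2 * l ^ 2) * ((Rcpow (/ l) (1 - w) - Rcpow (/ X) (1 - w)) / (1 - w))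
     + (- RtoC (l ^ 4)) * ((Rcpow (/ l) (3 - w) - Rcpow (/ X) (3 - w)) / (3 - w)))%C).
  { assert (G := is_CInt_plus _ _ _ _ _ _
      (is_CInt_Cmult _ _ _ _ (RtoC (2 * l ^ 2)) (is_CInt_Rcpow (1 - w) (/ X) (/ l) ltac:(lra) N2))
      (is_CInt_Cmult _ _ _ _ (- RtoC (l ^ 4))%C (is_CInt_Rcpow (3 - w) (/ X) (/ l) ltac:(lra) N3))).
    eapply is_RInt_ext; [|exact G]. intros x Hx. rewrite Rmin_left, Rmax_right in Hx by lra. unfold F. cbv beta. toC.
    rewrite co_bump_cell, bump_inside by (try exact Hl; try (rewrite Rabs_pos_eq; lra); lra).
    replace (1 - w - 1)%C with (RtoC 2 + - (2 + w))%C by (rewrite C_2_eq; ring).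
    replace (3 - w - 1)%C with (RtoC 4 + - (2 + w))%C.
    2:{ replace (RtoC 4) with (RtoC 2 + RtoC 2)%C by (rewrite <- RtoC_plus; f_equal; ring). rewrite C3, C_2_eq. ring. }
    rewrite !(Rcpow_plus x (RtoC _)), !Rcpow_R.
    replace (exp (2 * ln x)) with (x ^ 2).
    2:{ change (exp (2 * ln x)) with (Rpower x (INR 2)). rewrite Rpower_pow by lra. reflexivity. }
    replace (exp (4 * ln x)) with (x ^ 4).
    2:{ replace 4 with (INR 4) by (simpl; ring). change (exp (INR 4 * ln x)) with (Rpower x (INR 4)). rewrite Rpower_pow by lra. reflexivity. }
    replace (1 - (1 - l ^ 2 * x ^ 2) ^ 2) with (2 * l ^ 2 * x ^ 2 - l ^ 4 * x ^ 4) by ring.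
    rewrite RtoC_minus, (RtoC_mult (2 * l ^ 2)), (RtoC_mult (l ^ 4)). ring. }
  assert (I2 : is_CInt F (/ l) (1/2) ((Rcpow (1/2) (- (1 + w)) - Rcpow (/ l) (- (1 + w))) / - (1 + w))%C).
  { assert (G := is_CInt_Rcpow (- (1 + w)) (/ l) (1/2) ltac:(lra) N1').
    eapply is_RInt_ext; [|exact G]. intros x Hx. rewrite Rmin_left, Rmax_right in Hx by lra. unfold F. cbv beta. toC.
    rewrite co_bump_cell, bump_outside by (try exact Hl; try (rewrite Rabs_pos_eq; lra); lra).
    replace (- (1 + w) - 1)%C with (- (2 + w))%C by (rewrite C_2_eq; ring). rewrite Rminus_0_r. ring. }
  assert (I3' : exists I : C, is_CInt F (1/2) X I).
  { eexists. apply mellin_int_correct; [now apply co_bump_cont|lra|lra]. }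
  destruct I3' as [I I3].
  assert (E : trunc_mellin w (co_bump l) N = (RtoC (2 * l ^ 2) * ((Rcpow (/ l) (1 - w) - Rcpow (/ X) (1 - w)) / (1 - w))
     + (- RtoC (l ^ 4)) * ((Rcpow (/ l) (3 - w) - Rcpow (/ X) (3 - w)) / (3 - w))
     + ((Rcpow (1/2) (- (1 + w)) - Rcpow (/ l) (- (1 + w))) / - (1 + w) + I))%C).
  { apply is_CInt_unique. fold X.
    exact (is_RInt_Chasles (V := C_R_NormedModule) _ _ _ _ _ _ I1 (is_RInt_Chasles (V := C_R_NormedModule) _ _ _ _ _ _ I2 I3)). }
  rewrite E. unfold main_part.
  match goal with |- Cmod ?e <= _ => replace e with I by ring end.
  eapply Rle_trans; [apply (CInt_pow_bound F (1/2) X _ 1 (- 2 - Re w)) with (4 := I3)|].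
  - lra.
  - lra.
  - intros x Hx. unfold F. rewrite Cmod_mult, Cmod_R, Cmod_Rcpow_Rpower, re_2w.
    apply Rmult_le_compat_r; [left; apply exp_pos|]. pose proof (co_bump_range l Hl x). rewrite Rabs_pos_eq; lra.
  - eapply Rle_trans; [apply pow_tail_le; [exact Hw|lra|lra]|].
    assert (Rpower (1/2) (- (1 + Re w)) <= 2).
    { replace (Rpower (1/2) (- (1 + Re w))) with (Rpower 2 (1 + Re w)).
      - rewrite <- (Rpower_1 2) at 2 by lra. apply Rle_Rpower; lra.
      - unfold Rpower. replace (1/2) with (/ 2) by field. rewrite ln_Rinv by lra. f_equal. ring. }
    lra.
Qed.

(** The expression simplifies to [8 l^(1+w) / ((1+w)(1-w)(3-w)) - 2^(1+w) / (1+w)]. Since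
    [Re w > -1/2] and [l = m ^ 2], the power of [l] has modulus at least [m], and the hypothesis on
    [m] makes the first term at least 9; the second is at most 4. *)
Lemma main_part_lower : 5 <= Cmod (main_part (Rcpow (/ l) (1 - w)) (Rcpow (/ l) (3 - w))).
Proof.
  pose proof l_ge_4 as Hl.
  pose proof one_w_neq as N1. pose proof one_minus_w_neq as N2. pose proof three_minus_w_neq as N3.
  assert (C3 : RtoC 3 = (1 + 1 + 1)%C) by (rewrite <- !RtoC_plus; f_equal; ring).
  assert (Hre : Re (1 + w) = 1 + Re w) by (rewrite re_plus; reflexivity).
  set (Y := Rcpow l (1 + w)).
  assert (E : main_part (Rcpow (/ l) (1 - w)) (Rcpow (/ l) (3 - w)) =
    (Y * (RtoC 8 / ((1 + w) * (1 - w) * (3 - w))) + - (Rcpow 2 (1 + w) / (1 + w)))%C).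
  { unfold main_part. replace (1/2) with (/ 2) by field. rewrite !Rcpow_Rinv by lra.
    replace (- - (1 + w))%C with (1 + w)%C by ring. fold Y.
    assert (EY1 : (RtoC (2 * l ^ 2) * Rcpow l (- (1 - w)) = RtoC 2 * Y)%C).
    { unfold Y. replace (1 + w)%C with (RtoC 2 + - (1 - w))%C by (rewrite C_2_eq; ring).
      rewrite Rcpow_plus, Rcpow_R, RtoC_mult.
      replace (exp (2 * ln l)) with (l ^ 2); [ring|].
      change (exp (2 * ln l)) with (Rpower l (INR 2)). rewrite Rpower_pow by lra. reflexivity. }
    assert (EY2 : (RtoC (l ^ 4) * Rcpow l (- (3 - w)) = Y)%C).
    { unfold Y. replace (1 + w)%C with (RtoC 4 + - (3 - w))%C.
      2:{ replace (RtoC 4) with (RtoC 2 + RtoC 2)%C by (rewrite <- RtoC_plus; f_equal; ring). rewrite C3, C_2_eq. ring. }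
      rewrite Rcpow_plus, Rcpow_R. f_equal. f_equal.
      replace 4 with (INR 4) by (simpl; ring). change (exp (INR 4 * ln l)) with (Rpower l (INR 4)). rewrite Rpower_pow by lra. reflexivity. }
    transitivity ((RtoC (2 * l ^ 2) * Rcpow l (- (1 - w))) / (1 - w) + - ((RtoC (l ^ 4) * Rcpow l (- (3 - w))) / (3 - w))
      + (Rcpow 2 (1 + w) - Y) / - (1 + w))%C.
    { field. repeat split; auto. }
    rewrite EY1, EY2.
    replace (RtoC 8) with ((RtoC 2 * RtoC 2) * RtoC 2)%C by (rewrite <- !RtoC_mult; f_equal; ring).
    rewrite C3, C_2_eq in *. field. repeat split; auto. rewrite C3. exact N3. }
  rewrite E.
  assert (T : forall a b : C, Cmod a - Cmod b <= Cmod (a + - b)).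
  { intros a b. pose proof (Cmod_triangle (a + - b) b) as T. replace (a + - b + b)%C with a in T by ring. lra. }
  eapply Rle_trans; [|apply T]. clear T.
  assert (HY : m <= Cmod Y).
  { unfold Y. rewrite Cmod_Rcpow_Rpower, Hre. unfold l. rewrite <- (Rpower_pow 2 m), Rpower_mult by lra.
    rewrite <- (Rpower_1 m) at 1 by lra. apply Rle_Rpower; [lra|]. simpl. lra. }
  assert (B2 : Cmod (Rcpow 2 (1 + w) / (1 + w)) <= 4).
  { rewrite Cmod_div, Cmod_Rcpow_Rpower, Hre by exact N1.
    assert (Rpower 2 (1 + Re w) <= 2) by (rewrite <- (Rpower_1 2) at 2 by lra; apply Rle_Rpower; lra).
    assert (H1 : 1/2 <= Cmod (1 + w)).
    { pose proof (re_le_Cmod (1 + w)) as Q. rewrite Hre, Rabs_pos_eq in Q by lra. lra. }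
    pose proof (exp_pos ((1 + Re w) * ln 2)) as Ep. change (exp ((1 + Re w) * ln 2)) with (Rpower 2 (1 + Re w)) in Ep.
    apply Rmult_le_reg_r with (Cmod (1 + w)); [lra|].
    replace (Rpower 2 (1 + Re w) / Cmod (1 + w) * Cmod (1 + w)) with (Rpower 2 (1 + Re w)) by (field; lra). lra. }
  assert (Hd : Cmod ((1 + w) * (1 - w) * (3 - w)) <= (2 + Rabs (Im w)) * (2 + Rabs (Im w)) * (4 + Rabs (Im w))).
  { rewrite !Cmod_mult.
    assert (H1 : Cmod (1 + w) <= 2 + Rabs (Im w)).
    { eapply Rle_trans; [apply Cmod_le_abs|]. rewrite Hre, Rabs_pos_eq by lra.
      replace (Im (1 + w)) with (Im w) by (destruct w; simpl; ring). lra. }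
    assert (H2 : Cmod (1 - w) <= 2 + Rabs (Im w)).
    { eapply Rle_trans; [apply Cmod_le_abs|].
      replace (Im (1 - w)) with (- Im w) by (destruct w; simpl; ring). rewrite Rabs_Ropp.
      replace (Re (1 - w)) with (1 - Re w) by (destruct w; simpl; ring). rewrite Rabs_pos_eq; lra. }
    assert (H3 : Cmod (3 - w) <= 4 + Rabs (Im w)).
    { eapply Rle_trans; [apply Cmod_le_abs|].
      replace (Im (3 - w)) with (- Im w) by (destruct w; simpl; ring). rewrite Rabs_Ropp.
      replace (Re (3 - w)) with (3 - Re w) by (destruct w; simpl; ring). rewrite Rabs_pos_eq; lra. }
    pose proof (Cmod_ge_0 (1 + w)). pose proof (Cmod_ge_0 (1 - w)). pose proof (Cmod_ge_0 (3 - w)).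
    apply Rmult_le_compat; auto; [now apply Rmult_le_pos|]. apply Rmult_le_compat; auto. }
  assert (Hn : ((1 + w) * (1 - w) * (3 - w))%C <> 0) by (repeat apply Cmult_neq_0; auto).
  assert (Hn0 : 0 < Cmod ((1 + w) * (1 - w) * (3 - w))) by now apply Cmod_gt_0.
  rewrite Cmod_mult, Cmod_div, Cmod_R, Rabs_pos_eq by (auto; lra).
  set (q := Cmod ((1 + w) * (1 - w) * (3 - w))) in *.
  assert (9 <= Cmod Y * (8 / q)).
  { apply Rmult_le_reg_r with q; [exact Hn0|].
    replace (Cmod Y * (8 / q) * q) with (8 * Cmod Y) by (field; lra). lra. }
  lra.
Qed.

Lemma trunc_mellin_co_bump_lim Q :
  filterlim (trunc_mellin w (co_bump l)) eventually (locally (T := C_NormedModule) Q) -> 1 <= Cmod Q.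
Proof.
  intros HQ. pose proof l_ge_4 as Hl.
  set (A1 := fun N => (Rcpow (/ l) (1 - w) - Rcpow (/ INR (S N)) (1 - w))%C).
  set (A3 := fun N => (Rcpow (/ l) (3 - w) - Rcpow (/ INR (S N)) (3 - w))%C).
  set (M := main_part (Rcpow (/ l) (1 - w)) (Rcpow (/ l) (3 - w))).
  assert (L1 := filterlim_inv_Rcpow (Rcpow (/ l) (1 - w)) (1 - w)%C ltac:(unfold Cminus; rewrite re_plus, re_opp, re_RtoC; lra)).
  assert (L3 := filterlim_inv_Rcpow (Rcpow (/ l) (3 - w)) (3 - w)%C ltac:(unfold Cminus; rewrite re_plus, re_opp, re_RtoC; lra)).
  assert (LM : filterlim (fun N => main_part (A1 N) (A3 N)) eventually (locally (T := C_NormedModule) M)).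
  { assert (G := filterlim_Cplus _ _ _ _ (filterlim_Cplus _ _ _ _
      (filterlim_Cscal (RtoC (2 * l ^ 2) * / (1 - w))%C _ _ L1) (filterlim_Cscal (- RtoC (l ^ 4) * / (3 - w))%C _ _ L3))
      (filterlim_Cconst ((Rcpow (1/2) (- (1 + w)) - Rcpow (/ l) (- (1 + w))) / - (1 + w))%C)).
    match type of G with filterlim _ _ (locally ?z) => replace M with z by (unfold M, main_part, Cdiv; toC; ring) end.
    eapply filterlim_ext; [|exact G]. intros N. unfold main_part, A1, A3, Cdiv. toC. ring. }
  assert (D := filterlim_Cplus _ _ _ _ HQ (filterlim_Cscal (- (1))%C _ _ LM)).
  assert (B : Cmod (Q + - (1) * M) <= 4).
  { apply (is_lim_seq_le_loc (fun N => Cmod (trunc_mellin w (co_bump l) N + - (1) * main_part (A1 N) (A3 N))) (fun _ => 4) (Cmod (Q + - (1) * M)) 4).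
    - destruct (INR_unbounded l) as [N0 HN0]. exists N0. intros N HN.
      replace (trunc_mellin w (co_bump l) N + - (1) * main_part (A1 N) (A3 N))%C with (trunc_mellin w (co_bump l) N - main_part (A1 N) (A3 N))%C by ring.
      apply trunc_mellin_co_bump. apply Rle_trans with (INR N0); [lra|apply le_INR; lia].
    - apply (filterlim_comp _ _ _ (fun N => (trunc_mellin w (co_bump l) N + - (1) * main_part (A1 N) (A3 N))%C) Cmod _
        (locally (T := C_NormedModule) (Q + - (1) * M)%C) _); [exact D|].
      apply (filterlim_norm (V := C_NormedModule)).
    - apply is_lim_seq_const. }
  pose proof main_part_lower as HM. fold M in HM.
  pose proof (Cmod_triangle Q (- (Q + - (1) * M))) as T. rewrite Cmod_opp in T.
  replace (Q + - (Q + - (1) * M))%C with M in T by ring. lra.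
Qed.

(** By [cosine_mellin] the transform of [co_bump] is [P] times a coefficient sum, and its modulus is
    at least 5 - 4 = 1. So [1 <= |P| * B], with a [B] that depends on [m] but not on [Re w];
    inserting the functional equation eliminates [P]. *)
Lemma zeta_reflection_lower :
  Cmod w * Cmod (w + 1) / (2 * PI ^ 2) * Cmod (zeta (1 - w)) <=
  Cmod (zeta w) * Series (fun n => 2 * (Rabs (bump_coef l (S n)) * INR (S n))).
Proof.
  pose proof l_ge_4 as Hl. pose proof PI_RGT_0 as Hpi.
  destruct (cos_int_lim w Hw) as [P [HPb HP]].
  assert (Fe := zeta_functional w Hw P HPb HP).
  assert (Hre : Re (1 + w) = 1 + Re w) by (rewrite re_plus; reflexivity).
  assert (Hsum := ex_series_bump_coef l Hl).
  assert (Hdom : forall n, Rabs (2 * bump_coef l (S n)) * Rpower (INR (S n)) (1 + Re w) <= 2 * (Rabs (bump_coef l (S n)) * INR (S n))).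
  { intros n. pose proof (Spos n). rewrite Rabs_mult, (Rabs_pos_eq 2), Rmult_assoc by lra.
    apply Rmult_le_compat_l; [lra|]. apply Rmult_le_compat_l; [apply Rabs_pos|].
    rewrite <- (Rpower_1 (INR (S n))) at 2 by lra. apply Rle_Rpower; lra. }
  assert (Hs2 := ex_series_scal_l (V := R_NormedModule) 2 _ Hsum).
  assert (Hsum2 : ex_series (fun n => Rabs (2 * bump_coef l (S n)) * Rpower (INR (S n)) (1 + Re w))).
  { apply (ex_series_le (V := R_CompleteNormedModule) _ _) with (2 := Hs2). intros n.
    change (Rabs (Rabs (2 * bump_coef l (S n)) * Rpower (INR (S n)) (1 + Re w)) <= 2 * (Rabs (bump_coef l (S n)) * INR (S n))).
    rewrite Rabs_pos_eq; [apply Hdom|]. apply Rmult_le_pos; [apply Rabs_pos|left; apply exp_pos]. }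
  assert (L := cosine_mellin w Hw P (co_bump l) (fun n => 2 * bump_coef l (S n)) HPb HP (co_bump_cont l Hl) (co_bump_series l Hl) Hsum2).
  apply trunc_mellin_co_bump_lim in L. rewrite Cmod_mult in L.
  set (K := CSeries _) in L. set (B := Series _).
  assert (HK : Cmod K <= B).
  { apply (norm_series_le (V := C_NormedModule) (fun n => (RtoC (2 * bump_coef l (S n)) * Rcpow (INR (S n)) (1 + w))%C) K
      (fun n => 2 * (Rabs (bump_coef l (S n)) * INR (S n))) B).
    - apply ex_Cser_le with (2 := Hsum2). intros n. rewrite Cmod_mult, Cmod_R, Cmod_Rcpow_Rpower, Hre. lra.
    - apply Series_correct. exact Hs2.
    - intros n. change (Cmod (RtoC (2 * bump_coef l (S n)) * Rcpow (INR (S n)) (1 + w)) <= 2 * (Rabs (bump_coef l (S n)) * INR (S n))).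
      rewrite Cmod_mult, Cmod_R, Cmod_Rcpow_Rpower, Hre. apply Hdom. }
  pose proof (w_neq_0 w Hw) as N0. pose proof (w_neq_m1 w Hw) as N1.
  assert (Ez : zeta w = (w * (w + 1) * (P * (RtoC (/ (2 * PI ^ 2)) * zeta (1 - w))))%C).
  { rewrite <- Fe. field. split; auto. }
  assert (Hi : 0 < / (2 * PI ^ 2)) by (apply Rinv_0_lt_compat; pose proof (pow_lt PI 2 Hpi); lra).
  rewrite Ez, !Cmod_mult, Cmod_R, (Rabs_pos_eq (/ _)) by lra.
  pose proof (Cmod_ge_0 w). pose proof (Cmod_ge_0 (w + 1)). pose proof (Cmod_ge_0 (zeta (1 - w))).
  pose proof (Cmod_ge_0 P). pose proof (Cmod_ge_0 K).
  assert (HPB : 1 <= Cmod P * B) by (apply Rle_trans with (1 := L); apply Rmult_le_compat_l; lra).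
  set (V := Cmod w * Cmod (w + 1) * / (2 * PI ^ 2) * Cmod (zeta (1 - w))).
  assert (HV : 0 <= V) by (unfold V; repeat apply Rmult_le_pos; auto; lra).
  replace (Cmod w * Cmod (w + 1) / (2 * PI ^ 2) * Cmod (zeta (1 - w))) with V by reflexivity.
  replace (Cmod w * Cmod (w + 1) * (Cmod P * (/ (2 * PI ^ 2) * Cmod (zeta (1 - w)))) * B) with (V * (Cmod P * B)) by (unfold V; ring).
  nra.
Qed.

End LowerBound.

(** Let [w = - d + i t] with [d] tending to 0. A zero at [i t] makes the right-hand side of
    [zeta_reflection_lower] [O(d)], while the left-hand side stays near a positive multiple of
    [|zeta (1 - i t)|]. The choice of [m] depends only on [t], so the constants are uniform in
    [d]. *)
Lemma zeta_imag_neq_0 t : t <> 0 -> zeta (0, t) <> 0.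
Proof.
  intros Ht E.
  assert (N1 : (0, t) <> RtoC 1) by (intros Q; apply (f_equal Re) in Q; simpl in Q; lra).
  assert (N2 : (1, - t) <> RtoC 1) by (intros Q; apply (f_equal Im) in Q; simpl in Q; lra).
  destruct (Cdiff_local_bound zeta _ (zeta_Cdifferentiable _ N1)) as [K1 [d1 [HK1 [Hd1 H1]]]].
  destruct (Cdiff_local_bound zeta _ (zeta_Cdifferentiable _ N2)) as [K2 [d2 [HK2 [Hd2 H2]]]].
  assert (Hz : 0 < Cmod (zeta (1, - t))) by (apply Cmod_gt_0, zeta_1_neq_0; lra).
  set (z1 := Cmod (zeta (1, - t))) in *.
  set (q := (2 + Rabs t) * (2 + Rabs t) * (4 + Rabs t)).
  set (m := Rmax 2 (9 * q / 8)).
  assert (Hm2 : 2 <= m) by apply Rmax_l. assert (Hmq : 9 * q / 8 <= m) by apply Rmax_r.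
  set (B := Rabs (Series (fun n => 2 * (Rabs (bump_coef (m ^ 2) (S n)) * INR (S n)))) + 1).
  assert (HB : 1 <= B) by (unfold B; match goal with |- _ <= Rabs ?s + 1 => pose proof (Rabs_pos s) end; lra).
  pose proof PI_RGT_0 as Hpi. assert (Hp2 : 0 < 2 * PI ^ 2) by (pose proof (pow_lt PI 2 Hpi); lra).
  assert (Hta : 0 < Rabs t) by now apply Rabs_pos_lt.
  set (c := Rabs t * (1/2) / (2 * PI ^ 2)).
  assert (Hc : 0 < c) by (unfold c; apply Rdiv_lt_0_compat; lra).
  assert (Hall : forall d, 0 < d < 1/2 -> d < d1 -> d < d2 -> c * (z1 - K2 * d) <= K1 * d * B).
  { intros d Hd Hdd1 Hdd2. set (w := ((- d, t) : C)).
    assert (Rw : Re w = - d) by reflexivity. assert (Iw : Im w = t) by reflexivity.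
    assert (Lw := zeta_reflection_lower w m ltac:(rewrite Rw; lra) Hm2 ltac:(rewrite Iw; fold q; lra)).
    assert (Ed : Cmod (RtoC d) = d) by (rewrite Cmod_R; apply Rabs_pos_eq; lra).
    assert (A1 : Cmod (zeta w) <= K1 * d).
    { specialize (H1 (- RtoC d)%C ltac:(rewrite Cmod_opp; lra)). rewrite E, Cmod_opp, Ed in H1.
      replace ((0, t) + - RtoC d)%C with w in H1 by (unfold w; apply Ceq; simpl; ring).
      unfold Cminus in H1. rewrite Copp_0, Cplus_0_r in H1. exact H1. }
    assert (A2 : z1 - K2 * d <= Cmod (zeta (1 - w))).
    { specialize (H2 (RtoC d) ltac:(lra)). rewrite Ed in H2.
      replace ((1, (- t)%R) + RtoC d)%C with (1 - w)%C in H2 by (unfold w; apply Ceq; simpl; ring).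
      set (za := zeta (1 - w)) in *. set (zb := zeta (1, - t)) in *.
      pose proof (Cmod_triangle za (- (za - zb))) as T. replace (za + - (za - zb))%C with zb in T by ring.
      rewrite Cmod_opp in T. fold z1 in T. unfold z1 in *. lra. }
    assert (A3 : c <= Cmod w * Cmod (w + 1) / (2 * PI ^ 2)).
    { unfold c. apply Rmult_le_compat_r; [left; now apply Rinv_0_lt_compat|].
      apply Rmult_le_compat; [lra|lra| |].
      - rewrite <- Iw. eapply Rle_trans; [apply Rmax_r|apply Rmax_Cmod].
      - pose proof (re_le_Cmod (w + 1)) as Q. rewrite re_plus, Rw, re_RtoC, Rabs_pos_eq in Q by lra. lra. }
    pose proof (Cmod_ge_0 (zeta (1 - w))) as P1. pose proof (Cmod_ge_0 (zeta w)) as P2.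
    apply Rle_trans with (c * Cmod (zeta (1 - w))); [apply Rmult_le_compat_l; lra|].
    apply Rle_trans with (Cmod w * Cmod (w + 1) / (2 * PI ^ 2) * Cmod (zeta (1 - w))); [apply Rmult_le_compat_r; lra|].
    apply Rle_trans with (1 := Lw).
    apply Rle_trans with (Cmod (zeta w) * B).
    - apply Rmult_le_compat_l; [exact P2|]. unfold B.
      match goal with |- ?s <= _ => pose proof (Rle_abs s) end. lra.
    - apply Rmult_le_compat_r; lra. }
  set (S := c * K2 + K1 * B).
  assert (HS : 0 < S) by (unfold S; assert (0 < c * K2) by (apply Rmult_lt_0_compat; lra); assert (0 < K1 * B) by (apply Rmult_lt_0_compat; lra); lra).
  (* The inequality [Hall] rearranges to [c * z1 <= S * d], and the last entry forces
     [S * d <= c * z1 / 2]. *)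
  set (d := Rmin (1/4) (Rmin (d1 / 2) (Rmin (d2 / 2) (c * z1 / (2 * S))))).
  assert (Hcz : 0 < c * z1 / (2 * S)).
  { apply Rdiv_lt_0_compat; [now apply Rmult_lt_0_compat|lra]. }
  assert (Hd : 0 < d) by (unfold d; repeat apply Rmin_case; lra).
  assert (D1 : d <= 1/4) by apply Rmin_l.
  assert (D2 : d <= Rmin (d1 / 2) (Rmin (d2 / 2) (c * z1 / (2 * S)))) by apply Rmin_r.
  pose proof (Rmin_l (d1 / 2) (Rmin (d2 / 2) (c * z1 / (2 * S)))). pose proof (Rmin_r (d1 / 2) (Rmin (d2 / 2) (c * z1 / (2 * S)))).
  pose proof (Rmin_l (d2 / 2) (c * z1 / (2 * S))). pose proof (Rmin_r (d2 / 2) (c * z1 / (2 * S))).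
  specialize (Hall d ltac:(lra) ltac:(lra) ltac:(lra)).
  assert (Hfin : c * z1 <= S * d) by (unfold S; nra).
  assert (S * d <= S * (c * z1 / (2 * S))) by (apply Rmult_le_compat_l; lra).
  replace (S * (c * z1 / (2 * S))) with (c * z1 / 2) in * by (field; lra).
  assert (0 < c * z1) by now apply Rmult_lt_0_compat. lra.
Qed.

(** This makes the singularity at [pole beta m] a pole of exact order one: [has_pole_of_order] asks
    for a numerator that does not vanish there. *)
Lemma c_beta_neq_0 beta m : 1 < beta -> m <> 0%Z -> c_beta beta m <> 0.
Proof.
  intros hbeta Hm. pose proof (ln_beta_pos beta hbeta) as HL. pose proof PI_RGT_0 as Hpi.
  assert (Hm' : IZR m <> 0) by now apply not_0_IZR.
  unfold c_beta. destruct (Z.eq_dec m 0) as [|_]; [contradiction|]. unfold c_beta_nonzero.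
  assert (Hz : zeta (freq beta m) <> 0).
  { rewrite freq_eq by exact hbeta. apply zeta_imag_neq_0. intros E.
    apply (Rmult_eq_compat_r (ln beta)) in E. rewrite Rmult_0_l in E.
    replace (2 * PI * IZR m / ln beta * ln beta) with (2 * PI * IZR m) in E by (field; lra).
    apply Rmult_integral in E. destruct E; [lra|contradiction]. }
  assert (H1 : (1 + freq beta m)%C <> 0).
  { rewrite freq_eq by exact hbeta. intros E. apply (f_equal Re) in E. simpl in E. lra. }
  assert (H2 : (RtoC (2 * PI) * Ci * RtoC (IZR m))%C <> 0).
  { intros E. apply (f_equal Im) in E. simpl in E.
    assert (2 * PI * IZR m = 0) by lra. apply Rmult_integral in H. destruct H; [lra|contradiction]. }
  assert (H3 : RtoC (beta - 1) <> 0) by (intros E; apply RtoC_inj in E; lra).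
  set (Q := (RtoC (2 * PI) * Ci * RtoC (IZR m))%C) in *.
  apply Cmult_neq_0; [apply Cmult_neq_0|exact Hz].
  - intros E. apply H3.
    replace (RtoC (beta - 1)) with (- (- (RtoC (beta - 1) / Q)) * Q)%C by (field; exact H2).
    rewrite E. ring.
  - intros E. assert (R1 : (RtoC 1 = 0)%C); [|apply RtoC_inj in R1; lra].
    rewrite <- (Cinv_r _ H1), E. ring.
Qed.

(** * Poles and residues *)

Lemma holomorphic_plus f g p : holomorphic_at f p -> holomorphic_at g p ->
  holomorphic_at (fun z => f z + g z)%C p.
Proof.
  intros Hf Hg. unfold holomorphic_at in *. generalize (filter_and _ _ Hf Hg). apply filter_imp.
  intros z [H1 H2]. now apply Cdiff_plus.
Qed.

Lemma holomorphic_mult f g p : holomorphic_at f p -> holomorphic_at g p ->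
  holomorphic_at (fun z => f z * g z)%C p.
Proof.
  intros Hf Hg. unfold holomorphic_at in *. generalize (filter_and _ _ Hf Hg). apply filter_imp.
  intros z [H1 H2]. now apply Cdiff_mult.
Qed.

Lemma holomorphic_const c p : holomorphic_at (fun _ => c) p.
Proof. unfold holomorphic_at. apply filter_forall. intros z. apply Cdiff_const. Qed.

Lemma holomorphic_shift (a : C) p : holomorphic_at (fun z => z - a)%C p.
Proof. unfold holomorphic_at. apply filter_forall. intros z. apply Cdiff_plus; [apply Cdiff_id|apply Cdiff_const]. Qed.

Lemma Cdiff_div (c a s : C) : s <> a -> Cdifferentiable (fun z => c / (z - a))%C s.
Proof.
  intros Hs. pose proof (Cneq_minus _ _ Hs) as Hn. set (r := Cmod (s - a)).
  assert (Hr : 0 < r) by now apply Cmod_gt_0.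
  exists (- (c / ((s - a) * (s - a))))%C.
  apply Cderive_quad with (K := 2 / r ^ 3 * Cmod c) (d := r / 2); [lra|].
  intros h Hh. replace (s + h - a)%C with (s - a + h)%C by ring.
  apply pole_term_quad; auto. right. apply Rle_refl.
Qed.

Lemma holomorphic_div_sq (c a s : C) : s <> a -> holomorphic_at (fun z => c / (z - a) ^ 2)%C s.
Proof.
  intros Hs. pose proof (Cneq_minus _ _ Hs) as Hn.
  assert (Hr : 0 < Cmod (s - a)) by now apply Cmod_gt_0.
  assert (H1 : forall c, holomorphic_at (fun z => c / (z - a))%C s).
  { intros c'. apply (locally_Cmod s _ (Cmod (s - a)) Hr). intros z Hz. apply Cdiff_div. intros ->.
    rewrite <- Cmod_opp in Hz. replace (- (a - s))%C with (s - a)%C in Hz by ring. lra. }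
  assert (H2 := holomorphic_mult _ _ _ (H1 c) (H1 1)).
  unfold holomorphic_at. apply (filter_imp (Cdifferentiable (fun z => c / (z - a) * (RtoC 1 / (z - a)))%C)); [|exact H2].
  intros z. apply (ex_derive_ext (V := C_NormedModule)). intros t. simpl. unfold Cdiv.
  (* The two expressions must agree everywhere, including [t = a], where both are 0 because the
     inverse of 0 is 0. *)
  toC. destruct (Ceq_dec (t - a) 0) as [E|E].
  - rewrite E, !Cmult_1_r, Cmult_0_l.
    assert (Ei : (/ RtoC 0)%C = 0) by (unfold Cinv; apply Ceq; simpl; unfold Rdiv; ring). rewrite Ei. ring.
  - field. exact E.
Qed.

Section Main.
Variable beta : R.
Hypothesis hbeta : 1 < beta.

Let A0 := (beta - 1) / (2 * ln beta).
Let c := c_beta beta.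

Lemma reg_part_holo s : 1 < Re s -> holomorphic_at (reg_part beta) s.
Proof.
  intros Hs. apply (locally_Cmod s _ (Re s - 1)); [lra|]. intros z Hz. apply reg_part_diff; [exact hbeta|].
  pose proof (re_le_Cmod (z - s)) as Q. unfold Cminus in Q at 1. rewrite re_plus, re_opp in Q.
  apply Rabs_le_between in Q. lra.
Qed.

Lemma pole_re k : Re (pole beta k) = 2.
Proof. unfold pole. rewrite freq_eq by exact hbeta. simpl. ring. Qed.

Lemma pole_0 : pole beta 0 = RtoC 2.
Proof. unfold pole. rewrite freq_eq by exact hbeta. apply Ceq; simpl; [ring|]. unfold Rdiv. ring. Qed.

Lemma pole_inj j k : pole beta j = pole beta k -> j = k.
Proof.
  intros E. destruct (Z.eq_dec j k) as [|Hn]; [assumption|exfalso].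
  pose proof (pole_dist_pole beta hbeta k j Hn) as H. rewrite E in H. pose proof (gap_pos beta hbeta).
  replace (pole beta k - pole beta k)%C with (RtoC 0) in H by ring. rewrite Cmod_0 in H. lra.
Qed.

Lemma near_pole m z : Cmod (z - pole beta m) < gap beta -> z <> pole beta m -> forall k, z <> pole beta k.
Proof.
  intros Hz Hne k ->. destruct (Z.eq_dec k m) as [->|Hk]; [now apply Hne|].
  pose proof (pole_dist_pole beta hbeta k m ltac:(auto)) as H. lra.
Qed.

Lemma pole_sum_rest_holo m : holomorphic_at (pole_sum beta (c_without beta m)) (pole beta m).
Proof.
  apply (pole_sum_holo beta hbeta _ _ (gap beta) (gap_pos beta hbeta) (c_without_le beta m)).
  intros k. unfold c_without. destruct (Z.eq_dec k m) as [->|Hk]; [now left|right].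
  apply (pole_dist_pole beta hbeta m k Hk).
Qed.

(** What remains of [G_fun] after its principal part at [pole beta m] is taken away. For [m <> 0]
    the double-pole term at 2 is regular there and belongs to the remainder. *)
Definition rest (m : Z) (z : C) : C :=
  ((reg_part beta z + (if Z.eq_dec m 0 then RtoC 0 else RtoC A0 / (z - 2) ^ 2)) + pole_sum beta (c_without beta m) z)%C.

Lemma rest_holo m : holomorphic_at (rest m) (pole beta m).
Proof.
  unfold rest. apply holomorphic_plus; [apply holomorphic_plus|].
  - apply reg_part_holo. rewrite pole_re. lra.
  - destruct (Z.eq_dec m 0) as [|Hm]; [apply holomorphic_const|].
    apply holomorphic_div_sq. rewrite <- pole_0. intros E. now apply pole_inj in E.
  - apply pole_sum_rest_holo.
Qed.

Lemma G_holo s : 1 < Re s -> (forall m, s <> pole beta m) -> holomorphic_at (G_fun beta) s.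
Proof.
  intros Hs Hp. destruct (not_pole_dist beta hbeta s Hp) as [r [Hr Hd]].
  unfold G_fun. apply holomorphic_plus; [apply holomorphic_plus|].
  - now apply reg_part_holo.
  - apply holomorphic_div_sq. rewrite <- pole_0. apply Hp.
  - apply (pole_sum_holo beta hbeta _ _ r Hr); [intros; apply Rle_refl|]. intros k. right. apply Hd.
Qed.

Lemma G_at_pole m : m <> 0%Z -> locally' (T := C_UniformSpace) (pole beta m)
  (fun z => G_fun beta z = c m / (z - pole beta m) + rest m z)%C.
Proof.
  intros Hm. apply (locally'_Cmod _ _ (gap beta) (gap_pos beta hbeta)). intros z Hz Hne.
  unfold G_fun, rest. rewrite (pole_sum_split beta hbeta m z) by now apply near_pole with m.
  destruct (Z.eq_dec m 0) as [|_]; [contradiction|]. unfold c, A0. ring.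
Qed.

Lemma G_at_2 : locally' (T := C_UniformSpace) (RtoC 2)
  (fun z => G_fun beta z = RtoC A0 / (z - 2) ^ 2 + c 0 / (z - 2) + rest 0 z)%C.
Proof.
  rewrite <- pole_0. apply (locally'_Cmod _ _ (gap beta) (gap_pos beta hbeta)). intros z Hz Hne.
  unfold G_fun, rest. rewrite (pole_sum_split beta hbeta 0 z) by now apply near_pole with 0%Z.
  destruct (Z.eq_dec 0 0) as [_|E]; [|now contradiction E]. rewrite pole_0. unfold c, A0. ring.
Qed.

Lemma G_pole_form m : m <> 0%Z ->
  let g := (fun z => c m + (z - pole beta m) * rest m z)%C in
  holomorphic_at g (pole beta m) /\ g (pole beta m) = c m /\
  locally' (T := C_UniformSpace) (pole beta m) (fun z => G_fun beta z = g z / (z - pole beta m) ^ 1)%C.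
Proof.
  intros Hm g. split; [|split].
  - apply holomorphic_plus; [apply holomorphic_const|]. apply holomorphic_mult; [apply holomorphic_shift|apply rest_holo].
  - unfold g. ring.
  - apply filter_imp with (2 := filter_and _ _ (G_at_pole m Hm) (locally'_Cmod (pole beta m) (fun z => z <> pole beta m) 1 Rlt_0_1 (fun z _ H => H))).
    intros z [-> Hz]. unfold g. simpl. field. now apply Cneq_minus.
Qed.

Lemma G_2_form :
  let g := (fun z => RtoC A0 + (z - 2) * (c 0 + (z - 2) * rest 0 z))%C in
  holomorphic_at g 2 /\ g 2 = RtoC A0 /\
  locally' (T := C_UniformSpace) (RtoC 2) (fun z => G_fun beta z = g z / (z - 2) ^ 2)%C.
Proof.
  intros g. split; [|split].
  - assert (R := rest_holo 0). rewrite pole_0 in R.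
    apply holomorphic_plus; [apply holomorphic_const|]. apply holomorphic_mult; [apply holomorphic_shift|].
    apply holomorphic_plus; [apply holomorphic_const|]. apply holomorphic_mult; [apply holomorphic_shift|exact R].
  - unfold g. ring.
  - apply filter_imp with (2 := filter_and _ _ G_at_2 (locally'_Cmod (RtoC 2) (fun z => z <> RtoC 2) 1 Rlt_0_1 (fun z _ H => H))).
    intros z [-> Hz]. unfold g. simpl. field. now apply Cneq_minus.
Qed.

Lemma holomorphic_bounded f p : holomorphic_at f p ->
  exists M, locally (T := C_UniformSpace) p (fun z => Cmod (f z) <= M).
Proof.
  intros Hf. destruct (Cdiff_local_bound f p (locally_singleton _ _ Hf)) as [K [d [HK [Hd H]]]].
  exists (Cmod (f p) + K * d). apply (locally_Cmod p _ d Hd). intros z Hz.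
  specialize (H (z - p)%C Hz). replace (p + (z - p))%C with z in H by ring.
  replace (f z) with (f p + (f z - f p))%C by ring. eapply Rle_trans; [apply Cmod_triangle|].
  assert (K * Cmod (z - p) <= K * d) by (apply Rmult_le_compat_l; lra). lra.
Qed.

Lemma c_nonzero m : m <> 0%Z -> c m = c_beta_nonzero beta m.
Proof. intros Hm. unfold c, c_beta. destruct (Z.eq_dec m 0); [contradiction|reflexivity]. Qed.

End Main.

Theorem theorem1p5 (beta : R) (hbeta : 1 < beta) :
  exists G : C -> C,
    (forall s : C, 2 < Re s ->
       is_series (K := C_AbsRing) (V := C_NormedModule)
         (fun n => S_beta beta (S n) * Rcpow (INR (S n)) (- s))%C (G s)) /\
    (forall s : C, 1 < Re s -> meromorphic_at G s) /\
    (forall s : C, 1 < Re s ->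
       (forall m : Z, s <> (2 + freq beta m)%C) -> holomorphic_at G s) /\
    has_pole_of_order 2 G 2 /\
    (exists M : R,
       locally' (T := C_UniformSpace) (RtoC 2) (fun s =>
         Cmod (G s
               - (RtoC ((beta - 1) / (2 * ln beta)) / (s - 2) ^ 2
                  + RtoC ((beta - 1) / (2 * ln beta) * (ln (2 * PI) - 1)
                          - (beta + 1) / 4) / (s - 2)))%C <= M)) /\
    (forall m : Z, m <> 0%Z ->
       has_pole_of_order 1 G (2 + freq beta m)%C /\
       is_residue G (2 + freq beta m)%C
         (- (RtoC (beta - 1) / (RtoC (2 * PI) * Ci * RtoC (IZR m)))
          * / (1 + freq beta m) * zeta (freq beta m))%C).
Proof.
  exists (G_fun beta). split; [|split; [|split; [|split; [|split]]]].
  - intros s Hs. now apply G_series.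
  - intros s Hs. destruct (Classical_Prop.classic (exists m, s = pole beta m)) as [[m ->]|Hn].
    + destruct (Z.eq_dec m 0) as [->|Hm].
      * rewrite pole_0 by exact hbeta. destruct (G_2_form beta hbeta) as [H1 [_ H3]]. eexists 2%nat, _. split; [exact H1|exact H3].
      * destruct (G_pole_form beta hbeta m Hm) as [H1 [_ H3]]. eexists 1%nat, _. split; [exact H1|exact H3].
    + exists O, (G_fun beta). split.
      * apply G_holo; auto. intros m E. apply Hn. now exists m.
      * apply (locally'_Cmod s _ 1 Rlt_0_1). intros z _ _. simpl. field.
  - intros s Hs Hp. now apply G_holo.
  - destruct (G_2_form beta hbeta) as [H1 [H2 H3]]. eexists. split; [exact H1|]. split; [|exact H3].
    rewrite H2. intros E. apply RtoC_inj in E. pose proof (A0_gt_0 beta hbeta). lra.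
  - assert (R := rest_holo beta hbeta 0). rewrite pole_0 in R by exact hbeta.
    destruct (holomorphic_bounded _ _ R) as [M HM]. exists M.
    apply filter_imp with (2 := filter_and _ _ (G_at_2 beta hbeta) (filter_le_within _ _ HM)).
    intros z [-> Hz]. unfold c_beta. destruct (Z.eq_dec 0 0) as [_|E]; [|now contradiction E].
    unfold c_beta_zero. match goal with |- Cmod ?e <= _ => replace e with (rest beta 0 z) by ring end. exact Hz.
  - intros m Hm. change (2 + freq beta m)%C with (pole beta m). split.
    + destruct (G_pole_form beta hbeta m Hm) as [H1 [H2 H3]]. eexists. split; [exact H1|]. split; [|exact H3].
      rewrite H2. now apply c_beta_neq_0.
    (* With [N = 0] the principal part in [is_residue] has the single term of exponent 1. *)
    + exists O, (fun _ => c_beta beta m), (rest beta m). split; [now apply rest_holo|]. split; [exact (c_nonzero beta m Hm)|].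
      apply filter_imp with (2 := G_at_pole beta hbeta m Hm). intros z ->. rewrite sum_O. simpl. rewrite Cmult_1_r. reflexivity.
Qed.
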